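(* Let $n\geq 5$ and $\varepsilon>0$. For any number field $K$ of degree $n$, \[ \#h_{2}(K)\ll_{n,\varepsilon} D_{K}^{\frac{1}{2}-\frac{1}{2n}-\left(\frac{1}{6n}-\frac{\delta_{2,K}}{3}\right)+\varepsilon}. \]
   Context: Let $K$ be a number field of degree $n$ with absolute discriminant $D_K$ (absolute value), ring of integers $\mathcal{O}_K$, and fix $K\subset\mathbb{C}$. Let $\mathrm{Emb}(K/\mathbb{Q})$ be the set of the $n$ field embeddings $K\to\mathbb{C}$, and for $\alpha\in K$ put $\|\alpha\|=\sum_{\sigma\in\mathrm{Emb}(K/\mathbb{Q})}|\sigma(\alpha)|$. Fix a Minkowski-reduced $\mathbb{Z}$-basis $\{\alpha_{1,K}=1,\alpha_{2,K},\dots,\alpha_{n,K}\}$ of $\mathcal{O}_K$ with respect to $\|\cdot\|$, i.e. $1\leq\|\alpha_{2,K}\|\leq\cdots\leq\|\alpha_{n,K}\|$ and for each $i\le n-1$, $\|\alpha_{i,K}\|\ll\|v\|$ for every $v\in\mathcal{O}_K$ not in the span of $1,\alpha_{2,K},\dots,\alpha_{i-1,K}$. For $2\le i\le n$, $\delta_{i,K}\geq 0$ is defined by $\|\alpha_{i,K}\|=D_K^{\delta_{i,K}}$. $h_2(K)$ is the $2$-torsion subgroup of the class group of $K$. *)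

(* Defs.v *)
From HB Require Import structures.
From mathcomp Require Import all_boot all_order all_algebra all_field.
From mathcomp Require Import complex.
From mathcomp Require Import all_classical all_reals all_analysis.

Set Implicit Arguments.
Unset Strict Implicit.
Unset Printing Implicit Defensive.

Import Order.TTheory GRing.Theory Num.Theory.

Local Open Scope classical_set_scope.
Local Open Scope ring_scope.

Definition integers (K : fieldExtType rat) : set K :=
  [set x : K | integralOver (intr : int -> K) x].
Arguments integers K _ : clear implicits.

Definition embeddings (R : realType) (K : fieldExtType rat) : set (K -> R[i]) :=
  range (fun s : {rmorphism K -> R[i]} => (s : K -> R[i])).
Arguments embeddings R K _ : clear implicits.

(* The set of embeddings is finite, so this finitely supported sum is the
   full sum over it. *)
Definition emb_norm (R : realType) (K : fieldExtType rat) (x : K) : R :=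
  \sum_(s \in embeddings R K) Normc.normc (s x).
Arguments emb_norm R {K} x.

Definition integral_basis (K : fieldExtType rat) (n : nat) (w : n.-tuple K) :=
  (forall i : 'I_n, integers K (tnth w i)) /\
  (forall x : K, integers K x ->
     exists! c : {ffun 'I_n -> int}, x = \sum_(i < n) tnth w i *~ c i).

(* Trace of the Q-linear map y |-> x * y. *)
Definition field_trace (K : fieldExtType rat) (x : K) : rat :=
  \sum_(i < \dim {:K}) coord (vbasis {:K}) i (x * tnth (vbasis {:K}) i).

Definition tuple_disc (K : fieldExtType rat) (n : nat) (w : n.-tuple K) : rat :=
  \det (\matrix_(i < n, j < n) field_trace (tnth w i * tnth w j)).

(* The set below is a singleton: an integral basis exists, and the discriminant
   does not depend on it. *)
Definition abs_disc (K : fieldExtType rat) : rat :=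
  xget 0 [set d : rat | exists w : (\dim {:K}).-tuple K,
                          integral_basis w /\ d = `|tuple_disc w|].

(* A tuple is indexed from 0, so tnth w i and w`_i are the mathematicians'
   alpha_(i+1).  M is the constant implied by the sign << in the last
   condition, which is imposed on alpha_1, ..., alpha_(n-1) only. *)
Definition minkowski_reduced (R : realType) (M : R) (K : fieldExtType rat)
    (n : nat) (w : n.-tuple K) :=
  [/\ integral_basis w,
      w`_0 = 1,
      1 <= emb_norm R w`_1,
      (forall i : nat, (1 <= i)%N -> (i.+1 < n)%N ->
         emb_norm R w`_i <= emb_norm R w`_i.+1)
    & (forall i : nat, (i.+1 < n)%N ->
         forall v : K, integers K v -> v \notin <<take i w>>%VS ->
           emb_norm R w`_i <= M * emb_norm R v)].

Definition fractional_ideal (K : fieldExtType rat) (I : set K) :=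
  [/\ I 0,
      (forall x y, I x -> I y -> I (x + y)),
      (forall a x, integers K a -> I x -> I (a * x)),
      (exists2 x, I x & x != 0)
    & (exists d, [/\ integers K d, d != 0 & forall x, I x -> integers K (d * x)])].

Definition ideal_mul (K : fieldExtType rat) (I J : set K) : set K :=
  [set z : K | exists s : seq (K * K),
     (forall p, p \in s -> I p.1 /\ J p.2) /\ z = \sum_(p <- s) p.1 * p.2].

Definition ideal_class (K : fieldExtType rat) (I : set K) : set (set K) :=
  [set J : set K | exists2 a : K, a != 0 & J = [set a * x | x in I]].

Definition class_group (K : fieldExtType rat) : set (set (set K)) :=
  [set ideal_class I | I in @fractional_ideal K].
Arguments class_group K _ : clear implicits.

(* Elementwise product of cosets of the group of principal fractional ideals. *)
Definition class_mul (K : fieldExtType rat) (c d : set (set K)) : set (set K) :=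
  [set J : set K | exists I1 I2, [/\ c I1, d I2 & J = ideal_mul I1 I2]].

Definition class_one (K : fieldExtType rat) : set (set K) :=
  ideal_class (integers K).
Arguments class_one K _ : clear implicits.

Definition h2 (K : fieldExtType rat) : set (set (set K)) :=
  [set c | class_group K c /\ class_mul c c = class_one K].
Arguments h2 K _ : clear implicits.

(* Main.v *)
Require Import Defs.
From HB Require Import structures.
From mathcomp Require Import all_boot all_order all_algebra all_field.
From mathcomp Require Import ring lra zify.

Set Implicit Arguments.
Unset Strict Implicit.
Unset Printing Implicit Defensive.

Import Order.TTheory GRing.Theory Num.Theory.

(* A class c with c^2 = 1 contains an ideal I with I^2 = (beta), and I = {z | z^2 / beta is integral} is
   determined by beta. A short vector of I, for the norm weighted by 1 / |sigma beta|, allows to take all the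
   conjugates of beta of size O(X), X = D^(1/n). So #h_2 is at most the number of such beta, and a local
   idempotent argument shows that their norms are squares up to sign.

   Let 1, v_1, ..., v_(n-1) be a reduced basis of the ring of integers, |v_i|^2 ~ b_i, so that prod b_i = D. Once the
   coordinates of beta on v_2, ..., v_(n-1) are fixed, its norm is a product of n linear forms in two variables. The
   square sieve over (Z/M)^2, fed with Stepanov's bound for character sums along lines, saves the cube root of the
   number of pairs (a one-dimensional sieve is used when the box is too thin). As every b_i is O(X^2), the number of
   beta with distinct conjugates is O(X^(n/2 - 2/3 + eps) b_1^(1/6)), and b_1 = O(|alpha_2|^2).

   The other beta lie in a proper subfield. Subfields of index at least 3 contain few elements of size X. For a
   subfield L of index 2, write theta for an element with theta' = - theta; splitting I into its even and odd parts
   shows that the norm of beta from L is a square up to primes dividing 4 theta^2, and the sieve applies in L. *)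

(** * Counting primes *)

(** The sieve works in (Z/M)^2 with M the product of the primes used, after multiplication by a
    kernel dual to the box. A function periodic modulo p has its Fourier coefficients on p-torsion
    frequencies. Nonzero frequencies xi of p and eta of q interact when they differ by a short
    multiple of M/(pq); then q xi is one of few multiples of M/p, so xi is one of few vectors times
    q^(-1) modulo p. As q varies, q^(-1) moves along a line through the origin, so mean squares of
    coefficients on lines suffice: these are mean squares of character sums over parallel lines,
    within reach of a one-variable bound. With P^3 close to the number Q of pairs, the zero
    frequency and the others both cost about Q/P, whence the exponent 2/3. The bound on the b_i,
    which keeps all coordinate ranges from degenerating, comes from the multiplication table of the
    ring. Ideals are never factored: in the finite ring O/MO some power of each element is
    idempotent, and gluing along idempotents makes an ideal generated by one element modulo M, where
    unique factorization would be invoked otherwise. *)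

Definition primes_below (x : nat) := [seq p <- iota 0 x.+1 | prime p].

Lemma mem_primes_below x p : (p \in primes_below x) = prime p && (p <= x).
Proof. by rewrite mem_filter mem_iota add0n ltnS. Qed.

Lemma primes_below_uniq x : uniq (primes_below x).
Proof. exact/filter_uniq/iota_uniq. Qed.

(** In Legendre's formula for (2m)!/(m!)^2 the term at p^k is at most 1, and it vanishes once p^k >
    2m. So the exponent is at most [trunc_log p m.*2]. *)
Lemma logn_central_binomial p m : prime p -> 0 < m -> p ^ logn p 'C(m.*2, m) <= m.*2.
Proof.
move=> p_pr m0.
have [lt0|] := posnP (logn p 'C(m.*2, m)); first by rewrite lt0 expn0; lia.
move=> l0; pose k0 := trunc_log p m.*2.
have p1 := prime_gt1 p_pr.
have k0P : p ^ k0 <= m.*2 < p ^ k0.+1 by apply: trunc_log_bounds => //; lia.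
suff : logn p 'C(m.*2, m) <= k0.
  by move=> le; apply: leq_trans (_ : p ^ k0 <= _); [rewrite leq_exp2l|case/andP: k0P].
have mm : m <= m.*2 by lia.
have := bin_fact mm; have -> : m.*2 - m = m by lia.
move/(congr1 (logn p)); rewrite !lognM ?fact_gt0 ?muln_gt0 ?fact_gt0 ?bin_gt0 // addnn.
rewrite !logn_fact //.
have ext : \sum_(1 <= k < m.+1) m %/ p ^ k = \sum_(1 <= k < m.*2.+1) m %/ p ^ k.
  rewrite [RHS](big_cat_nat (n := m.+1)) ?ltnS //=.
  rewrite [X in _ = _ + X]big_nat [X in _ = _ + X]big1 ?addn0 // => k /andP[mk _].
  by rewrite divn_small //; apply: leq_trans mk _; apply: ltnW; apply: ltn_expl.
rewrite ext -[(\sum_(_ <= _ < _) _).*2]mul2n big_distrr /= => E.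
have k0m : k0 < m.*2.+1.
  by apply: leq_trans (ltn_expl k0 p1) _; case/andP: k0P => ? _; lia.
have : \sum_(1 <= k < m.*2.+1) m.*2 %/ p ^ k <=
   \sum_(1 <= k < m.*2.+1) (2 * (m %/ p ^ k) + (k <= k0)).
  rewrite big_nat [X in _ <= X]big_nat; apply: leq_sum => k _.
  have pk : 0 < p ^ k by rewrite expn_gt0 ltnW.
  have [kk|kk] := leqP k k0.
    by have := divn_eq m (p ^ k); have := ltn_pmod m pk; move: (m %/ _) (m %% _) => q r r1 ->;
      rewrite -ltnS -[leqRHS]addn1 /= ltn_divLR //; nia.
  by rewrite divn_small //; case/andP: k0P => _ h; apply: leq_trans h _; rewrite leq_exp2l.
rewrite big_split /= -E [X in _ + X <= _ -> _]/=.
have -> : \sum_(1 <= k < m.*2.+1) (k <= k0 : nat) = k0.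
  rewrite (big_cat_nat (n := k0.+1)) //=.
  rewrite [X in X + _](_ : _ = k0); last first.
    rewrite big_nat (eq_bigr (fun=> 1)) => [|k /andP[_]]; last by rewrite ltnS => ->.
    by rewrite -big_nat sum_nat_const_nat subn1 muln1.
  rewrite big_nat big1 ?addn0 // => k /andP[kk _].
  by rewrite leqNgt kk.
by lia.
Qed.

Lemma prod_leq_exp (s : seq nat) (F : nat -> nat) B : (forall x, x \in s -> F x <= B) ->
  \prod_(x <- s) F x <= B ^ size s.
Proof.
elim: s => [|x s IH] H; first by rewrite big_nil.
rewrite big_cons expnS leq_mul ?H ?mem_head // IH // => y ys.
by apply: H; rewrite inE ys orbT.
Qed.

Lemma central_binomial_le m : 0 < m -> 'C(m.*2, m) <= m.*2 ^ size (primes_below m.*2).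
Proof.
move=> m0.
have b0 : 0 < 'C(m.*2, m) by rewrite bin_gt0; lia.
rewrite {1}(prod_prime_decomp b0) prime_decompE big_map /=.
apply: leq_trans (_ : m.*2 ^ size (primes 'C(m.*2, m)) <= _).
  apply: prod_leq_exp => p; rewrite mem_primes => /and3P[pp _ _].
  exact: logn_central_binomial.
rewrite leq_exp2l; last by lia.
apply: uniq_leq_size; first exact: primes_uniq.
move=> p; rewrite mem_primes_below -logn_gt0 => l0.
have pp : prime p by move: l0; rewrite logn_gt0 mem_primes => /andP[].
rewrite pp; apply: leq_trans (logn_central_binomial pp m0).
by rewrite -{1}[p]expn1 leq_exp2l ?prime_gt1.
Qed.

Lemma exp4_central_binomial m : 0 < m -> 4 ^ m <= m.*2 * 'C(m.*2, m).
Proof.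
elim: m => [//|[_ _ //|m IH _]]; rewrite -/m.
have {}IH := IH isT; set k := m.+1 in IH *.
have e1 := mul_bin_diag (k.+1.*2) k; have e2 := mul_bin_down (k.*2.+1) k.
have E1 : k.+1 * 'C(k.+1.*2, k.+1) = k.+1.*2 * 'C(k.*2.+1, k).
  by rewrite -e1 doubleS.
have E2 : k.+1 * 'C(k.*2.+1, k) = k.*2.+1 * 'C(k.*2, k).
  by move: e2; rewrite /= => ->; congr (_ * _); lia.
have k0 : 0 < k by [].
rewrite expnS; move: IH E1 E2; rewrite -!muln2; move: (4 ^ k) => z.
move: 'C(_, _) 'C(_, _) 'C(_, _) => a b c.
nia.
Qed.

Local Open Scope ring_scope.

(** * Character sums of polynomials (Stepanov's method) *)

(** The Legendre symbol, read off Euler's criterion, which is the form that Stepanov's method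
    handles. *)
Definition quadchar (p : nat) (a : 'F_p) : int :=
  if a == 0 then 0 else if a ^+ p.-1./2 == 1 then 1 else -1.

(** That f is not a constant times the square of a rational function s/r, with denominators cleared.
    Taking c = 0 shows that f is nonzero. *)
Definition nonsquare_poly (F : fieldType) (f : {poly F}) :=
  forall (c : F) (r s : {poly F}), r ^+ 2 * f = c *: s ^+ 2 -> r = 0.

(** If h = q (X - x), the derivative of order k+1 of h takes at x the value (k+1) q^(k)(x), and k+1
    is invertible as long as it is below p. Hence the restriction L <= p. *)
Lemma root_order_pchar (p : nat) (F : fieldType) (h : {poly F}) (x : F) (L : nat) :
  p \in [pchar F] -> (L <= p)%N -> (forall k, (k < L)%N -> root h^`(k) x) ->
  ('X - x%:P) ^+ L %| h.
Proof.
move=> pF; elim: L h => [|L IH] h Lp hk; first by rewrite expr0 dvd1p.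
have /factor_theorem[q] := hk 0%N isT; rewrite derivn0 => hq.
have dh k : h^`(k.+1) = q^`(k.+1) * ('X - x%:P) + q^`(k) *+ k.+1.
  elim: k => [|k IHk]; first by rewrite derivn1 hq derivM derivXsubC mulr1 derivn0 derivn1.
  rewrite derivnS IHk derivD derivM derivXsubC mulr1 derivMn -!derivnS.
  by rewrite -addrA -mulrS.
have: ('X - x%:P) ^+ L %| q.
  apply: IH => [|k kL]; first exact: ltnW.
  have := hk k.+1 kL; rewrite dh rootE !hornerE subrr mulr0 add0r hornerMn.
  rewrite -mulr_natr mulf_eq0 => /orP[//|].
  rewrite -(dvdn_pcharf pF) => /dvdn_leq -/(_ isT); lia.
by move=> qd; rewrite hq exprSr; apply: dvdp_mul.
Qed.

Section Stepanov.
Variables (p : nat) (d : nat).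
Hypotheses (p_pr : prime p) (p_odd : odd p).
Variable f : {poly 'F_p}.
Hypotheses (fd : (size f <= d.+1)%N) (f0 : f.[0] != 0).
Hypothesis fns : nonsquare_poly f.
Let c := p.-1./2.
Let g := f ^+ c.
Let pF : p \in [pchar 'F_p] := pchar_Fp p_pr.

Let cE : p = c.*2.+1.
Proof. by have := prime_gt0 p_pr; rewrite /c; lia. Qed.

(** Since f g' = c f' g, the derivative of f^m (r + s g) is f^(m-1) times an expression of the same
    shape; [st m] gives the new pair, and [it L k] the pair after k derivations starting from the
    exponent L. *)
Let st m (u : {poly 'F_p} * {poly 'F_p}) : {poly 'F_p} * {poly 'F_p} :=
  (f^`() * u.1 *+ m + f * u.1^`(), f^`() * u.2 *+ (m + c) + f * u.2^`()).
Let it L := fix it k u := if k is k'.+1 then st (L - k') (it k' u) else u.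

Let itB L k u v : it L k (u - v) = it L k u - it L k v.
Proof.
elim: k => [//|k IH] /=; rewrite IH /st /= !derivB !mulrBr !mulrnBl.
by congr pair => /=; ring.
Qed.

Let size_it L k A (u : {poly 'F_p} * {poly 'F_p}) : (size u.1 <= A)%N -> (size u.2 <= A)%N ->
  (size (it L k u).1 <= A + k * d)%N /\ (size (it L k u).2 <= A + k * d)%N.
Proof.
have df : (size f^`() <= d)%N.
  have [->|fn0] := eqVneq f 0; first by rewrite deriv0 size_poly0.
  by have := lt_size_deriv fn0; lia.
have stB m (q : {poly 'F_p}) B : (size q <= B)%N -> (size (f^`() * q *+ m + f * q^`())%R <= B + d)%N.
  move=> qB; case: (eqVneq q 0) => [->|q0]; first by rewrite mulr0 mul0rn deriv0 mulr0 addr0 size_poly0.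
  have dq : (size q^`() < size q)%N by apply: lt_size_deriv.
  apply: leq_trans (size_polyD _ _) _; rewrite geq_max; apply/andP; split.
    rewrite -scaler_nat; apply: leq_trans (size_scale_leq _ _) _.
    by apply: leq_trans (size_polyMleq _ _) _; lia.
  by apply: leq_trans (size_polyMleq _ _) _; lia.
move=> u1 u2; elim: k => [|k [IH1 IH2]] /=; first by rewrite mul0n addn0.
by rewrite mulSn [(d + _)%N]addnC addnA; split; apply: stB.
Qed.

Variable J : nat.
Implicit Types rs : 'I_J -> {poly 'F_p} * {poly 'F_p}.

(** Stepanov's auxiliary polynomial. The factors X^(jp) have zero derivative and take the value x^j
    on F_p, so where g = a the values of [Phi] are those of f^m times [sig a], whose degree is
    small. *)
Let Phi m rs := f ^+ m * \sum_j ((rs j).1 + (rs j).2 * g) * 'X^(j * p).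
Let sig (a : 'F_p) rs := \sum_j ((rs j).1 + a *: (rs j).2) * 'X^j.

Let derivXp j : ('X^(j * p) : {poly 'F_p})^`() = 0.
Proof.
by rewrite derivXn -mulr_natr natrM (pcharf0 (rmorph_pchar (@polyC 'F_p) pF)) !mulr0.
Qed.

Let derivPhi m rs : (Phi m.+1 rs)^`() = Phi m (fun j => st m.+1 (rs j)).
Proof.
rewrite /Phi derivM raddf_sum mulr_sumr mulr_sumr mulr_sumr -big_split /=.
apply: eq_bigr => j _; rewrite /st /=.
move: (rs j) => [r s] /=.
rewrite derivM derivXp mulr0 addr0 derivD derivM.
have gE : f * g^`() = f^`() * g *+ c.
  rewrite /g deriv_exp mulrnAr; congr (_ *+ _).
  have c1 : c = c.-1.+1 by have := prime_gt1 p_pr; lia.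
  by rewrite [in RHS]c1 exprS; ring.
rewrite deriv_exp /= exprS.
have -> : f ^+ m * ((f^`() * r *+ m.+1 + f * r^`() +
   (f^`() * s *+ (m.+1 + c) + f * s^`()) * g) * 'X^(j * p)) =
  f ^+ m * ((f^`() * r *+ m.+1 + f * r^`() +
   (f^`() * s *+ m.+1 + f * s^`()) * g + s * (f^`() * g *+ c)) * 'X^(j * p)).
  by rewrite mulrnDr; ring.
rewrite -gE; ring.
Qed.

Let derivnPhi L k rs : (k <= L)%N -> (Phi L rs)^`(k) = Phi (L - k) (fun j => it L k (rs j)).
Proof.
elim: k => [|k IH] kL; first by rewrite derivn0 subn0.
rewrite derivnS IH; last exact: ltnW.
have E : (L - k = (L - k.+1).+1)%N by lia.
by rewrite [in LHS]E derivPhi /= E.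
Qed.

Let PhiE m rs a x : g.[x] = a -> (Phi m rs).[x] = f.[x] ^+ m * (sig a rs).[x].
Proof.
move=> ga; rewrite /Phi /sig hornerM horner_exp; congr (_ * _).
rewrite !horner_sum; apply: eq_bigr => j _.
rewrite !hornerM !hornerD hornerZ hornerM ga !hornerXn mulnC exprM; congr (_ * _ ^+ _); last first.
  by have := expf_card x; rewrite card_Fp.
by rewrite [_ * a]mulrC.
Qed.

Let PhiB L rs : (forall j, (size (rs j).1 <= p)%N /\ (size (rs j).2 <= p)%N) ->
  (size (Phi L rs) <= (L * d + c * d + J * p).+1)%N.
Proof.
move=> rsp; rewrite /Phi mulr_sumr.
apply: leq_trans (size_sum _ _ _) _; apply/bigmax_leqP => j _.
have fe k : (size (f ^+ k) <= (k * d).+1)%N.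
  by apply: leq_trans (size_poly_exp_leq _ _) _; rewrite ltnS mulnC leq_mul2l; lia.
have [r1 r2] := rsp j.
apply: leq_trans (size_polyMleq _ _) _.
have := fe L; have := fe c; rewrite -/g => gl fl.
have : (size (((rs j).1 + (rs j).2 * g) * 'X^(j * p))%R <= (c * d + J * p).+1)%N.
  apply: leq_trans (size_polyMleq _ _) _; rewrite size_polyXn.
  have : (size ((rs j).1 + (rs j).2 * g)%R <= p + c * d)%N.
    apply: leq_trans (size_polyD _ _) _; rewrite geq_max; apply/andP; split; first by lia.
    by apply: leq_trans (size_polyMleq _ _) _; lia.
  have : (j * p + p <= J * p)%N by rewrite -mulSnr leq_mul2r ltn_ord orbT.
  by lia.
by lia.
Qed.

Let f_neq0 : f != 0.
Proof. by apply: contraNneq f0 => ->; rewrite horner0. Qed.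

(** At the lowest index with a nonzero pair (r, s), X^p divides r + s g. Multiplying by (r - s g) f
    gives r^2 f - s^2 f^p, and f^p is f(0) modulo X^p. So X^p divides r^2 f - f(0) s^2, whose degree
    is below p: it vanishes, against the hypothesis that f is not a square up to a constant. *)
Let Phi_eq0 L A rs : (A.*2 + d <= p)%N ->
  (forall j, (size (rs j).1 <= A)%N /\ (size (rs j).2 <= A)%N) ->
  Phi L rs = 0 -> forall j, rs j = 0.
Proof.
move=> Ap rsA /eqP; rewrite mulf_eq0 expf_eq0 (negPf f_neq0) andbF /= => /eqP S0 j1.
apply/eqP; apply: contraT => nz1.
have [j0 nz0 min0] := @arg_minnP _ j1 (fun j => rs j != 0) val nz1.
have : 'X^p %| (rs j0).1 + (rs j0).2 * g.
  have X0 : ('X^(j0 * p) : {poly 'F_p}) != 0 by rewrite -size_poly_eq0 size_polyXn.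
  rewrite -(dvdp_mul2r _ _ X0) -exprD -mulSn.
  move: S0; rewrite (bigD1 j0) //= => /eqP; rewrite addr_eq0 => /eqP ->; rewrite dvdpNr.
  apply: (big_ind (fun h => 'X^(j0.+1 * p) %| h)) => [|a b|j jj0]; rewrite ?dvdp0 //; first exact: dvdp_add.
  have [->|nz] := eqVneq (rs j) 0; first by rewrite /= mul0r addr0 mul0r dvdp0.
  apply: dvdp_mull; apply: dvdp_exp2l; rewrite leq_mul2r; apply/orP; right.
  have : (j0 <= j)%N by apply: min0.
  by rewrite leq_eqVlt => /orP[/eqP/val_inj E|//]; rewrite E eqxx in jj0.
have [r1 s1] := rsA j0; move: nz0 r1 s1; case: (rs j0) => r s /= nz0 r1 s1 dv.
have [k fk] : exists k, f = (f.[0])%:P + 'X * k.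
  have /factor_theorem[k kE] : root (f - (f.[0])%:P) 0 by rewrite rootE !hornerE subrr.
  by exists k; rewrite mulrC -[X in _ * X]subr0 -kE addrC subrK.
have pP : p \in [pchar {poly 'F_p}] := rmorph_pchar (@polyC 'F_p) pF.
have fpE : f ^+ p = (f.[0])%:P + 'X^p * k ^+ p.
  have := @pFrobenius_autD_comm _ _ pP (f.[0])%:P ('X * k) (mulrC _ _).
  rewrite -fk !pFrobenius_autE exprMn -polyC_exp => ->.
  by have := expf_card f.[0]; rewrite card_Fp // => ->.
have E : r ^+ 2 * f - f.[0] *: s ^+ 2 = (r + s * g) * ((r - s * g) * f) + 'X^p * (k ^+ p * s ^+ 2).
  have ggf : g * g * f = f ^+ p by rewrite /g -exprD -exprSr addnn -cE.
  have -> : (r + s * g) * ((r - s * g) * f) = r ^+ 2 * f - s ^+ 2 * (g * g * f) by ring.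
  by rewrite ggf fpE -mul_polyC; ring.
have Z : r ^+ 2 * f - f.[0] *: s ^+ 2 = 0.
  apply/eqP; apply: contraT => nzE.
  have /(dvdp_leq nzE) : 'X^p %| r ^+ 2 * f - f.[0] *: s ^+ 2.
    by rewrite E dvdp_add ?dvdp_mulr.
  rewrite size_polyXn leqNgt ltnS => /negP[].
  have sq (q : {poly 'F_p}) : (size q <= A)%N -> (size (q ^+ 2) <= A.*2.-1)%N.
    by move=> qA; rewrite expr2; apply: leq_trans (size_polyMleq _ _) _; move: (size q) qA; clear => z zA; lia.
  apply: leq_trans (size_polyD _ _) _; rewrite geq_max size_polyN.
  apply/andP; split.
    apply: leq_trans (size_polyMleq _ _) _; rewrite -subn1 leq_subLR add1n.
    by apply: leq_trans (leq_add (sq _ r1) fd) _; move: Ap; clear; lia.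
  by apply: leq_trans (size_scale_leq _ _) (leq_trans (sq _ s1) _); move: Ap; clear; lia.
have r0 : r = 0 by apply: (fns (c := f.[0]) (s := s)); apply/eqP; rewrite -subr_eq0 Z.
move: Z; rewrite r0 expr0n /= mul0r sub0r => /eqP; rewrite oppr_eq0 scaler_eq0 (negPf f0) /=.
by rewrite expf_eq0 /= => /eqP s0; rewrite r0 s0 eqxx in nz0.
Qed.

Let prod_dvd (h : {poly 'F_p}) L (s : seq 'F_p) : uniq s ->
  (forall x, x \in s -> ('X - x%:P) ^+ L %| h) -> \prod_(x <- s) ('X - x%:P) ^+ L %| h.
Proof.
elim: s => [|x s IH] /=; first by rewrite big_nil dvd1p.
move=> /andP[xs us] H; rewrite big_cons Gauss_dvdp; last first.
  apply: coprimep_expl; rewrite coprimep_sym coprimep_XsubC rootE horner_prod prodf_seq_neq0.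
  apply/allP => y ys /=; rewrite horner_exp !hornerE expf_eq0 negb_and; apply/orP; right.
  by rewrite subr_eq0; apply: contraNneq xs => ->.
by rewrite H ?mem_head // IH // => y ys; apply: H; rewrite inE ys orbT.
Qed.

(** Pigeonhole on finite sets: there are p^(2JA) choices of coefficients and p^(L(A + Ld + J))
    possible values for the L polynomials [sig]. Two choices with the same values have a nonzero
    difference that makes all of them vanish. *)
Let exists_aux A L a : (L * (A + L * d + J) < 2 * (J * A))%N ->
  exists rs, [/\ (forall j, (size (rs j).1 <= A)%N /\ (size (rs j).2 <= A)%N),
    (exists j, rs j != 0) & forall k, (k < L)%N -> sig a (fun j => it L k (rs j)) = 0].
Proof.
move=> cnt; pose B := (A + L * d + J)%N.
pose V := {ffun 'I_J * bool * 'I_A -> 'F_p}; pose W := {ffun 'I_L * 'I_B -> 'F_p}.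
pose pv (v : V) j b : {poly 'F_p} := \sum_(i < A) v (j, b, i) *: 'X^i.
have pvc v j b (i : 'I_A) : (pv v j b)`_i = v (j, b, i).
  rewrite /pv coef_sum (bigD1 i) //= coefZ coefXn eqxx mulr1 big1 ?addr0 // => k ki.
  by rewrite coefZ coefXn eq_sym (inj_eq val_inj) (negPf ki) mulr0.
have pvs v j b : (size (pv v j b) <= A)%N.
  apply: leq_trans (size_sum _ _ _) _; apply/bigmax_leqP => i _.
  by apply: leq_trans (size_scale_leq _ _) _; rewrite size_polyXn.
pose rsv (v : V) j := (pv v j true, pv v j false).
pose T (v : V) : W := [ffun ki : 'I_L * 'I_B => (sig a (fun j => it L ki.1 (rsv v j)))`_ki.2].
have : ~~ injectiveb T.
  apply/negP => /injectiveP/leq_card; rewrite !card_ffun card_Fp // !card_prod !card_ord card_bool.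
  rewrite leq_exp2l ?prime_gt1 // leqNgt => /negP[].
  by move: cnt; rewrite /B mulnCA mulnA.
case/injectivePn => v [v' vv' TT].
have sigB k : sig a (fun j => it L k (rsv v j - rsv v' j)) =
    sig a (fun j => it L k (rsv v j)) - sig a (fun j => it L k (rsv v' j)).
  rewrite /sig -sumrB; apply: eq_bigr => j _; rewrite itB.
  by move: (it _ _ _) (it _ _ _) => [r s] [r' s'] /=; rewrite scalerBr; ring.
exists (fun j => rsv v j - rsv v' j); split.
- by move=> j /=; split; apply: leq_trans (size_polyD _ _) _; rewrite size_polyN geq_max !pvs.
- have : [exists j, rsv v j - rsv v' j != 0].
    apply: contraT; rewrite negb_exists => /forallP H; case/negP: vv'; apply/eqP/ffunP => -[[j b] i].
    have := H j; rewrite negbK subr_eq0 => /eqP[e1 e2].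
    by rewrite -!pvc; case: b; rewrite ?e1 ?e2.
  by case/existsP => j nz; exists j.
- move=> k kL; rewrite sigB; apply/polyP => i; rewrite coefB coef0.
  have sB w : (size (sig a (fun j => it L k (rsv w j))) <= B)%N.
    rewrite /sig; apply: leq_trans (size_sum _ _ _) _; apply/bigmax_leqP => j _.
    have [] := @size_it L k A (rsv w j) (pvs _ _ _) (pvs _ _ _).
    move: (it L k _) => [r s] /= r1 s1.
    have kd : (k * d <= L * d)%N by rewrite leq_mul2r ltnW ?orbT.
    have : (size (r + a *: s)%R <= A + k * d)%N.
      apply: leq_trans (size_polyD _ _) _; rewrite geq_max r1 /=.
      exact: leq_trans (size_scale_leq _ _) _.
    move=> rB; apply: leq_trans (size_polyMleq _ _) _; rewrite size_polyXn.
    rewrite addnS /=; apply: leq_trans (leq_add rB (leqnn _)) _.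
    by rewrite /B leq_add ?leq_add2l // ltnW.
  have [iB|iB] := ltnP i B; last by rewrite !nth_default ?subr0 //; apply: leq_trans (sB _) iB.
  by move/ffunP/(_ (Ordinal kL, Ordinal iB)): TT; rewrite !ffunE /= => ->; rewrite subrr.
Qed.

(** Each point of the set is a zero of order L of [Phi]: where g = a because the [sig] vanish, and
    at a zero of f because the k-th derivative keeps the factor f^(L-k). Then L times the number of
    points is at most the degree. *)
Lemma stepanov_zeros A L (a : 'F_p) : (0 < L)%N -> (L <= p)%N -> (A.*2 + d <= p)%N ->
  (L * (A + L * d + J) < 2 * (J * A))%N ->
  (#|[pred x : 'F_p | (f.[x] == 0%R) || (f.[x] ^+ c == a)%R]| * L <= L * d + c * d + J * p)%N.
Proof.
move=> L0 Lp Ap cnt.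
have [rs [rsA [j rsj] sg]] := exists_aux a cnt.
have nz : Phi L rs != 0.
  by apply: contraNneq rsj => /(Phi_eq0 Ap rsA) ->.
set S := [pred x | _].
have dv : \prod_(x <- enum S) ('X - x%:P) ^+ L %| Phi L rs.
  apply: prod_dvd; first exact: enum_uniq.
  move=> x; rewrite mem_enum inE => xS; apply: (root_order_pchar pF) => // k kL.
  rewrite rootE derivnPhi ?(ltnW kL) //.
  have Lk : (0 < L - k)%N by rewrite subn_gt0.
  have [fx|fx] := eqVneq f.[x] 0.
    by rewrite /Phi hornerM horner_exp fx expr0n eqn0Ngt Lk mul0r.
  move: xS; rewrite (negPf fx) /= => /eqP ga.
  by rewrite (PhiE _ _ (a := a)) ?sg // ?horner0 ?mulr0 // /g horner_exp.
have := dvdp_leq nz dv; rewrite (big_nth 0) big_mkord.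
rewrite size_prod => [|i _]; last by rewrite expf_eq0 polyXsubC_eq0 andbF.
under eq_bigr do rewrite size_exp_XsubC.
rewrite sum_nat_const card_ord -cardE => H1.
have H2 : (size (Phi L rs) <= (L * d + c * d + J * p).+1)%N.
  have Alep : (A <= p)%N by move: Ap; clear; lia.
  by apply: PhiB => i; have [? ?] := rsA i; split; apply: leq_trans Alep.
by move: (leq_trans H1 H2); rewrite mulnS; move: (_ + _ + _)%N (#|S|) => B k; nia.
Qed.
End Stepanov.

(** With n0 zeros, n1 squares and n2 nonsquares among the values, p = n0 + n1 + n2 and n1 - n2 = 2
    (n0 + n1) - p - n0. So upper bounds for n0 + n1 and n0 + n2 bound the sum from both sides. *)
Lemma quadchar_sum (p : nat) (f : 'F_p -> 'F_p) : prime p -> odd p ->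
  \sum_x quadchar (f x) <= #|[pred x | (f x == 0) || (f x ^+ p.-1./2 == 1)]|%:Z *+ 2 - p%:Z /\
  - \sum_x quadchar (f x) <= #|[pred x | (f x == 0) || (f x ^+ p.-1./2 == -1)]|%:Z *+ 2 - p%:Z.
Proof.
move=> p_pr p_odd; set c := p.-1./2.
have cE : p = c.*2.+1 by have := prime_gt0 p_pr; rewrite /c; lia.
have p2 : 1 != -1 :> 'F_p.
  rewrite -subr_eq0 opprK -mulr2n; apply/negP; rewrite -(dvdn_pcharf (pchar_Fp p_pr)).
  by move/dvdn_leq => /(_ isT); have := prime_gt1 p_pr; lia.
have p2' : (-1 == 1 :> 'F_p) = false by rewrite eq_sym (negPf p2).
have pm x : x != 0 :> 'F_p -> x ^+ c = 1 \/ x ^+ c = -1.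
  move=> x0; suff : (x ^+ c == 1) || (x ^+ c == -1) by case/orP => /eqP; [left|right].
  rewrite -sqrf_eq1 -exprM.
  have xp := expf_card x; rewrite card_Fp // in xp.
  have : x * x ^+ (c * 2) == x by rewrite -exprS muln2 -cE xp.
  by rewrite -[X in _ == X]mulr1 (inj_eq (mulfI x0)).
pose n0 := #|[pred x | f x == 0]|; pose n1 := #|[pred x | (f x != 0) && (f x ^+ c == 1)]|.
pose n2 := #|[pred x | (f x != 0) && (f x ^+ c == -1)]|.
have -> : \sum_x quadchar (f x) = n1%:Z - n2%:Z.
  rewrite /n1 /n2 -!sum1_card !(big_morph Posz PoszD (erefl 0%:Z)) [X in _ = X - _]big_mkcond [X in _ - X]big_mkcond -sumrB /=.
  apply: eq_bigr => x _; rewrite /quadchar -/c !inE.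
  have [//|fx] := eqVneq (f x) 0.
  by have [->|->] := pm _ fx; rewrite ?eqxx ?(negPf p2) ?p2' /=.
have e1 : #|[pred x | (f x == 0) || (f x ^+ c == 1)]| = (n0 + n1)%N.
  rewrite /n0 /n1 -cardUI [X in (_ + X)%N]eq_card0 ?addn0.
    by apply: eq_card => x; rewrite !inE; case: eqP.
  by move=> x; rewrite !inE; case: eqP.
have e2 : #|[pred x | (f x == 0) || (f x ^+ c == -1)]| = (n0 + n2)%N.
  rewrite /n0 /n2 -cardUI [X in (_ + X)%N]eq_card0 ?addn0.
    by apply: eq_card => x; rewrite !inE; case: eqP.
  by move=> x; rewrite !inE; case: eqP.
have e3 : p = (n0 + n1 + n2)%N.
  rewrite -e1 /n2 -cardUI [X in (_ + X)%N]eq_card0 ?addn0.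
    rewrite -[LHS](card_Fp p_pr); apply: eq_card => x; rewrite !inE.
    have [//|fx] := eqVneq (f x) 0.
    by have [->|->] := pm _ fx; rewrite eqxx ?orbT.
  move=> x; rewrite !inE; have [//|fx] := eqVneq (f x) 0.
  by have [->|->] := pm _ fx; rewrite ?(negPf p2) ?p2' ?andbF.
by rewrite e1 e2; have := e3; lia.
Qed.

(** Here L = 2l with 4 l^2 about p, J = l + 2d + 4 and 2A about p. The terms 2lA cancel; the surplus
    2d + 4 in J, worth about (2d + 4) p, pays for L (L d + J), which is about (d + 1/2) p. *)
Lemma stepanov_params (p d l A : nat) :
  (4 * (l * l) <= p)%N -> (100 * d.+1 * (100 * d.+1) < p)%N -> (50 * d.+1 <= l.+1)%N ->
  (p <= 2 * A + d.+1)%N ->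
  (2 * l * (A + 2 * l * d + (l + 2 * d + 4)) < 2 * ((l + 2 * d + 4) * A))%N.
Proof.
move=> a b c e.
suff : (l * (2 * l * d + (l + 2 * d + 4)) < (2 * d + 4) * A)%N by nia.
have h1 : (2 * (l * (2 * l * d + (l + 2 * d + 4))) <= d * p + (l* l) * 2 + l * (4 * d + 8))%N by nia.
have h2 : (l * (4 * d + 8) <= l * l)%N by nia.
have h3 : (2 * (2*d+4) * A >= (2*d+4) * p - (2*d+4)*d.+1)%N by nia.
have h4 : ((2*d+4)*d.+1 <= p)%N by nia.
by nia.
Qed.

Lemma stepanov_conclusion (p d l c S : nat) :
  (p < 4 * (l.+1 * l.+1))%N -> (49 <= l)%N -> (2 * c <= p)%N ->
  (S * (2 * l) <= 2 * l * d + c * d + (l + 2 * d + 4) * p)%N ->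
  (2 * S <= p + 20 * d.+1 * (2 * l))%N.
Proof.
move=> a b e K.
have pL : (p <= 2 * l * (2 * l + 5))%N by nia.
have cd : (2 * (c * d) <= p * d)%N by nia.
have K2 : (2 * S * (2 * l) <= 2 * l * (2 * d) + p * d + (2 * l + 4 * d + 8) * p)%N by lia.
have K3 : ((5 * d + 8) * p <= (5 * d + 8) * (2 * l * (2 * l + 5)))%N by rewrite leq_mul2l pL orbT.
have K4 : (2 * l * (2 * S) <= 2 * l * (2 * d + p + (5 * d + 8) * (2 * l + 5)))%N by lia.
move: K4; rewrite leq_pmul2l; last by lia.
by nia.
Qed.

Lemma stepanov_shifted (p d : nat) (f : {poly 'F_p}) : prime p -> odd p ->
  (size f <= d.+1)%N -> f.[0] != 0 -> nonsquare_poly f ->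
  (`|\sum_x quadchar f.[x]| ^+ 2 <= ((100 * d.+1) ^ 2 * p)%:Z)%R.
Proof.
move=> p_pr p_odd fd f0 fns.
have [l /andP[l1 l2]] : exists l, ((l.*2) ^ 2 <= p < (l.+1.*2) ^ 2)%N.
  have ex : exists k, (p < (k.+1.*2) ^ 2)%N by exists p; rewrite -mul2n expnMn; nia.
  have [k pk kmin] := ex_minnP ex; exists k; rewrite pk andbT.
  by case: k pk kmin => [|k] // pk kmin; rewrite leqNgt; apply/negP => /kmin; lia.
have p3 := odd_prime_gt2 p_odd p_pr.
have triv : `|\sum_x quadchar f.[x]| <= p%:Z.
  apply: le_trans (ler_norm_sum _ _ _) _.
  have -> : p%:Z = \sum_(x : 'F_p) 1 by rewrite sumr_const [#|_|]card_Fp // natz.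
  by apply: ler_sum => x _; rewrite /quadchar; case: eqP => // _; case: eqP.
(* For these p the trivial bound p is enough, as p^2 is at most the claimed right-hand side. *)
have [small|big] := leqP p ((100 * d.+1) ^ 2).
  apply: le_trans (_ : p%:Z ^+ 2 <= _); first by rewrite ler_pXn2r ?nnegrE.
  by rewrite expr2 -PoszM lez_nat leq_mul2r small orbT.
pose L := (2 * l)%N; pose A := (p - d)./2; pose J := (l + 2 * d + 4)%N.
have d1 : (100 * d.+1 * (100 * d.+1) < p)%N by rewrite mulnn.
have l1' : (4 * (l * l) <= p)%N by move: l1; rewrite -mul2n expnMn -mulnn; clear; lia.
have l2' : (p < 4 * (l.+1 * l.+1))%N by move: l2; rewrite -mul2n expnMn -mulnn; clear; lia.
have l50 : (50 * d.+1 <= l.+1)%N by move: l2' d1; clear; nia.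
have Lp : (L <= p)%N by rewrite /L; move: l1' l50; clear; nia.
have dp : (d <= p)%N by move: d1; clear; nia.
have A1 : (p <= 2 * A + d.+1)%N by rewrite /A; clear; lia.
have A2 : (A.*2 + d <= p)%N by rewrite /A; move: dp; clear; lia.
have L0 : (0 < L)%N by rewrite /L; move: l50; clear; lia.
have l49 : (49 <= l)%N by move: l50; clear; lia.
have c1 : (2 * p.-1./2 <= p)%N by clear; lia.
have bnd a : (#|[pred x | (f.[x] == 0) || (f.[x] ^+ p.-1./2 == a)]|%:Z *+ 2 - p%:Z <= (20 * d.+1 * L)%:Z)%R.
  have := stepanov_params l1' d1 l50 A1; rewrite -/L -/J => H.
  have K := @stepanov_zeros p d p_pr p_odd f fd f0 fns J A L a L0 Lp A2 H.
  have := stepanov_conclusion l2' l49 c1 K.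
  by rewrite -/L; move: #|_| (20 * _ * L)%N; clear => u v; lia.
have [u1 u2] := quadchar_sum (fun x => f.[x]) p_pr p_odd.
have S1 := le_trans u1 (bnd 1); have S2 := le_trans u2 (bnd (-1)).
have L2 : (L * L <= p)%N by rewrite /L; move: l1'; clear; lia.
have : `|\sum_x quadchar f.[x]| <= (20 * d.+1 * L)%:Z by rewrite ler_norml; move: S1 S2; move: (\sum_x _) (20 * _ * L)%N; clear => u v; lia.
rewrite -(ler_pXn2r (_ : 0 < 2)%N) ?nnegrE // => /le_trans; apply.
rewrite expr2 -PoszM lez_nat expnMn -mulnn -mulnn; move: (d.+1) => e.
rewrite mulnACA [(20 * e * (20 * e))%N]mulnACA; apply: leq_mul => //.
by rewrite leq_mul2r orbC.
Qed.

(* Translating to a point where f does not vanish reduces to f(0) <> 0. *)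
Theorem quadchar_poly_sum (p d : nat) (f : {poly 'F_p}) : prime p -> odd p ->
  (size f <= d.+1)%N -> nonsquare_poly f ->
  (`|\sum_x quadchar f.[x]| ^+ 2 <= ((100 * d.+1) ^ 2 * p)%:Z)%R.
Proof.
move=> p_pr p_odd fd fns.
have triv : `|\sum_x quadchar f.[x]| <= p%:Z.
  apply: le_trans (ler_norm_sum _ _ _) _.
  have -> : p%:Z = \sum_(x : 'F_p) 1 by rewrite sumr_const [#|_|]card_Fp // natz.
  by apply: ler_sum => x _; rewrite /quadchar; case: eqP => // _; case: eqP.
have [small|big] := leqP p ((100 * d.+1) ^ 2).
  apply: le_trans (_ : p%:Z ^+ 2 <= _); first by rewrite ler_pXn2r ?nnegrE.
  by rewrite expr2 -PoszM lez_nat leq_mul2r small orbT.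
have fn0 : f != 0.
  apply/eqP => f0; have := fns 0 1 0; rewrite f0 mulr0 scale0r => /(_ erefl)/eqP.
  by rewrite oner_eq0.
have [x0 fx0] : exists x0, f.[x0] != 0.
  apply/existsP; apply: contraT; rewrite negb_exists => /forallP H.
  have /(max_poly_roots fn0) : all (root f) (enum 'F_p).
    by apply/allP => x _; rewrite rootE; have := H x; rewrite negbK.
  rewrite enum_uniq -cardE card_Fp // => /(_ isT) pf.
  by have := leq_ltn_trans (ltnW big) (leq_trans pf fd); rewrite -mulnn; clear; nia.
pose h := f \Po ('X + x0%:P).
have hE x : h.[x] = f.[x + x0] by rewrite horner_comp !hornerE.
have -> : \sum_x quadchar f.[x] = \sum_x quadchar h.[x].
  rewrite (reindex_onto (fun x => x + x0) (fun x => x - x0)) /=; last by move=> x _; rewrite subrK.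
  by apply: eq_big => [x|x _]; rewrite ?hE ?addrK ?eqxx.
apply: stepanov_shifted => //.
- by rewrite /h size_comp_poly2 // size_XaddC.
- by rewrite hE add0r.
move=> c r s E.
have comp q : (q \Po ('X - x0%:P)) \Po ('X + x0%:P) = q :> {poly 'F_p}.
  by rewrite -comp_polyA comp_polyB comp_polyX comp_polyC addrK comp_polyXr.
have comp' q : (q \Po ('X + x0%:P)) \Po ('X - x0%:P) = q :> {poly 'F_p}.
  by rewrite -comp_polyA comp_polyD comp_polyX comp_polyC subrK comp_polyXr.
have := fns c (r \Po ('X - x0%:P)) (s \Po ('X - x0%:P)).
rewrite -!rmorphXn /= -[X in _ * X](comp' f) -rmorphM /= -/h E comp_polyZ => /(_ erefl) r0.
by rewrite -(comp r) r0 comp_poly0.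
Qed.

(** * Fourier analysis on (Z/M)^I and the square sieve inequality *)

Section Fourier.
Variables (C : numClosedFieldType) (m : nat) (I : finType) (z : C).
Local Notation M := m.+2.
Hypotheses (zM : z ^+ M = 1) (zn : forall k, (0 < k < M)%N -> z ^+ k != 1).
Local Notation G := {ffun I -> 'I_m.+2}.
Implicit Types (x y xi eta : G) (f g S : G -> C).

Definition gdot xi x : 'I_m.+2 := \sum_i xi i * x i.
Definition gchar xi x : C := z ^+ gdot xi x.

Let zmod k : z ^+ (k %% M) = z ^+ k.
Proof. by rewrite {2}(divn_eq k M) exprD mulnC exprM zM expr1n mul1r. Qed.

Let zZ (a b : 'I_m.+2) : z ^+ (a + b)%R = z ^+ a * z ^+ b.
Proof. by rewrite -exprD -[RHS]zmod. Qed.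

Lemma norm_z : `|z| = 1.
Proof.
have /eqP : `|z| ^+ M = 1 by rewrite -normrX zM normr1.
by rewrite pexpr_eq1 // => /eqP.
Qed.

Lemma gcharDr xi x y : gchar xi (x + y) = gchar xi x * gchar xi y.
Proof.
rewrite /gchar -zZ; suff -> : gdot xi (x + y) = gdot xi x + gdot xi y by [].
by rewrite /gdot -big_split; apply: eq_bigr => i _; rewrite ffunE mulrDr.
Qed.

Lemma gcharC xi x : gchar xi x = gchar x xi.
Proof. by rewrite /gchar /gdot; under eq_bigr do rewrite mulrC. Qed.

Lemma gcharDl xi eta x : gchar (xi + eta) x = gchar xi x * gchar eta x.
Proof. by rewrite !(gcharC _ x) gcharDr. Qed.

Lemma gchar0l x : gchar 0 x = 1.
Proof. by rewrite /gchar /gdot big1 // => i _; rewrite ffunE mul0r. Qed.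

Lemma norm_gchar xi x : `|gchar xi x| = 1.
Proof. by rewrite /gchar normrX norm_z expr1n. Qed.

Lemma gchar_neq0 xi x : gchar xi x != 0.
Proof. by rewrite -normr_eq0 norm_gchar oner_eq0. Qed.

Lemma gcharN xi x : gchar (- xi) x = (gchar xi x)^*.
Proof.
apply: (mulfI (gchar_neq0 xi x)); rewrite -gcharDl subrr gchar0l.
by rewrite -normCK norm_gchar expr1n.
Qed.

Lemma gcharB xi eta x : gchar (xi - eta) x = gchar xi x * (gchar eta x)^*.
Proof. by rewrite gcharDl gcharN. Qed.

Lemma gcharMn xi x n : gchar (xi *+ n) x = gchar xi x ^+ n.
Proof. by elim: n => [|n IH]; rewrite ?gchar0l // mulrS exprS gcharDl IH. Qed.

Lemma gchar_nontrivial xi : xi != 0 -> exists x, gchar xi x != 1.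
Proof.
move=> xi0; have [i xii] : exists i, xi i != 0.
  apply/existsP; apply: contraT; rewrite negb_exists => /forallP H.
  by case/eqP: xi0; apply/ffunP => i; rewrite ffunE; apply/eqP; have := H i; rewrite negbK.
exists [ffun j => 1 *+ (j == i)].
have -> : gchar xi [ffun j => 1 *+ (j == i)] = z ^+ xi i.
  rewrite /gchar; suff -> : gdot xi [ffun j => 1 *+ (j == i)] = xi i by [].
  transitivity (xi i * 1 + 0); last by rewrite mulr1 addr0.
  rewrite /gdot (bigD1 i) //; congr (_ + _); first by rewrite ffunE eqxx.
  by apply: big1 => j /negPf ji; rewrite ffunE ji; apply: mulr0.
apply: zn; rewrite lt0n ltn_ord andbT.
by apply: contraNneq xii => e; apply/eqP/val_inj.
Qed.

Lemma gchar_sum xi : \sum_x gchar xi x = if xi == 0 then #|{: G}|%:R else 0.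
Proof.
have [->|xi0] := eqVneq; first by under eq_bigr do rewrite gchar0l; rewrite sumr_const.
have [y yn] := gchar_nontrivial xi0.
set S := \sum_x _; have : gchar xi y * S = S.
  rewrite [RHS](reindex_inj (addIr y)) mulr_sumr; apply: eq_bigr => x _.
  by rewrite gcharDr mulrC.
move/eqP; rewrite -subr_eq0 -{2}[S]mul1r -mulrBl mulf_eq0 subr_eq0 (negPf yn) /=.
by move/eqP.
Qed.

Definition nG : C := #|{: G}|%:R.

Lemma nG_gt0 : 0 < nG.
Proof. by rewrite ltr0n; apply/card_gt0P; exists 0. Qed.

Definition ghat f xi : C := nG^-1 * \sum_x f x * (gchar xi x)^*.

Lemma ghat_inv f x : f x = \sum_xi ghat f xi * gchar xi x.
Proof.
rewrite /ghat; under eq_bigr do rewrite -mulrA mulr_suml.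
rewrite -mulr_sumr exchange_big /=.
have E y : \sum_xi f y * (gchar xi y)^* * gchar xi x = if y == x then nG * f x else 0.
  transitivity (f y * \sum_xi gchar xi (x - y)).
    rewrite mulr_sumr; apply: eq_bigr => xi _.
    by rewrite ![gchar xi _]gcharC gcharB -mulrA [_^* * _]mulrC.
  under eq_bigr do rewrite gcharC; rewrite gchar_sum subr_eq0 eq_sym.
  by case: eqP => [->|_]; rewrite ?mulr0 // mulrC.
rewrite (eq_bigr _ (fun y _ => E y)) -big_mkcond big_pred1_eq mulKf //.
by rewrite gt_eqF ?nG_gt0.
Qed.

Lemma eq_ghat f g xi : f =1 g -> ghat f xi = ghat g xi.
Proof. by move=> fg; rewrite /ghat; under eq_bigr do rewrite fg. Qed.

Lemma ghat_parseval f : \sum_xi `|ghat f xi| ^+ 2 = nG^-1 * \sum_x `|f x| ^+ 2.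
Proof.
rewrite mulr_sumr [RHS](eq_bigr (fun x => \sum_xi nG^-1 * (f x * (gchar xi x)^* * (ghat f xi)^*))); last first.
  move=> x _; have E : (f x)^* = \sum_xi (ghat f xi)^* * (gchar xi x)^*.
    by rewrite {1}(ghat_inv f x) rmorph_sum; apply: eq_bigr => xi _; rewrite rmorphM.
  rewrite normCK E !mulr_sumr.
  by apply: eq_bigr => xi _; ring.
rewrite exchange_big /=; apply: eq_bigr => xi _.
by rewrite -mulr_sumr -mulr_suml mulrA normCK.
Qed.

Lemma ghat_shift f h eta : ghat (fun x => gchar h x * f x) eta = ghat f (eta - h).
Proof.
rewrite /ghat; congr (_ * _); apply: eq_bigr => x _.
by rewrite gcharB rmorphM /= conjCK; ring.
Qed.

Lemma ghat_sum (J : Type) (r : seq J) (F : J -> G -> C) xi :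
  ghat (fun x => \sum_(j <- r) F j x) xi = \sum_(j <- r) ghat (F j) xi.
Proof.
rewrite /ghat; under eq_bigr do rewrite mulr_suml.
by rewrite exchange_big mulr_sumr.
Qed.

(** Translation by p y multiplies the coefficient at xi by the conjugate of the character p xi at y.
    So the spectrum of a function periodic modulo p is p-torsion. *)
Lemma ghat_periodic f p xi : (forall x y, f (x + y *+ p) = f x) -> ghat f xi != 0 -> xi *+ p = 0.
Proof.
move=> fp nz; apply/eqP; apply: contraT => /gchar_nontrivial[y yn].
suff E : ghat f xi * (gchar (xi *+ p) y)^* = ghat f xi.
  case/negP: yn; apply/eqP; rewrite -[LHS]conjCK -[RHS]conjC1; congr (_^*).
  by apply: (mulfI nz); rewrite E mulr1.
rewrite {2}/ghat (reindex_inj (addIr (y *+ p))) /= /ghat -mulrA; congr (_ * _).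
rewrite mulr_suml; apply: eq_bigr => x _; rewrite fp gcharDr rmorphM -mulrA; congr (_ * (_ * _^*)).
by rewrite [gchar xi (y *+ p)]gcharC !gcharMn gcharC.
Qed.

(** * A large sieve inequality in Schur's form *)

Section Sieve.
Variables (X H : I -> nat) (c0 : C).
Hypotheses (c0_gt0 : 0 < c0) (zRe : forall k, (8 * k <= M)%N -> c0 <= 'Re (z ^+ k)).
Hypotheses (H_gt0 : forall i, (0 < H i)%N) (XH : (8 * \sum_i X i * H i <= M)%N).

Definition gbox (Y : I -> nat) : {set G} := [set x : G | [forall i, x i < Y i]%N].
Let B := gbox H.

Definition gclose xi eta := [exists h in B, exists h' in B, eta == xi + h - h'].

(** The kernel of the dual box: for x in the box, h.x is at most M/8, so all terms have real part at
    least c0 and nothing cancels. *)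
Let D x := \sum_(h in B) gchar h x.

Let D_lower x : x \in gbox X -> c0 * #|B|%:R <= `|D x|.
Proof.
rewrite inE => /forallP xX; apply: le_trans (_ : 'Re (D x) <= _); last first.
  by case: (leif_Re_Creal (D x)).
rewrite /D raddf_sum /= -sumr_const mulr_sumr; apply: ler_sum => h; rewrite inE => /forallP hH.
rewrite mulr1 /gchar.
have -> : z ^+ gdot h x = z ^+ (\sum_i h i * x i)%N.
  rewrite -[RHS]zmod; congr (z ^+ _); rewrite /gdot.
  elim/big_rec2: _ => [|i y1 y2 _ IH] /=; first by rewrite mod0n.
  by rewrite IH modnDml modnDmr.
apply: zRe; apply: leq_trans XH; rewrite leq_mul2l /=; apply: leq_sum => i _.
by rewrite mulnC leq_mul // ltnW.
Qed.

Variable S : G -> C.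
Let a xi := `|ghat S xi|.
Hypothesis isol : forall xi, a xi != 0 -> gclose 0 xi -> xi = 0.

Definition gdeg xi := #|[set eta : G | [&& eta != 0, ghat S eta != 0 & gclose xi eta]]|.

Let a0 xi : 0 <= a xi. Proof. exact: normr_ge0. Qed.

Let P xi eta := [&& xi != 0, eta != 0, ghat S xi != 0 & ghat S eta != 0].

Let gclose_sym xi eta : gclose xi eta = gclose eta xi.
Proof.
apply/existsP/existsP => -[h /andP[hB /existsP[h' /andP[hB' /eqP E]]]];
  exists h'; rewrite hB' /=; apply/existsP; exists h; rewrite hB E /=.
  by rewrite subrK addrK.
by rewrite subrK addrK.
Qed.

Let closeI xi h h' : h \in B -> h' \in B -> gclose xi (xi + h - h').
Proof.
by move=> hB hB'; apply/existsP; exists h; rewrite hB; apply/existsP; exists h'; rewrite hB' eqxx.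
Qed.

(** Two nonzero frequencies are decoupled by 2ab <= a^2 + b^2. If one of them is zero, isolation
    forces the other to be zero, and then h = h'. *)
Let pair_le xi h h' : h \in B -> h' \in B ->
  a xi * a (xi + h - h') <= ((xi == 0) && (h == h'))%:R * a 0 ^+ 2 +
    ((P xi (xi + h - h'))%:R * a xi ^+ 2 + (P xi (xi + h - h'))%:R * a (xi + h - h') ^+ 2) / 2.
Proof.
move=> hB hB'; have cl := closeI xi hB hB'; set eta := xi + h - h' in cl *.
have nn t : 0 <= (P xi eta)%:R * a t ^+ 2 by rewrite mulr_ge0 ?exprn_ge0.
have nn2 : 0 <= ((P xi eta)%:R * a xi ^+ 2 + (P xi eta)%:R * a eta ^+ 2) / 2.
  by rewrite divr_ge0 // addr_ge0.
have [xi0|xi0] := eqVneq xi 0.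
  have [eta0|eta0] := eqVneq eta 0.
    have hh : h = h' by move: (eta0); rewrite /eta xi0 add0r => /eqP; rewrite subr_eq0 => /eqP.
    have -> : a xi * a eta = a 0 ^+ 2 by rewrite eta0 xi0 expr2.
    by rewrite hh eqxx mul1r lerDl.
  have [e0|e0] := eqVneq (a eta) 0; first by rewrite [X in _ * X <= _]e0 mulr0 addr_ge0 // mulr_ge0 ?exprn_ge0.
  by rewrite xi0 in cl; rewrite (isol e0 cl) eqxx in eta0.
have [e0|e0] := eqVneq (a eta) 0; first by rewrite [X in _ * X <= _]e0 mulr0 addr_ge0 // mulr_ge0 ?exprn_ge0.
have [x0|x0] := eqVneq (a xi) 0; first by rewrite [X in X * _ <= _]x0 mul0r addr_ge0 // mulr_ge0 ?exprn_ge0.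
have [eta0|eta0] := eqVneq eta 0.
  by rewrite gclose_sym eta0 in cl; rewrite (isol x0 cl) eqxx in xi0.
have -> : P xi eta by rewrite /P xi0 eta0 -normr_eq0 x0 -normr_eq0 e0.
rewrite /= mul0r add0r !mul1r ler_pdivlMr // -subr_ge0.
have -> : a xi ^+ 2 + a eta ^+ 2 - a xi * a eta * 2 = (a xi - a eta) ^+ 2 by ring.
by rewrite real_exprn_even_ge0 // rpredB // ger0_real.
Qed.

Let pair_sum : \sum_xi \sum_(h in B) \sum_(h' in B) a xi * a (xi + h - h') <=
  #|B|%:R * (a 0 ^+ 2 + \sum_(xi : G | xi != 0) a xi ^+ 2 * (gdeg xi)%:R).
Proof.
pose T := \sum_xi \sum_(h in B) \sum_(h' in B) (P xi (xi + h - h'))%:R * a xi ^+ 2.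
have T2 : \sum_xi \sum_(h in B) \sum_(h' in B) (P xi (xi + h - h'))%:R * a (xi + h - h') ^+ 2 = T.
  rewrite exchange_big /=; under eq_bigr do rewrite exchange_big /=.
  rewrite exchange_big /= /T [RHS]exchange_big /=; apply: eq_bigr => h' hB'.
  rewrite [RHS]exchange_big /=; apply: eq_bigr => h hB.
  rewrite [RHS](reindex_inj (addIr (h - h'))); apply: eq_bigr => xi _.
  rewrite !addrA subrK addrK; congr (_%:R * _).
  by rewrite /P; do 4 case: (_ != _).
have first_sum : \sum_(xi : G) \sum_(h in B) \sum_(h' in B) ((xi == 0) && (h == h'))%:R * a 0 ^+ 2 = #|B|%:R * a 0 ^+ 2.
  rewrite (bigD1 (0 : G)) //= [X in _ + X]big1 ?addr0 => [|xi xi0]; last first.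
    by rewrite big1 // => h _; rewrite big1 // => h' _; rewrite (negPf xi0) mul0r.
  rewrite mulr_natl -sumr_const; apply: eq_bigr => h hB.
  rewrite (bigD1 h) //= !eqxx mul1r big1 ?addr0 // => h' /andP[_ nh].
  by rewrite eq_sym (negPf nh) mul0r.
apply: le_trans (_ : #|B|%:R * a 0 ^+ 2 + (T + T) / 2 <= _).
  rewrite -{2}T2 -first_sum /T -!big_split /= mulr_suml -big_split /=; apply: ler_sum => xi _.
  rewrite -big_split /= mulr_suml -big_split /=; apply: ler_sum => h hB.
  rewrite -big_split /= mulr_suml -big_split /=; apply: ler_sum => h' hB'.
  exact: pair_le.
have -> : (T + T) / 2 = T.
  by transitivity (T * 2 / 2); [congr (_ / _); ring | rewrite mulfK ?pnatr_eq0].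
rewrite mulrDr lerD2l mulr_sumr big_mkcond /=; apply: ler_sum => xi _.
have [->|xi0] := eqVneq xi 0.
  by rewrite big1 // => h _; rewrite big1 // => h' _; rewrite /P eqxx mul0r.
rewrite exchange_big /= mulrCA -mulr_natl mulr_natl -sumr_const mulrC !mulr_suml.
apply: ler_sum => h' hB'; rewrite mul1r -mulr_suml ler_wpM2r ?exprn_ge0 //.
rewrite -natr_sum ler_nat /gdeg.
apply: leq_trans (_ : #|[set h in B | P xi (xi + h - h')%R]| <= _)%N.
  rewrite -sum1_card [X in (_ <= X)%N]big_mkcond [X in (X <= _)%N]big_mkcond /=.
  apply: leq_sum => h _; case: ifP => // hB; case: ifP => [_|]; first by case: (P _ _).
  by rewrite in_set hB andTb => ->.
apply: leq_trans (_ : #|(fun h : G => h + (xi - h'))%R @: [set h in B | P xi (xi + h - h')%R]| <= _)%N.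
  by rewrite card_imset //; apply: addIr.
apply/subset_leq_card/subsetP => e /imsetP[h].
rewrite inE => /andP[hB Ph] ->; rewrite inE (_ : h + (xi - h') = xi + h - h'); last by rewrite addrCA addrA.
by move: Ph; rewrite /P => /and4P[_ -> _ ->] /=; apply: closeI.
Qed.

(** The kernel D is at least c0 |B| on the box, so the mean square of D S dominates. By Parseval it
    is a sum over eta of squares of sums of coefficients at eta - h; expanded, it couples xi with xi
    + h - h', and each xi is charged for its [gdeg xi] neighbours. *)
Lemma large_sieve_schur : c0 ^+ 2 * #|B|%:R * \sum_(x in gbox X) `|S x| ^+ 2 <=
  nG * (a 0 ^+ 2 + \sum_(xi : G | xi != 0) a xi ^+ 2 * (gdeg xi)%:R).
Proof.
have B0 : 0 < #|B|%:R :> C.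
  by rewrite ltr0n; apply/card_gt0P; exists 0; rewrite inE; apply/forallP => i; rewrite ffunE.
rewrite -(ler_pM2l B0).
apply: le_trans (_ : \sum_x `|D x * S x| ^+ 2 <= _).
  rewrite [_ * (_ * _)](_ : _ = \sum_(x in gbox X) (c0 * #|B|%:R * `|S x|) ^+ 2); last first.
    by rewrite !mulr_sumr; apply: eq_bigr => x _; ring.
  rewrite [X in _ <= X](bigID (mem (gbox X))) /=.
  rewrite -[X in X <= _]addr0; apply: lerD; last by apply: sumr_ge0 => x _; rewrite exprn_ge0.
  apply: ler_sum => x xX; rewrite normrM; apply: lerXn2r.
  - by rewrite nnegrE !mulr_ge0 // ltW.
  - by rewrite nnegrE mulr_ge0.
  by apply: ler_wpM2r => //; apply: D_lower.
have -> : \sum_x `|D x * S x| ^+ 2 = nG * \sum_(eta : G) `|\sum_(h in B) ghat S (eta - h)| ^+ 2.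
  have := ghat_parseval (fun x => D x * S x) => /(congr1 (fun t => nG * t)).
  rewrite mulrA divff ?gt_eqF ?nG_gt0 // mul1r => <-; congr (_ * _).
  apply: eq_bigr => eta _; congr (`|_| ^+ 2).
  rewrite -[RHS]big_enum; under [RHS]eq_bigr do rewrite -ghat_shift.
  rewrite -ghat_sum; apply: eq_ghat => x.
  by rewrite big_enum /= /D mulr_suml.
rewrite mulrCA ler_pM2l ?nG_gt0 //; apply: le_trans pair_sum.
apply: le_trans (_ : \sum_(eta : G) (\sum_(h in B) a (eta - h)) ^+ 2 <= _).
  apply: ler_sum => eta _; rewrite ler_pXn2r ?nnegrE ?sumr_ge0 //.
  exact: ler_norm_sum.
rewrite le_eqVlt; apply/orP; left; apply/eqP.
under eq_bigr do rewrite expr2 mulr_suml; rewrite exchange_big /=.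
rewrite [RHS]exchange_big /=; apply: eq_bigr => h hB.
rewrite [LHS](reindex_inj (addIr h)) /=; apply: eq_bigr => xi _.
by rewrite mulr_sumr; apply: eq_bigr => h' _; rewrite addrK.
Qed.
End Sieve.

(** * Interaction of the frequencies of different primes *)

Section SquareSieve.
Variables (X H Rb : I -> nat) (c0 kap K : C) (mult : nat) (ps : seq nat) (f : nat -> G -> C).
Hypotheses (c0_gt0 : 0 < c0) (zRe : forall k, (8 * k <= M)%N -> c0 <= 'Re (z ^+ k)).
Hypotheses (H_gt0 : forall i, (0 < H i)%N) (XH : (8 * \sum_i X i * H i <= M)%N).
Hypotheses (ps_uniq : uniq ps) (ps_prime : forall p, p \in ps -> prime p)
  (psM : forall p, p \in ps -> (p %| M)%N)
  (f_per : forall p, p \in ps -> forall x y, f p (x + y *+ p) = f p x)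
  (f_le1 : forall p x, p \in ps -> `|f p x| <= 1)
  (HM : forall p i, p \in ps -> (H i * p <= M)%N)
  (HR : forall p q i, p \in ps -> q \in ps -> (H i * (p * q) <= Rb i * M)%N)
  (K_ge0 : 0 <= K) (f_zero : forall p, p \in ps -> `|ghat (f p) 0| <= kap)
  (f_line : forall p u, p \in ps -> u != 0 -> u *+ p = 0 ->
     \sum_(1 <= l < p) `|ghat (f p) (u *+ l)| ^+ 2 <= K)
  (f_mult : forall p r, p \in ps -> (count (fun q => q %% p == r) ps <= mult)%N).
Let S x := \sum_(p <- ps) f p x.
Let B := gbox H.

Let SE xi : ghat S xi = \sum_(p <- ps) ghat (f p) xi.
Proof. exact: ghat_sum. Qed.

Let coordP (a b : 'I_m.+2) d : (d %| M)%N -> (a - b) *+ d = 0 -> a = b %[mod M %/ d].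
Proof.
move=> dM /eqP; rewrite mulrnBl subr_eq0 !Zp_mulrn => /eqP/(congr1 val) /= E.
have d0 : (0 < d)%N by move: dM; case: d {E} => //; rewrite dvd0n.
apply/eqP; rewrite -(eqn_pmul2r d0) !muln_modl //; first by rewrite divnK // E.
Qed.

(** The p-torsion is spaced by M/p in each coordinate, and [HM] says that a side of B is no longer
    than this spacing. *)
Let close_fixed p xi eta : p \in ps -> gclose H xi eta -> (eta - xi) *+ p = 0 -> eta = xi.
Proof.
move=> pp /existsP[h /andP[hB /existsP[h' /andP[hB' /eqP ->]]]].
have -> : xi + h - h' - xi = h - h' by rewrite [LHS]addrC !addrA addNr add0r.
move=> E; suff -> : h = h' by rewrite addrK.
apply/ffunP => i; apply: val_inj.
move/ffunP/(_ i): E; rewrite ffunMnE !ffunE => /(coordP (psM pp)).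
move: hB hB'; rewrite !inE => /forallP/(_ i) h1 /forallP/(_ i) h2.
have p0 : (0 < p)%N by apply/prime_gt0/ps_prime.
have Hp : (H i <= M %/ p)%N by rewrite leq_divRL ?HM.
by rewrite !modn_small //; apply: leq_trans Hp.
Qed.

Let isolS xi : `|ghat S xi| != 0 -> gclose H 0 xi -> xi = 0.
Proof.
rewrite normr_eq0 SE => nz cl.
have [p pp nzp] : exists2 p, p \in ps & ghat (f p) xi != 0.
  apply/hasP; apply: contraNT nz => /hasPn h; rewrite big_seq big1 // => p pp.
  by apply/eqP; have := h p pp; rewrite negbK.
apply: (close_fixed pp cl); rewrite subr0; exact: ghat_periodic (f_per pp) nzp.
Qed.

(** A frequency that is both p-torsion and q-torsion is zero by Bezout. So each nonzero coefficient
    of S comes from a single prime. *)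
Let unique_p p q xi : p \in ps -> q \in ps -> xi != 0 -> ghat (f p) xi != 0 -> ghat (f q) xi != 0 -> p = q.
Proof.
move=> pp qq xi0 /(ghat_periodic (f_per pp)) e1 /(ghat_periodic (f_per qq)) e2.
apply/eqP; apply: contraNT xi0 => npq.
have cop : coprime p q by rewrite prime_coprime ?ps_prime // dvdn_prime2 ?ps_prime.
case: (egcdnP q (prime_gt0 (ps_prime pp))) => u v E _; move: E; rewrite (eqP cop) => E.
have := congr1 (fun t => xi *+ t) E; rewrite /= [(u * p)%N]mulnC mulrnA e1 mul0rn.
by rewrite mulrnDr mulr1n [(v * q)%N]mulnC mulrnA e2 mul0rn add0r => <-.
Qed.

Let Nq q xi := #|[set eta : G | [&& eta != 0, eta *+ q == 0 & gclose H xi eta]]|.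

Let deg_le xi : (gdeg H S xi <= \sum_(q <- ps) Nq q xi)%N.
Proof.
rewrite /gdeg -sum1_card (eq_bigr (fun q => \sum_(eta : G)
    ([&& eta != 0%R, eta *+ q == 0%R & gclose H xi eta] : nat)%N)); last first.
  by move=> q _; rewrite /Nq -sum1_card big_mkcond; apply: eq_bigr => eta _; rewrite inE; case: ifP.
rewrite exchange_big /= big_mkcond; apply: leq_sum => eta _; rewrite inE; case: ifP => // /and3P[e0 se cl].
move: se; rewrite SE => se.
have [p pp nzp] : exists2 p, p \in ps & ghat (f p) eta != 0.
  apply/hasP; apply: contraNT se => /hasPn h; rewrite big_seq big1 // => p pp.
  by apply/eqP; have := h p pp; rewrite negbK.
by rewrite (big_rem p) //= e0 cl (ghat_periodic (f_per pp) nzp) eqxx.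
Qed.

Let a2_le xi : xi != 0 -> `|ghat S xi| ^+ 2 <= \sum_(p <- ps) `|ghat (f p) xi| ^+ 2.
Proof.
move=> xi0; rewrite SE.
have [/hasP[p pp nzp]|h] := boolP (has (fun p => ghat (f p) xi != 0) ps); last first.
  rewrite big_seq big1 => [|p pp]; first by rewrite normr0 expr0n sumr_ge0 // => p _; rewrite exprn_ge0.
  by apply/eqP; move/hasPn/(_ p pp): h; rewrite negbK.
rewrite (bigD1_seq p) //= [X in _ <= X](bigD1_seq p) //= big_seq_cond big1 => [|q /andP[qq qp]].
  by rewrite addr0 lerDl sumr_ge0 // => q _; rewrite exprn_ge0.
apply/eqP; apply: contraNT qp => nzq; apply/eqP; exact: (unique_p qq pp xi0).
Qed.

Let inv_mod p q := ((egcdn q p).1 %% p)%N.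

Let inv_modP p q : p \in ps -> q \in ps -> p != q -> (inv_mod p q * q = 1 %[mod p])%N.
Proof.
move=> pp qq pq; rewrite /inv_mod modnMml mulnC.
have cop : coprime q p by rewrite coprime_sym prime_coprime ?ps_prime // dvdn_prime2 ?ps_prime.
case: egcdnP => [|u v E _ /=]; first exact/prime_gt0/ps_prime.
by rewrite mulnC E (eqP cop) modnMDl.
Qed.

Let Rm := (\max_i Rb i).*2.+1.
Let ks : {set {ffun I -> 'I_Rm}} :=
  [set k : {ffun I -> 'I_Rm} | [forall i, k i <= (Rb i).*2]%N].

Let card_ks : (#|ks| <= \prod_i (Rb i).*2.+1)%N.
Proof.
pose F i := [pred j : 'I_Rm | j <= (Rb i).*2]%N.
have -> : #|ks| = #|(family F : simpl_pred {ffun I -> 'I_Rm})|.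
  by apply: eq_card => k; rewrite inE; apply/forallP/familyP => h i; have := h i; rewrite ?inE.
rewrite card_family foldrE big_map enumT -/(index_enum I).
apply: leq_prod => i _.
have := @leq_card_in _ _ (fun j : 'I_Rm => (inord j : 'I_(Rb i).*2.+1)) (F i).
rewrite card_ord; apply=> j1 j2; rewrite !inE => h1 h2 /(congr1 val).
by rewrite /= !inordK // => /val_inj.
Qed.

Let U p (k : {ffun I -> 'I_Rm}) : G := [ffun i => (M %/ p * Rb i)%:R - (M %/ p * k i)%:R].

Let Up p k : p \in ps -> U p k *+ p = 0.
Proof.
move=> pp; apply/ffunP => i; rewrite ffunMnE !ffunE mulrnBl -!mulrnA ![(_ * _ * p)%N]mulnAC.
have M0 : (M%:R : 'I_m.+2) = 0 by rewrite Zp_nat; apply: val_inj; rewrite /= modnn.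
by rewrite !divnK ?psM // !mulrnA M0 !mul0rn subrr.
Qed.

(** If eta is q-torsion and close to xi, then eta = xi + (M/pq)(k - Rb) with 0 <= k <= 2 Rb in each
    coordinate, by [HR]. Multiplication by q kills eta and leaves q xi = (M/p)(Rb - k) = [U p k]. So
    xi is [U p k] times the inverse of q modulo p, and eta is recovered from k. *)
Let Nq_le p q xi : p \in ps -> q \in ps -> p != q -> xi *+ p = 0 ->
  (Nq q xi <= #|[set k in ks | U p k *+ inv_mod p q == xi]|)%N.
Proof.
move=> pp qq pq xip.
have p0 := prime_gt0 (ps_prime pp); have q0 := prime_gt0 (ps_prime qq).
have cop : coprime p q by rewrite prime_coprime ?ps_prime // dvdn_prime2 ?ps_prime.
have pqM : (p * q %| M)%N by rewrite Gauss_dvd // !psM.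
set n := (M %/ (p * q))%N.
have Mn : M = (n * (p * q))%N by rewrite /n divnK.
have n0 : (0 < n)%N by move: (Mn); case: (n).
have np : (n * q = M %/ p)%N by rewrite Mn mulnCA mulKn // mulnC.
pose E := [set eta : G | [&& eta != 0, eta *+ q == 0 & gclose H xi eta]].
pose kk (eta : G) : {ffun I -> 'I_Rm} := [ffun i => odflt ord0
  [pick j : 'I_Rm | (j <= (Rb i).*2)%N && (eta i == xi i + (n * j)%:R - (n * Rb i)%:R)]].
have kkP eta : eta \in E -> forall i, (kk eta i <= (Rb i).*2)%N /\
    eta i = xi i + (n * kk eta i)%:R - (n * Rb i)%:R.
  rewrite inE => /and3P[_ /eqP eq0 cl] i; rewrite ffunE; case: pickP => [j /andP[? /eqP ?] //|nopick].
  exfalso; move/existsP: cl => [h /andP[hB /existsP[h' /andP[hB' /eqP E1]]]].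
  have Z : (h i - h' i) *+ (p * q) = 0.
    have : (eta - xi) *+ (p * q) = 0 by rewrite mulrnBl {1}mulnC !mulrnA eq0 xip !mul0rn subrr.
    rewrite E1 (_ : xi + h - h' - xi = h - h'); last by rewrite [LHS]addrC !addrA addNr add0r.
    by move=> /ffunP/(_ i); rewrite ffunMnE !ffunE.
  have := coordP pqM Z; rewrite -/n => hh.
  move: hB hB'; rewrite !inE => /forallP/(_ i) h1 /forallP/(_ i) h2.
  have HRn : (H i <= Rb i * n)%N.
    have := HR i pp qq; rewrite [X in (_ <= _ * X)%N]Mn [X in (_ <= X)%N]mulnA leq_mul2r.
    by rewrite muln_eq0 !eqn0Ngt p0 q0.
  have le2 : (h' i <= h i + n * Rb i)%N by rewrite mulnC; apply: leq_trans (ltnW h2) (leq_trans HRn (leq_addl _ _)).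
  have dv : (n %| h i + n * Rb i - h' i)%N.
    by rewrite -eqn_mod_dvd // addnC mulnC modnMDl hh.
  pose j := ((h i + n * Rb i - h' i) %/ n)%N.
  have jE : (n * j = h i + n * Rb i - h' i)%N by rewrite /j mulnC divnK.
  have jR : (j <= (Rb i).*2)%N.
    rewrite -(leq_pmul2l n0) jE -addnn mulnDr leq_subLR.
    apply: leq_trans (leq_addl _ _); rewrite leq_add2r mulnC.
    exact: leq_trans (ltnW h1) HRn.
  have jR' : (j < Rm)%N.
    by rewrite /Rm ltnS; apply: leq_trans jR _; rewrite leq_double; apply: leq_bigmax.
  have := nopick (Ordinal jR'); rewrite /= jR /= jE E1 !ffunE natrB // natrD !natr_Zp.
  by move/eqP; apply; ring.
apply: leq_trans (_ : #|kk @: E| <= _)%N.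
  rewrite card_in_imset // => e1 e2 E1 E2 ee; apply/ffunP => i.
  by rewrite (kkP _ E1 i).2 (kkP _ E2 i).2 ee.
apply/subset_leq_card/subsetP => k /imsetP[eta eE ->]; rewrite inE; apply/andP; split.
  by rewrite inE; apply/forallP => i; case: (kkP _ eE i).
apply/eqP/ffunP => i; rewrite ffunMnE.
have [_ ei] := kkP _ eE i.
have : eta i *+ q = 0 by move: eE; rewrite inE => /and3P[_ /eqP/ffunP/(_ i)]; rewrite ffunMnE !ffunE.
rewrite ei mulrnBl mulrnDl -!mulrnA ![(_ * _ * q)%N]mulnAC np => e0.
have -> : U p (kk eta) i = xi i *+ q.
  by rewrite ffunE; apply/eqP; rewrite eq_sym -subr_eq0 opprB addrA e0.
rewrite -mulrnA (divn_eq (q * _) p) mulrnDr [(_ %/ p * p)%N]mulnC mulrnA.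
have -> : xi i *+ p = 0 by move/ffunP/(_ i): xip; rewrite ffunMnE ffunE.
rewrite mul0rn add0r [(q * _)%N]mulnC inv_modP // modn_small ?mulr1n //.
exact/prime_gt1/ps_prime.
Qed.

Let inv_range p q : p \in ps -> q \in ps -> p != q -> (1 <= inv_mod p q < p)%N.
Proof.
move=> pp qq pq; rewrite /inv_mod ltn_mod (prime_gt0 (ps_prime pp)) andbT -/(inv_mod p q).
rewrite lt0n; apply/eqP => e0; have := inv_modP pp qq pq; rewrite e0 mul0n mod0n modn_small //.
exact/prime_gt1/ps_prime.
Qed.

(** A given l is the inverse of q modulo p for the q of one residue class, of which there are at
    most [mult]. *)
Let mult_sum p (F : nat -> C) : p \in ps -> (forall l, 0 <= F l) ->
  \sum_(q <- ps | q != p) F (inv_mod p q) <= mult%:R * \sum_(1 <= l < p) F l.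
Proof.
move=> pp F0.
rewrite big_seq_cond (eq_bigr (fun q => \sum_(1 <= l < p) (l == inv_mod p q)%:R * F l)); last first.
  move=> q /andP[qq qp]; rewrite eq_sym in qp; have r := inv_range pp qq qp.
  rewrite (bigD1_seq (inv_mod p q)) /= ?mem_index_iota ?iota_uniq // eqxx mul1r big1 ?addr0 //.
  by move=> l /negPf ->; rewrite mul0r.
rewrite exchange_big /= mulr_sumr; apply: ler_sum => l _.
rewrite -mulr_suml ler_wpM2r // -natr_sum ler_nat.
have [/hasP[q0 q0s /andP[q0p /eqP lE]]|h] := boolP (has (fun q => (q != p) && (l == inv_mod p q)) ps); last first.
  rewrite big1 // => q /andP[qq qp]; move/hasPn/(_ q qq): h; rewrite qp /=.
  by case: eqP.
apply: (@leq_trans (count (fun q => q %% p == q0 %% p)%N ps)); last exact: f_mult.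
rewrite -sum1_count -big_seq_cond big_mkcond [X in (_ <= X)%N]big_mkcond /=.
rewrite big_seq [X in (_ <= X)%N]big_seq; apply: leq_sum => q qq; case: ifP => // qp.
case: eqP => //= lq; rewrite lE in lq; case: ifP => // /negP[]; apply/eqP.
rewrite eq_sym in qp; rewrite eq_sym in q0p.
have e1 := inv_modP pp qq qp; have e2 := inv_modP pp q0s q0p; rewrite lq in e2.
have f1 : ((q * (inv_mod p q * q0)) %% p = q %% p)%N by rewrite -modnMmr e2 modnMmr muln1.
have f2 : ((q0 * (inv_mod p q * q)) %% p = q0 %% p)%N by rewrite -modnMmr e1 modnMmr muln1.
by rewrite -f1 -f2; congr (_ %% _)%N; rewrite mulnCA [RHS]mulnCA [(q * q0)%N]mulnC.
Qed.

(** The prime q = p meets each xi at most once, and Parseval bounds this part by 1. For q different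
    from p, fix the offset k: the xi that occur lie on the line of multiples of [U p k], each hit at
    most [mult] times, and the mean square on a line is at most K. *)
Let nzsum p : p \in ps -> \sum_(xi : G | xi != 0) `|ghat (f p) xi| ^+ 2 * (\sum_(q <- ps) Nq q xi)%:R <=
  1 + #|ks|%:R * mult%:R * K.
Proof.
move=> pp; set w := fun xi => `|ghat (f p) xi| ^+ 2.
have w0 xi : 0 <= w xi by rewrite exprn_ge0.
have wp xi : w xi != 0 -> xi *+ p = 0.
  by rewrite expf_eq0 /= normr_eq0; apply: ghat_periodic; apply: f_per.
rewrite (eq_bigr (fun xi => \sum_(q <- ps) w xi * (Nq q xi)%:R)); last first.
  by move=> xi _; rewrite natr_sum mulr_sumr.
rewrite exchange_big /= (bigD1_seq p) //=; apply: lerD.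
  apply: le_trans (_ : \sum_xi w xi <= _).
    rewrite [X in _ <= X](bigID (fun xi : G => xi != 0)) /= -[X in X <= _]addr0.
    apply: lerD; last by apply: sumr_ge0.
    apply: ler_sum => xi _; have [->|nz] := eqVneq (w xi) 0; first by rewrite mul0r.
    rewrite -[X in _ <= X]mulr1; apply: ler_wpM2l => //; rewrite lern1.
    apply: leq_trans (_ : #|[set xi]| <= _)%N; last by rewrite cards1.
    apply/subset_leq_card/subsetP => eta; rewrite !inE => /and3P[_ /eqP e0 cl]; apply/eqP.
    by apply: (close_fixed pp cl); rewrite mulrnBl e0 (wp _ nz) subrr.
  rewrite /w ghat_parseval ler_pdivrMl ?nG_gt0 // mulr1 /nG -sum1_card natr_sum.
  by apply: ler_sum => x _; rewrite exprn_ile1 // f_le1.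
apply: le_trans (_ : \sum_(q <- ps | q != p) \sum_(k in ks | U p k != 0) w (U p k *+ inv_mod p q) <= _).
  rewrite big_seq_cond [X in _ <= X]big_seq_cond; apply: ler_sum => q /andP[qq qp].
  rewrite eq_sym in qp.
  apply: le_trans (_ : \sum_(xi : G | xi != 0) \sum_(k in ks | U p k *+ inv_mod p q == xi) w xi <= _).
    apply: ler_sum => xi xi0; have [->|nz] := eqVneq (w xi) 0; first by rewrite mul0r sumr_ge0.
    rewrite sumr_const -[X in _ <= X]mulr_natr; apply: ler_wpM2l => //; rewrite ler_nat.
    apply: leq_trans (Nq_le pp qq qp (wp _ nz)) _; apply: eq_leq.
    by apply: eq_card => k; rewrite inE.
  rewrite (exchange_big_dep (mem ks)) /=; last by move=> xi k _ /andP[].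
  rewrite [X in _ <= X]big_mkcondr /=; apply: ler_sum => k kK.
  case: ifP => [u0|/negbFE/eqP u0].
    rewrite big_mkcond (bigD1 (U p k *+ inv_mod p q)) //= big1 ?addr0 => [|xi xin].
      by rewrite kK eqxx /= andbT; case: ifP.
    by rewrite [U p k *+ _ == xi]eq_sym (negPf xin) !andbF.
  rewrite big1 // => xi /andP[xi0 /andP[_ /eqP e]]; case/negP: xi0.
  by rewrite -e u0 mul0rn.
rewrite exchange_big /=.
rewrite -mulrA mulr_natl -sumr_const [X in _ <= X](bigID (fun k => U p k != 0)) /=.
rewrite -[X in X <= _]addr0; apply: lerD; last first.
  by apply: sumr_ge0 => k _; rewrite mulr_ge0.
apply: ler_sum => k /andP[kK u0].
apply: le_trans (@mult_sum p (fun l => w (U p k *+ l)) pp _) _ => //.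
by rewrite ler_wpM2l // f_line // Up.
Qed.

(** The zero frequency collects the means of all f p, each at most kap. For the other frequencies S
    has the coefficients of one f p at a time, so the neighbours are counted prime by prime with
    [nzsum]. *)
Theorem square_sieve_inequality :
  c0 ^+ 2 * #|B|%:R * \sum_(x in gbox X) `|\sum_(p <- ps) f p x| ^+ 2 <=
  nG * (((size ps)%:R * kap) ^+ 2 + (size ps)%:R * (1 + (\prod_i (Rb i).*2.+1)%:R * mult%:R * K)).
Proof.
apply: le_trans (large_sieve_schur c0_gt0 zRe H_gt0 XH isolS) _.
apply: ler_wpM2l; first by rewrite ltW // nG_gt0.
apply: lerD.
  have kE : (size ps)%:R * kap = \sum_(p <- ps) kap by rewrite big_const_seq count_predT iter_addr_0 mulr_natl.
  have h : `|ghat S 0| <= (size ps)%:R * kap.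
    rewrite SE kE; apply: le_trans (ler_norm_sum _ _ _) _.
    by rewrite big_seq [X in _ <= X]big_seq; apply: ler_sum => p; apply: f_zero.
  by apply: lerXn2r; rewrite ?nnegrE ?(le_trans _ h).
apply: le_trans (_ : \sum_(xi : G | xi != 0) \sum_(p <- ps) `|ghat (f p) xi| ^+ 2 * (\sum_(q <- ps) Nq q xi)%:R <= _).
  apply: ler_sum => xi xi0; rewrite -mulr_suml ler_pM ?exprn_ge0 ?a2_le //.
  by rewrite ler_nat deg_le.
rewrite exchange_big /= -sum1_size natr_sum mulr_suml big_seq [X in _ <= X]big_seq.
apply: ler_sum => p pp; rewrite mul1r; apply: le_trans (nzsum pp) _.
by rewrite lerD2l !ler_wpM2r // ler_nat card_ks.
Qed.
End SquareSieve.
End Fourier.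

(** * Fourier coefficients of functions pulled back from a prime field *)

Section PrimeLevel.
Variables (C : numClosedFieldType) (m : nat) (I : finType) (z : C).
Local Notation M := m.+2.
Hypotheses (zM : z ^+ M = 1) (zn : forall k, (0 < k < M)%N -> z ^+ k != 1).
Local Notation G := {ffun I -> 'I_m.+2}.
Variables (p : nat) (p_pr : prime p) (pM : (p %| M)%N).
Local Notation V := {ffun I -> 'F_p}.

Definition gred (x : G) : V := [ffun i => (x i : nat)%:R].

Let natM k : (k %% M)%:R = k%:R :> 'F_p.
Proof.
rewrite {2}(divn_eq k M) natrD natrM.
have -> : (M%:R : 'F_p) = 0 by apply/eqP; rewrite -(dvdn_pcharf (pchar_Fp p_pr)).
by rewrite mulr0 add0r.
Qed.

Lemma gredD x y : gred (x + y) = gred x + gred y.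
Proof. by apply/ffunP => i; rewrite !ffunE /= natM natrD. Qed.

Lemma gredMn x k : gred (x *+ k) = gred x *+ k.
Proof.
elim: k => [|k IH]; last by rewrite !mulrS gredD IH.
by apply/ffunP => i; rewrite !ffunE.
Qed.

Lemma gred_per x y : gred (x + y *+ p) = gred x.
Proof.
rewrite gredD gredMn; apply/ffunP => i; rewrite !ffunE ffunMnE.
by rewrite -[_ *+ p]mulr_natr (pcharf0 (pchar_Fp p_pr)) mulr0 addr0.
Qed.

Let pp0 := prime_gt0 p_pr.
Let glift (v : V) : G := [ffun i => inord (v i)].

Let FpE (a : 'F_p) : (nat_of_ord a < p)%N.
Proof. by have := ltn_ord a; rewrite [X in (_ < X)%N]Fp_cast. Qed.

Let glift_red v : gred (glift v) = v.
Proof.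
apply/ffunP => i; rewrite !ffunE inordK; first exact: natr_Zp.
by apply: leq_trans (FpE _) (dvdn_leq _ pM).
Qed.

Let r := #|I|.

Lemma sum_gred (Phi : V -> C) :
  \sum_x Phi (gred x) = nG C m I / p%:R ^+ r * \sum_v Phi v.
Proof.
pose fib v := #|[set x | gred x == v]|.
have fibE v : fib v = fib 0.
  rewrite /fib -(card_imset [set x | gred x == 0] (addIr (glift v))).
  apply: eq_card => x; rewrite inE; apply/eqP/imsetP => [xv|[y]]; last first.
    by rewrite inE => /eqP y0 ->; rewrite gredD y0 add0r glift_red.
  exists (x - glift v); last by rewrite subrK.
  rewrite inE; apply/eqP; have : gred (x - glift v + glift v) = v by rewrite subrK.
  by rewrite gredD glift_red => /(canRL (addrK _)); rewrite subrr.
have S (Ps : V -> C) : \sum_x Ps (gred x) = (fib 0)%:R * \sum_v Ps v.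
  rewrite (partition_big gred predT) //= mulr_sumr; apply: eq_bigr => v _.
  rewrite (eq_bigr (fun=> Ps v)) => [|x /eqP -> //].
  rewrite sumr_const -[_ *+ _]mulr_natl -(fibE v); congr (_%:R * _).
  by apply: eq_card => x; rewrite inE.
have := S (fun=> 1); rewrite !sumr_const -[X in X *+ _ = _]mulr1n mulr1n -/(nG C m I).
rewrite card_ffun card_Fp // -/r natrX => ->.
rewrite S mulfK // expf_neq0 // pnatr_eq0 -lt0n //.
Qed.

Variable phi : V -> int.
Definition gfun (x : G) : C := (phi (gred x))%:~R.

Lemma ghat_gfun0 : ghat z gfun 0 = (\sum_v phi v)%:~R / p%:R ^+ r.
Proof.
rewrite /ghat (eq_bigr (fun x => (phi (gred x))%:~R)) => [|x _]; last by rewrite gchar0l // conjC1 mulr1.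
rewrite (sum_gred (fun v => (phi v)%:~R)) mulrA mulrA mulVf ?mul1r; last by rewrite gt_eqF ?nG_gt0.
by rewrite mulrC rmorph_sum.
Qed.

Definition lsum (a : V) (c : 'F_p) : int := \sum_(v : V | \sum_i a i * v i == c) phi v.

Let om := z ^+ (M %/ p).

Let omp : om ^+ p = 1. Proof. by rewrite /om -exprM divnK. Qed.
Let omn k : (0 < k < p)%N -> om ^+ k != 1.
Proof.
move=> /andP[k0 kp]; rewrite /om -exprM; apply: zn.
have n0 : (0 < M %/ p)%N by rewrite divn_gt0 // dvdn_leq.
rewrite muln_gt0 k0 n0; move: kp; rewrite -(ltn_pmul2l n0) => /leq_trans; apply.
exact: leq_trunc_div.
Qed.

(** A p-torsion u is (M/p) a for a linear form a modulo p, and its character depends on a.v alone.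
    The coefficient at l u is thus the one-dimensional Fourier coefficient at l of c |-> [lsum a c],
    and Parseval on F_p gives the mean square over all l. *)
Lemma ghat_gfun_line (u : G) : u *+ p = 0 ->
  exists a : V, (u != 0 -> a != 0) /\
  \sum_(1 <= l < p) `|ghat z gfun (u *+ l)| ^+ 2 <=
    p%:R / (p%:R ^+ r) ^+ 2 * (\sum_c lsum a c ^+ 2)%:~R.
Proof.
move=> up; set n := (M %/ p)%N.
have n0 : (0 < n)%N by rewrite divn_gt0 // dvdn_leq.
have Mn : M = (n * p)%N by rewrite divnK.
have dv i : (n %| u i)%N.
  move/ffunP/(_ i): up; rewrite ffunMnE ffunE Zp_mulrn => /(congr1 val) /= /eqP.
  by rewrite -/(dvdn _ _) {1}Mn dvdn_pmul2r.
pose av i := (u i %/ n)%N.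
have uE i : u i = (n * av i)%N :> nat by rewrite mulnC divnK.
have avp i : (av i < p)%N by rewrite /av ltn_divLR // mulnC -Mn.
pose a : V := [ffun i => (av i)%:R].
exists a; split.
  apply: contraNneq => a0; apply/eqP/ffunP => i; rewrite ffunE; apply: val_inj => /=.
  move/ffunP/(_ i): a0; rewrite !ffunE => /eqP; rewrite -(dvdn_pcharf (pchar_Fp p_pr)).
  by rewrite uE; case: (posnP (av i)) => [->|a0 /(dvdn_leq a0)]; rewrite ?muln0 // leqNgt avp.
have chE x : gchar z u x = om ^+ (\sum_i a i * gred x i : 'F_p)%R.
  rewrite /gchar /om -exprM.
  have omod k : om ^+ (k %% p) = om ^+ k.
    by rewrite {2}(divn_eq k p) exprD mulnC exprM omp expr1n mul1r.
  have zmod k : z ^+ (k %% M) = z ^+ k.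
    by rewrite {2}(divn_eq k M) exprD mulnC exprM zM expr1n mul1r.
  have -> : z ^+ gdot u x = z ^+ (\sum_i u i * x i)%N.
    rewrite -[RHS]zmod; congr (z ^+ _); rewrite /gdot.
    elim/big_rec2: _ => [|i y1 y2 _ IH] /=; first by rewrite mod0n.
    by rewrite IH modnDml modnDmr.
  have -> : (\sum_i u i * x i = n * \sum_i av i * x i)%N.
    by rewrite big_distrr; apply: eq_bigr => i _; rewrite uE /= mulnA.
  rewrite exprM exprM -/n -/om -[LHS]omod -[RHS]omod; congr (_ ^+ _).
  have -> : \sum_i a i * gred x i = (\sum_i av i * x i)%:R.
    by rewrite natr_sum; apply: eq_bigr => i _; rewrite !ffunE natrM.
  by rewrite val_Fp_nat // modn_mod.
pose L c : C := (lsum a c)%:~R; pose w := om^*.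
have hE l : ghat z gfun (u *+ l) = (p%:R ^+ r)^-1 * \sum_c L c * w ^+ (l * c).
  rewrite /ghat (eq_bigr (fun x => (fun v : V => (phi v)%:~R * w ^+ (l * (\sum_i a i * v i : 'F_p)%R)) (gred x))); last first.
    move=> x _; rewrite gcharMn // rmorphXn /= chE rmorphXn /= -/w -exprM mulnC //.
  rewrite (sum_gred (fun v : V => (phi v)%:~R * w ^+ (l * (\sum_i a i * v i : 'F_p)%R))) mulrA mulrA mulVf ?mul1r; last by rewrite gt_eqF ?nG_gt0.
  congr (_ * _); rewrite (partition_big (fun v : V => \sum_i a i * v i) predT) //=.
  apply: eq_bigr => c _; rewrite /L /lsum rmorph_sum mulr_suml; apply: eq_bigr => v /eqP -> //.
have w1 : w * om = 1.
  by rewrite mulrC -normCK /om normrX (norm_z zM) expr1n expr1n.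
have wn c c' : c != c' :> 'F_p -> w ^+ c * om ^+ c' != 1.
  move=> cc; wlog lt : c c' cc / (c < c')%N.
    move=> W; have [/W-> //|] := ltnP c c'; rewrite leq_eqVlt => /orP[/eqP/val_inj e|lt].
      by rewrite e eqxx in cc.
    have := W c' c; rewrite eq_sym cc lt => /(_ isT isT); apply: contraNneq => E.
    have : (w ^+ c' * om ^+ c) * (w ^+ c * om ^+ c') = 1.
      by rewrite mulrACA -!exprD [(c' + c)%N]addnC -exprMn w1 expr1n.
    by rewrite E mulr1 => ->.
  rewrite -(subnKC (ltnW lt)) exprD mulrA -exprMn w1 expr1n mul1r.
  by apply: omn; rewrite subn_gt0 lt /=; apply: leq_ltn_trans (leq_subr _ _) (FpE _).
apply: le_trans (_ : \sum_(0 <= l < p) `|ghat z gfun (u *+ l)| ^+ 2 <= _).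
  by rewrite [X in _ <= X](big_cat_nat (n := 1)) //= lerDr sumr_ge0 // => l _; rewrite exprn_ge0.
under eq_bigr do rewrite hE normrM exprMn.
rewrite -mulr_sumr normfV normrX normr_nat exprVn [p%:R / _]mulrC -mulrA.
rewrite ler_wpM2l ?invr_ge0 ?exprn_ge0 ?ler0n //.
rewrite (eq_bigr (fun l => \sum_c \sum_c' L c * L c' * (w ^+ c * om ^+ c') ^+ l)); last first.
  move=> l _; rewrite normCK rmorph_sum /= mulr_suml; apply: eq_bigr => c _.
  rewrite mulr_sumr; apply: eq_bigr => c' _.
  have -> : (L c' * w ^+ (l * c'))^* = L c' * om ^+ (l * c').
    by rewrite rmorphM rmorphXn /= -/w /L rmorph_int /w conjCK.
  by rewrite exprMn -!exprM ![(l * _)%N]mulnC; ring.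
rewrite exchange_big /=; under eq_bigr do rewrite exchange_big /=.
rewrite rmorph_sum /= mulr_sumr le_eqVlt; apply/orP; left; apply/eqP; apply: eq_bigr => c _.
rewrite (bigD1 c) //= -exprMn w1 expr1n.
under eq_bigr do rewrite expr1n mulr1.
rewrite big_const_nat subn0 iter_addr_0 [X in _ + X]big1 => [|c' cc']; last first.
  rewrite -mulr_sumr; set q := w ^+ c * om ^+ c'.
  have q1 : q != 1 by apply: wn; rewrite eq_sym.
  have qp : q ^+ p = 1.
    by rewrite /q exprMn -!exprM ![(_ * p)%N]mulnC !exprM omp /w -rmorphXn /= omp conjC1 !expr1n mulr1.
  have := subrX1 q p; rewrite qp subrr => /esym/eqP; rewrite mulf_eq0 subr_eq0 (negPf q1) /= big_mkord.
  by move/eqP ->; rewrite mulr0.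
by rewrite addr0 -[_ *+ p]mulr_natl rmorphXn /= expr2.
Qed.
End PrimeLevel.

(** * Character sums of products of linear forms along lines *)

Lemma char_poly_conj_diag (K : fieldType) n (A V : 'M[K]_n) (a : 'rV[K]_n) : V \in unitmx ->
  V *m A = diag_mx a *m V -> char_poly A = \prod_i ('X - (a 0 i)%:P).
Proof.
move=> Vu VA.
have dV : \det (map_mx (@polyC K) V) \is a GRing.unit by rewrite det_map_mx rmorph_unit // -unitmxE.
apply: (mulrI dV); rewrite /char_poly -det_mulmx /char_poly_mx mulmxBr mul_mx_scalar -map_mxM VA map_mxM.
have -> : 'X *: map_mx polyC V - map_mx polyC (diag_mx a) *m map_mx polyC V =
    diag_mx (\row_i ('X - (a 0 i)%:P)) *m map_mx polyC V.
  rewrite map_diag_mx !mul_diag_mx; apply/matrixP => i j; rewrite !mxE; ring.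
rewrite det_mulmx det_diag mulrC; congr (_ * _); by apply: eq_bigr => i _; rewrite mxE.
Qed.

(** B has distinct eigenvalues, so it is diagonalizable, and a matrix commuting with it is diagonal
    in the same basis. *)
Lemma comm_diag_factor (F : fieldType) (K : closedFieldType) (io : {rmorphism F -> K}) n
    (A B : 'M[F]_n) : A *m B = B *m A -> separable_poly (char_poly B) ->
  exists (V : 'M[K]_n) (a b : 'rV[K]_n), [/\ V \in unitmx,
    V *m map_mx io A = diag_mx a *m V, V *m map_mx io B = diag_mx b *m V & injective (b 0)].
Proof.
case: n A B => [|n] A B AB sepB.
  exists 1%:M, 0, 0; split; rewrite ?unitmx1 //; try by apply/matrixP => -[].
  by move=> [].
set A' := map_mx io A; set B' := map_mx io B.
have AB' : A' *m B' = B' *m A' by rewrite -!map_mxM AB.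
have sepB' : separable_poly (char_poly B') by rewrite -map_char_poly separable_map.
have [r rE] := closed_field_poly_normal (char_poly B').
move: rE; rewrite (monicP (char_poly_monic B')) scale1r => rE.
have ur : uniq r by rewrite -separable_prod_XsubC -rE.
have /mxpoly.diagonalizableP[V Vu /(mxpoly.diagonalizable_forP _ Vu) VB] :
    exists2 rs : seq K, uniq rs & mxminpoly B' %| \prod_(x <- rs) ('X - x%:P).
  by exists r => //; rewrite -rE mxminpoly_dvd_char.
pose D := V *m B' *m invmx V; pose b : 'rV[K]_n.+1 := \row_i D i i.
have DE : D = diag_mx b.
  apply/matrixP => i j; rewrite [RHS]mxE; case: eqP => [->|/eqP ij]; first by rewrite mulr1n [RHS]mxE.
  by rewrite mulr0n; apply: VB.
have bV : V *m B' = diag_mx b *m V by rewrite -DE /D -!mulmxA mulVmx // mulmx1.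
have cB := char_poly_conj_diag Vu bV.
have binj : injective (b 0).
  have : uniq [seq b 0 i | i <- enum 'I_n.+1].
    rewrite -separable_prod_XsubC big_map enumT -/(index_enum _).
    by rewrite -cB.
  by move=> u; apply/injectiveP.
pose D2 := V *m A' *m invmx V; pose a : 'rV[K]_n.+1 := \row_i D2 i i.
have comm : D2 *m D = D *m D2.
  rewrite /D2 /D !mulmxA !(mulmxKV Vu) -!(mulmxA V) AB' //.
exists V, a, b; split => //; rewrite -/A'.
have -> : diag_mx a = D2; last by rewrite /D2 -!mulmxA mulVmx // mulmx1.
apply/matrixP => i j; rewrite [LHS]mxE; case: eqP => [->|/eqP ij]; first by rewrite mulr1n [LHS]mxE.
have := congr1 (fun Q : 'M_n.+1 => Q i j) comm; rewrite DE mul_mx_diag mul_diag_mx [X in X = _]mxE [X in _ = X]mxE => /eqP.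
rewrite mulr0n -subr_eq0 [D2 i j * _]mulrC -mulrBl mulf_eq0 subr_eq0 => /orP[/eqP/binj/esym/eqP|/eqP //].
by rewrite (negPf ij).
Qed.

Section Lines.
Variables (p n : nat) (p_pr : prime p) (p_odd : odd p).
Variables (A B : 'M['F_p]_n).
Hypotheses (AB : A *m B = B *m A) (sepB : separable_poly (char_poly B)).
Hypothesis nA : forall t, char_poly A <> ('X - t%:P) ^+ n.

(** Over the algebraic closure this is the product of the forms x + a_j y + b_j, with the b_j
    distinct by [sepB] and the a_j not all equal by [nA]. *)
Definition linform2 (x y : 'F_p) := \det (x%:M + y *: A + B).

Let Cn := ((100 * n.+1) ^ 2)%N.

Let line_poly (x0 y0 h k : 'F_p) : {poly 'F_p} :=
  \det (map_mx polyC (x0%:M + y0 *: A + B) + 'X *: map_mx polyC (k%:M - h *: A)).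

Let line_polyE x0 y0 h k s : (line_poly x0 y0 h k).[s] = linform2 (x0 + k * s) (y0 - h * s).
Proof.
rewrite -horner_evalE -det_map_mx /linform2; congr (\det _).
apply/matrixP => i j; rewrite !mxE.
rewrite -[LHS]/(_.[s]) !(hornerD, hornerM, hornerX, hornerC, hornerN).
by rewrite !mulrnDl; ring.
Qed.

(** On the line h x + k y = c the factors become u_j + d_j X with d_j = k - a_j h, and some d_j is
    nonzero since the a_j are not all equal. The factors i and j share a root when (a_i - a_j) c +
    b_i d_j - b_j d_i = 0. This is a nontrivial linear equation in c: if a_i = a_j, its constant
    term is (b_i - b_j) d_j. So each i excludes at most one c, and for the other c the j-th root is
    simple. *)
Lemma line_poly_nonsquare h k : (h, k) != (0, 0) -> exists bad : {set 'F_p}, (#|bad| <= n)%N /\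
  forall x0 y0, h * x0 + k * y0 \notin bad ->
    nonsquare_poly (line_poly x0 y0 h k) /\ (size (line_poly x0 y0 h k) <= n.+1)%N.
Proof.
move=> hk.
have [K [io _]] := countable_algebraic_closure 'F_p.
have [V [a [b [Vu VA VB binj]]]] := comm_diag_factor io AB sepB.
pose u x0 y0 j := io x0 + a 0 j * io y0 + b 0 j; pose d j := io k - a 0 j * io h.
have fE x0 y0 : map_poly io (line_poly x0 y0 h k) = \prod_j ((u x0 y0 j)%:P + d j *: 'X).
  rewrite /line_poly -det_map_mx map_mxD map_mxZ /= map_polyX -!map_mx_comp.
  set P := map_mx _ _; set Q := map_mx _ _.
  have mV : \det (map_mx (@polyC K) V) \is a GRing.unit.
    by rewrite det_map_mx rmorph_unit // -unitmxE.
  apply: (mulrI mV); rewrite -det_mulmx.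
  pose E : 'rV[{poly K}]_n := \row_j ((u x0 y0 j)%:P + d j *: 'X).
  have -> : map_mx (@polyC K) V *m (P + 'X *: Q) = diag_mx E *m map_mx polyC V.
    have PE : P = map_mx (@polyC K) ((io x0)%:M + io y0 *: map_mx io A + map_mx io B).
      by apply/matrixP => i j; rewrite !mxE /= map_polyC /= !rmorphD !rmorphM ?rmorphMn.
    have QE : Q = map_mx (@polyC K) ((io k)%:M - io h *: map_mx io A).
      by apply/matrixP => i j; rewrite !mxE /= map_polyC /= rmorphB rmorphM rmorphMn.
    have VP : V *m ((io x0)%:M + io y0 *: map_mx io A + map_mx io B) = diag_mx (\row_j u x0 y0 j) *m V.
      rewrite !mulmxDr mul_mx_scalar -scalemxAr VA VB !mul_diag_mx.
      by apply/matrixP => i j; rewrite !mxE /u; ring.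
    have VQ : V *m ((io k)%:M - io h *: map_mx io A) = diag_mx (\row_j d j) *m V.
      rewrite mulmxBr mul_mx_scalar -scalemxAr VA !mul_diag_mx.
      by apply/matrixP => i j; rewrite !mxE /d; ring.
    rewrite mulmxDr -scalemxAr PE QE -!map_mxM VP VQ !mul_diag_mx.
    apply/matrixP => i j; rewrite !mxE.
    rewrite !rmorphM /= mulrDl -!mul_polyC; ring.
  rewrite det_mulmx det_diag mulrC; congr (_ * _).
  by apply: eq_bigr => j _; rewrite mxE.
have [j dj] : exists j, d j != 0.
  apply/existsP; apply: contraT; rewrite negb_exists => /forallP H0.
  have H j : a 0 j * io h = io k by have := H0 j; rewrite negbK subr_eq0 => /eqP.
  have [h0|h0] := eqVneq h 0.
    have n0 : (0 < n)%N.
      rewrite lt0n; apply/eqP => n0; case: (@nA 0).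
      have -> : ('X - 0%:P : {poly 'F_p}) ^+ n = 1 by rewrite n0 expr0.
      have sz : size (char_poly A) == 1%N by rewrite size_char_poly n0.
      have [c c0 cE] := size_poly1P _ sz.
      by have := monicP (char_poly_monic A); rewrite cE lead_coefC => ->.
    have := H (Ordinal n0); rewrite h0 rmorph0 mulr0 => /esym/eqP; rewrite fmorph_eq0 => /eqP k0.
    by rewrite h0 k0 eqxx in hk.
  case: (@nA (k / h)); apply: (map_inj_poly (fmorph_inj io) (rmorph0 io)).
  rewrite map_char_poly (char_poly_conj_diag Vu VA) rmorphXn rmorphB /= map_polyX map_polyC /=.
  rewrite (eq_bigr (fun=> 'X - (io (k / h))%:P)) => [|i _]; first by rewrite prodr_const card_ord.
  by rewrite fmorph_div -(H i) mulfK // fmorph_eq0.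
pose bad : {set 'F_p} := [set c | [exists i, (i != j) &&
   ((a 0 i - a 0 j) * io c + (b 0 i * d j - b 0 j * d i) == 0)]].
have uE x0 y0 i : u x0 y0 i * d j - u x0 y0 j * d i =
   (a 0 i - a 0 j) * io (h * x0 + k * y0) + (b 0 i * d j - b 0 j * d i).
  by rewrite /u /d rmorphD !rmorphM; ring.
exists bad; split.
  pose cond i c := (i != j) && ((a 0 i - a 0 j) * io c + (b 0 i * d j - b 0 j * d i) == 0).
  pose g c := odflt j [pick i | cond i c].
  have gP c : c \in bad -> cond (g c) c.
    rewrite inE => /existsP[i ci]; rewrite /g; case: pickP => [//|/(_ i)].
    by rewrite /cond ci.
  rewrite -[X in (_ <= X)%N]card_ord -(@card_in_imset _ _ g); first exact: max_card.
  move=> c c' /gP + /gP + gE; rewrite -gE => /andP[ij /eqP e1] /andP[_ /eqP e2].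
  apply: (fmorph_inj io); apply/eqP; rewrite -subr_eq0; apply: contraT => nz.
  have : (a 0 (g c) - a 0 j) * (io c - io c') == 0.
    rewrite mulrBr subr_eq0; apply/eqP; apply: (addIr (b 0 (g c) * d j - b 0 j * d (g c))).
    by rewrite e1 e2.
  rewrite mulf_eq0 (negPf nz) orbF subr_eq0 => /eqP aE.
  move: e1; rewrite {1}aE subrr mul0r add0r {2}/d aE -/(d j) -mulrBl => /eqP.
  by rewrite mulf_eq0 (negPf dj) orbF subr_eq0 => /eqP/binj/eqP; rewrite (negPf ij).
move=> x0 y0; rewrite inE negb_exists => /forallP good.
have gd i : i != j -> u x0 y0 i * d j != u x0 y0 j * d i.
  by move=> ij; have := good i; rewrite ij /= -uE subr_eq0.
split; last first.
  rewrite -(size_map_poly io) fE; apply: leq_trans (size_prod_leq _ _) _.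
  rewrite leq_subLR cardE size_enum_ord addnS ltnS.
  apply: (@leq_trans (\sum_(i < n) 2)); last by rewrite sum_nat_const card_ord muln2 addnn.
  apply: leq_sum => i _; apply: leq_trans (size_polyD _ _) _; rewrite geq_max; apply/andP; split.
    by apply: leq_trans (size_polyC_leq1 _) _.
  by apply: leq_trans (size_scale_leq _ _) _; rewrite size_polyX.
move=> c r s /(congr1 (map_poly io)); rewrite rmorphM rmorphXn /= fE map_polyZ rmorphXn /=.
rewrite (bigD1 j) //=; set g := \prod_(i | _) _.
pose rho := - u x0 y0 j / d j.
have rd : rho * d j = - u x0 y0 j by rewrite /rho divfK.
have gr : ~~ root g rho.
  rewrite rootE horner_prod; apply/prodf_neq0 => i ij; rewrite hornerD hornerC hornerZ hornerX.
  apply: contraNneq (gd i ij) => E.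
  have : (u x0 y0 i + d i * rho) * d j = 0 by rewrite E mul0r.
  by rewrite mulrDl -mulrA rd mulrN => /eqP; rewrite subr_eq0 [d i * _]mulrC.
have lE : (u x0 y0 j)%:P + d j *: 'X = d j *: ('X - rho%:P).
  rewrite scalerBr -mul_polyC -[d j *: rho%:P]mul_polyC -polyCM /rho mulrCA divff // mulr1 polyCN opprK addrC.
  by rewrite mul_polyC.
rewrite lE => E; apply/eqP; apply: contraT => r0.
have R0 : map_poly io r != 0 by rewrite map_poly_eq0.
have g0 : g != 0 by apply: contraNneq gr => ->; rewrite root0.
have L0 : d j *: ('X - rho%:P) != 0 by rewrite scaler_eq0 negb_or dj polyXsubC_eq0.
have : map_poly io r ^+ 2 * (d j *: ('X - rho%:P) * g) != 0.
  by rewrite !mulf_neq0 ?expf_neq0.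
rewrite E scaler_eq0 negb_or => /andP[c0 S0].
have S1 : map_poly io s != 0 by apply: contraNneq S0 => ->; rewrite expr0n.
have mscale (e : K) q : e != 0 -> mup rho (e *: q) = mup rho q.
  by move=> e0; rewrite -mul_polyC mupMr // rootC.
(* The multiplicity of rho is odd on the left and even on the right. *)
have := congr1 (mup rho) E; rewrite mscale // !expr2 mupM ?mulf_neq0 // mupM // mupMl // mscale //.
rewrite [in RHS]mupM // -['X - _]expr1 mup_XsubCX eqxx.
by move: (mup rho _) (mup rho _); clear => x y; lia.
Qed.

Let sum_line (h k c : 'F_p) : int :=
  \sum_(xy : 'F_p * 'F_p | h * xy.1 + k * xy.2 == c) quadchar (linform2 xy.1 xy.2).

Let sum_lineE h k x0 y0 : (h, k) != (0, 0) ->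
  sum_line h k (h * x0 + k * y0) = \sum_s quadchar (line_poly x0 y0 h k).[s].
Proof.
move=> hk; rewrite /sum_line.
pose F s := (x0 + k * s, y0 - h * s); 
pose F' (xy : 'F_p * 'F_p) := if h == 0 then (xy.1 - x0) / k else (y0 - xy.2) / h.
rewrite (reindex_onto F F') => [|[x y] /= /eqP e].
  apply: eq_big => [s|s _]; last by rewrite line_polyE.
  rewrite /F /F' /=; apply/idP; apply/andP; split; first by apply/eqP; ring.
  have [h0|h0] := eqVneq h 0; last by rewrite opprB addrC addrNK mulrC mulKf.
  have k0 : k != 0 by apply: contraNneq hk => ->; rewrite h0.
  by rewrite addrC addKr mulrC mulKf.
rewrite /F /F' /=; case: eqVneq => [h0|h0].
  have k0 : k != 0 by apply: contraNneq hk => ->; rewrite h0.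
  move: e; rewrite h0 !mul0r !add0r => /(mulfI k0) ->.
  by rewrite subr0 mulrC divfK // addrC subrK.
rewrite [h * (_ / h)]mulrC divfK // subKr; congr (_, _).
apply: (mulfI h0); rewrite mulrDr mulrCA [h * (_ / h)]mulrC divfK // mulrBr addrA -e; ring.
Qed.

Let normq_le : forall a : 'F_p, `|quadchar a| <= 1.
Proof. by move=> a; rewrite /quadchar; case: eqP => // _; case: eqP. Qed.

(** At most n bad lines cost p^2 each, trivially; each of the p lines costs at most [Cn * p] when
    good, by Stepanov's bound. *)
Theorem line_sums h k : (h, k) != (0, 0) ->
  \sum_c sum_line h k c ^+ 2 <= ((n + Cn) * p ^ 2)%:Z.
Proof.
move=> hk; have [bad [cbad good]] := line_poly_nonsquare hk.
have base c : exists xy : 'F_p * 'F_p, h * xy.1 + k * xy.2 = c.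
  have [h0|h0] := eqVneq h 0.
    have k0 : k != 0 by apply: contraNneq hk => ->; rewrite h0.
    by exists (0, c / k); rewrite /= mulr0 add0r mulrC divfK.
  by exists (c / h, 0); rewrite /= mulr0 addr0 mulrC divfK.
have trivial_bound c : sum_line h k c ^+ 2 <= (p ^ 2)%:Z.
  have [[x0 y0] /= <-] := base c; rewrite sum_lineE //.
  have : `|\sum_s quadchar (line_poly x0 y0 h k).[s]| <= p%:Z.
    apply: le_trans (ler_norm_sum _ _ _) _.
    have -> : p%:Z = \sum_(x : 'F_p) 1 by rewrite sumr_const [#|_|]card_Fp // natz.
    by apply: ler_sum => x _; apply: normq_le.
  by rewrite -(ler_pXn2r (_ : 0 < 2)%N) ?nnegrE // real_normK ?num_real.
rewrite (bigID (mem bad)) /= mulnDl PoszD; apply: lerD.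
  apply: le_trans (_ : \sum_(c in bad) (p ^ 2)%:Z <= _); first by apply: ler_sum.
  rewrite sumr_const -mulr_natr natz -PoszM lez_nat mulnC leq_mul2r cbad orbT //.
apply: le_trans (_ : \sum_(c : 'F_p) (Cn * p)%:Z <= _).
  rewrite [X in _ <= X](bigID (mem bad)) /= -[X in X <= _]add0r; apply: lerD; first exact: sumr_ge0.
  apply: ler_sum => c cb; have [[x0 y0] /= cE] := base c; rewrite -cE in cb *; rewrite sum_lineE //.
  have [ns sz] := good x0 y0 cb.
  have := quadchar_poly_sum p_pr p_odd sz ns; rewrite real_normK ?num_real //.
rewrite sumr_const [#|_|]card_Fp // -mulr_natr natz -PoszM lez_nat; lia.
Qed.

(** Cauchy-Schwarz over the p lines parallel to an axis. *)
Theorem total_sum : (\sum_(xy : 'F_p * 'F_p) quadchar (linform2 xy.1 xy.2)) ^+ 2 <=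
  ((n + Cn) * p ^ 3)%:Z.
Proof.
have -> : \sum_(xy : 'F_p * 'F_p) quadchar (linform2 xy.1 xy.2) = \sum_c sum_line 0 1 c.
  by rewrite (partition_big (fun xy : 'F_p * 'F_p => 0 * xy.1 + 1 * xy.2) predT).
have cs (F : 'F_p -> int) : (\sum_c F c) ^+ 2 <= p%:Z * \sum_c F c ^+ 2.
  have : 0 <= \sum_c \sum_c' (F c - F c') ^+ 2 by do 2 apply: sumr_ge0 => ? _; rewrite sqr_ge0.
  have -> : \sum_c \sum_c' (F c - F c') ^+ 2 = (p%:Z * \sum_c F c ^+ 2 - (\sum_c F c) ^+ 2) *+ 2.
    rewrite (eq_bigr (fun c => p%:Z * F c ^+ 2 + \sum_c' F c' ^+ 2 - (F c * \sum_c' F c') *+ 2)).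
      rewrite big_split /= big_split /= -mulr_sumr sumr_const [#|_|]card_Fp // sumrN sumrMnl -mulr_suml.
      by rewrite -mulr_natl natz; ring.
    move=> c _; rewrite (eq_bigr (fun c' => F c ^+ 2 + F c' ^+ 2 - (F c * F c') *+ 2)); last by move=> c' _; ring.
    by rewrite !big_split /= sumr_const [#|_|]card_Fp // sumrN sumrMnl -mulr_sumr -[_ *+ p]mulr_natl natz.
  by rewrite pmulrn_lge0 // subr_ge0.
apply: le_trans (cs _) _; rewrite expnS mulnCA PoszM ler_wpM2l //.
by apply: line_sums; rewrite xpair_eqE oner_eq0 andbF.
Qed.
End Lines.

From mathcomp Require Import finmap complex perm.
From mathcomp Require Import all_classical all_reals all_analysis.

Import Order.TTheory GRing.Theory Num.Theory.
Local Open Scope ring_scope.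

Local Open Scope complex_scope.

(** * The sieve as a bound for the number of points *)

Definition rootu (R : realType) (M : nat) : R[i] :=
  (cos (pi *+ 2 / M%:R)) +i* (sin (pi *+ 2 / M%:R)).

Section RootOfUnity.
Variables (R : realType) (M : nat) (M0 : (0 < M)%N).
Let t : R := pi *+ 2 / M%:R.
Let Mr : 0 < M%:R :> R. Proof. by rewrite ltr0n. Qed.

Lemma rootuX k : rootu R M ^+ k = (cos (k%:R * t)) +i* (sin (k%:R * t)).
Proof.
elim: k => [|k IH]; first by rewrite expr0 mul0r cos0 sin0.
rewrite exprSr IH /rootu -/t -[in RHS]natr1 mulrDl mul1r cosD sinD; apply/eqP.
by rewrite eq_complex /= eqxx /= addrC.
Qed.

Lemma rootu_unity : rootu R M ^+ M = 1.
Proof. by rewrite rootuX /t mulrC divfK ?gt_eqF // cos2pi sin2pi. Qed.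

Lemma rootu_primitive k : (0 < k < M)%N -> rootu R M ^+ k != 1.
Proof.
move=> /andP[k0 kM]; rewrite rootuX eq_complex /= negb_and.
have pi0 := @pi_gt0 R.
have t0 : 0 < t by rewrite divr_gt0 // mulrn_wgt0.
have kt0 : 0 < k%:R * t by rewrite mulr_gt0 ?ltr0n.
have kt2 : k%:R * t < pi *+ 2.
  by rewrite /t mulrA ltr_pdivrMr // mulrC ltr_pM2l ?ltr_nat // mulrn_wgt0.
have lt1 x : 0 < x -> x <= pi -> cos x != 1 :> R.
  move=> x0 xp; rewrite lt_eqF // -[ltRHS](@cos0 R) ltr_cos // !in_itv /= ?lexx ?(ltW x0) ?xp ?(ltW pi0) //.
apply/orP; left; have [le|lt] := lerP (k%:R * t) pi; first exact: lt1.
rewrite -[X in cos X]opprK cosN -cosD2pi; apply: lt1.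
  by rewrite addrC subr_gt0.
by rewrite addrC lerBlDr mulr2n lerD2l ltW.
Qed.

(** The angle 2 pi k / M is at most pi/4, hence at most 1, where the cosine is still positive. *)
Lemma rootu_Re k : (8 * k <= M)%N -> (cos 1)%:C <= 'Re (rootu R M ^+ k).
Proof.
move=> kM; rewrite -complexRe rootuX /= lecR.
have pi0 := @pi_gt0 R; have pi4 : pi < 4 :> R by have := @pihalf_lt2 R; lra.
have pi2 := @pi_ge2 R.
have kt : 0 <= k%:R * t <= 1.
  have t0 : 0 <= t by rewrite divr_ge0 // mulrn_wge0 // ltW.
  rewrite mulr_ge0 //= /t mulrA ler_pdivrMr // mul1r.
  have : 8 * k%:R <= M%:R :> R by rewrite -natrM ler_nat.
  have : 0 <= k%:R :> R by [].
  by rewrite mulr2n; nra.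
case/andP: kt => k0 k1; rewrite leNgt ltr_cos -?leNgt // !in_itv /= ?k0 ?ler01 //=; lra.
Qed.
End RootOfUnity.

Lemma count_mod_le (s : seq nat) (p P r : nat) : uniq s -> (0 < p)%N ->
  (forall q, q \in s -> (q <= P)%N) -> (count (fun q => q %% p == r) s <= (P %/ p).+1)%N.
Proof.
move=> us p0 sP; rewrite -size_filter -(size_iota 0 (P %/ p).+1) -(size_map (fun q => q %/ p)%N).
apply: uniq_leq_size.
  rewrite map_inj_in_uniq ?filter_uniq // => x y; rewrite !mem_filter => /andP[/eqP xr _] /andP[/eqP yr _] E.
  by rewrite (divn_eq x p) (divn_eq y p) xr yr E.
move=> u /mapP[q]; rewrite mem_filter => /andP[_ /sP qP] ->.
by rewrite mem_iota /= add0n ltnS leq_div2r.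
Qed.

Lemma leq_double_floor (M D : nat) : (0 < D)%N -> (0 < M %/ D)%N -> (M <= 2 * D * (M %/ D))%N.
Proof.
move=> D0; have := ltn_pmod M D0; rewrite {3}(divn_eq M D).
move: (M %/ D)%N (M %% D)%N => q u; nia.
Qed.

Section SieveCount.
Variables (R : realType) (I : finType) (ps : seq nat) (X Rb : I -> nat) (P Pl : nat).
Variables (phi : forall p : nat, {ffun I -> 'F_p} -> int) (k2 K : R) (s : seq {ffun I -> nat}).
Arguments phi : clear implicits.
Let r := #|I|.
Hypotheses (r0 : (0 < r)%N) (ps_uniq : uniq ps) (ps_prime : forall p, p \in ps -> prime p)
  (Pl0 : (0 < Pl)%N) (psP : forall p, p \in ps -> (Pl <= p <= P)%N)
  (X0 : forall i, (0 < X i)%N) (PX : forall i, (P <= 8 * r * X i)%N)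
  (PR : forall i, (P ^ 2 <= 8 * r * X i * Rb i)%N)
  (XM : forall i, (8 * r * X i <= \prod_(p <- ps) p)%N)
  (phi1 : forall p v, `|phi p v| <= 1)
  (K0 : 0 <= K)
  (phi0 : forall p, p \in ps -> (\sum_v phi p v)%:~R ^+ 2 <= k2 * (p%:R ^+ r) ^+ 2)
  (philine : forall p a, p \in ps -> a != 0 ->
     p%:R * (\sum_c lsum (phi p) a c ^+ 2)%:~R <= K * (p%:R ^+ r) ^+ 2)
  (us : uniq s) (sX : forall x i, x \in s -> (x i < X i)%N)
  (sS : forall x, x \in s ->
     (size ps)%:R <= 2 * \sum_(p <- ps) phi p [ffun i => (x i)%:R] :> int).
Let N := size ps.
Let mult := (P %/ Pl).+1.

(** The modulus M is the product of the primes and the dual box has sides [H i], the floor of M / (8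
    r X_i): then h.x stays below M/8. Every point of s contributes at least (N/2)^2 to the mean
    square, which gives a lower bound for the left-hand side of the sieve inequality. *)
Theorem square_sieve_count :
  (cos 1 ^+ 2 / (4 * (16 * r%:R) ^+ r)) * (size s)%:R * N%:R ^+ 2 <=
  (\prod_i (X i)%:R) * (N%:R ^+ 2 * k2 + N%:R * (1 + (\prod_i (Rb i).*2.+1)%:R * mult%:R * K)) :> R.
Proof.
have [i0 _] : exists i : I, true by have /card_gt0P[i _] := r0; exists i.
set M0 := (\prod_(p <- ps) p)%N.
have M8 : (8 <= M0)%N by apply: leq_trans (XM i0); rewrite -mulnA leq_pmulr // muln_gt0 r0 X0.
have [m Mm] : exists m, M0 = m.+2 by exists M0.-2; lia.
pose z := rootu R m.+2; pose c0 : R[i] := (cos 1 : R)%:C.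
have zM : z ^+ m.+2 = 1 by apply: rootu_unity.
have zn k : (0 < k < m.+2)%N -> z ^+ k != 1 by apply: rootu_primitive.
have c00 : 0 < c0 by rewrite ltcR cos1_gt0.
have zRe k : (8 * k <= m.+2)%N -> c0 <= 'Re (z ^+ k) by apply: rootu_Re.
pose H i := (m.+2 %/ (8 * r * X i))%N.
have d0 i : (0 < 8 * r * X i)%N by rewrite !muln_gt0 r0 X0.
have H0 i : (0 < H i)%N by rewrite /H divn_gt0 // -Mm XM.
have XH : (8 * \sum_i X i * H i <= m.+2)%N.
  have le i : (8 * r * X i * H i <= m.+2)%N by rewrite mulnC leq_trunc_div.
  rewrite -(leq_pmul2l r0) mulnA big_distrr /=; have -> : (r * m.+2 = \sum_(i : I) m.+2)%N by rewrite sum_nat_const.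
  by apply: leq_sum => i _; apply: leq_trans (le i); rewrite [(r * 8)%N]mulnC mulnA.
have psM p : p \in ps -> (p %| m.+2)%N by move=> pp; rewrite -Mm /M0 (big_rem p) //= dvdn_mulr.
pose f p : {ffun I -> 'I_m.+2} -> R[i] := gfun _ (phi p).
have f_per p : p \in ps -> forall x y, f p (x + y *+ p) = f p x.
  by move=> pp x y; rewrite /f /gfun gred_per ?ps_prime ?psM.
have f1 p x : p \in ps -> `|f p x| <= 1.
  by move=> _; rewrite /f /gfun -intr_norm lerz1.
have HMl i : (H i * (8 * r * X i) <= m.+2)%N by rewrite leq_trunc_div.
have HM p i : p \in ps -> (H i * p <= m.+2)%N.
  move=> /psP/andP[_ pP]; apply: leq_trans (HMl i); rewrite leq_mul2l; apply/orP; right.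
  exact: leq_trans pP (PX i).
have HR p q i : p \in ps -> q \in ps -> (H i * (p * q) <= Rb i * m.+2)%N.
  move=> /psP/andP[_ pP] /psP/andP[_ qP]; apply: leq_trans (_ : H i * (8 * r * X i * Rb i) <= _)%N.
    by rewrite leq_mul2l (leq_trans _ (PR i)) ?orbT // leq_mul.
  by rewrite mulnA mulnC leq_mul2l HMl orbT.
have k20 p : p \in ps -> 0 <= k2.
  move=> pp; have p0 := prime_gt0 (ps_prime pp).
  by move: (le_trans (sqr_ge0 _) (phi0 pp)); rewrite pmulr_lge0 // exprn_gt0 // exprn_gt0 // ltr0n.
have CM x : `|(x : R)%:C| = `|x|%:C by rewrite normc_def /= expr0n /= addr0 sqrtr_sqr.
have intC (a : int) : (a%:~R : R)%:C = a%:~R :> R[i] by rewrite rmorph_int.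
have natC (a : nat) : (a%:R : R)%:C = a%:R :> R[i] by rewrite rmorph_nat.
have fz p : p \in ps -> `|ghat z (f p) 0| <= (Num.sqrt k2)%:C.
  move=> pp; have p0 := prime_gt0 (ps_prime pp).
  have q0 : 0 < p%:R ^+ r :> R by rewrite exprn_gt0 // ltr0n.
  rewrite /f (ghat_gfun0 z (ps_prime pp) (psM p pp) (phi p)) -/r -intC -natC -rmorphXn -fmorphV -rmorphM CM lecR.
  rewrite normrM normfV (gtr0_norm q0) ler_pdivrMr // -sqrtr_sqr -[X in _ <= _ * X](gtr0_norm q0) -[X in _ <= _ * X]sqrtr_sqr.
  by rewrite -sqrtrM ?(k20 p) // ler_sqrt ?phi0 // mulr_ge0 ?(k20 p) ?sqr_ge0.
have fl p u : p \in ps -> u != 0 -> u *+ p = 0 -> \sum_(1 <= l < p) `|ghat z (f p) (u *+ l)| ^+ 2 <= K%:C.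
  move=> pp u0 up; have p0 := prime_gt0 (ps_prime pp).
  have q0 : 0 < (p%:R ^+ r) ^+ 2 :> R by rewrite exprn_gt0 // exprn_gt0 // ltr0n.
  have [a [a0 le]] := ghat_gfun_line zM zn (ps_prime pp) (psM p pp) (phi p) up.
  apply: le_trans le _; rewrite -/r.
  have -> : p%:R / p%:R ^+ r ^+ 2 * (\sum_c lsum (phi p) a c ^+ 2)%:~R =
      (p%:R / p%:R ^+ r ^+ 2 * (\sum_c lsum (phi p) a c ^+ 2)%:~R : R)%:C.
    by rewrite !rmorphM fmorphV !rmorphXn /= !natC intC.
  rewrite lecR.
  by rewrite mulrAC ler_pdivrMr //; apply: philine => //; apply: a0.
have fm p c : p \in ps -> (count (fun q => q %% p == c) ps <= mult)%N.
  move=> pp; apply: leq_trans (count_mod_le c ps_uniq (prime_gt0 (ps_prime pp)) (fun q qp => proj2 (andP (psP qp)))) _.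
  by rewrite /mult ltnS leq_div2l //; case/andP: (psP pp).
have K0C : 0 <= K%:C by rewrite lecR.
have sv := square_sieve_inequality zM zn c00 zRe H0 XH ps_uniq ps_prime psM f_per f1 HM HR K0C fz fl fm.
have XMi i : (X i <= m.+2)%N.
  by rewrite -Mm; apply: leq_trans (XM i); rewrite leq_pmull // muln_gt0 r0.
pose g (x : {ffun I -> nat}) : {ffun I -> 'I_m.+2} := [ffun i => inord (x i)].
have gE x i : x \in s -> g x i = x i :> nat.
  by move=> xs; rewrite ffunE inordK //; apply: leq_trans (sX i xs) (XMi i).
have ginj : {in s &, injective g}.
  move=> x y xs ys E; apply/ffunP => i; rewrite -(gE x i xs) -(gE y i ys) E //.
have gred_g p x : x \in s -> gred p (g x) = [ffun i => (x i)%:R] :> {ffun I -> 'F_p}.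
  by move=> xs; apply/ffunP => i; rewrite !ffunE; congr _%:R; have := gE x i xs; rewrite ffunE.
have low : (size s)%:R * (N%:R / 2) ^+ 2 <= \sum_(x in gbox m X) `|\sum_(p <- ps) f p x| ^+ 2 :> R[i].
  pose t : {set {ffun I -> 'I_m.+2}} := [set y in map g s].
  have ct : #|t| = size s.
    by rewrite cardsE -(size_map g s); apply/card_uniqP; rewrite map_inj_in_uniq.
  have tX : t \subset gbox m X.
    apply/fintype.subsetP => y; rewrite inE => /mapP[x xs ->]; rewrite inE; apply/forallP => i.
    by rewrite gE // sX.
  rewrite (big_setID t) /= (finset.setIidPr tX) -[X in X <= _]addr0.
  apply: lerD; last by apply: sumr_ge0 => y _; rewrite exprn_ge0.
  rewrite -ct mulr_natl -sumr_const; apply: ler_sum => y; rewrite inE => /mapP[x xs ->].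
  apply: lerXn2r; rewrite ?nnegrE ?divr_ge0 //.
  have -> : \sum_(p <- ps) f p (g x) = (\sum_(p <- ps) phi p [ffun i => (x i)%:R])%:~R.
    by rewrite rmorph_sum /=; apply: eq_bigr => p _; rewrite /f /gfun gred_g.
  have := sS xs; rewrite -(ler_int R[i]) rmorph_nat rmorphM /= => h.
  rewrite ler_pdivrMr // mulrC; apply: le_trans h _.
  by rewrite ler_pM2l // real_ler_norm // realz.
have cB : (#|gbox m H| = \prod_i H i)%N.
  have -> : #|gbox m H| = #|family (fun i => [pred k : 'I_m.+2 | (k < H i)%N])|.
    by apply: eq_card => x; rewrite inE.
  rewrite card_family foldrE big_map big_enum /=; apply: eq_bigr => i _.
  have Hm : (H i <= m.+2)%N by rewrite leq_div.
  by rewrite -sum1_card (big_ord_narrow Hm) sum1_card card_ord.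
have nGE : nG R[i] m I = ((m.+2 ^ r)%:R : R)%:C by rewrite /nG card_ffun card_ord natC.
move: sv; rewrite cB nGE -/N => sv.
have {}low := le_trans (ler_wpM2l _ low) sv.
have {low} : cos 1 ^+ 2 * (\prod_i H i)%N%:R * ((size s)%:R * (N%:R / 2) ^+ 2) <=
   (m.+2 ^ r)%:R * ((N%:R * Num.sqrt k2) ^+ 2 + N%:R * (1 + (\prod_i (Rb i).*2.+1)%N%:R * mult%:R * K)) :> R.
  have e1 : c0 ^+ 2 * (\prod_i H i)%:R * ((size s)%:R * (N%:R / 2) ^+ 2) =
      (cos 1 ^+ 2 * (\prod_i H i)%:R * ((size s)%:R * (N%:R / 2) ^+ 2) : R)%:C.
    by rewrite /c0 !(rmorphM, rmorphXn, fmorphV, rmorph_nat).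
  have e2 : ((m.+2 ^ r)%:R)%:C * ((N%:R * (Num.sqrt k2)%:C) ^+ 2 +
       N%:R * (1 + (\prod_i (Rb i).*2.+1)%:R * mult%:R * K%:C)) =
    ((m.+2 ^ r)%:R * ((N%:R * Num.sqrt k2) ^+ 2 + N%:R * (1 + (\prod_i (Rb i).*2.+1)%:R * mult%:R * K)) : R)%:C.
    by rewrite !(rmorphM, rmorphXn, rmorphD, rmorph1, rmorph_nat).
  rewrite -lecR -e1 -e2; apply: low.
  by rewrite mulr_ge0 // exprn_ge0 // ltW.
have [ps0|] := eqVneq ps [::].
  have N0 : N%:R = 0 :> R by rewrite /N ps0.
  by move=> _; rewrite N0 expr0n /= !(mulr0, mul0r, addr0).
move=> ps0; have [p pp] : exists p, p \in ps by case: (ps) ps0 => // p l _; exists p; rewrite inE eqxx.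
have kk : (N%:R * Num.sqrt k2) ^+ 2 = N%:R ^+ 2 * k2 by rewrite exprMn sqr_sqrtr ?(k20 p).
rewrite kk; set Q := (N%:R ^+ 2 * k2 + _); set h := (\prod_i H i)%N; move=> main.
have Q0 : 0 <= Q.
  rewrite /Q addr_ge0 ?mulr_ge0 ?(k20 p) // addr_ge0 // !mulr_ge0 //.
have h0 : 0 < h%:R :> R by rewrite ltr0n /h prodn_cond_gt0.
(* Rounding down in [H i] loses at most a factor 2, which turns 8 r into 16 r. *)
have Mh : (m.+2 ^ r)%:R <= (16 * r%:R) ^+ r * (\prod_i (X i)%:R) * h%:R :> R.
  have -> : (16 * r%:R) ^+ r * (\prod_i (X i)%:R) * h%:R = (\prod_i (16 * r * X i * H i))%N%:R :> R.
    rewrite natr_prod; under [RHS]eq_bigr do rewrite !natrM.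
    by rewrite !big_split /= !prodr_const natr_prod exprMn.
  have -> : (m.+2 ^ r = \prod_(i : I) m.+2)%N by rewrite prod_nat_const.
  rewrite ler_nat; apply: leq_prod => i _.
  apply: leq_trans (leq_double_floor (d0 i) (H0 i)) _.
  by rewrite -/(H i) !mulnA.
have c1 : 0 < (16 * r%:R) ^+ r :> R by rewrite exprn_gt0 // mulr_gt0 // ltr0n.
rewrite -(ler_pM2l h0) -(ler_pM2l c1).
apply: le_trans (_ : cos 1 ^+ 2 * h%:R * ((size s)%:R * (N%:R / 2) ^+ 2) <= _).
  rewrite le_eqVlt; apply/orP; left; apply/eqP; move: c1; set c := (_ ^+ r) => c1.
  by field; rewrite gt_eqF.
apply: le_trans main _; apply: le_trans (ler_wpM2r Q0 Mh) _.
by rewrite le_eqVlt; apply/orP; left; apply/eqP; ring.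
Qed.

End SieveCount.

Close Scope complex_scope.

(** * Powers dominate constants and logarithms *)

Lemma powR_unbounded (R : realType) (e C : R) : 0 < e ->
  exists2 x0 : R, 1 <= x0 & forall x, x0 <= x -> C <= x `^ e.
Proof.
move=> e0; pose c := Num.max C 1.
have c1 : 1 <= c by rewrite le_max lexx orbT.
have c0 : 0 < c by apply: lt_le_trans c1.
exists (c `^ e^-1).
  have {1}-> : (1 : R) = 1 `^ e^-1 by rewrite powR1.
   apply: ge0_ler_powR; rewrite ?nnegrE ?invr_ge0 // ltW //.
move=> x cx; apply: le_trans (_ : c <= _); first by rewrite le_max lexx.
have -> : c = (c `^ e^-1) `^ e by rewrite -powRrM mulVf ?gt_eqF // powRr1 // ltW.
by apply: ge0_ler_powR; rewrite ?nnegrE ?powR_ge0 ?(ltW e0) //; apply: le_trans cx; apply: powR_ge0.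
Qed.

(* From [e^t >= 1 + t]. *)
Lemma ln_le_powR (R : realType) (e x : R) : 0 < e -> 0 < x -> ln x <= x `^ e / e.
Proof.
move=> e0 x0; rewrite ler_pdivlMr // mulrC -ln_powR.
have := ln_sublinear (powR_gt0 e x0); move=> h; exact: ltW.
Qed.

Lemma ln_eventually_le (R : realType) (e C : R) : 0 < e ->
  exists2 x0 : R, 1 <= x0 & forall x, x0 <= x -> C * ln x <= x `^ e.
Proof.
move=> e0; have e2 : 0 < e / 2 by rewrite divr_gt0.
have [x0 x01 H] := powR_unbounded (`|C| / (e / 2)) e2.
exists x0 => // x xx; have x1 : 1 <= x := le_trans x01 xx.
have xp : 0 < x := lt_le_trans ltr01 x1.
apply: le_trans (_ : `|C| * ln x <= _).
  by rewrite ler_wpM2r ?ln_ge0 // ler_norm.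
apply: le_trans (_ : `|C| * (x `^ (e / 2) / (e / 2)) <= _).
  by rewrite ler_wpM2l // ln_le_powR.
rewrite [X in _ <= _ `^ X](splitr e) powRD; last by rewrite (gt_eqF xp) implybT.
rewrite mulrA mulrAC.
by rewrite ler_wpM2r ?powR_ge0 // H.
Qed.

(** With 2m <= x <= 4m, the bounds 4^m <= 2m C(2m, m) and C(2m, m) <= (2m)^pi(2m) give 4^m <=
    x^(pi(x) + 1). The factor 2m accounts for the successor. *)
Lemma chebyshev_lower (R : realType) (x : nat) : (4 <= x)%N ->
  x%:R * (1 / 4) * ln 2 <= (size (primes_below x)).+1%:R * ln x%:R :> R.
Proof.
move=> x4; pose m := x./2; have m0 : (0 < m)%N by rewrite /m; lia.
have mx : (m.*2 <= x)%N by rewrite /m; lia.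
have xm : (x <= 4 * m)%N by rewrite /m; lia.
have sub : (size (primes_below m.*2) <= size (primes_below x))%N.
  apply: uniq_leq_size; first exact: primes_below_uniq.
  by move=> p; rewrite !mem_primes_below => /andP[-> /= h]; apply: leq_trans mx.
have h : (4 ^ m <= x ^ (size (primes_below x)).+1)%N.
  apply: leq_trans (exp4_central_binomial m0) _; rewrite expnS leq_mul //.
  apply: leq_trans (central_binomial_le m0) _.
  apply: leq_trans (_ : m.*2 ^ size (primes_below x) <= _)%N; first by rewrite leq_exp2l //; lia.
  by case: (size _) => [|k]; rewrite ?expn0 // leq_exp2r.
have x0 : 0 < x%:R :> R by rewrite ltr0n; lia.
have : ln (4%:R ^+ m) <= ln (x%:R ^+ (size (primes_below x)).+1) :> R.
  by rewrite ler_ln ?posrE ?exprn_gt0 // -!natrX ler_nat.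
rewrite !lnXn // (_ : 4%:R = 2%:R ^+ 2 :> R); last by rewrite -natrX.
rewrite lnXn // -mulrnA -[X in X <= _]mulr_natl -[X in _ <= X]mulr_natl => h2.
apply: le_trans h2.
rewrite ler_wpM2r ?ln_ge0 ?ler1n //.
have : x%:R <= 4%:R * m%:R :> R by rewrite -natrM ler_nat.
rewrite natrM; have : 0 <= m%:R :> R by []; move: (x%:R : R) (m%:R : R) => u v; lra.
Qed.

(** A window reaching down to x^(1-e) asks for nothing beyond Chebyshev's lower bound; the loss of a
    power x^e goes into the epsilon. *)
Definition primes_window (R : realType) (e : R) (x : nat) :=
  [seq p <- primes_below x | x%:R `^ (1 - e) <= p%:R :> R].

Lemma primes_window_size (R : realType) (e : R) : 0 < e -> e < 1 ->
  exists2 x0 : R, 1 <= x0 & forall x : nat, x0 <= x%:R ->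
    x%:R `^ (1 - e) <= (size (primes_window e x))%:R.
Proof.
move=> e0 e1; have l2 : 0 < ln 2 :> R by rewrite ln_gt0 // ltr1n.
have [x0 x01 H] := ln_eventually_le (16 / ln 2) e0.
exists (Num.max x0 4) => [|x]; first by rewrite le_max x01.
rewrite ge_max => /andP[xx0 x4].
have x4' : (4 <= x)%N by rewrite -(ler_nat R).
have xp : 0 < x%:R :> R by rewrite ltr0n; lia.
have x1 : 1 <= x%:R :> R by rewrite ler1n; lia.
have lx : 0 < ln x%:R :> R by rewrite ln_gt0 // ltr1n; lia.
have ch := chebyshev_lower R x4'.
set y := x%:R `^ (1 - e).
have y1 : 1 <= y by have {1}-> : (1 : R) = 1 `^ (1 - e) by [rewrite powR1]; apply: ge0_ler_powR; rewrite ?nnegrE ?subr_ge0 // ltW.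
pose small := [seq p <- primes_below x | ~~ (y <= p%:R)].
have szE : (size (primes_window e x) + size small = size (primes_below x))%N.
  by have := count_predC (fun p : nat => y <= p%:R) (primes_below x); rewrite -!size_filter.
have ssm : (size small)%:R <= y + 1 :> R.
  have : (size small <= size (iota 0 (Num.truncn y).+1))%N.
    apply: uniq_leq_size; first exact/filter_uniq/primes_below_uniq.
    move=> p; rewrite mem_filter -ltNge => /andP[py _]; rewrite mem_iota add0n ltnS /=.
    rewrite -(ler_nat R); have := truncn_itv (le_trans ler01 y1) => /andP[_ h2].
    have : p%:R < (Num.truncn y).+1%:R :> R by apply: lt_trans h2.
    by rewrite ltr_nat ltnS ler_nat.
  rewrite size_iota -(ler_nat R) => /le_trans; apply.
  by rewrite -addn1 natrD lerD2r; have /andP[] := truncn_itv (le_trans ler01 y1).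
have tot : (size (primes_below x))%:R = (size (primes_window e x))%:R + (size small)%:R :> R.
  by rewrite -natrD szE.
have key : 4 * y * ln x%:R <= x%:R * (1 / 4) * ln 2.
  have := H _ xx0; rewrite mulrAC ler_pdivrMr // => h.
  have xE : x%:R = y * x%:R `^ e.
    rewrite /y -powRD; last by rewrite (gt_eqF xp) implybT.
    by rewrite subrK powRr1 // ltW.
  have -> : x%:R * (1 / 4) * ln 2 = y * (x%:R `^ e * ln 2) * (1 / 4) by rewrite {1}xE; ring.
  have := ler_wpM2l (le_trans ler01 y1) h; move: (x%:R `^ e * ln 2) (ln x%:R) => A D; nra.
have : 4 * y <= (size (primes_below x)).+1%:R by rewrite -(ler_pM2r lx); apply: le_trans ch.
rewrite -[(size (primes_below x)).+1%:R]natr1 tot; lra.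
Qed.

Lemma primes_windowP (R : realType) (e : R) (x p : nat) : p \in primes_window e x ->
  [/\ prime p, (p <= x)%N & x%:R `^ (1 - e) <= p%:R :> R].
Proof. by rewrite mem_filter mem_primes_below => /and3P[]. Qed.

Lemma primes_window_uniq (R : realType) (e : R) (x : nat) : uniq (primes_window e x).
Proof. exact/filter_uniq/primes_below_uniq. Qed.

(** * The square sieve for norm forms *)

Ltac nneg := solve [repeat first [assumption | (apply: ltW; assumption) | exact: ler0n | exact: powR_ge0 | exact: sqr_ge0
  | match goal with
    | |- is_true (_ <= _ * _) => apply: mulr_ge0
    | |- is_true (_ <= _ + _) => apply: addr_ge0
    | |- is_true (_ <= _ ^+ _) => apply: exprn_ge0
    | |- is_true (_ <= _ ^-1) => rewrite invr_ge0
    end | lra]].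

Lemma powR_ge1 (R : realType) (a b : R) : 1 <= a -> 0 <= b -> 1 <= a `^ b.
Proof. by move=> a1 b0; rewrite -[leLHS](@powRr0 _ a) ler_powR. Qed.

Section Quadchar.
Variables (p : nat) (p_pr : prime p) (p_odd : odd p).

Lemma quadchar_norm_le1 (a : 'F_p) : `|quadchar a| <= 1.
Proof. by rewrite /quadchar; case: eqP => // _; case: eqP. Qed.

Lemma Fp_half_power (a : 'F_p) : a != 0 -> (a ^+ p.-1./2 == 1) || (a ^+ p.-1./2 == -1).
Proof.
move=> a0; rewrite -eqf_sqr expr1n -exprM muln2.
have -> : (p.-1./2.*2 = p.-1)%N.
  by rewrite -[RHS]odd_double_half; move: (prime_gt0 p_pr) p_odd; case: (p) => //= k _ /negPf ->.
apply/eqP/(mulfI a0); rewrite -exprS prednK ?prime_gt0 // mulr1.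
by have := expf_card a; rewrite card_Fp.
Qed.

Lemma quadcharM (a b : 'F_p) : quadchar (a * b) = quadchar a * quadchar b.
Proof.
rewrite /quadchar mulf_eq0.
have [a0|a0] := eqVneq a 0; first by rewrite /= mul0r.
have [b0|b0] := eqVneq b 0; first by rewrite /= mulr0.
rewrite /= exprMn.
have p2 : (2 < p)%N by apply: odd_prime_gt2.
have n1 : (-1 : 'F_p) != 1.
  rewrite -subr_eq0 -opprD oppr_eq0 -(natrD _ 1 1).
  by rewrite -(dvdn_pcharf (pchar_Fp p_pr)); apply/negP => h; have le : (p <= 2)%N by [apply: dvdn_leq]; rewrite leqNgt p2 in le.
have [/eqP->|/eqP->] := orP (Fp_half_power a0); have [/eqP->|/eqP->] := orP (Fp_half_power b0);
  by rewrite ?mulr1 ?mul1r ?mulrNN ?mulr1 ?eqxx ?(negPf n1).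
Qed.

Lemma quadchar_sqr (a : 'F_p) : quadchar (a ^+ 2) = (a != 0)%:R.
Proof.
rewrite expr2 quadcharM /quadchar; case: eqVneq => // _.
by case: eqP.
Qed.
End Quadchar.

(** After division by the gcd, r^2 divides c s^2 with r and s coprime, so r is constant; then s^2
    divides g, so s is constant and g would be constant too. *)
Lemma sqrfree_nonsquare (F : fieldType) (g : {poly F}) : separable_poly g -> (1 < size g)%N ->
  nonsquare_poly g.
Proof.
move=> gs g1 c r s E; apply/eqP; apply: contraT => r0.
have g0 : g != 0 by rewrite -size_poly_gt0 ltnW.
have : r ^+ 2 * g != 0 by rewrite mulf_neq0 ?expf_neq0.
rewrite E scaler_eq0 negb_or => /andP[c0 s20].
have s0 : s != 0 by apply: contraNneq s20 => ->; rewrite expr0n.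
set d := gcdp r s.
have d0 : d != 0 by rewrite gcdp_eq0 negb_and r0.
have rE : r = (r %/ d) * d by rewrite divpK ?dvdp_gcdl.
have sE : s = (s %/ d) * d by rewrite divpK ?dvdp_gcdr.
have cop : coprimep (r %/ d) (s %/ d) by apply: coprimep_div_gcd; rewrite r0.
set r' := r %/ d in rE cop; set s' := s %/ d in sE cop.
have E' : r' ^+ 2 * g = c *: s' ^+ 2.
  apply: (mulIf (expf_neq0 2 d0)); move: E; rewrite rE sE !exprMn => E.
  by rewrite mulrAC E scalerAl.
have r1 : r' ^+ 2 %| s' ^+ 2.
  by rewrite -(dvdpZr _ _ c0) -E' dvdp_mulr.
have : size (r' ^+ 2) == 1%N.
  rewrite -coprimepp; apply: (coprimep_dvdr r1).
  by rewrite coprimep_expl // coprimep_expr // coprimep_sym.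
rewrite size_poly_eq1 => /eqp_dvdl r1'.
have [sp _] := separable_polyP gs.
have sg : s' * s' %| g.
  rewrite -expr2 -(@Gauss_dvdpr _ _ (r' ^+ 2)) ?E' ?dvdpZr //.
  by rewrite coprimep_expl // coprimep_expr // coprimep_sym.
have s1 : size s' == 1%N by rewrite -coprimepp; apply: sp.
have /eqP := congr1 (fun q : {poly F} => size q) E'.
have r'0 : r' ^+ 2 != 0 by rewrite expf_neq0 //; apply: contraNneq r0 => r'0; rewrite rE r'0 mul0r.
rewrite size_scale // size_mul //.
have [a a0 ->] := size_poly1P _ s1; rewrite -polyC_exp size_polyC expf_neq0 //.
have := size_poly_gt0 (r' ^+ 2); rewrite r'0.
move=> h1 /eqP h2; have {h2} : (size (r' ^+ 2) + size g).-1 = 1%N := h2.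
by move: h1 g1; move: (size (r' ^+ 2)) (size g); clear => u v; lia.
Qed.

Lemma size_primes_dvd (s : seq nat) (m W : nat) : uniq s -> (forall p, p \in s -> prime p && (p %| m)%N) ->
  (0 < m <= 2 ^ W)%N -> (size s <= W)%N.
Proof.
move=> us sm /andP[m0 mW].
have : (\prod_(p <- s) p %| m)%N.
  elim: s us sm => [|p s IH] /=; first by rewrite big_nil dvd1n.
  move=> /andP[ps us] sm; rewrite big_cons Gauss_dvd; last first.
    have := sm p; rewrite inE eqxx => /(_ isT)/andP[pp _].
    rewrite big_seq; elim/big_rec: _ => [|q x qs IHx]; first by rewrite coprimen1.
    rewrite coprimeMr IHx andbT prime_coprime //.
    have := sm q; rewrite inE qs orbT => /(_ isT)/andP[qp _].
    by rewrite dvdn_prime2 //; apply: contraNneq ps => ->.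
  have := sm p; rewrite inE eqxx => /(_ isT)/andP[_ ->] /=; apply: IH => // q qs.
  by apply: sm; rewrite inE qs orbT.
move/(dvdn_leq m0)/leq_trans => /(_ _ mW) h.
rewrite -(@leq_exp2l 2) //; apply: leq_trans h.
elim: s {us} sm => [|p s IH] sm; first by rewrite big_nil.
rewrite big_cons /= expnS leq_mul //.
  by have := sm p; rewrite inE eqxx => /(_ isT)/andP[/prime_gt1].
by apply: IH => q qs; apply: sm; rewrite inE qs orbT.
Qed.

(** An integer D with |D| <= 2^W has at most W prime factors, so once P^(1-e) is a large multiple of
    W + 1 the primes dividing 2D are few. The bound 2W <= [size ps] serves the values of the form,
    which also have at most W prime factors; 64 P^2 makes the modulus exceed the box. *)
Lemma sieve_primes (R : realType) (e : R) : 0 < e -> e <= 1 / 2 ->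
  exists2 C : R, 1 <= C & forall (P W : nat) (D : int), D != 0 -> (`|D| <= 2 ^ W)%N ->
    C * W.+1%:R <= P%:R `^ (1 - e) -> exists ps : seq nat,
    [/\ uniq ps, (forall p, p \in ps -> [/\ prime p, odd p, ~~ (p %| `|D|)%N, (p <= P)%N & P%:R `^ (1 - e) <= p%:R]),
        P%:R `^ (1 - e) <= 2 * (size ps)%:R, (2 * W <= size ps)%N & (64 * P ^ 2 <= \prod_(p <- ps) p)%N].
Proof.
move=> e0 e1; have e1' : e < 1 by lra.
have [x0 x01 win] := primes_window_size e0 e1'.
exists (x0 + 16) => [|P W D D0 DW]; first by lra.
set y := _ `^ _ => Cy.
have W1 : 1 <= W.+1%:R :> R by rewrite ler1n.
have y16 : x0 + 16 <= y by apply: le_trans Cy; rewrite ler_peMr //; lra.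
have P1 : (0 < P)%N.
  by rewrite lt0n; apply: contraTneq y16 => P0; rewrite -ltNge /y P0 powR0 ?subr_eq0 ?gt_eqF; lra.
have P1r : 1 <= P%:R :> R by rewrite ler1n.
have yP : y <= P%:R.
  by rewrite -[leRHS]powRr1 // /y ler_powR //; lra.
have y2 : P%:R <= y ^+ 2.
  rewrite -powR_mulrn ?powR_ge0 // -powRrM -[leLHS]powRr1 // ler_powR //; lra.
pose ps := [seq p <- primes_window e P | odd p && ~~ (p %| `|D|)%N].
pose bad := [seq p <- primes_window e P | ~~ (odd p && ~~ (p %| `|D|)%N)].
have upw := primes_window_uniq e P.
have szE : (size ps + size bad = size (primes_window e P))%N.
  by have := count_predC (fun p => odd p && ~~ (p %| `|D|)%N) (primes_window e P); rewrite -!size_filter.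
have badW : (size bad <= W.+1)%N.
  have : {subset bad <= 2%N :: [seq p <- primes_window e P | (p %| `|D|)%N]}.
    move=> p; rewrite mem_filter negb_and negbK => /andP[h pw]; rewrite inE mem_filter pw andbT.
    have [pp _ _] := primes_windowP pw.
    case/orP: h => [po|->]; last by rewrite orbT.
    by have [/eqP -> //|] := even_prime pp; rewrite ?eqxx // (negPf po).
  move/(uniq_leq_size (filter_uniq _ upw))=> /leq_trans; apply; rewrite /= ltnS.
  apply: (@size_primes_dvd _ `|D|); first exact: filter_uniq.
    by move=> p; rewrite mem_filter => /andP[-> /primes_windowP[->]].
  by rewrite DW absz_gt0 D0.
have Ny : y <= (size ps)%:R + W.+1%:R.
  have := win P (le_trans _ yP); rewrite -/y -szE natrD => h.
  apply: le_trans (h _) _; first by lra.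
  by rewrite lerD2l ler_nat.
have yW : 16 * W.+1%:R <= y by apply: le_trans Cy; rewrite ler_wpM2r //; lra.
have N8 : (8 <= size ps)%N by rewrite -(ler_nat R); move: yW Ny y16 W1; move: (W.+1%:R : R) => u; lra.
exists ps; split.
- exact: filter_uniq.
- by move=> p; rewrite mem_filter => /andP[/andP[-> ->] /primes_windowP[-> -> ->]].
- by move: Ny yW; move: (W.+1%:R : R) => u; lra.
- rewrite -(ler_nat R) natrM; move: Ny yW; rewrite -natr1; move: (W%:R : R) => u.
  have : 0 <= (size ps)%:R :> R by []. lra.
- rewrite -(ler_nat R) natrM natrX natr_prod.
  apply: le_trans (_ : y ^+ size ps <= _); last first.
    have : forall p, p \in ps -> y <= p%:R by move=> p; rewrite mem_filter => /andP[_ /primes_windowP[]].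
    elim: (ps) => [|p l IH] h; first by rewrite big_nil expr0.
    rewrite big_cons exprS ler_pM ?exprn_ge0 ?powR_ge0 ?h ?inE ?eqxx //.
    by apply: IH => q ql; apply: h; rewrite inE ql orbT.
  apply: le_trans (_ : y ^+ 8 <= _); last by rewrite ler_weXn2l //; lra.
  have -> : y ^+ 8 = (y ^+ 2) ^+ 4 by rewrite -exprM.
  have P16 : 16 <= P%:R :> R by lra.
  apply: le_trans (_ : P%:R ^+ 4 <= _); last by rewrite lerXn2r ?nnegrE // ?sqr_ge0 ?ler0n.
  have -> : P%:R ^+ 4 = P%:R ^+ 2 * P%:R ^+ 2 :> R by rewrite -exprD.
  rewrite ler_wpM2r ?sqr_ge0 //; nra.
Qed.

Notation mxp p := (map_mx (intr : int -> 'F_p)).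

(** A nonzero square has character 1 except at its prime divisors, at most W of them, hence at most
    half of the primes. *)
Lemma sieve_lower_bound (ps : seq nat) (W : nat) (F t : int) : uniq ps ->
  (forall p, p \in ps -> prime p && odd p) -> (2 * W <= size ps)%N ->
  F = t ^+ 2 -> F != 0 -> (`|F| <= 2 ^ W)%N ->
  (size ps)%:R <= 2 * \sum_(p <- ps) quadchar (F%:~R : 'F_p) :> int.
Proof.
move=> ups psp Wps Ft F0 FW.
pose D := [seq p <- ps | (p %| `|F|)%N].
have szD : (size D <= W)%N.
  apply: (@size_primes_dvd _ `|F|); rewrite ?filter_uniq ?FW ?absz_gt0 ?F0 //.
  by move=> p; rewrite mem_filter => /andP[-> /psp/andP[->]].
have -> : \sum_(p <- ps) quadchar (F%:~R : 'F_p) = (size ps)%:Z - (size D)%:Z.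
  have -> : (size ps)%:Z = \sum_(p <- ps) 1 by rewrite big_const_seq count_predT iter_addr_0 natz.
  have -> : (size D)%:Z = \sum_(p <- ps) (p %| `|F|)%N%:Z.
    by rewrite /D size_filter -sum1_count big_mkcond (big_morph Posz PoszD (erefl _)); apply: eq_bigr => p _; case: dvdn.
  rewrite -sumrB big_seq [RHS]big_seq; apply: eq_bigr => p /psp/andP[pp po].
  rewrite Ft rmorphXn /= quadchar_sqr //.
  have -> : (t%:~R == 0 :> 'F_p) = (p %| `|t ^+ 2|)%N.
    rewrite abszX Euclid_dvdX // andbT.
    have -> : (p %| `|t|)%N = (`|t|%:R == 0 :> 'F_p) by rewrite (dvdn_pcharf (pchar_Fp pp)).
    by case: (intP t) => // k; rewrite ?abszN ?rmorphN ?oppr_eq0.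
  by case: dvdn.
have : (size ps)%:R = (size ps)%:Z by rewrite natz.
by move=> ->; move: szD Wps; move: (size D) (size ps); clear => a b; lia.
Qed.

(** * The sieve in two variables *)

Section Dim2.
Variables (n : nat) (A B : 'M[int]_n) (e : int).
Hypothesis AB : A *m B = B *m A.

(** With A and B the matrices of multiplication by v and b0, this is the norm of b0 + x + y v. The
    integer e fixes the class of this norm modulo squares. *)
Definition nform2 (x y : nat) : int := \det (x%:R%:M + y%:R *: A + B).

Definition good2 (p : nat) := [/\ (e%:~R : 'F_p) != 0, separable_poly (char_poly (mxp p B))
  & forall t, char_poly (mxp p A) <> ('X - t%:P) ^+ n].

Definition phi2 (p : nat) (v : {ffun bool -> 'F_p}) : int :=
  quadchar ((e%:~R : 'F_p) * linform2 (mxp p A) (mxp p B) (v true) (v false)).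

Lemma phi2E (p x y : nat) (X : {ffun bool -> nat}) :
  @phi2 p [ffun i => (X i)%:R] = quadchar ((e * nform2 (X true) (X false))%:~R : 'F_p).
Proof.
rewrite /phi2 !ffunE rmorphM /=; congr (quadchar (_ * _)).
rewrite /nform2 /linform2 -det_map_mx; congr (\det _).
apply/matrixP => i j; rewrite !mxE !rmorphD rmorphM /= rmorphMn /= !rmorph_nat //.
Qed.

Let Cn := (n + (100 * n.+1) ^ 2)%N.

Section Prime.
Variables (p : nat) (p_pr : prime p) (p_odd : odd p) (gp : good2 p).

Let vof (xy : 'F_p * 'F_p) : {ffun bool -> 'F_p} := [ffun b : bool => if b then xy.1 else xy.2].
Let vofK : bijective vof.
Proof.
exists (fun v : {ffun bool -> 'F_p} => (v true, v false)) => [[x y]|v]; first by rewrite !ffunE.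
by apply/ffunP => -[]; rewrite ffunE.
Qed.

Let ABp : mxp p A *m mxp p B = mxp p B *m mxp p A.
Proof. by rewrite -!map_mxM AB. Qed.

Let echi : quadchar (e%:~R : 'F_p) ^+ 2 = 1.
Proof. by have [e0 _ _] := gp; rewrite /quadchar (negPf e0); case: eqP. Qed.

Lemma phi2_line (a : {ffun bool -> 'F_p}) : a != 0 -> \sum_c lsum (@phi2 p) a c ^+ 2 <= (Cn * p ^ 2)%:Z.
Proof.
move=> a0; have [_ sB nA] := gp.
have hk : (a true, a false) != (0, 0).
  apply: contraNneq a0 => -[h k]; apply/eqP/ffunP => -[]; rewrite ffunE //.
apply: le_trans (line_sums p_pr p_odd ABp sB nA hk).
rewrite le_eqVlt; apply/orP; left; apply/eqP; apply: eq_bigr => c _.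
rewrite /lsum (reindex vof) /=; last exact: (onW_bij _ vofK).
have -> : \sum_(xy | \sum_i a i * vof xy i == c) phi2 (vof xy) =
  quadchar (e%:~R : 'F_p) * \sum_(xy : 'F_p * 'F_p | a true * xy.1 + a false * xy.2 == c)
     quadchar (linform2 (mxp p A) (mxp p B) xy.1 xy.2).
  rewrite mulr_sumr; apply: eq_big => [xy|xy _]; first by rewrite big_bool !ffunE.
  by rewrite /phi2 !ffunE quadcharM.
by rewrite exprMn echi mul1r.
Qed.

Lemma phi2_total : (\sum_v @phi2 p v) ^+ 2 <= (Cn * p ^ 3)%:Z.
Proof.
have [_ sB nA] := gp.
apply: le_trans (total_sum p_pr p_odd ABp sB nA).
rewrite le_eqVlt; apply/orP; left; apply/eqP.
rewrite (reindex vof) /=; last exact: (onW_bij _ vofK).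
have -> : \sum_xy phi2 (vof xy) = quadchar (e%:~R : 'F_p) * \sum_(xy : 'F_p * 'F_p)
     quadchar (linform2 (mxp p A) (mxp p B) xy.1 xy.2).
  by rewrite mulr_sumr; apply: eq_bigr => xy _; rewrite /phi2 !ffunE quadcharM.
by rewrite exprMn echi mul1r.
Qed.
End Prime.
End Dim2.

Lemma nat_root (k Q : nat) : (0 < k)%N -> (0 < Q)%N -> exists2 P, (0 < P)%N & (P ^ k <= Q < P.+1 ^ k)%N.
Proof.
move=> k0 Q0; have ex : exists P, (P ^ k <= Q)%N by exists 0%N; rewrite exp0n.
have ub P : (P ^ k <= Q)%N -> (P <= Q)%N.
  move=> h; apply: leq_trans h; case: P => // P; rewrite -{1}(expn1 P.+1) leq_pexp2l //.
case: (ex_maxnP ex ub) => P PQ Pmax; exists P.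
  by apply: Pmax; rewrite exp1n.
rewrite PQ /= ltnNge; apply/negP => /Pmax; by rewrite ltnn.
Qed.

Lemma cube_square P : ((8 * P ^ 3) ^ 2 = (4 * P ^ 2) ^ 3)%N.
Proof. by rewrite !expnS !expn0 !muln1; lia. Qed.

(** Here u = P^2/X and v = P^2/Y measure the offsets, and ml the multiplicity of residues. The
    condition u v <= P says P^3 <= Q, the choice that balances the two terms; the outcome is Q/P up
    to powers of P/y. *)
Lemma sieve_alg2 (R : realType) (k4 c S N y P Q u v kk ml : R) : 400 <= k4 -> 0 < c -> 0 < N -> 1 <= y -> y <= P -> 1 <= kk ->
  y <= 2 * N -> 0 <= ml -> ml <= 3 * (P / y) -> 0 <= u -> 0 <= v -> u <= P -> v <= P -> u * v <= P -> 0 <= Q ->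
  c * S * N ^+ 2 <= Q * (N ^+ 2 * (2 * kk / y) + N * (1 + (2 * u + 3) * (2 * v + 3) * ml * (2 * kk / y))) ->
  c * S <= k4 * kk * (Q * (P ^+ 2 / y ^+ 3)).
Proof.
move=> k400 c0 N0 y1 yP k1 yN m0 mP u0 v0 uP vP uvP Q0 h.
have y0 : 0 < y by lra. have P1 : 1 <= P by lra.
have uv : (2 * u + 3) * (2 * v + 3) <= 25 * P by nra.
have uv0 : 0 <= (2 * u + 3) * (2 * v + 3) by nra.
have h2 : (2 * u + 3) * (2 * v + 3) * ml * (2 * kk / y) <= 150 * kk * (P ^+ 2 / y ^+ 2).
  have -> : 150 * kk * (P ^+ 2 / y ^+ 2) = 25 * P * (3 * (P / y)) * (2 * kk / y) by field; rewrite gt_eqF.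
  apply: ler_wpM2r; first by nneg.
  exact: ler_pM.
have Py : 1 <= P / y by rewrite ler_pdivlMr // mul1r.
have r2 : P ^+ 2 / y ^+ 2 = (P / y) ^+ 2 by rewrite expr_div_n.
have r3 : P ^+ 2 / y ^+ 3 = (P / y) ^+ 2 / y by field; rewrite gt_eqF.
have P2 : 1 <= (P / y) ^+ 2 by rewrite exprn_ege1.
have N2 : 0 < N ^+ 2 by rewrite exprn_gt0.
rewrite -(ler_pM2r N2); apply: le_trans h _; rewrite r2 in h2; rewrite r3.
move: ((P / y) ^+ 2) P2 h2 => z z1 h2.
have -> : k4 * kk * (Q * (z / y)) * N ^+ 2 = Q * ((N ^+ 2 * (k4 * kk * z)) / y) by field; rewrite gt_eqF.
apply: ler_wpM2l => //; apply: le_trans (_ : N ^+ 2 * (2 * kk / y) + N * (151 * kk * z) <= _).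
  by rewrite lerD2l ler_pM2l //; apply: le_trans (_ : 1 + 150 * kk * z <= _); [rewrite lerD2l|nra].
rewrite ler_pdivlMr // mulrDl.
have -> : N ^+ 2 * (2 * kk / y) * y = N ^+ 2 * (2 * kk) by field; rewrite gt_eqF.
have kz : 0 <= kk * z by nra.
have E1 : 151 * kk * z = 151 * (kk * z) by ring.
have E4 : k4 * kk * z = k4 * (kk * z) by ring.
have kq : kk <= kk * z by rewrite ler_peMr //; lra.
rewrite E1 E4; move: (kk * z) kz kq => q q0 kq.
have t1 : N ^+ 2 * (2 * kk) <= N ^+ 2 * (2 * q) by rewrite ler_pM2l // ler_pM2l.
have t2 : N * (151 * q) * y <= N * (151 * q) * (2 * N) by rewrite ler_wpM2l //; nneg.
apply: le_trans (lerD t1 t2) _.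
have -> : N ^+ 2 * (2 * q) + N * (151 * q) * (2 * N) = 304 * (N ^+ 2 * q) by ring.
have -> : N ^+ 2 * (k4 * q) = k4 * (N ^+ 2 * q) by ring.
by apply: ler_wpM2r; [nneg|move: k400; clear; lra].
Qed.

(** The primes go up to P, the integer cube root of XY. The hypothesis X <= Y^2 gives P <= Y, so the
    box is at least P wide in both directions, and X <= 4 P^2, so the modulus exceeds it. The factor
    with W covers the case where P is too small to avoid the bad primes. *)
Theorem square_sieve2 (R : realType) (n : nat) (eps : R) : 0 < eps -> exists2 C : R, 0 < C &
  forall (A B : 'M[int]_n) (e D : int) (W X Y : nat) (s : seq (nat * nat)),
    A *m B = B *m A -> D != 0 -> (`|D| <= 2 ^ W)%N ->
    (forall p, prime p -> odd p -> ~~ (p %| `|D|)%N -> good2 A B e p) ->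
    (0 < Y)%N -> (Y <= X)%N -> (X <= Y ^ 2)%N -> uniq s ->
    (forall xy, xy \in s -> [/\ (xy.1 < X)%N, (xy.2 < Y)%N, e * nform2 A B xy.1 xy.2 != 0,
       (`|(e * nform2 A B xy.1 xy.2)%R| <= 2 ^ W)%N & exists t, e * nform2 A B xy.1 xy.2 = t ^+ 2]) ->
    (size s)%:R <= C * (X * Y)%:R `^ (2 / 3 + eps) * W.+1%:R ^+ 6.
Proof.
move=> eps0; have [e' [e'0 e'2 e'e]] : exists e' : R, [/\ 0 < e', e' <= 1 / 2 & e' <= eps].
  exists (Num.min eps (1 / 2)); rewrite lt_min eps0 !ge_min !lexx orbT /=; split => //; lra.
have [k4 k400] : exists k4 : R, 400 <= k4 by exists 400.
have k40 : 0 < k4 by move: k400; clear; lra.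
have [C0 C01 prs] := sieve_primes e'0 e'2.
have C0ge : 0 <= C0 by move: C01; clear; lra.
have [kk [kkE kk1]] : exists kk : R, (forall x, (n + (100 * n.+1) ^ 2)%N%:R * x = kk * x) /\ 1 <= kk.
  exists (n + (100 * n.+1) ^ 2)%N%:R; split => [x|]; first reflexivity.
  by rewrite ler1n addn_gt0 expn_gt0 muln_gt0 orbT.
have kk0 : 0 <= kk by apply: le_trans kk1.
have [c [cE c0]] : exists c : R, (forall x, cos 1 ^+ 2 / (4 * (16 * 2%:R) ^+ 2) * x = c * x) /\ 0 < c.
  exists (cos 1 ^+ 2 / (4 * (16 * 2%:R) ^+ 2)); split=> //.
  by rewrite divr_gt0 ?exprn_gt0 ?cos1_gt0 // mulr_gt0 ?exprn_gt0 ?mulr_gt0 ?ltr0n.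
have [C1 [C10 C1E]] : exists C1 : R, 0 < C1 /\ C1 * c = 2 * (k4 * kk).
  exists (2 * (k4 * kk) / c); split; last by rewrite divfK // gt_eqF.
  by apply: divr_gt0 => //; apply: mulr_gt0 => //; apply: mulr_gt0 => //; apply: lt_le_trans kk1.
exists (8 * C0 ^+ 6 + C1).
  by apply: ltr_wpDl => //; nneg.
move=> A B e D W X Y s AB D0 DW good Y0 YX XY us sP.
have Q1 : (0 < X * Y)%N by rewrite muln_gt0 Y0 (leq_trans Y0).
set Q : R := (X * Y)%:R; have Q1r : 1 <= Q by rewrite ler1n.
have Q0r : 0 < Q by apply: lt_le_trans Q1r.
have Qge0 := ltW Q0r.
have W1 : 1 <= W.+1%:R :> R by rewrite ler1n.
have triv : (size s <= X * Y)%N.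
  have := @uniq_leq_size _ s [seq (x, y) | x <- iota 0 X, y <- iota 0 Y] us.
  rewrite size_allpairs !size_iota; apply => -[x y] /sP [/= xX yY _ _ _].
  by apply/allpairsP; exists (x, y); rewrite !mem_iota !add0n.
have [P P0 /andP[PQ QP]] := @nat_root 3 (X * Y) isT Q1.
have P1 : 1 <= P%:R :> R by rewrite ler1n.
have P0r : 0 < P%:R :> R by apply: lt_le_trans P1.
have QP8 : (X * Y <= 8 * P ^ 3)%N.
  apply: leq_trans (ltnW QP) _; have -> : (8 = 2 ^ 3)%N by [].
  by rewrite -expnMn leq_exp2r // mul2n -addnn -addn1 leq_add2l.
set y : R := P%:R `^ (1 - e').
have y1 : 1 <= y by apply: powR_ge1 => //; move: e'2; clear; lra.
have y0 : 0 < y by apply: lt_le_trans y1.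
have yP : y <= P%:R by rewrite -[leRHS]powRr1 // /y ler_powR //; move: e'0; clear; lra.
have Pow1 : 1 <= Q `^ (2 / 3 + eps) by apply: powR_ge1 => //; move: eps0; clear; lra.
have W6 : 1 <= W.+1%:R ^+ 6 :> R by rewrite exprn_ege1.
(* If P^(1-e') is below C0 (W+1), then P <= y^2 and the trivial count XY <= 8 P^3 is at most 8 (C0
   (W+1))^6. *)
have [lt|ge] := ltrP y (C0 * W.+1%:R).
  apply: le_trans (_ : Q <= _); first by rewrite ler_nat.
  have P6 : P%:R ^+ 3 <= (C0 * W.+1%:R) ^+ 6 :> R.
    have -> : (C0 * W.+1%:R) ^+ 6 = ((C0 * W.+1%:R) ^+ 2) ^+ 3 by rewrite -exprM.
    rewrite lerXn2r ?nnegrE ?sqr_ge0 //; apply: le_trans (_ : y ^+ 2 <= _).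
      by rewrite -powR_mulrn ?powR_ge0 // -powRrM -[leLHS]powRr1 // ler_powR //; move: e'2; clear; lra.
    by rewrite lerXn2r ?nnegrE ?(ltW lt) ?(ltW y0) // mulr_ge0.
  apply: le_trans (_ : 8 * C0 ^+ 6 * 1 * W.+1%:R ^+ 6 <= _).
    rewrite mulr1 -mulrA -exprMn; apply: le_trans (_ : 8 * P%:R ^+ 3 <= _); last by rewrite ler_pM2l.
    by rewrite -natrX -natrM ler_nat.
  rewrite ler_wpM2r ?exprn_ge0 // ler_pM //; first by rewrite mulr_ge0 // exprn_ge0.
  by rewrite lerDl ltW.
have [ps [ups psP psN psW psM]] := prs P W D D0 DW ge.
pose Pl := Num.truncn y.
have Pl0 : (0 < Pl)%N by rewrite /Pl truncn_gt0.
have Ply : Pl%:R <= y by rewrite /Pl truncn_le // ltW.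
have yPl : y <= 2 * Pl%:R.
  have := truncn_itv (ltW y0) => /andP[_]; rewrite -/Pl -natr1 => h.
  have : 1 <= Pl%:R :> R by rewrite ler1n.
  by move: h; clear; lra.
have PY : (P <= Y)%N.
  rewrite -(@leq_exp2r _ _ 3) //; apply: leq_trans PQ _.
  by rewrite expnSr leq_mul2r XY orbT.
have PX := leq_trans PY YX.
pose XX (b : bool) := if b then X else Y; pose Rb b := (P ^ 2 %/ XX b).+1.
have XX0 b : (0 < XX b)%N by case: b => //=; apply: leq_trans YX.
have PXX b : (P <= XX b)%N by case: b.
pose sv (xy : nat * nat) : {ffun bool -> nat} := [ffun b => if b then xy.1 else xy.2].
have svinj : injective sv.
  move=> [x1 x2] [x1' x2'] /ffunP E; have := E true; have := E false; by rewrite !ffunE /= => -> ->.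
have N0 : 0 < (size ps)%:R :> R by move: psN y0; rewrite -/y; clear; lra.
have key := @square_sieve_count R bool ps XX Rb P Pl (phi2 A B e) (kk / Pl%:R) (kk / Pl%:R) (map sv s).
move: key; rewrite card_bool size_map big_bool /= -mulrA cE mulrA => key.
have {}key : c * (size s)%:R * (size ps)%:R ^+ 2 <= X%:R * Y%:R * ((size ps)%:R ^+ 2 * (kk / Pl%:R) +
   (size ps)%:R * (1 + (\prod_i (Rb i).*2.+1)%:R * (P %/ Pl).+1%:R * (kk / Pl%:R))).
  have Plr : 0 < Pl%:R :> R by rewrite ltr0n.
  have ppr p : p \in ps -> [/\ prime p, odd p, good2 A B e p, (Pl <= p)%N & (p <= P)%N].
    move=> /psP[pp po pD pP yp]; split => //; first exact: good.
    by rewrite -(ler_nat R); apply: le_trans Ply yp.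
  apply: key => //.
  - by move=> p /ppr[].
  - by move=> p /ppr[_ _ _ -> ->].
  - by move=> b; apply: leq_trans (PXX b) _; rewrite leq_pmull.
  - move=> b; apply: leq_trans (_ : XX b * Rb b <= _)%N.
      by rewrite /Rb mulnC ltnW // ltn_ceil.
    by rewrite -mulnA leq_pmull.
  - move=> b; apply: leq_trans psM; apply: leq_trans (_ : 16 * X <= _)%N.
      by rewrite leq_mul2l /=; case: b => //=.
    suff h4 : (X <= 4 * P ^ 2)%N by apply: leq_trans (leq_mul (leqnn 16) h4) _; rewrite mulnA.
    rewrite -(@leq_exp2r _ _ 3) //; apply: leq_trans (_ : (X * Y) ^ 2 <= _)%N.
      by rewrite expnMn expnSr leq_mul2l XY orbT.
    apply: leq_trans (_ : (8 * P ^ 3) ^ 2 <= _)%N; first by rewrite leq_exp2r.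
    by rewrite cube_square.
  - by move=> p v; apply: quadchar_norm_le1.
  - by rewrite divr_ge0.
  - move=> p /ppr[pp po gp Plp _]; have := phi2_total AB pp po gp.
    rewrite -(ler_int R) rmorphXn /= => h; apply: le_trans h _.
    rewrite mulrAC ler_pdivlMr // -pmulrn natrM kkE natrX -mulrA ler_wpM2l //.
    have -> : (p%:R ^+ 2) ^+ 2 = p%:R ^+ 3 * p%:R :> R by rewrite -exprM -exprSr.
    by rewrite ler_wpM2l ?exprn_ge0 // ler_nat.
  - move=> p a /ppr[pp po gp Plp _] a0; have := phi2_line AB pp po gp a0.
    rewrite -(ler_int R) => h; apply: le_trans (ler_wpM2l (ler0n _ _) h) _.
    rewrite mulrAC ler_pdivlMr // -pmulrn natrM kkE natrX mulrCA -mulrA ler_wpM2l //.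
    have -> : (p%:R ^+ 2) ^+ 2 = p%:R ^+ 2 * p%:R * p%:R :> R by rewrite -exprM -!exprSr.
    by rewrite [p%:R * _ ^+ 2]mulrC; apply: ler_wpM2l; [rewrite mulr_ge0 ?exprn_ge0|rewrite ler_nat].
  - by rewrite map_inj_uniq.
  - by move=> x b /mapP[xy /sP[h1 h2 _ _ _] ->]; rewrite ffunE; case: b.
  - move=> x /mapP[xy /sP[_ _ F0 FW [t Ft]] ->]; rewrite (eq_bigr (fun p => quadchar ((e * nform2 A B xy.1 xy.2)%:~R : 'F_p))).
      apply: sieve_lower_bound Ft F0 FW => //.
      by move=> p /ppr[-> ->].
    by move=> p _; rewrite phi2E // !ffunE.
have XYr : X%:R * Y%:R = Q by rewrite -natrM.
pose u : R := P%:R ^+ 2 / X%:R; pose v : R := P%:R ^+ 2 / Y%:R.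
have X0r : 0 < X%:R :> R by rewrite ltr0n (leq_trans Y0).
have Y0r : 0 < Y%:R :> R by rewrite ltr0n.
have Plr : 0 < Pl%:R :> R by rewrite ltr0n.
have PXr : P%:R <= X%:R :> R by rewrite ler_nat.
have PYr : P%:R <= Y%:R :> R by rewrite ler_nat.
have fl (a b : nat) : (0 < b)%N -> (a %/ b)%:R <= a%:R / b%:R :> R.
  by move=> b0; rewrite ler_pdivlMr ?ltr0n // -natrM ler_nat leq_trunc_div.
have main : c * (size s)%:R <= k4 * kk * (Q * (P%:R ^+ 2 / y ^+ 3)).
  apply: (@sieve_alg2 R k4 c (size s)%:R (size ps)%:R y P%:R Q u v kk ((P %/ Pl).+1%:R)) => //.
  - rewrite -natr1 (le_trans (lerD (fl _ _ Pl0) (lexx _))) //.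
    have a1 : P%:R / Pl%:R <= 2 * (P%:R / y).
      by rewrite ler_pdivrMr // mulrAC mulrA ler_pdivlMr // mulrAC [2 * _]mulrC -mulrA ler_wpM2l.
    have a2 : 1 <= P%:R / y by rewrite ler_pdivlMr // mul1r.
    by move: a1 a2; clear; lra.
  - by rewrite divr_ge0 // ?sqr_ge0 // ltW.
  - by rewrite divr_ge0 // ?sqr_ge0 // ltW.
  - by rewrite ler_pdivrMr // expr2 ler_wpM2l.
  - by rewrite ler_pdivrMr // expr2 ler_wpM2l.
  - have -> : u * v = P%:R ^+ 4 / Q by rewrite /u /v -XYr; field; rewrite !gt_eqF.
    rewrite ler_pdivrMr //.
    by rewrite exprS ler_wpM2l // -natrX ler_nat.
  - apply: le_trans key _; rewrite XYr; apply: ler_wpM2l => //.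
    have kP : kk / Pl%:R <= 2 * kk / y.
      rewrite ler_pdivrMr // mulrAC ler_pdivlMr //.
      have -> : 2 * kk * Pl%:R = kk * (2 * Pl%:R) by ring.
      by apply: ler_wpM2l => //; apply: le_trans kk1.
    apply: lerD; first by rewrite ler_wpM2l ?sqr_ge0.
    rewrite ler_wpM2l // lerD2l; apply: ler_pM => //; rewrite ?mulr_ge0 ?divr_ge0 //.
    rewrite ler_wpM2r // big_bool natrM /Rb /= !doubleS.
    have dbl a : (a.*2.+3)%:R = 2 * a%:R + 3 :> R by rewrite -addn3 natrD -mul2n natrM.
    rewrite !dbl ler_pM //; try by rewrite addr_ge0 ?mulr_ge0.
      by rewrite lerD2r ler_pM2l // /u -natrX fl // (leq_trans Y0).
    by rewrite lerD2r ler_pM2l // /v -natrX fl.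
pose t := Q `^ (1 / 3); pose z := P%:R `^ e'.
have Pn0 : P%:R != 0 :> R by rewrite gt_eqF.
have yz : y * z = P%:R.
  by rewrite /y /z -powRD ?subrK ?powRr1 // Pn0 implybT.
have t3 : t ^+ 3 = Q by rewrite -powR_mulrn ?powR_ge0 // -powRrM div1r mulVf // powRr1.
have tP : P%:R <= t.
  rewrite leNgt; apply/negP => lt; have : t ^+ 3 < P%:R ^+ 3 by rewrite ltrXn2r ?nnegrE ?powR_ge0.
  by rewrite t3 ltNge /Q -natrX ler_nat PQ.
have tP2 : t <= 2 * P%:R.
  rewrite leNgt; apply/negP => lt; have : (2 * P%:R) ^+ 3 < t ^+ 3 by rewrite ltrXn2r ?nnegrE ?powR_ge0 ?mulr_ge0.
  by rewrite t3 ltNge exprMn -!natrX -natrM ler_nat QP8.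
have z3 : z ^+ 3 <= Q `^ e'.
  rewrite -t3 -powR_mulrn ?powR_ge0 // -powRrM -powR_mulrn ?powR_ge0 // -powRrM [3%:R * _]mulrC.
  by apply: ge0_ler_powR; [apply: mulr_ge0 => //; apply: ltW|rewrite nnegrE|rewrite nnegrE powR_ge0|exact: tP].
have e1 : Q * (P%:R ^+ 2 / y ^+ 3) = t ^+ 3 / P%:R * z ^+ 3 by rewrite t3 -yz; field; rewrite !gt_eqF ?powR_gt0.
have e2 : t ^+ 3 / P%:R <= 2 * t ^+ 2.
  rewrite ler_pdivrMr //.
  have -> : 2 * t ^+ 2 * P%:R = t ^+ 2 * (2 * P%:R) by ring.
  by rewrite exprSr; apply: ler_wpM2l => //; apply: sqr_ge0.
have e3 : Q * (P%:R ^+ 2 / y ^+ 3) <= 2 * Q `^ (2 / 3 + eps).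
  rewrite e1; apply: le_trans (_ : 2 * t ^+ 2 * Q `^ e' <= _).
    by rewrite ler_pM ?divr_ge0 ?exprn_ge0 ?powR_ge0 // ?ler0n.
  rewrite -mulrA ler_pM2l // -powR_mulrn ?powR_ge0 // -powRrM -powRD; last by rewrite (gt_eqF Q0r) implybT.
  by rewrite ler_powR //; move: e'e; clear; lra.
have h : (size s)%:R <= C1 * Q `^ (2 / 3 + eps).
  rewrite -(ler_pM2l c0); apply: le_trans main _; rewrite [leRHS]mulrA [c * C1]mulrC C1E.
  have -> : 2 * (k4 * kk) * Q `^ (2 / 3 + eps) = k4 * kk * (2 * Q `^ (2 / 3 + eps)) by ring.
  by apply: ler_wpM2l => //; rewrite mulr_ge0 // ltW.
apply: le_trans h _; apply: le_trans (_ : (8 * C0 ^+ 6 + C1) * Q `^ (2 / 3 + eps) <= _).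
  by rewrite ler_wpM2r ?powR_ge0 // lerDr mulr_ge0 // exprn_ge0.
by apply: ler_peMr => //; rewrite mulr_ge0 ?powR_ge0 // addr_ge0 ?mulr_ge0 ?exprn_ge0 // ltW.
Qed.

(** * The sieve in one variable *)

Section Dim1.
Variables (n : nat) (B : 'M[int]_n) (e : int).
Hypothesis n0 : (0 < n)%N.

Definition good1 (p : nat) := (e%:~R : 'F_p) != 0 /\ separable_poly (char_poly (mxp p B)).

Definition nform1 (x : nat) : int := (char_poly B).[x%:R].

Definition phi1 (p : nat) (v : {ffun unit -> 'F_p}) : int :=
  quadchar ((e%:~R : 'F_p) * (char_poly (mxp p B)).[v tt]).

Lemma phi1E (p : nat) (X : {ffun unit -> nat}) :
  @phi1 p [ffun i => (X i)%:R] = quadchar ((e * nform1 (X tt))%:~R : 'F_p).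
Proof.
rewrite /phi1 !ffunE rmorphM /=; congr (quadchar (_ * _)).
by rewrite /nform1 -horner_map /= map_char_poly rmorph_nat.
Qed.

Section Prime.
Variables (p : nat) (p_pr : prime p) (p_odd : odd p) (gp : good1 p).

Let vof (x : 'F_p) : {ffun unit -> 'F_p} := [ffun _ => x].
Let vofK : bijective vof.
Proof.
exists (fun v : {ffun unit -> 'F_p} => v tt) => [x|v]; first by rewrite ffunE.
by apply/ffunP => -[]; rewrite ffunE.
Qed.

Lemma phi1_line (a : {ffun unit -> 'F_p}) : a != 0 -> \sum_c lsum (@phi1 p) a c ^+ 2 <= p%:Z.
Proof.
move=> a0; have at0 : a tt != 0.
  by apply: contraNneq a0 => h; apply/eqP/ffunP => -[]; rewrite ffunE h.
have -> : p%:Z = \sum_(c : 'F_p) 1 by rewrite sumr_const [#|_|]card_Fp // natz.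
apply: ler_sum => c _; rewrite /lsum (big_pred1 (vof (c / a tt))).
  have := quadchar_norm_le1 ((e%:~R : 'F_p) * (char_poly (mxp p B)).[vof (c / a tt) tt]).
  rewrite -/(phi1 _); move: (phi1 _); clear => u.
  rewrite -[X in _ -> X <= _]real_normK ?num_real // => h; exact: exprn_ile1.
move=> v /=; have -> : \sum_i a i * v i = a tt * v tt by rewrite (bigD1 tt) //= big1 ?addr0 // => -[].
apply/eqP/eqP => [<-|->]; last by rewrite ffunE mulrC divfK.
by apply/ffunP => -[]; rewrite ffunE mulrAC divff // mul1r.
Qed.

Lemma phi1_total : (\sum_v @phi1 p v) ^+ 2 <= ((100 * n.+1) ^ 2 * p)%:Z.
Proof.
have [e0 sB] := gp.
have sz : (size (char_poly (mxp p B)) <= n.+1)%N by rewrite size_char_poly.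
have ns : nonsquare_poly (char_poly (mxp p B)).
  by apply: sqrfree_nonsquare; rewrite ?size_char_poly.
have := quadchar_poly_sum p_pr p_odd sz ns; rewrite real_normK ?num_real //; apply: le_trans.
rewrite le_eqVlt; apply/orP; left; apply/eqP.
rewrite (reindex vof) /=; last exact: (onW_bij _ vofK).
have -> : \sum_x phi1 (vof x) = quadchar (e%:~R : 'F_p) * \sum_x quadchar (char_poly (mxp p B)).[x].
  by rewrite mulr_sumr; apply: eq_bigr => x _; rewrite /phi1 !ffunE quadcharM.
by rewrite exprMn {1}/quadchar (negPf e0); case: eqP => _; rewrite ?expr1n ?sqrrN ?expr1n mul1r.
Qed.
End Prime.
End Dim1.

Lemma sieve_alg1 (R : realType) (k4 c S N y P Q kk ml : R) : 50 <= k4 -> 0 < c -> 0 < N -> 1 <= y -> y <= P -> 1 <= kk ->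
  y <= 2 * N -> 0 <= ml -> ml <= 3 * (P / y) -> 0 <= Q ->
  c * S * N ^+ 2 <= Q * (N ^+ 2 * (2 * kk / y) + N * (1 + 5 * ml)) ->
  c * S <= k4 * kk * (Q * (P / y ^+ 2)).
Proof.
move=> k400 c0 N0 y1 yP k1 yN m0 mP Q0 h.
have y0 : 0 < y by lra.
have Py : 1 <= P / y by rewrite ler_pdivlMr // mul1r.
have r3 : P / y ^+ 2 = (P / y) / y by field; rewrite gt_eqF.
have N2 : 0 < N ^+ 2 by rewrite exprn_gt0.
rewrite -(ler_pM2r N2); apply: le_trans h _; rewrite r3.
move: (P / y) Py mP => z z1 mP.
have -> : k4 * kk * (Q * (z / y)) * N ^+ 2 = Q * ((N ^+ 2 * (k4 * kk * z)) / y) by field; rewrite gt_eqF.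
apply: ler_wpM2l => //.
have kz : 0 <= kk * z by nra.
have kq : kk <= kk * z by rewrite ler_peMr //; lra.
have zq : z <= kk * z by rewrite ler_peMl //; lra.
have E4 : k4 * kk * z = k4 * (kk * z) by ring.
rewrite E4; move: (kk * z) kz kq zq => q q0 kq zq.
apply: le_trans (_ : N ^+ 2 * (2 * kk / y) + N * (16 * q) <= _).
  by rewrite lerD2l ler_pM2l //; lra.
rewrite ler_pdivlMr // mulrDl.
have -> : N ^+ 2 * (2 * kk / y) * y = N ^+ 2 * (2 * kk) by field; rewrite gt_eqF.
have t1 : N ^+ 2 * (2 * kk) <= N ^+ 2 * (2 * q) by rewrite ler_pM2l // ler_pM2l.
have t2 : N * (16 * q) * y <= N * (16 * q) * (2 * N) by rewrite ler_wpM2l //; nneg.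
apply: le_trans (lerD t1 t2) _.
have -> : N ^+ 2 * (2 * q) + N * (16 * q) * (2 * N) = 34 * (N ^+ 2 * q) by ring.
have -> : N ^+ 2 * (k4 * q) = k4 * (N ^+ 2 * q) by ring.
by apply: ler_wpM2r; [nneg|move: k400; clear; lra].
Qed.

(** Now P is the integer square root of X, so that P^2 <= X and a constant offset bound works ([Rb]
    is 2, whence the 5). A nonzero linear form on F_p separates points, so each [lsum] is a single
    character value and K = 1. *)
Theorem square_sieve1 (R : realType) (n : nat) (eps : R) : 0 < eps -> (0 < n)%N -> exists2 C : R, 0 < C &
  forall (B : 'M[int]_n) (e D : int) (W X : nat) (s : seq nat),
    D != 0 -> (`|D| <= 2 ^ W)%N ->
    (forall p, prime p -> odd p -> ~~ (p %| `|D|)%N -> good1 B e p) ->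
    (0 < X)%N -> uniq s ->
    (forall x, x \in s -> [/\ (x < X)%N, e * nform1 B x != 0,
       (`|(e * nform1 B x)%R| <= 2 ^ W)%N & exists t, e * nform1 B x = t ^+ 2]) ->
    (size s)%:R <= C * X%:R `^ (1 / 2 + eps) * W.+1%:R ^+ 6.
Proof.
move=> eps0 n0; have [e' [e'0 e'2 e'e]] : exists e' : R, [/\ 0 < e', e' <= 1 / 2 & e' <= eps].
  exists (Num.min eps (1 / 2)); rewrite lt_min eps0 !ge_min !lexx orbT /=; split => //; lra.
have [k4 k400] : exists k4 : R, 50 <= k4 by exists 50.
have k40 : 0 < k4 by move: k400; clear; lra.
have [C0 C01 prs] := sieve_primes e'0 e'2.
have C0ge : 0 <= C0 by move: C01; clear; lra.
have [kk [kkE kk1]] : exists kk : R, (forall x, ((100 * n.+1) ^ 2)%N%:R * x = kk * x) /\ 1 <= kk.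
  exists ((100 * n.+1) ^ 2)%N%:R; split => [x|]; first reflexivity.
  by rewrite ler1n expn_gt0 muln_gt0.
have kk0 : 0 <= kk by apply: le_trans kk1.
have [c [cE c0]] : exists c : R, (forall x, cos 1 ^+ 2 / (4 * (16 * 1%:R) ^+ 1) * x = c * x) /\ 0 < c.
  exists (cos 1 ^+ 2 / (4 * (16 * 1%:R) ^+ 1)); split=> //.
  by rewrite divr_gt0 ?exprn_gt0 ?cos1_gt0 // mulr_gt0 ?exprn_gt0 ?mulr_gt0 ?ltr0n.
have [C1 [C10 C1E]] : exists C1 : R, 0 < C1 /\ C1 * c = 2 * (k4 * kk).
  exists (2 * (k4 * kk) / c); split; last by rewrite divfK // gt_eqF.
  by apply: divr_gt0 => //; apply: mulr_gt0 => //; apply: mulr_gt0 => //; apply: lt_le_trans kk1.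
exists (8 * C0 ^+ 6 + C1).
  by apply: ltr_wpDl => //; nneg.
move=> B e D W X s D0 DW good X0 us sP.
set Q : R := X%:R; have Q1r : 1 <= Q by rewrite ler1n.
have Q0r : 0 < Q by apply: lt_le_trans Q1r.
have Qge0 := ltW Q0r.
have W1 : 1 <= W.+1%:R :> R by rewrite ler1n.
have triv : (size s <= X)%N.
  by rewrite -(size_iota 0 X); apply: uniq_leq_size us _ => x /sP [xX _ _ _]; rewrite mem_iota.
have [P P0 /andP[PQ QP]] := @nat_root 2 X isT X0.
have P1 : 1 <= P%:R :> R by rewrite ler1n.
have P0r : 0 < P%:R :> R by apply: lt_le_trans P1.
have QP8 : (X <= 4 * P ^ 2)%N.
  apply: leq_trans (ltnW QP) _; have -> : (4 = 2 ^ 2)%N by [].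
  by rewrite -expnMn leq_exp2r // mul2n -addnn -addn1 leq_add2l.
set y : R := P%:R `^ (1 - e').
have y1 : 1 <= y by apply: powR_ge1 => //; move: e'2; clear; lra.
have y0 : 0 < y by apply: lt_le_trans y1.
have yP : y <= P%:R by rewrite -[leRHS]powRr1 // /y ler_powR //; move: e'0; clear; lra.
have Pow1 : 1 <= Q `^ (1 / 2 + eps) by apply: powR_ge1 => //; move: eps0; clear; lra.
have W6 : 1 <= W.+1%:R ^+ 6 :> R by rewrite exprn_ege1.
have [lt|ge] := ltrP y (C0 * W.+1%:R).
  apply: le_trans (_ : Q <= _); first by rewrite ler_nat.
  have P6 : P%:R ^+ 2 <= (C0 * W.+1%:R) ^+ 6 :> R.
    have Pz : P%:R <= (C0 * W.+1%:R) ^+ 2.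
      apply: le_trans (_ : y ^+ 2 <= _).
        by rewrite -powR_mulrn ?powR_ge0 // -powRrM -[leLHS]powRr1 // ler_powR //; move: e'2; clear; lra.
      by rewrite lerXn2r ?nnegrE ?(ltW lt) ?(ltW y0) // mulr_ge0.
    apply: le_trans (_ : P%:R ^+ 3 <= _); first by rewrite ler_weXn2l.
    have -> : (C0 * W.+1%:R) ^+ 6 = ((C0 * W.+1%:R) ^+ 2) ^+ 3 by rewrite -exprM.
    by rewrite lerXn2r ?nnegrE ?sqr_ge0.
  apply: le_trans (_ : 8 * C0 ^+ 6 * 1 * W.+1%:R ^+ 6 <= _).
    rewrite mulr1 -mulrA -exprMn; apply: le_trans (_ : 8 * P%:R ^+ 2 <= _); last by rewrite ler_pM2l.
    rewrite -natrX -natrM ler_nat; apply: leq_trans QP8 _; by rewrite leq_mul2r orbT.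
  rewrite ler_wpM2r ?exprn_ge0 // ler_pM //; first by rewrite mulr_ge0 // exprn_ge0.
  by rewrite lerDl ltW.
have [ps [ups psP psN psW psM]] := prs P W D D0 DW ge.
pose Pl := Num.truncn y.
have Pl0 : (0 < Pl)%N by rewrite /Pl truncn_gt0.
have Ply : Pl%:R <= y by rewrite /Pl truncn_le // ltW.
have yPl : y <= 2 * Pl%:R.
  have := truncn_itv (ltW y0) => /andP[_]; rewrite -/Pl -natr1 => h.
  have : 1 <= Pl%:R :> R by rewrite ler1n.
  by move: h; clear; lra.
have PX : (P <= X)%N by apply: leq_trans PQ; rewrite -{1}(expn1 P) leq_pexp2l.
pose sv (x : nat) : {ffun unit -> nat} := [ffun _ => x].
have svinj : injective sv by move=> x x' /ffunP/(_ tt); rewrite !ffunE.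
have N0 : 0 < (size ps)%:R :> R by move: psN y0; rewrite -/y; clear; lra.
have key := @square_sieve_count R unit ps (fun=> X) (fun=> 2%N) P Pl (phi1 B e) (kk / Pl%:R) 1 (map sv s).
move: key; rewrite card_unit size_map -mulrA cE mulrA => key.
have Plr : 0 < Pl%:R :> R by rewrite ltr0n.
have {}key : c * (size s)%:R * (size ps)%:R ^+ 2 <= Q * ((size ps)%:R ^+ 2 * (kk / Pl%:R) +
   (size ps)%:R * (1 + 5 * (P %/ Pl).+1%:R)).
  have ppr p : p \in ps -> [/\ prime p, odd p, good1 B e p, (Pl <= p)%N & (p <= P)%N].
    move=> /psP[pp po pD pP yp]; split => //; first exact: good.
    by rewrite -(ler_nat R); apply: le_trans Ply yp.
  have -> : Q = \prod_(i : unit) X%:R by rewrite big_const card_unit /= mulr1.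
  have -> : 5 * (P %/ Pl).+1%:R = (\prod_(i : unit) (2%N).*2.+1)%N%:R * (P %/ Pl).+1%:R * 1 :> R.
    by rewrite mulr1; congr (_ * _); rewrite big_const card_unit.
  apply: key => //.
  - by move=> p /ppr[].
  - by move=> p /ppr[_ _ _ -> ->].
  - by move=> _; apply: leq_trans PX _; rewrite leq_pmull.
  - move=> _; apply: leq_trans PQ _.
    by rewrite muln1 mulnAC leq_pmull.
  - move=> _; apply: leq_trans psM; rewrite muln1; apply: leq_trans (leq_mul (leqnn 8) QP8) _.
    by rewrite mulnA leq_mul2r orbT.
  - by move=> p v; apply: quadchar_norm_le1.
  - move=> p /ppr[pp po gp Plp _]; have : (\sum_v phi1 B e (p:=p) v) ^+ 2 <= ((100 * n.+1) ^ 2 * p)%:Z by apply: phi1_total.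
    rewrite -(ler_int R) rmorphXn /= => h; apply: le_trans h _.
    rewrite mulrAC ler_pdivlMr // -pmulrn natrM kkE expr1 -mulrA; apply: ler_wpM2l; first by apply: le_trans kk1.
    by rewrite expr2; apply: ler_wpM2l => //; rewrite ler_nat.
  - move=> p a /ppr[pp po gp Plp _] a0; have : \sum_c lsum (phi1 B e (p:=p)) a c ^+ 2 <= p%:Z by apply: phi1_line.
    rewrite -(ler_int R) => h; apply: le_trans (ler_wpM2l (ler0n _ _) h) _.
    by rewrite -pmulrn expr1 mul1r expr2.
  - by rewrite map_inj_uniq.
  - by move=> x b /mapP[z /sP[h1 _ _ _] ->]; rewrite ffunE.
  - move=> x /mapP[z /sP[_ F0 FW [t Ft]] ->]; rewrite (eq_bigr (fun p => quadchar ((e * nform1 B z)%:~R : 'F_p))).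
      apply: sieve_lower_bound Ft F0 FW => //.
      by move=> p /ppr[-> ->].
    by move=> p _; rewrite phi1E // !ffunE.
have fl (a b : nat) : (0 < b)%N -> (a %/ b)%:R <= a%:R / b%:R :> R.
  by move=> b0; rewrite ler_pdivlMr ?ltr0n // -natrM ler_nat leq_trunc_div.
have main : c * (size s)%:R <= k4 * kk * (Q * (P%:R / y ^+ 2)).
  apply: (@sieve_alg1 R k4 c (size s)%:R (size ps)%:R y P%:R Q kk ((P %/ Pl).+1%:R)) => //.
  - rewrite -natr1 (le_trans (lerD (fl _ _ Pl0) (lexx _))) //.
    have a1 : P%:R / Pl%:R <= 2 * (P%:R / y).
      by rewrite ler_pdivrMr // mulrAC mulrA ler_pdivlMr // mulrAC [2 * _]mulrC -mulrA ler_wpM2l.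
    have a2 : 1 <= P%:R / y by rewrite ler_pdivlMr // mul1r.
    by move: a1 a2; clear; lra.
  - apply: le_trans key _; apply: ler_wpM2l => //.
    have kP : kk / Pl%:R <= 2 * kk / y.
      rewrite ler_pdivrMr // mulrAC ler_pdivlMr //.
      have -> : 2 * kk * Pl%:R = kk * (2 * Pl%:R) by ring.
      by apply: ler_wpM2l => //; apply: le_trans kk1.
    by rewrite lerD2r; apply: ler_wpM2l => //; apply: exprn_ge0.
pose t := Q `^ (1 / 2); pose z := P%:R `^ e'.
have Pn0 : P%:R != 0 :> R by rewrite gt_eqF.
have yz : y * z = P%:R.
  by rewrite /y /z -powRD ?subrK ?powRr1 // Pn0 implybT.
have t3 : t ^+ 2 = Q by rewrite -powR_mulrn ?powR_ge0 // -powRrM div1r mulVf // powRr1.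
have tP : P%:R <= t.
  rewrite leNgt; apply/negP => lt; have : t ^+ 2 < P%:R ^+ 2 by rewrite ltrXn2r ?nnegrE ?powR_ge0.
  by rewrite t3 ltNge /Q -natrX ler_nat PQ.
have tP2 : t <= 2 * P%:R.
  rewrite leNgt; apply/negP => lt; have : (2 * P%:R) ^+ 2 < t ^+ 2 by rewrite ltrXn2r ?nnegrE ?powR_ge0 ?mulr_ge0.
  by rewrite t3 ltNge exprMn -!natrX -natrM ler_nat QP8.
have z3 : z ^+ 2 <= Q `^ e'.
  rewrite -t3 -powR_mulrn ?powR_ge0 // -powRrM -powR_mulrn ?powR_ge0 // -powRrM [2%:R * _]mulrC.
  by apply: ge0_ler_powR; [apply: mulr_ge0 => //; apply: ltW|rewrite nnegrE|rewrite nnegrE powR_ge0|exact: tP].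
have e1 : Q * (P%:R / y ^+ 2) = t ^+ 2 / P%:R * z ^+ 2 by rewrite t3 -yz; field; rewrite !gt_eqF ?powR_gt0.
have e2 : t ^+ 2 / P%:R <= 2 * t.
  rewrite ler_pdivrMr //.
  have -> : 2 * t * P%:R = t * (2 * P%:R) by ring.
  by rewrite expr2; apply: ler_wpM2l => //; apply: powR_ge0.
have e3 : Q * (P%:R / y ^+ 2) <= 2 * Q `^ (1 / 2 + eps).
  rewrite e1; apply: le_trans (_ : 2 * t * Q `^ e' <= _).
    by rewrite ler_pM ?divr_ge0 ?exprn_ge0 ?powR_ge0 // ?ler0n.
  rewrite -mulrA ler_pM2l // -powRD; last by rewrite (gt_eqF Q0r) implybT.
  by rewrite ler_powR //; move: e'e; clear; lra.
have h : (size s)%:R <= C1 * Q `^ (1 / 2 + eps).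
  rewrite -(ler_pM2l c0); apply: le_trans main _; rewrite [leRHS]mulrA [c * C1]mulrC C1E.
  have -> : 2 * (k4 * kk) * Q `^ (1 / 2 + eps) = k4 * kk * (2 * Q `^ (1 / 2 + eps)) by ring.
  by apply: ler_wpM2l => //; rewrite mulr_ge0 // ltW.
apply: le_trans h _; apply: le_trans (_ : (8 * C0 ^+ 6 + C1) * Q `^ (1 / 2 + eps) <= _).
  by rewrite ler_wpM2r ?powR_ge0 // lerDr mulr_ge0 // exprn_ge0.
by apply: ler_peMr => //; rewrite mulr_ge0 ?powR_ge0 // addr_ge0 ?mulr_ge0 ?exprn_ge0 // ltW.
Qed.

Local Open Scope classical_set_scope.
Local Open Scope ring_scope.

(** * Reduction of positive definite quadratic forms *)

Notation mxz R := (map_mx (intr : int -> R)).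

Definition qform (R : realType) n (G : 'M[R]_n) (x : 'rV[R]_n) : R := (x *m G *m x^T) 0 0.

(** Gram-Schmidt data of the basis formed by the rows of U: b holds the squared lengths of the
    orthogonalized vectors and L the projection coefficients. The conditions are size reduction and
    a Lovász-type inequality. *)
Definition reduced_form (R : realType) n (G : 'M[R]_n) (U : 'M[int]_n)
    (L : 'M[R]_n) (b : 'rV[R]_n) :=
  [/\ U \in unitmx, mxz R U *m G *m (mxz R U)^T = L *m diag_mx b *m L^T & forall i, 0 < b 0 i] /\
  [/\ (forall i j : 'I_n, (i < j)%N -> L i j = 0), (forall i, L i i = 1),
      (forall i j : 'I_n, (j < i)%N -> `|L i j| <= 1 / 2)
    & (forall i j : 'I_n, i = j.+1 :> nat -> b 0 j <= 2 * b 0 i)].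

Lemma qform_sum (R : realType) n (L : 'M[R]_n) (b : 'rV[R]_n) (c : 'rV[R]_n) :
  qform (L *m diag_mx b *m L^T) c = \sum_i b 0 i * ((c *m L) 0 i) ^+ 2.
Proof.
rewrite /qform !mulmxA -mulmxA -trmx_mul mxE; apply: eq_bigr => i _.
by rewrite mul_mx_diag !mxE; ring.
Qed.

Lemma qform_conj (R : realType) n (G W : 'M[R]_n) (c : 'rV[R]_n) :
  qform (W *m G *m W^T) c = qform G (c *m W).
Proof. by rewrite /qform trmx_mul !mulmxA. Qed.

Lemma near_int (R : realType) (x : R) : exists t : int, `|x + t%:~R| <= 1 / 2.
Proof.
exists (- Num.floor (x + 1 / 2)); rewrite mulrNz.
have := floor_le_tmp (x + 1 / 2); have := floorD1_gt (x + 1/2).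
rewrite intrD; move: (_%:~R) => f; rewrite ler_norml; lra.
Qed.

(** Completing the square leaves the Schur complement H. A nonzero y lifts to a vector whose first
    coordinate, after projection, is at most 1/2; near minimality of a = [G 0 0] then reads 3/4 a <=
    a/4 + H(y), so H(y) >= a/2. This gives both the hypothesis for H and the inequality b_0 <= 2
    b_1. *)
Lemma reduce_step (R : realType) n (G : 'M[R]_(1 + n)) : G^T = G -> 0 < G 0 0 ->
  (forall x : 'rV[int]_(1 + n), x != 0 -> 3 / 4 * G 0 0 <= qform G (mxz R x)) ->
  (forall H : 'M[R]_n, H^T = H ->
     (exists2 c, 0 < c & forall x : 'rV[int]_n, x != 0 -> c <= qform H (mxz R x)) ->
     exists U L b, reduced_form H U L b) ->
  exists U L b, [/\ reduced_form G U L b, row 0 U = delta_mx 0 0 & b 0 0 = G 0 0].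
Proof.
move=> Gs; set a := G 0 0 => a0 Gmin IH.
pose l : 'rV[R]_n := a^-1 *: ursubmx G.
pose H := drsubmx G - a *: (l^T *m l).
pose T : 'M[R]_(1 + n) := block_mx 1%:M 0 l^T 1%:M.
have dl : dlsubmx G = (ursubmx G)^T by rewrite trmx_ursub Gs.
have an0 : a != 0 by rewrite gt_eqF.
have GE : G = T *m block_mx a%:M 0 0 H *m T^T.
  rewrite /T tr_block_mx !mulmx_block !mul1mx !mul0mx !mulmx0 !addr0 !add0r ?mulmx1.
  rewrite -[LHS]submxK !trmx1 !trmx0 trmxK !mulmx1 !mulmx0 ?addr0.
  have ul : ulsubmx G = a%:M.
    apply/matrixP => i j; rewrite !ord1 !mxE eqxx mulr1n /a.
    by congr (G _ _); apply: val_inj.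
  have ur : ursubmx G = a%:M *m l by rewrite mul_scalar_mx /l scalerA divff // scale1r.
  congr block_mx => //.
    by rewrite dl ur trmx_mul tr_scalar_mx.
  by rewrite mul_mx_scalar /H -scalemxAl [X in _ = X]addrC subrK.
have Hs : H^T = H.
  rewrite /H raddfB /= linearZ /= trmx_mul trmxK; congr (_ - _).
  by rewrite trmx_drsub Gs.
pose D := block_mx a%:M 0 0 H.
have split_q (t : R) (y : 'rV[R]_n) :
    qform G (row_mx t%:M y) = a * (t + (y *m l^T) 0 0) ^+ 2 + qform H y.
  rewrite GE qform_conj /T mul_row_block mulmx1 mulmx0 add0r mulmx1 /qform.
  rewrite mul_row_block !mulmx0 addr0 add0r tr_row_mx mul_row_col mxE; congr (_ + _).
  rewrite mul_mx_scalar -scalemxAl !mxE big_ord1 !mxE eqxx mulr1n; ring.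
have Hc : exists2 c, 0 < c & forall x : 'rV[int]_n, x != 0 -> c <= qform H (mxz R x).
  exists (a / 2); first by rewrite divr_gt0.
  move=> y y0; have [t tP] := near_int ((mxz R y *m l^T) 0 0).
  have x0 : row_mx t%:M y != 0 by apply: contraNneq y0 => /eqP; rewrite row_mx_eq0 => /andP[_].
  have := Gmin _ x0; rewrite map_row_mx map_scalar_mx split_q.
  have : (t%:~R + (mxz R y *m l^T) 0 0) ^+ 2 <= 1 / 4.
    rewrite addrC; move: tP; rewrite ler_norml; move: (_ + _) => u; nra.
  move: (_ ^+ 2) (qform _ _) => u v; nra.
have [U' [L' [b' [[U'u U'E b'p] [L'0 L'1 L'2 b'2]]]]] := IH H Hs Hc.
have /choice[t tP] : forall j, exists t : int, `|(mxz R U' *m l^T) j 0 + t%:~R| <= 1 / 2.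
  by move=> j; apply: near_int.
pose tc : 'cV[int]_n := \col_j t j; pose m := mxz R U' *m l^T + mxz R tc.
exists (block_mx 1%:M 0 tc U'), (block_mx 1%:M 0 m L'), (row_mx a%:M b'); split; first split; first split.
- by rewrite unitmxE det_lblock det1 mul1r -unitmxE.
- rewrite diag_mx_row (_ : diag_mx a%:M = a%:M); last first.
    by apply/matrixP => i j; rewrite !ord1 !mxE eqxx !mulr1n.
  rewrite GE !mulmxA -mulmxA -trmx_mul map_block_mx map_mx1 map_mx0 /T mulmx_block.
  rewrite !mul1mx !mul0mx !mulmx0 !mulmx1 !addr0 !add0r [mxz R tc + _]addrC -/m.
  rewrite !tr_block_mx !mulmx_block !trmx1 !trmx0 !mulmx1 !mul1mx !mul0mx !mulmx0 !addr0 !add0r ?mulmx1 ?mulmx0 ?addr0.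
  by rewrite U'E !mul0mx.
- by move=> i; case: (split_ordP i) => k ->; rewrite ?row_mxEl ?row_mxEr // !ord1 mxE eqxx mulr1n.
- split.
  + move=> i j; case: (split_ordP i) => i' ->; case: (split_ordP j) => j' ->;
      rewrite ?block_mxEul ?block_mxEur ?block_mxEdl ?block_mxEdr /= ?mxE ?ord1 //=.
    by rewrite ltn_add2l; apply: L'0.
  + by move=> i; case: (split_ordP i) => i' ->; rewrite ?block_mxEul ?block_mxEdr // mxE eqxx.
  + move=> i j; case: (split_ordP i) => i' ->; case: (split_ordP j) => j' ->;
      rewrite ?block_mxEul ?block_mxEur ?block_mxEdl ?block_mxEdr /= ?ord1 //=.
    * by move=> _; have := tP i'; rewrite /m !mxE.
    * by rewrite ltn_add2l; apply: L'2.
  + move=> i j; case: (split_ordP i) => i' ->; case: (split_ordP j) => j' ->;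
      rewrite ?row_mxEl ?row_mxEr /= ?ord1 //=.
    * rewrite mxE eqxx mulr1n => -[i0].
      have E0 : (mxz R U' *m H *m (mxz R U')^T) i' i' = qform H (mxz R (row i' U')).
        rewrite /qform map_row -row_mul [LHS]mxE [RHS]mxE; apply: eq_bigr => k _.
        by rewrite !mxE.
      move: E0; rewrite U'E [LHS]mxE (bigD1 i') //= [X in _ + X]big1 ?addr0 => [|k ki]; last first.
        rewrite mul_mx_diag !mxE L'0 ?mul0r //.
        by rewrite ltn_neqAle eq_sym ki /=; have := i0; lia.
      rewrite mul_mx_diag !mxE L'1 mul1r mulr1 => ->.
      have r0 : row i' U' != 0.
        apply/eqP => r0; have := congr1 (row i') (mulmxV U'u).
        rewrite row_mul r0 mul0mx => /rowP/(_ i'); rewrite !mxE eqxx => /eqP.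
        by rewrite eq_sym oner_eq0.
      have [t0 t0P] := near_int ((mxz R (row i' U') *m l^T) 0 0).
      have x0 : row_mx t0%:M (row i' U') != 0.
        by apply: contraNneq r0 => /eqP; rewrite row_mx_eq0 => /andP[_].
      have := Gmin _ x0; rewrite map_row_mx map_scalar_mx split_q.
      have : (t0%:~R + (mxz R (row i' U') *m l^T) 0 0) ^+ 2 <= 1 / 4.
        rewrite addrC; move: t0P; rewrite ler_norml; move: (_ + _) => u; nra.
      move: (_ ^+ 2) (qform _ _) => u v; nra.
    * by move=> e; apply: b'2; move: e; rewrite !add1n => -[].
- have z : 0 = lshift n 0 :> 'I_(1 + n) by apply: val_inj.
  apply/rowP => j; rewrite z [LHS]mxE; case: (split_ordP j) => j' ->.
    transitivity ((1%:M : 'M[int]_1) 0 j'); first exact: block_mxEul.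
    by rewrite !mxE !ord1 !eqxx.
  transitivity ((0 : 'M[int]_(1, n)) 0 j'); first exact: block_mxEur.
  rewrite [LHS]mxE [RHS]mxE eqxx /=; case: (@eqP _ (rshift 1 j') (lshift n 0)) => [/(congr1 val)//|_].
  by [].
- have z : 0 = lshift n 0 :> 'I_(1 + n) by apply: val_inj.
  rewrite z; transitivity ((a%:M : 'M[R]_1) 0 0); first exact: row_mxEl.
  by rewrite mxE eqxx mulr1n.
Qed.

(** A positive lower bound on nonzero integer vectors is a property that passes to the Schur
    complement. The infimum need not be attained for the argument: a vector within a factor 4/3 of
    it does, which is the origin of the 3/4 in [reduce_step]. *)
Theorem exists_reduced_form (R : realType) n (G : 'M[R]_n) : G^T = G ->
  (exists2 c, 0 < c & forall x : 'rV[int]_n, x != 0 -> c <= qform G (mxz R x)) ->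
  exists U L b, reduced_form G U L b.
Proof.
elim: n G => [|n IH] G Gs [c c0 Gc].
  exists 1%:M, 1%:M, 0; split; split => //; rewrite ?unitmx1 //; try by case.
  by apply/matrixP => -[].
pose E := [set r | exists2 x : 'rV[int]_n.+1, x != 0 & r = qform G (mxz R x)].
have E0 : E !=set0.
  exists (qform G (mxz R (delta_mx 0 0))); exists (delta_mx 0 0) => //.
  by apply/eqP => /matrixP/(_ 0 0); rewrite !mxE !eqxx.
have Elb : lbound E c by move=> r [x x0 ->]; apply: Gc.
have hE : has_inf E by split => //; exists c.
have m0 : 0 < inf E by apply: lt_le_trans c0 _; apply: lb_le_inf.
have [r [x x0 rE] rm] := inf_adherent (divr_gt0 m0 (ltr0n R 3)) hE.
(* The near-minimal x is an integer e times the first row of a unimodular W. This row is at least as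
   short and can serve as first basis vector. *)
have [L0 L0u [W Wu [d _ xE]]] := int_Smith_normal_form x.
have x2 : x = (L0 0 0 * d`_0) *: row 0 W.
  rewrite xE; apply/matrixP => i j; rewrite !ord1 !mxE (bigD1 ord0) //= big1 ?addr0; last first.
    by move=> k k0; rewrite !mxE big_ord1 !mxE /= (_ : (0 == k :> nat) = false) ?mulr0 ?mul0r //;
      apply/negbTE; move: k0; rewrite eq_sym.
  by rewrite !mxE big_ord1 !mxE /= mulr1n.
set e := L0 0 0 * d`_0 in x2.
have e0 : e != 0 by apply: contraNneq x0 => e0; rewrite x2 e0 scale0r.
pose G1 := mxz R W *m G *m (mxz R W)^T.
have G1E (y : 'rV[int]_n.+1) : qform G1 (mxz R y) = qform G (mxz R (y *m W)).
  by rewrite qform_conj map_mxM.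
have mE (y : 'rV[int]_n.+1) : y != 0 -> inf E <= qform G (mxz R y).
  by move=> y0; apply: inf_lbound; [exists c|exists y].
have yW (y : 'rV[int]_n.+1) : y != 0 -> y *m W != 0.
  by apply: contraNneq => yW0; rewrite -(mulmxK Wu y) yW0 mul0mx.
have G100 : G1 0 0 = qform G1 (mxz R (delta_mx 0 0)).
  by rewrite /qform map_delta_mx trmx_delta -rowE -colE !mxE.
have q1 : qform G (mxz R x) = (e%:~R) ^+ 2 * G1 0 0.
  rewrite G100 G1E -rowE x2 map_mxZ /qform linearZ /= -!scalemxAl -scalemxAr !mxE; ring.
have d0 : delta_mx 0 0 != 0 :> 'rV[int]_n.+1.
  by apply/eqP => /matrixP/(_ 0 0); rewrite !mxE !eqxx.
have G1p : inf E <= G1 0 0 by rewrite G100 G1E mE ?yW.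
have e1 : 1 <= (e%:~R : R) ^+ 2.
  by rewrite -rmorphXn /= ler1z; move: e0; clear; nia.
have G1u : 3 / 4 * G1 0 0 <= inf E.
  have : G1 0 0 <= qform G (mxz R x) by rewrite q1 ler_peMl // (le_trans _ G1p) // ltW.
  by rewrite -rE; move: rm; move: (inf E) (G1 0 0) => u v; lra.
have [||y y0|H Hs Hc|U [L [b [rU _ _]]]] := @reduce_step R n G1.
- by rewrite /G1 !trmx_mul trmxK Gs mulmxA.
- exact: lt_le_trans m0 G1p.
- by rewrite G1E; apply: le_trans G1u _; apply: mE; apply: yW.
- exact: IH.
exists (U *m W), L, b; case: rU => -[Uu UE bp] rest; split => //; split => //.
  by rewrite unitmx_mul Uu Wu.
by rewrite map_mxM trmx_mul -UE /G1 !mulmxA.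
Qed.

(** * Orders in number fields *)

Notation normc := Normc.normc.

Lemma normc_ge0 (R : rcfType) (x : R[i]) : 0 <= normc x.
Proof. by case: x => a b; apply: sqrtr_ge0. Qed.

Lemma normcJ2 (R : rcfType) (x : R[i]) : normc x ^+ 2 = (complex.Re x) ^+ 2 + (complex.Im x) ^+ 2.
Proof. by case: x => a b /=; rewrite sqr_sqrtr // addr_ge0 ?sqr_ge0. Qed.

Lemma normc_int (R : rcfType) (k : int) : normc (k%:~R : R[i]) = `|k%:~R|.
Proof.
have -> : (k%:~R : R[i]) = ((k%:~R : R)%:C)%C by rewrite rmorph_int.
by rewrite /= expr0n /= addr0 sqrtr_sqr.
Qed.

Lemma normc_eq0 (R : rcfType) (x : R[i]) : (normc x == 0) = (x == 0).
Proof.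
apply/eqP/eqP => [/Normc.eq0_normc //|->]; exact: Normc.normc0.
Qed.

Lemma normc_prod (R : rcfType) (I : finType) (F : I -> R[i]) : normc (\prod_i F i) = \prod_i normc (F i).
Proof.
apply: (big_morph _ (@Normc.normcM R)).
by rewrite -[1]/(1%:~R : R[i]) normc_int normr1.
Qed.

Section ZSpan.
Variables (K : fieldExtType rat) (n : nat) (w : 'I_n -> K).

Definition elt (c : 'rV[int]_n) : K := \sum_l w l *~ c 0 l.
Definition zspan : set K := [set x | exists c, x = elt c].

Lemma eltD c d : elt (c + d) = elt c + elt d.
Proof. by rewrite /elt -big_split; apply: eq_bigr => i _; rewrite mxE mulrzDr. Qed.
Lemma eltN c : elt (- c) = - elt c.
Proof. by rewrite /elt -sumrN; apply: eq_bigr => i _; rewrite mxE mulrNz. Qed.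
Lemma elt0 : elt 0 = 0.
Proof. by rewrite /elt big1 // => i _; rewrite mxE mulr0z. Qed.
Lemma eltB c d : elt (c - d) = elt c - elt d. Proof. by rewrite eltD eltN. Qed.
Lemma eltZ k c : elt (k *: c) = elt c *~ k.
Proof.
rewrite /elt; elim/big_rec2: _ => [|i x y _ ->]; rewrite ?mul0rz // mulrzDl mxE mulrC mulrzA //.
Qed.
Lemma elt_sum (I : Type) (r : seq I) (F : I -> 'rV[int]_n) : elt (\sum_(i <- r) F i) = \sum_(i <- r) elt (F i).
Proof. exact: (big_morph _ eltD elt0). Qed.
Lemma elt_delta j : elt (delta_mx 0 j) = w j.
Proof.
rewrite /elt (bigD1 j) //= big1 ?addr0; first by rewrite mxE !eqxx.
by move=> i /negPf ij; rewrite mxE ij andbF mulr0z.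
Qed.

Lemma zspan0 : zspan 0. Proof. by exists 0; rewrite elt0. Qed.
Lemma zspanD x y : zspan x -> zspan y -> zspan (x + y).
Proof. by move=> [c ->] [d ->]; exists (c + d); rewrite eltD. Qed.
Lemma zspanN x : zspan x -> zspan (- x).
Proof. by move=> [c ->]; exists (- c); rewrite eltN. Qed.
Lemma zspanB x y : zspan x -> zspan y -> zspan (x - y).
Proof. by move=> hx hy; apply: zspanD => //; apply: zspanN. Qed.
Lemma zspanMz x k : zspan x -> zspan (x *~ k).
Proof. by move=> [c ->]; exists (k *: c); rewrite eltZ. Qed.
Lemma zspanMn x k : zspan x -> zspan (x *+ k).
Proof. by move=> h; rewrite pmulrn; apply: zspanMz. Qed.
Lemma zspan_sum (I : Type) (r : seq I) (P : pred I) (F : I -> K) : (forall i, P i -> zspan (F i)) ->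
  zspan (\sum_(i <- r | P i) F i).
Proof. by move=> h; elim/big_ind: _ => //; [exact: zspan0|exact: zspanD]. Qed.
Lemma zspan_w j : zspan (w j). Proof. by exists (delta_mx 0 j); rewrite elt_delta. Qed.
End ZSpan.

(* An order in a number field, through a Z-basis [w] and as many embeddings [s] as its rank; the field
   it generates may be smaller than K. *)
Record is_order (R : realType) (K : fieldExtType rat) (n : nat) (w : 'I_n -> K)
    (s : 'I_n -> {rmorphism K -> R[i]}) : Prop := IsOrder {
  order_unit : (\matrix_(j, i) s i (w j)) \in unitmx;
  order_mul : forall j k, zspan w (w j * w k);
  order_one : zspan w 1 }.

Section Order.
Variables (R : realType) (K : fieldExtType rat) (n : nat) (w : 'I_n -> K).
Variables (s : 'I_n -> {rmorphism K -> R[i]}) (ow : is_order w s).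
Local Notation V := (\matrix_(j, i) s i (w j)).
Local Notation O := (zspan w).
Local Notation mxc := (map_mx (intr : int -> R[i])).

Lemma s_elt c i : s i (elt w c) = (mxc c *m V) 0 i.
Proof.
rewrite /elt raddf_sum !mxE; apply: eq_bigr => l _.
by rewrite !mxE raddfMz /= mulrzl.
Qed.

Lemma elt_inj : injective (elt w).
Proof.
move=> c d E; apply/eqP; rewrite -subr_eq0; set e := c - d.
have e0 : elt w e = 0 by rewrite /e eltB E subrr.
have : mxc e *m V = 0 by apply/matrixP => a i; rewrite ord1 -s_elt e0 rmorph0 mxE.
move/(congr1 (fun M => M *m invmx V)); rewrite mulmxK ?(order_unit ow) // mul0mx => /matrixP h.
apply/eqP/matrixP => a i; have /eqP := h a i; rewrite !mxE intr_eq0 => /eqP //.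
Qed.

Lemma zspanM x y : O x -> O y -> O (x * y).
Proof.
move=> [c ->] [d ->]; rewrite /elt mulr_suml; apply: zspan_sum => i _.
rewrite mulr_sumr; apply: zspan_sum => j _.
by rewrite mulrzAl mulrzAr; do 2 apply: zspanMz; apply: order_mul ow _ _.
Qed.
Lemma zspan1 : O 1. Proof. exact: order_one ow. Qed.
Lemma zspan_nat k : O k%:R. Proof. exact/zspanMn/zspan1. Qed.
Lemma zspan_int k : O k%:~R. Proof. exact/zspanMz/zspan1. Qed.
Lemma zspanX x k : O x -> O (x ^+ k).
Proof. by move=> h; elim: k => [|k IH]; [exact: zspan1|rewrite exprS; apply: zspanM]. Qed.

Definition ocoord (x : K) : 'rV[int]_n := xget 0 [set c | x = elt w c].
Lemma ocoordK x : O x -> elt w (ocoord x) = x.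
Proof. by case=> c xc; rewrite /ocoord; case: xgetP => [d _ <- //|/(_ c)/=]. Qed.
Lemma eltK c : ocoord (elt w c) = c.
Proof. by apply: elt_inj; rewrite ocoordK //; exists c. Qed.

Definition zm (x : K) : 'M[int]_n := \matrix_j ocoord (w j * x).

Lemma zmP x c : O x -> elt w (c *m zm x) = elt w c * x.
Proof.
move=> Ox; rewrite mulmx_sum_row elt_sum /elt mulr_suml; apply: eq_bigr => j _.
rewrite -[in LHS]/(elt w _) eltZ /zm rowK ocoordK ?mulrzAl //.
by apply: zspanM => //; apply: zspan_w.
Qed.

Lemma zm_uniq x M : O x -> (forall c, elt w (c *m M) = elt w c * x) -> zm x = M.
Proof.
move=> Ox h; apply/row_matrixP => j; apply: elt_inj.
by rewrite !rowE zmP // h.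
Qed.

Lemma zmD x y : O x -> O y -> zm (x + y) = zm x + zm y.
Proof.
move=> hx hy; apply: zm_uniq => [|c]; first exact: zspanD.
by rewrite mulmxDr eltD !zmP // mulrDr.
Qed.
Lemma zmM x y : O x -> O y -> zm (x * y) = zm x *m zm y.
Proof.
move=> hx hy; apply: zm_uniq => [|c]; first exact: zspanM.
by rewrite mulmxA !zmP // mulrA.
Qed.
Lemma zm_int k : zm k%:~R = k%:M.
Proof.
apply: zm_uniq => [|c]; first exact: zspan_int.
by rewrite mul_mx_scalar eltZ mulrzr.
Qed.
Lemma zmMz x k : O x -> zm (x *~ k) = k *: zm x.
Proof.
move=> hx; apply: zm_uniq => [|c]; first exact: zspanMz.
by rewrite -scalemxAr eltZ zmP // mulrzAr.
Qed.
Lemma zm_comm x y : O x -> O y -> zm x *m zm y = zm y *m zm x.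
Proof. by move=> hx hy; rewrite -!zmM // mulrC. Qed.

(** The columns of V are common eigenvectors of all multiplication matrices; norm, trace and
    characteristic polynomial in terms of the conjugates follow from this. *)
Lemma zm_diag x : O x -> mxc (zm x) *m V = V *m diag_mx (\row_i s i x).
Proof.
move=> Ox; apply/matrixP => j i; rewrite mul_mx_diag !mxE -rmorphM.
have <- : elt w (row j (zm x)) = w j * x by rewrite rowE zmP // elt_delta.
by rewrite s_elt mxE; apply: eq_bigr => l _; rewrite !mxE.
Qed.

Definition onorm (x : K) : int := \det (zm x).

Lemma onormE x : O x -> (onorm x)%:~R = \prod_i s i x.
Proof.
move=> Ox; have := congr1 determinant (zm_diag Ox).
rewrite !det_mulmx det_diag det_map_mx mulrC => /mulrI ->; last by rewrite -unitmxE (order_unit ow).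
by apply: eq_bigr => i _; rewrite mxE.
Qed.

Lemma onormM x y : O x -> O y -> onorm (x * y) = onorm x * onorm y.
Proof. by move=> hx hy; rewrite /onorm zmM // det_mulmx. Qed.
Lemma onorm_int k : onorm k%:~R = k ^+ n.
Proof. by rewrite /onorm zm_int det_scalar. Qed.
Lemma onorm1 : onorm 1 = 1.
Proof. by rewrite -[1]/(1%:~R) onorm_int expr1n. Qed.
Lemma onorm_neq0 x : O x -> x != 0 -> onorm x != 0.
Proof.
move=> Ox x0; rewrite -(intr_eq0 R[i]) onormE //; apply/prodf_neq0 => i _.
by rewrite fmorph_eq0.
Qed.

Lemma onorm_ge1 x : O x -> x != 0 -> 1 <= \prod_i normc (s i x).
Proof.
move=> Ox x0; rewrite -normc_prod -onormE // normc_int -intr_norm ler1z.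
by rewrite -gtz0_ge1 normr_gt0 onorm_neq0.
Qed.

Lemma char_poly_zm x : O x -> map_poly (intr : int -> R[i]) (char_poly (zm x)) = \prod_i ('X - (s i x)%:P).
Proof.
move=> Ox; rewrite map_char_poly.
have Vu := order_unit ow.
rewrite (@char_poly_conj_diag _ _ _ (invmx V) (\row_i s i x)) ?unitmx_inv //.
  by apply: eq_bigr => i _; rewrite mxE.
apply: (can_inj (mulKmx Vu)); rewrite mulmxA mulmxV // mul1mx mulmxA -zm_diag //.
by rewrite -mulmxA mulmxV // mulmx1.
Qed.

(* Multiplication by x has the adjugate as an integral quasi-inverse. *)
Lemma onorm_dvd x : O x -> exists2 y, O y & x * y = (onorm x)%:~R.
Proof.
move=> Ox; exists (elt w (ocoord 1 *m \adj (zm x))); first by eexists.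
rewrite mulrC -zmP // -mulmxA mul_adj_mx mul_mx_scalar eltZ ocoordK; last exact: zspan1.
by [].
Qed.
End Order.

(** * Weighted sums of squares of conjugates *)

Section Gram.
Variables (R : realType) (K : fieldExtType rat) (n m : nat).
Variables (s : 'I_n -> {rmorphism K -> R[i]}).

Definition gram (t : 'I_n -> R) (u : 'I_m -> K) : 'M[R]_m :=
  \matrix_(j, k) \sum_i t i * complex.Re (s i (u j) * ((s i (u k))^*)%C).

Lemma gram_sym t u : (gram t u)^T = gram t u.
Proof.
apply/matrixP => j k; rewrite !mxE; apply: eq_bigr => i _; congr (_ * _).
by move: (s i (u k)) (s i (u j)) => [a b] [c d] /=; ring.
Qed.

Lemma gram_qform t u (c : 'rV[int]_m) :
  qform (gram t u) (mxz R c) = \sum_i t i * normc (s i (elt u c)) ^+ 2.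
Proof.
have E i : normc (s i (elt u c)) ^+ 2 =
    \sum_j \sum_k (c 0 j)%:~R * (c 0 k)%:~R * complex.Re (s i (u j) * ((s i (u k))^*)%C).
  have zE x k : s i (x *~ k) = ((k%:~R : R)%:C)%C * s i x by rewrite raddfMz /= -mulrzl rmorph_int.
  rewrite normcJ2 /elt raddf_sum /= !raddf_sum /= !expr2 !big_distrlr -big_split /=.
  apply: eq_bigr => j _; rewrite -big_split /=; apply: eq_bigr => k _.
  rewrite !zE; move: (s i (u k)) (s i (u j)) => [a b] [a' b'] /=.
  by move: ((c 0 j)%:~R : R) ((c 0 k)%:~R : R) => x y; ring.
rewrite /qform !mxE; under eq_bigr do rewrite !mxE mulr_suml.
rewrite exchange_big /=.
transitivity (\sum_i \sum_j \sum_k t i * ((c 0 j)%:~R * (c 0 k)%:~R * complex.Re (s i (u j) * ((s i (u k))^*)%C))); last first.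
  by apply: eq_bigr => i _; rewrite E mulr_sumr; apply: eq_bigr => j _; rewrite mulr_sumr.
rewrite [RHS]exchange_big /=; apply: eq_bigr => j _.
rewrite [RHS]exchange_big /=; apply: eq_bigr => k _.
rewrite !mxE mulr_sumr mulr_suml; apply: eq_bigr => i _; ring.
Qed.
End Gram.

(** * Ideals whose square is principal *)

Section Idempotents.
Variables (R : realType) (K : fieldExtType rat) (n : nat) (w : 'I_n -> K).
Variables (s : 'I_n -> {rmorphism K -> R[i]}) (ow : is_order w s).
Local Notation O := (zspan w).
Variables (M : nat) (M0 : (0 < M)%N).

Definition omul : set K := [set x | exists2 z, O z & x = z *+ M].

Lemma omul0 : omul 0. Proof. by exists 0; [exact: zspan0|rewrite mul0rn]. Qed.
Lemma omulD x y : omul x -> omul y -> omul (x + y).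
Proof. by move=> [a Oa ->] [b Ob ->]; exists (a + b); [exact: zspanD|rewrite mulrnDl]. Qed.
Lemma omulN x : omul x -> omul (- x).
Proof. by move=> [a Oa ->]; exists (- a); [exact: zspanN|rewrite mulNrn]. Qed.
Lemma omulMl a x : O a -> omul x -> omul (a * x).
Proof. by move=> Oa [b Ob ->]; exists (a * b); [exact: (zspanM ow)|rewrite mulrnAr]. Qed.
Lemma omul_sum (I : Type) (r : seq I) (P : pred I) (F : I -> K) : (forall i, P i -> omul (F i)) ->
  omul (\sum_(i <- r | P i) F i).
Proof. by move=> h; elim/big_ind: _ => //; [exact: omul0|exact: omulD]. Qed.

(** Among M^n + 1 powers of e two agree modulo M, so the powers are periodic of some period d from
    an exponent i0 on. The exponent d (i0 + 1) is a multiple of d and at least i0. *)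
Lemma idempotent_power e : O e -> exists2 m, (0 < m)%N & omul (e ^+ m * e ^+ m - e ^+ m).
Proof.
move=> Oe; pose f (k : 'I_(M ^ n).+1) : {ffun 'I_n -> 'I_M} :=
  [ffun j => Ordinal (ltn_pmod `|modz (ocoord w (e ^+ k) 0 j) M%:Z| M0)].
have : ~~ injectiveb f.
  apply/negP => /injectiveP /leq_card; rewrite card_ffun !card_ord; by rewrite ltnn.
move=> /injectivePn[i0 [j0 ij fE]].
wlog lt : i0 j0 ij fE / (i0 < j0)%N.
  move=> W; have [lt|gt|eq] := ltngtP i0 j0; first exact: (W i0 j0).
    by apply: (W j0 i0) => //; rewrite eq_sym.
  by case/eqP: ij; apply: val_inj.
have OeX k : O (e ^+ k) by apply: (zspanX ow).
have eij : omul (e ^+ j0 - e ^+ i0).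
  exists (elt w (\row_j divz (ocoord w (e ^+ j0) 0 j - ocoord w (e ^+ i0) 0 j) M%:Z)); first by eexists.
  rewrite -[LHS](ocoordK (zspanB (OeX j0) (OeX i0))).
  rewrite pmulrn -eltZ; congr elt.
  have -> : ocoord w (e ^+ j0 - e ^+ i0) = ocoord w (e ^+ j0) - ocoord w (e ^+ i0).
    by apply: (elt_inj ow); rewrite eltB !ocoordK //; apply: zspanB.
  apply/matrixP => a j; rewrite !mxE ord1 mulrC divzK //.
  have /(congr1 (fun h : {ffun 'I_n -> 'I_M} => val (h j))) := fE; rewrite !ffunE /=.
  have Mz : M%:Z != 0 by rewrite eqz_nat -lt0n.
  have md (x : int) : (`|modz x M%:Z| %% M = `|modz x M%:Z|)%N.
    by rewrite modn_small // -ltz_nat gez0_abs ?modz_ge0 // ltz_pmod.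
  rewrite !md => h; rewrite -eqz_mod_dvd; apply/eqP.
  by rewrite -(gez0_abs (modz_ge0 (ocoord w (e ^+ j0) 0 j) Mz)) -h gez0_abs ?modz_ge0.
set d := (j0 - i0)%N; have d0 : (0 < d)%N by rewrite subn_gt0.
have step k : (i0 <= k)%N -> omul (e ^+ (k + d) - e ^+ k).
  move=> ik; have -> : e ^+ (k + d) - e ^+ k = e ^+ (k - i0) * (e ^+ j0 - e ^+ i0).
    rewrite mulrBr -!exprD; congr (e ^+ _ - e ^+ _); rewrite /d; lia.
  exact: omulMl.
have steps k q : (i0 <= k)%N -> omul (e ^+ (k + d * q) - e ^+ k).
  move=> ik; elim: q => [|q IH]; first by rewrite muln0 addn0 subrr; apply: omul0.
  have -> : e ^+ (k + d * q.+1) - e ^+ k = (e ^+ (k + d * q + d) - e ^+ (k + d * q)) + (e ^+ (k + d * q) - e ^+ k).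
    rewrite addrA subrK; congr (e ^+ _ - _); lia.
  by apply: omulD => //; apply: step; apply: leq_trans ik _; apply: leq_addr.
exists (d * i0.+1)%N; first by rewrite muln_gt0 d0.
rewrite -exprD; apply: steps; apply: leq_trans (leqnSn i0) _; exact: leq_pmull.
Qed.

Variables (T : set K) (beta : K) (b0 : beta != 0).
Hypotheses (T0 : T 0) (TD : forall x y, T x -> T y -> T (x + y)) (TM : forall a x, O a -> T x -> T (a * x))
  (TT : forall x y, T x -> T y -> O (x * y / beta)).

(** In O/MO each e = x' y' / beta has an idempotent power f = E e. Its part h = (1 - g) f orthogonal
    to the idempotent g already built is added to g, and x, y become g x + h x' and g y + h E y',
    whose product over beta is g + h. The complement of the final idempotent kills a power of each
    summand, hence of the sum. *)
Lemma idempotent_combination (l : seq (K * K)) : (forall p, p \in l -> T p.1 /\ T p.2) ->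
  exists g x y r, [/\ O g, T x, T y, omul (g * g - g) &
    omul (x * y / beta - g) /\ omul ((1 - g) * (\sum_(p <- l) p.1 * p.2 / beta) ^+ r)].
Proof.
have O1 := zspan1 ow.
elim: l => [|[x' y'] l IH] lT.
  exists 0, 0, 0, 1%N; split => //; first exact: zspan0.
    by rewrite mulr0 subr0; apply: omul0.
  by rewrite !mul0r subrr big_nil mulr0; split; apply: omul0.
have [|g [x [y [r [Og Tx Ty gg [xyg gS]]]]]] := IH; first by move=> p pl; apply: lT; rewrite inE pl orbT.
have [/= Tx' Ty'] : T (x', y').1 /\ T (x', y').2 by apply: lT; rewrite inE eqxx.
set S := \sum_(p <- l) _ in gS.
have OS : O S.
  rewrite /S big_seq; apply: zspan_sum => p pl; have [h1 h2] : T p.1 /\ T p.2 by apply: lT; rewrite inE pl orbT.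
  exact: TT.
set e := x' * y' / beta; have Oe : O e by apply: TT.
have [[//|m] _ ff] := idempotent_power Oe.
set f := e ^+ m.+1 in ff; set E := e ^+ m.
have OE : O E by apply: (zspanX ow). have Of : O f by apply: (zspanX ow).
have fE : f = E * e by rewrite /f exprSr.
have O1g : O (1 - g) by apply: zspanB.
set h := (1 - g) * f; have Oh : O h by apply: (zspanM ow).
have hh : omul (h * h - h).
  have -> : h * h - h = (f * f) * (g * g - g) + (1 - g) * (f * f - f) by rewrite /h; ring.
  by apply: omulD; apply: omulMl => //; apply: (zspanM ow).
have gh : omul (g * h).
  have -> : g * h = (- f) * (g * g - g) by rewrite /h; ring.
  by apply: omulMl => //; apply: zspanN.
have hf : omul (h * f - h).
  have -> : h * f - h = (1 - g) * (f * f - f) by rewrite /h; ring.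
  exact: omulMl.
exists (g + h), (g * x + h * x'), (g * y + (h * E) * y'), (r + m.+1)%N; split.
- exact: zspanD.
- by apply: TD; apply: TM.
- by apply: TD; apply: TM => //; apply: (zspanM ow).
- have -> : (g + h) * (g + h) - (g + h) = (g * g - g) + (h * h - h) + (g * h + g * h) by ring.
  by do 2 apply: omulD => //; apply: omulD.
split.
  have -> : (g * x + h * x') * (g * y + h * E * y') / beta - (g + h) =
     (g * g) * (x * y / beta - g) + (g + 1) * (g * g - g) +
     (E * (x * y' / beta) + x' * y / beta) * (g * h) + f * (h * h - h) + (h * f - h).
    by rewrite fE /e; field.
  have Oxy' : O (x * y' / beta) by apply: TT.
  have Ox'y : O (x' * y / beta) by apply: TT.
  apply: omulD => //; apply: omulD; last exact: omulMl.
  apply: omulD; last by apply: omulMl => //; apply: zspanD => //; apply: (zspanM ow).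
  by apply: omulD; apply: omulMl => //; [apply: (zspanM ow)|apply: zspanD].
rewrite big_cons -/S -/e [e + S]addrC exprDn mulr_sumr; apply: omul_sum => i _.
rewrite -[_ * e ^+ i *+ _]mulrnAl.
have g'S : omul ((1 - (g + h)) * S ^+ r).
  have -> : (1 - (g + h)) * S ^+ r = (1 - f) * ((1 - g) * S ^+ r) by rewrite /h; ring.
  by apply: omulMl => //; apply: zspanB.
have g'f : omul ((1 - (g + h)) * f).
  have -> : (1 - (g + h)) * f = - (h * f - h) by rewrite /h; ring.
  exact: omulN.
have [im|im] := leqP m.+1 i.
  have -> : e ^+ i = f * e ^+ (i - m.+1) by rewrite -exprD subnKC.
  have -> : (1 - (g + h)) * (S ^+ (r + m.+1 - i) *+ 'C(r + m.+1, i) * (f * e ^+ (i - m.+1))) =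
    (S ^+ (r + m.+1 - i) *+ 'C(r + m.+1, i) * e ^+ (i - m.+1)) * ((1 - (g + h)) * f) by ring.
  apply: omulMl => //; apply: (zspanM ow); last exact: (zspanX ow).
  by apply: zspanMn; apply: (zspanX ow).
have -> : (r + m.+1 - i = r + (m.+1 - i))%N by lia.
have -> : (1 - (g + h)) * (S ^+ (r + (m.+1 - i)) *+ 'C(r + m.+1, i) * e ^+ i) =
    (S ^+ (m.+1 - i) *+ 'C(r + m.+1, i) * e ^+ i) * ((1 - (g + h)) * S ^+ r) by rewrite exprD; ring.
apply: omulMl => //; apply: (zspanM ow); last exact: (zspanX ow).
by apply: zspanMn; apply: (zspanX ow).
Qed.

(** If the sum is 1 modulo M, then 1 - g kills a power of a unit, so g = 1 modulo M. Up to M, a sum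
    of products is replaced by one product: T becomes generated by one element at the primes
    dividing M. *)
Theorem unit_product (l : seq (K * K)) : (forall p, p \in l -> T p.1 /\ T p.2) ->
  omul (\sum_(p <- l) p.1 * p.2 / beta - 1) -> exists x y, [/\ T x, T y & omul (x * y / beta - 1)].
Proof.
move=> lT l1; have [g [x [y [r [Og Tx Ty gg [xyg gS]]]]]] := idempotent_combination lT.
exists x, y; split=> //; set S := \sum_(p <- l) _ in l1 gS.
have OS : O S by have [z Oz h] := l1; rewrite -[S](subrK 1) h; apply: zspanD; [exact: zspanMn|exact: (zspan1 ow)].
have OX k : O (S ^+ k) by apply: (zspanX ow).
have Sr : omul (S ^+ r - 1).
  elim: (r) => [|k IH]; first by rewrite subrr; apply: omul0.
  have -> : S ^+ k.+1 - 1 = S ^+ k * (S - 1) + (S ^+ k - 1) by rewrite exprSr; ring.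
  by apply: omulD => //; apply: omulMl.
have -> : x * y / beta - 1 = (x * y / beta - g) + (1 - g) * (S ^+ r - 1) - (1 - g) * S ^+ r by ring.
apply: omulD; last exact: omulN.
by apply: omulD => //; apply: omulMl => //; apply: zspanB => //; apply: (zspan1 ow).
Qed.

End Idempotents.

Lemma onorm_cong1 (R : realType) (K : fieldExtType rat) (n : nat) (w : 'I_n -> K)
  (s : 'I_n -> {rmorphism K -> R[i]}) (ow : is_order w s) (M : nat) (x : K) :
  omul w M (x - 1) -> (onorm w x == 1 %[mod M])%Z.
Proof.
move=> [z Oz xE]; have -> : x = 1 + z *~ M by rewrite -pmulrn -xE addrC subrK.
rewrite /onorm (zmD ow (zspan1 ow) (zspanMz _ Oz)) (zmMz ow _ Oz).
rewrite -[1 : K]/(1%:~R) (zm_int ow) eqz_mod_dvd.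
have [M1|M1] := leqP M 1.
  case: M M1 {xE} => [|[|//]] _; last by rewrite dvd1z.
  by rewrite scale0r addr0 det1 subrr.
have e0 (a : int) : ((a%:~R : 'Z_M) == 0) = (M %| a)%Z.
  case: (intP a) => [|k|k].
  - by rewrite dvdz0 eqxx.
  - by rewrite -pmulrn -[RHS]/(M %| k.+1)%N /dvdn -val_Zp_nat.
  - by rewrite mulrNz oppr_eq0 dvdzE abszN -pmulrn /= /dvdn -val_Zp_nat.
have dm (A : 'M[int]_n) : ((\det A)%:~R : 'Z_M) = \det (map_mx (intr : int -> 'Z_M) A) by rewrite det_map_mx.
rewrite -e0 rmorphB /= subr_eq0 dm.
have M00 : (M%:Z%:~R : 'Z_M) = 0 by apply/eqP; rewrite e0 dvdzz.
have -> : map_mx (intr : int -> 'Z_M) (1%:M + M%:Z *: zm w z) = 1%:M.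
  by apply/matrixP => i j; rewrite !mxE intrD intrM M00 mul0r addr0; case: (i == j).
by rewrite det1.
Qed.

Lemma prime_dvd_prod (p : nat) (l : seq nat) : prime p -> all prime l -> (p %| \prod_(q <- l) q)%N -> p \in l.
Proof.
move=> pp; elim: l => [|q l IH] /=; first by rewrite big_nil dvdn1 => _ /eqP p1; move: pp; rewrite p1.
move=> /andP[qp lp]; rewrite big_cons Euclid_dvdM // dvdn_prime2 // inE.
by case/orP => [->//|/(IH lp) ->]; rewrite orbT.
Qed.

Lemma odd_logn_zero (a b c p : nat) : (0 < a)%N -> (0 < b)%N -> (c ^ 2 = a * b)%N -> ~~ (p %| b)%N -> prime p ->
  ~~ odd (logn p a).
Proof.
move=> a0 b0 E pb pp; have := congr1 (logn p) E; rewrite lognX lognM // [logn p b]lognE pp b0 (negPf pb) addn0 => <-.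
by rewrite oddM.
Qed.

Lemma square_part (a : nat) : (0 < a)%N -> exists d t, [/\ a = (d * t ^ 2)%N, (0 < d)%N &
  forall p, prime p -> (p %| d)%N -> (p %| a)%N && odd (logn p a)] /\
  d = (\prod_(p <- [seq p <- primes a | odd (logn p a)]) p)%N.
Proof.
move=> a0; pose d := (\prod_(p <- [seq p <- primes a | odd (logn p a)]) p)%N.
pose t := (\prod_(p <- primes a) p ^ (logn p a)./2)%N.
have aE : a = (d * t ^ 2)%N.
  rewrite {1}(prod_prime_decomp a0) prime_decompE big_map /= /d big_filter [X in (_ = X * _)%N]big_mkcond /=.
  have -> : (t ^ 2 = \prod_(p <- primes a) (p ^ (logn p a)./2) ^ 2)%N by rewrite /t (big_morph (fun x => x ^ 2)%N (fun x y => expnMn x y 2) (exp1n 2)).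
  rewrite -big_split /= big_seq [RHS]big_seq; apply: eq_bigr => p _.
  by rewrite -expnM -[in LHS](odd_double_half (logn p a)) expnD muln2; case: odd.
exists d, t; split => //; split => //; first by move: a0; rewrite {1}aE muln_gt0 => /andP[].
move=> p pp /(prime_dvd_prod pp); rewrite all_filter.
have -> : all (fun p => odd (logn p a) ==> prime p) (primes a).
  by apply/allP => q; rewrite mem_primes => /and3P[-> _ _]; rewrite implybT.
by move=> /(_ isT); rewrite mem_filter mem_primes => /and4P[-> _ _ ->].
Qed.

(** * Parity of the valuations of the norm *)

Section Parity.
Variables (R : realType) (K : fieldExtType rat) (n : nat) (w : 'I_n -> K).
Variables (s : 'I_n -> {rmorphism K -> R[i]}) (ow : is_order w s).
Local Notation O := (zspan w).
Variables (T : set K) (beta : K) (b0 : beta != 0) (Ob : O beta).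
Hypotheses (T0 : T 0) (TD : forall x y, T x -> T y -> T (x + y)) (TM : forall a x, O a -> T x -> T (a * x))
  (TT : forall x y, T x -> T y -> O (x * y / beta)) (TO : forall x, T x -> O x).

(** An element whose norm is prime to M is invertible modulo M, by Bezout and [onorm_dvd]. So T T
    need only contain beta times such a c. *)
Lemma unit_product_coprime (M : nat) (c : K) (l : seq (K * K)) : (0 < M)%N -> O c -> coprimez M (onorm w c) ->
  (forall p, p \in l -> T p.1 /\ T p.2) -> \sum_(p <- l) p.1 * p.2 = beta * c ->
  exists x y, [/\ T x, T y & omul w M (x * y / beta - 1)].
Proof.
move=> M0 Oc cop lT lE; have [c' Oc' cc'] := onorm_dvd ow Oc.
have [u [v uv]] := Bezoutz M (onorm w c); rewrite (eqP cop) in uv.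
pose a := (c' *~ v); have Oa : O a by apply: zspanMz.
apply: (unit_product ow M0 b0 T0 TD TM TT (l := [seq (a * p.1, p.2) | p <- l])).
  by move=> _ /mapP[p pl ->] /=; have [h1 h2] := lT p pl; split=> //; apply: TM.
rewrite big_map /=.
have -> : \sum_(p <- l) a * p.1 * p.2 / beta = a * (\sum_(p <- l) p.1 * p.2) / beta.
  by rewrite mulr_sumr mulr_suml; apply: eq_bigr => p _; rewrite mulrA.
have -> : a * (\sum_(p <- l) p.1 * p.2) / beta = (v * onorm w c)%:~R.
  by rewrite lE intrM -cc' /a -mulrzl; field.
exists (- u%:~R); first by apply: zspanN; apply: (zspan_int ow).
rewrite -mulr_natr; have h : (v * onorm w c)%:~R + u%:~R * M%:R = 1 :> K.
  by rewrite addrC -[RHS]/(1%:~R) -uv intrD (intrM _ u) -pmulrn.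
by rewrite (canRL (addrK _) h) addrAC subrr add0r mulNr.
Qed.

(** Take x, y in T with x y / beta = 1 modulo p. As (x^2/beta)(y^2/beta) is the square of x y /
    beta, the norm of x^2/beta is prime to p, and N(x)^2 = N(beta) N(x^2/beta) shows that p divides
    N(beta) to an even power. *)
Lemma parity (c : K) (l : seq (K * K)) (p : nat) : prime p -> O c -> ~~ (p %| `|onorm w c|)%N ->
  (forall p, p \in l -> T p.1 /\ T p.2) -> \sum_(p <- l) p.1 * p.2 = beta * c ->
  ~~ odd (logn p `|onorm w beta|).
Proof.
move=> pp Oc pc lT lE.
have cop : coprimez p (onorm w c) by rewrite coprimezE /= prime_coprime.
have [x [y [Tx Ty xy]]] := unit_product_coprime (prime_gt0 pp) Oc cop lT lE.
have Ov : O (x ^+ 2 / beta) by rewrite expr2; apply: TT.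
have Ov' : O (y ^+ 2 / beta) by rewrite expr2; apply: TT.
have Oxy : O (x * y / beta) by apply: TT.
have N1 := onorm_cong1 ow xy.
have vv : x ^+ 2 / beta * (y ^+ 2 / beta) = (x * y / beta) ^+ 2 by field.
have Nv := congr1 (onorm w) vv; rewrite (onormM ow Ov Ov') expr2 (onormM ow Oxy Oxy) in Nv.
have pv : ~~ (p %| `|onorm w (x ^+ 2 / beta)|)%N.
  apply/negP => h; have : (p %| onorm w (x * y / beta) * onorm w (x * y / beta))%Z.
    by rewrite -Nv dvdz_mulr // dvdzE.
  rewrite dvdzE abszM Euclid_dvdM // orbb => h2.
  move: N1; rewrite eqz_mod_dvd => h3.
  have h4 : (p %| onorm w (x * y / beta))%Z by rewrite dvdzE.
  have := rpredB h4 h3; rewrite subKr.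
  by rewrite dvdzE /= dvdn1 => /eqP p1; move: pp; rewrite p1.
have E : onorm w x ^+ 2 = onorm w beta * onorm w (x ^+ 2 / beta).
  by rewrite -(onormM ow Ob Ov) expr2 -(onormM ow) //; [congr (onorm w _); field|apply: TO..].
have b1 : onorm w beta != 0 by apply: (onorm_neq0 ow).
have v1 : onorm w (x ^+ 2 / beta) != 0 by apply: contraNneq pv => ->; rewrite dvdn0.
apply: (@odd_logn_zero _ `|onorm w (x ^+ 2 / beta)| `|onorm w x| p) => //; rewrite ?absz_gt0 //.
by rewrite -abszM -E abszX.
Qed.
End Parity.

Definition sqideal (K : fieldExtType rat) n (w : 'I_n -> K) (beta : K) : set K := [set z | zspan w (z ^+ 2 / beta)].

(** Encodes I^2 = (beta) for I = [sqideal w beta]: the sum of products is the inclusion of beta in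
    I^2, and the other inclusion is [sqidealMM]. *)
Definition sqrep (K : fieldExtType rat) n (w : 'I_n -> K) (beta : K) :=
  [/\ beta != 0, zspan w beta & exists2 l : seq (K * K),
    forall p, p \in l -> sqideal w beta p.1 /\ sqideal w beta p.2 & \sum_(p <- l) p.1 * p.2 = beta].

Section Sqideal.
Variables (R : realType) (K : fieldExtType rat) (n : nat) (w : 'I_n -> K).
Variables (s : 'I_n -> {rmorphism K -> R[i]}) (ow : is_order w s).
Local Notation O := (zspan w).
Hypothesis oic : forall x, O (x ^+ 2) -> O x.
Variables (beta : K) (b0 : beta != 0) (Ob : O beta).
Local Notation I := (sqideal w beta).

(** Its square is the product of x^2/beta and y^2/beta, and by [oic] the order contains the square
    roots in K of its elements. *)
Lemma sqidealMM x y : I x -> I y -> O (x * y / beta).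
Proof.
move=> hx hy; apply: oic; have -> : (x * y / beta) ^+ 2 = (x ^+ 2 / beta) * (y ^+ 2 / beta) by field.
exact: (zspanM ow).
Qed.
Lemma sqideal0 : I 0. Proof. by rewrite /sqideal /= expr0n /= mul0r; apply: zspan0. Qed.
Lemma sqidealD x y : I x -> I y -> I (x + y).
Proof.
move=> hx hy; have := sqidealMM hx hy => hxy; rewrite /sqideal /=.
have -> : (x + y) ^+ 2 / beta = x ^+ 2 / beta + (x * y / beta) *+ 2 + y ^+ 2 / beta by field.
by do 2 apply: zspanD => //; apply: zspanMn.
Qed.
Lemma sqidealM a x : O a -> I x -> I (a * x).
Proof.
move=> Oa hx; rewrite /sqideal /= exprMn -mulrA; apply: (zspanM ow) => //; exact: (zspanX ow).
Qed.
Lemma sqideal_sub x : I x -> O x.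
Proof.
by move=> hx; apply: oic; rewrite (_ : x ^+ 2 = (x ^+ 2 / beta) * beta); [exact: (zspanM ow hx Ob)|rewrite divfK].
Qed.
End Sqideal.

Section GramDet.
Variables (R : realType) (K : fieldExtType rat) (n : nat) (w : 'I_n -> K).
Variables (s : 'I_n -> {rmorphism K -> R[i]}).
Local Notation V := (\matrix_(j, i) s i (w j)).
Hypothesis conjs : exists2 pi : 'I_n -> 'I_n, injective pi & forall i x, s (pi i) x = ((s i x)^*)%C.

(** Complex conjugation permutes the embeddings and preserves the weights, so the Hermitian Gram
    matrix W diag(t) W^* is real and equals [gram]; its determinant is then immediate. *)
Lemma gram_det (t : 'I_n -> R) (Bm : 'M[int]_n) :
  (forall i j, (forall x, s j x = ((s i x)^*)%C) -> t j = t i) ->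
  \det (gram s t (fun j => elt w (row j Bm))) = (\prod_i t i) * (\det Bm)%:~R ^+ 2 * normc (\det V) ^+ 2.
Proof.
move=> tsym; have [pi pinj piE] := conjs.
set u := fun j => elt w (row j Bm).
pose Wm : 'M[R[i]]_n := \matrix_(j, i) s i (u j).
have WE : Wm = map_mx intr Bm *m V.
  apply/matrixP => j i; rewrite !mxE /u s_elt mxE; apply: eq_bigr => k _; by rewrite !mxE.
pose tc : 'rV[R[i]]_n := \row_i (t i)%:C%C.
have gE : map_mx (real_complex R) (gram s t u) = Wm *m diag_mx tc *m (map_mx conjc Wm)^T.
  apply/matrixP => j k; rewrite mul_mx_diag !mxE.
  pose z := \sum_i (t i)%:C%C * (s i (u j) * ((s i (u k))^*)%C).
  have zr : (z^*)%C = z.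
    rewrite /z raddf_sum /= [RHS](reindex_inj pinj) /=; apply: eq_bigr => i _.
    rewrite !piE (tsym i (pi i) (fun x => piE i x)) !rmorphM /= conjcK.
    by congr (_ * _); rewrite /= oppr0.
  have -> : \sum_i t i * complex.Re (s i (u j) * ((s i (u k))^*)%C) = complex.Re z.
    rewrite /z raddf_sum /=; apply: eq_bigr => i _.
    by move: (s i (u j) * _) => [a b] /=; rewrite mul0r subr0.
  have zz : ((complex.Re z)%:C)%C = z.
    by move: zr; case: (z) => a b /= [] h; congr (_ +i* _)%C; move: h; lra.
  by rewrite [LHS]zz /z; apply: eq_bigr => i _; rewrite !mxE; ring.
have detC : \det (map_mx conjc Wm) = ((\det Wm)^*)%C by rewrite det_map_mx.
apply: (complexI (R := R)); rewrite -det_map_mx gE !det_mulmx det_tr det_diag detC WE det_mulmx det_map_mx.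
have -> : \prod_i tc 0 i = ((\prod_i t i)%:C)%C by rewrite rmorph_prod; apply: eq_bigr => i _; rewrite mxE.
rewrite !rmorphM /= rmorph_int.
have sq (z : R[i]) : z * (z^*)%C = ((normc z ^+ 2)%:C)%C.
  by case: z => a b; rewrite normcJ2 /=; apply/eqP; rewrite eq_complex /=; apply/andP; split; apply/eqP; ring.
have h := sq (\det V); rewrite expr2 rmorphM /= in h.
by rewrite !rmorph_int -h; ring.
Qed.
End GramDet.

Lemma det_unit_sqr (R : realType) n (U : 'M[int]_n) : U \in unitmx -> (\det U)%:~R ^+ 2 = 1 :> R.
Proof.
move=> Uu; have := congr1 determinant (mulmxV Uu); rewrite det_mulmx det1.
set a := \det U; set b := \det _ => ab.
have /eqP : (`|a| * `|b|)%N = 1%N by rewrite -abszM ab.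
rewrite muln_eq1 => /andP[/eqP a1 _].
have [->|->] : a = 1 \/ a = -1 by move: a1; clear; lia.
  by rewrite expr1n.
by rewrite mulrNz sqrrN expr1n.
Qed.

(** Hermite's bound: b_0 <= 2^i b_i for all i, and the product of the b_i is the determinant of
    G. *)
Lemma reduced_first (R : realType) n (G : 'M[R]_n.+1) U L b : reduced_form G U L b ->
  qform G (mxz R (row 0 U)) = b 0 0 /\ b 0 0 ^+ n.+1 <= 2 ^+ (n.+1 ^ 2) * \det G.
Proof.
move=> [[Uu UE bp] [Lz L1 L2 bb]]; split.
  have -> : mxz R (row 0 U) = delta_mx 0 0 *m mxz R U by rewrite -rowE map_row.
  rewrite -qform_conj UE qform_sum (bigD1 0) //= -rowE !mxE L1 expr1n mulr1 big1 ?addr0 //.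
  by move=> i i0; rewrite !mxE Lz ?expr0n ?mulr0 //; case: i i0 => -[].
have b2 (i : 'I_n.+1) : b 0 0 <= 2 ^+ i * b 0 i.
  case: i => i; elim: i => [|i IH] hi; first by rewrite expr0 mul1r; have -> : Ordinal hi = 0 by apply: val_inj.
  apply: le_trans (IH (ltnW hi)) _; rewrite exprSr -mulrA ler_wpM2l ?exprn_ge0 //.
  exact: (bb (Ordinal hi) (Ordinal (ltnW hi))).
have dE : \det G = \prod_i b 0 i.
  have := congr1 determinant UE; rewrite !det_mulmx !det_tr det_diag det_map_mx.
  have -> : \det L = 1.
    by rewrite det_trig ?big1 //; apply/is_trig_mxP.
  have u2 : (\det U)%:~R ^+ 2 = 1 :> R by apply: det_unit_sqr.
  rewrite mulr1 mul1r mulrC mulrA -expr2 u2 mul1r //.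
rewrite dE; have -> : b 0 0 ^+ n.+1 = \prod_(i < n.+1) b 0 0 by rewrite prodr_const card_ord.
have -> : 2 ^+ (n.+1 ^ 2) = \prod_(i < n.+1) 2 ^+ n.+1 :> R by rewrite prodr_const card_ord -exprM.
rewrite -big_split /=; apply: ler_prod => i _; rewrite ltW //=.
apply: le_trans (b2 i) _; rewrite ler_wpM2r ?(ltW (bp _)) // ler_weXn2l ?ler1n // ltnW //.
Qed.

(** The rows of A span a module with at most n generators: in the Smith form, keep the diagonal
    times W. The zeros given by [insub] pad vectors when m and n differ. *)
Lemma submodule_basis n m (A : 'M[int]_(m, n)) : exists Bm : 'M[int]_n,
  (forall c : 'rV[int]_m, exists d, c *m A = d *m Bm) /\ (forall d : 'rV[int]_n, (m >= n)%N -> exists c : 'rV[int]_m, c *m A = d *m Bm).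
Proof.
have [L0 L0u [W Wu [d _ AE]]] := int_Smith_normal_form A.
pose D : 'M[int]_(m, n) := \matrix_(i, j) (d`_i *+ (i == j :> nat)).
exists ((\matrix_(i, j) (d`_i *+ (i == j :> nat) *+ (i < m)%N)) *m W); split.
  move=> c; exists (\row_j (if insub (j : nat) is Some k then (c *m L0) 0 k else 0)).
  rewrite AE !mulmxA; congr (_ *m W); apply/matrixP => a j; rewrite !ord1 !mxE.
  have [jm|jm] := ltnP j m.
    rewrite (bigD1 (Ordinal jm)) //= big1 ?addr0; last first.
      move=> k kj; rewrite !mxE; case: eqP => [e|_]; last by rewrite mulr0.
      by case/eqP: kj; apply: val_inj.
    rewrite [RHS](bigD1 j) //= [X in _ = _ + X]big1 ?addr0; last first.
      by move=> k kj; rewrite !mxE; case: eqP => [/val_inj e|_]; [rewrite e eqxx in kj|rewrite mul0rn mulr0].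
    rewrite !mxE eqxx /= jm insubT /= mulr1n; congr (_ * _).
    by rewrite [RHS]mxE; apply: eq_bigr => k _; congr (_ * L0 _ _); apply: val_inj.
  rewrite big1; last first.
    move=> k _; rewrite !mxE; case: eqP => [e|_]; last by rewrite mulr0.
    by have := ltn_ord k; rewrite e ltnNge jm.
  rewrite big1 // => k _; rewrite !mxE; case: eqP => [e|_]; last by rewrite mul0rn mulr0.
  by rewrite e [(j < m)%N]ltnNge jm mulr0n mulr0.
move=> e nm; exists ((\row_i (if insub (i : nat) is Some k then e 0 k else 0)) *m invmx L0).
rewrite AE !mulmxA mulmxKV //; congr (_ *m W); apply/matrixP => a j; rewrite !ord1 !mxE.
have jm := leq_trans (ltn_ord j) nm.
rewrite (bigD1 (Ordinal jm)) //= big1 ?addr0; last first.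
  move=> k kj; rewrite !mxE; case: eqP => [h|_]; last by rewrite mulr0.
  by case/eqP: kj; apply: val_inj.
rewrite [RHS](bigD1 j) //= [X in _ = _ + X]big1 ?addr0; last first.
  by move=> k kj; rewrite !mxE; case: eqP => [/val_inj h|_]; [rewrite h eqxx in kj|rewrite mul0rn mulr0].
transitivity (e 0 j * d`_j).
  by rewrite !mxE /= (insubT (fun k => (k < n)%N) (ltn_ord j)) eqxx mulr1n; congr (e 0 _ * _); apply: val_inj.
by rewrite !mxE eqxx jm !mulr1n.
Qed.

(** To be read with a the index of the ideal I, c = N(x), m = N(beta) and b = N(x^2/beta) up to
    sign: it bounds the index of I by the square root of N(beta). *)
Lemma square_coprime_dvd (a b c m m' k : nat) : (0 < m)%N -> (c ^ 2 = m * b)%N -> coprime b m' ->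
  (a %| c)%N -> (a %| m' ^ k)%N -> (a ^ 2 <= m)%N.
Proof.
move=> m0 E cop ac am.
have : (a ^ 2 %| m * b)%N by rewrite -E dvdn_exp2r.
rewrite Gauss_dvdl; first exact: dvdn_leq.
rewrite coprimeXl // (coprime_dvdl am) // coprimeXl // coprime_sym //.
Qed.

(** * Short vectors in an ideal whose square is principal *)

Section StepA.
Variables (R : realType) (K : fieldExtType rat) (n : nat) (w : 'I_n.+1 -> K).
Variables (s : 'I_n.+1 -> {rmorphism K -> R[i]}) (ow : is_order w s).
Local Notation O := (zspan w).
Local Notation V := (\matrix_(j, i) s i (w j)).
Hypothesis oic : forall x, O (x ^+ 2) -> O x.
Hypothesis conjs : exists2 pi : 'I_n.+1 -> 'I_n.+1, injective pi & forall i x, s (pi i) x = ((s i x)^*)%C.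

(** On the lattice I the form weighted by 1/|s_i beta| has determinant at most the discriminant: the
    square of the index of I is at most N(beta), which the weights compensate. The first vector of a
    reduced basis is kappa. *)
Lemma sqrep_short (beta : K) (B : R) : sqrep w beta -> 0 < B -> 2 ^+ (n.+1 ^ 2) * normc (\det V) ^+ 2 <= B ^+ n.+1 ->
  exists kappa, [/\ kappa != 0, sqideal w beta kappa & forall i, normc (s i kappa) ^+ 2 <= B * normc (s i beta)].
Proof.
move=> [b0 Ob [l lI lE]] B0 hB; set I := sqideal w beta in lI.
have Nb := onorm_neq0 ow Ob b0.
set N := `|onorm w beta|%N; have N0 : (0 < N)%N by rewrite absz_gt0.
(* M is a multiple of N(beta), hence of beta in O, and this puts M itself into I. *)
set M := (N * 2)%N; have M0 : (0 < M)%N by rewrite muln_gt0 N0.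
have IMM := sqidealMM ow oic b0; have I0 := @sqideal0 K n.+1 w beta.
have ID := sqidealD ow oic b0; have IM := @sqidealM R K _ w s ow beta; have IO := sqideal_sub ow oic b0 Ob.
have cop : coprimez M (onorm w 1) by rewrite (onorm1 ow) coprimezE /= coprimen1.
have lE1 : \sum_(p <- l) p.1 * p.2 = beta * 1 by rewrite mulr1.
have [x [y [Ix Iy xy]]] := @unit_product_coprime R K _ w s ow I beta b0 I0 ID IM IMM M 1 l M0 (zspan1 ow) cop lI lE1.
have Ox := IO _ Ix.
have [b' Ob' bb'] := onorm_dvd ow Ob.
have IMn : I M%:R.
  have [e eE] : exists e : int, M%:Z = onorm w beta * e.
    rewrite /M /N; move: (onorm w beta) => q; clear.
    by have [h|h] := lerP 0 q; [exists 2|exists (-2)]; lia.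
  have ee : M%:R = beta * (b' *~ e) by rewrite pmulrn eE intrM -bb' -mulrA mulrzr.
  rewrite /I /sqideal /= ee.
  have -> : (beta * (b' *~ e)) ^+ 2 / beta = beta * (b' *~ e) ^+ 2 by field.
  by apply: (zspanM ow) => //; apply: (zspanX ow); apply: zspanMz.
(* I is generated over O by x and M: if x y / beta = 1 + u M, then z = (z y / beta) x - M u z for z
   in I. The rows of A generate it over Z. *)
pose A : 'M[int]_(n.+1 + n.+1, n.+1) := col_mx (zm w x) M%:Z%:M.
have AE c1 c2 : elt w (row_mx c1 c2 *m A) = elt w c1 * x + elt w c2 *+ M.
  by rewrite /A mul_row_col eltD (zmP ow) // mul_mx_scalar eltZ pmulrn.
have AI c : I (elt w (c *m A)).
  rewrite -[c]hsubmxK AE; apply: ID.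
    by apply: IM => //; eexists.
  by rewrite -mulr_natr; apply: IM => //; eexists.
have IA z : I z -> exists c, z = elt w (c *m A).
  move=> Iz; have [u Ou xyu] := xy.
  have Ozy : O (z * y / beta) by apply: IMM.
  have Ozu : O (- (z * u)) by apply: zspanN; apply: (zspanM ow) => //; apply: IO.
  exists (row_mx (ocoord w (z * y / beta)) (ocoord w (- (z * u)))); rewrite AE !ocoordK //.
  have -> : z * y / beta * x + - (z * u) *+ M = z * (x * y / beta) - z * (u *+ M).
    by rewrite mulNrn -mulrnAr; field.
  by rewrite -xyu; ring.
have [Bm [B1 B2]] := submodule_basis A.
have BI d : I (elt w (d *m Bm)) by have [c <-] := B2 d (leq_addr _ _); apply: AI.
have IB z : I z -> exists d, z = elt w (d *m Bm).
  by move=> /IA [c ->]; have [d ->] := B1 c; exists d.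
have rowsB (P : 'M[int]_n.+1) : (forall j, I (elt w (row j P))) -> exists Q, P = Q *m Bm.
  move=> h; have /boolp.choice [f fE] : forall j, exists d, row j P = d *m Bm.
    by move=> j; have [d E] := IB _ (h j); exists d; apply: (elt_inj ow).
  exists (\matrix_j f j); apply/row_matrixP => j; by rewrite row_mul rowK fE.
have [Q1 Q1E] : exists Q, zm w x = Q *m Bm.
  apply: rowsB => j; rewrite rowE (zmP ow) //; apply: IM => //; by eexists.
have [Q2 Q2E] : exists Q, (M%:Z%:M : 'M[int]_n.+1) = Q *m Bm.
  by apply: rowsB => j; rewrite rowE mul_mx_scalar eltZ -pmulrn -mulr_natr; apply: IM => //; eexists.
have d1 : (`|\det Bm| %| `|onorm w x|)%N by rewrite /onorm Q1E det_mulmx abszM dvdn_mull.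
have d2 : (`|\det Bm| %| M ^ n.+1)%N.
  have := congr1 (fun P => `|\det P|%N) Q2E; rewrite det_scalar det_mulmx abszM abszX /= => ->.
  exact: dvdn_mull.
have Ov : O (x ^+ 2 / beta) := Ix.
have Ov' : O (y ^+ 2 / beta) := Iy.
have Oxy : O (x * y / beta) by apply: IMM.
have Nx : onorm w x ^+ 2 = onorm w beta * onorm w (x ^+ 2 / beta).
  by rewrite -(onormM ow Ob Ov) expr2 -(onormM ow) //; congr (onorm w _); field.
have copv : coprime `|onorm w (x ^+ 2 / beta)| M.
  have N1 := onorm_cong1 ow xy.
  have vv : x ^+ 2 / beta * (y ^+ 2 / beta) = (x * y / beta) * (x * y / beta) by field.
  have Nv := congr1 (onorm w) vv; rewrite (onormM ow Ov Ov') (onormM ow Oxy Oxy) in Nv.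
  have c1 : coprimez (onorm w (x * y / beta)) M by rewrite /coprimez -gcdz_modl (eqP N1) gcdz_modl gcd1z.
  have : coprimez (onorm w (x ^+ 2 / beta) * onorm w (y ^+ 2 / beta)) M by rewrite Nv coprimezMl c1.
  by rewrite coprimezMl => /andP[]; rewrite coprimezE.
have dB : (`|\det Bm| ^ 2 <= N)%N.
  apply: (@square_coprime_dvd _ `|onorm w (x ^+ 2 / beta)| `|onorm w x| N M n.+1) => //.
  by rewrite -abszX Nx abszM.
pose t i : R := (normc (s i beta))^-1.
have sb i : 0 < normc (s i beta) by rewrite lt_def normc_ge0 normc_eq0 fmorph_eq0 b0.
have t0 i : 0 < t i by rewrite invr_gt0.
have tsym i j : (forall x, s j x = ((s i x)^*)%C) -> t j = t i.
  by move=> h; rewrite /t h; case: (s i beta) => a b /=; rewrite sqrrN.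
have gd := gram_det w conjs Bm tsym.
set G := gram _ _ _ in gd.
have Gq c : qform G (mxz R c) = \sum_i t i * normc (s i (elt w (c *m Bm))) ^+ 2.
  rewrite gram_qform; have -> : elt (fun j => elt w (row j Bm)) c = elt w (c *m Bm) => //.
  by rewrite mulmx_sum_row elt_sum; apply: eq_bigr => j _; rewrite eltZ.
have pb : \prod_i normc (s i beta) = N%:R.
  by rewrite -normc_prod -(onormE ow) // normc_int -intr_norm /N natr_absz.
have detB0 : \det Bm != 0.
  have := congr1 (fun P => \det P) Q2E; rewrite det_scalar det_mulmx => E; apply/eqP => h.
  move: E; rewrite h mulr0 => /eqP; rewrite expf_eq0 /= => /eqP [] M00.
  by rewrite M00 in M0.
have Gdet : \det G <= normc (\det V) ^+ 2.
  rewrite gd prodfV pb ler_piMl ?sqr_ge0 // mulrC ler_pdivrMr ?ltr0n // mul1r.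
  have -> : (\det Bm)%:~R ^+ 2 = (`|\det Bm| ^ 2)%N%:R :> R.
    by rewrite natrX natr_absz intr_norm real_normK ?num_real.
  by rewrite ler_nat.
(* A nonzero integer has norm at least 1 in absolute value, so one of its conjugates has modulus at
   least 1. *)
have [c cpos cmin] : exists2 c, 0 < c & forall x : 'rV[int]_n.+1, x != 0 -> c <= qform G (mxz R x).
  have S0 : 0 < \sum_i normc (s i beta) by rewrite big_ord_recl ltr_wpDr ?sb // sumr_ge0 // => i _; apply: normc_ge0.
  exists (\sum_i normc (s i beta))^-1 => [|c c0]; first by rewrite invr_gt0.
  set z := elt w (c *m Bm).
  have z0 : z != 0.
    apply: contraNneq c0 => z0; have cB : c *m Bm = 0 by apply: (elt_inj ow); rewrite elt0.
    have := congr1 (fun P => P *m \adj Bm) cB; rewrite -mulmxA mul_mx_adj mul0mx mul_mx_scalar => /matrixP h.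
    apply/eqP/matrixP => a j; have /eqP := h a j; rewrite !mxE mulf_eq0 (negPf detB0) => /eqP //.
  have [i zi] : exists i, 1 <= normc (s i z).
    apply: contrapT => h; have lt i : normc (s i z) < 1 by rewrite ltNge; apply/negP => h'; apply: h; exists i.
    have Oz : O z by eexists.
    have := onorm_ge1 ow Oz z0; rewrite leNgt => /negP; apply.
    rewrite big_ord_recl; apply: le_lt_trans (lt 0); rewrite ler_piMr ?normc_ge0 //.
    by apply: prodr_ile1 => i _; rewrite normc_ge0 ltW.
  rewrite Gq; apply: le_trans (_ : t i * normc (s i z) ^+ 2 <= _); last first.
    by rewrite (bigD1 i) //= lerDl sumr_ge0 // => j _; rewrite mulr_ge0 ?sqr_ge0 ?ltW.
  apply: le_trans (_ : t i * 1 <= _); last by rewrite ler_pM2l // exprn_ege1.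
  rewrite mulr1 /t lef_pV2 ?posrE //; rewrite (bigD1 i) //= lerDl sumr_ge0 // => j _; exact: normc_ge0.
have [U [L [b rf]]] := exists_reduced_form (gram_sym _ _ _) (ex_intro2 _ _ c cpos cmin).
have [qk bk] := reduced_first rf.
exists (elt w (row 0 U *m Bm)); split.
- apply/eqP => h; have [[_ _ bp] _] := rf; have := bp 0; rewrite -qk -/G Gq h big1 ?ltxx // => i _.
  by rewrite rmorph0 /= expr0n /= addr0 sqrtr0 expr0n mulr0.
- exact: BI.
move=> i; have bB : b 0 0 <= B.
  rewrite leNgt; apply/negP => lt; have : B ^+ n.+1 < b 0 0 ^+ n.+1 by rewrite ltrXn2r ?nnegrE ?ltW.
  by rewrite ltNge (le_trans bk) // (le_trans _ hB) // ler_wpM2l ?exprn_ge0.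
have : t i * normc (s i (elt w (row 0 U *m Bm))) ^+ 2 <= B.
  apply: le_trans bB; rewrite -qk -/G Gq (bigD1 i) //= lerDl sumr_ge0 // => j _.
  by rewrite mulr_ge0 ?sqr_ge0 ?ltW.
by rewrite /t mulrC ler_pdivrMr.
Qed.
End StepA.

(** * Embeddings and the discriminant *)

Section Embeddings.
Variables (R : realType) (K : fieldExtType rat).
Local Notation n := (\dim {:K}).
Local Notation inK := (in_alg K).
Local Notation toC := (ratr : rat -> R[i]).

Lemma emb_rat (f : {rmorphism K -> R[i]}) (a : rat) : f (inK a) = ratr a.
Proof.
pose g : {rmorphism rat -> R[i]} := (f \o inK).
by rewrite -(fmorph_eq_rat g).
Qed.

Lemma emb_scale (f : {rmorphism K -> R[i]}) (a : rat) (x : K) : f (a *: x) = ratr a * f x.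
Proof. by rewrite -[a *: x]mulr_algl rmorphM /= emb_rat. Qed.

Lemma primitive_element : exists z : K, exists p : {poly rat}, [/\ p \is monic, size p = n.+1, separable_poly p,
  (forall x, exists q : {poly rat}, x = (map_poly inK q).[z]) &
  (forall q : {poly rat}, (map_poly inK q).[z] = 0 -> p %| q) /\ (map_poly inK p).[z] = 0].
Proof.
have sep : separable 1%AS {:K}%AS.
  apply/separableP => y _; rewrite separable_nz_der.
  set q := minPoly _ y; have qm : q \is monic := monic_minPoly _ _.
  have [k qk] : exists k, size q = k.+2 by exists (adjoin_degree 1 y).-1; rewrite size_minPoly.
  apply/eqP => /(congr1 (fun u : {poly K} => u`_k)) /eqP; rewrite coef_deriv coef0.
  have -> : q`_k.+1 = 1 by rewrite -(monicP qm) /lead_coef qk.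
  by rewrite -(rmorph_nat inK) fmorph_eq0 pnatr_eq0.
have gen := eq_adjoin_separable_generator sep (sub1v _).
set z := separable_generator _ _ in gen.
have /polyOver1P[p pE] := minPolyOver 1 z.
exists z, p; split.
- by have := monic_minPoly 1 z; rewrite pE map_monic.
- rewrite -(size_map_poly inK) -pE size_minPoly adjoin_degreeE -gen dimv1 divn1 //.
- by rewrite -(separable_map inK) -pE; apply: separable_generatorP.
- move=> x; have xz : x \in <<1; z>>%VS by rewrite -gen memvf.
  have /polyOver1P[q qE] := Fadjoin_polyOver 1 z x.
  by exists q; rewrite -qE Fadjoin_poly_eq.
split; last by rewrite -pE; apply/rootP; apply: root_minPoly.
move=> q q0; rewrite -(dvdp_map inK) -pE; apply: minPoly_dvdp; last exact/rootP.
by apply/polyOver1P; exists q.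
Qed.

(** The complex roots of the minimal polynomial of a primitive element z give the embeddings; z
    remains as the witness that they are distinct. *)
Lemma exists_embeddings : exists s : 'I_n -> {rmorphism K -> R[i]}, exists z : K,
  injective (fun i => s i z) /\ forall g : {rmorphism K -> R[i]}, exists i, g =1 s i.
Proof.
have [z [p [pm ps psep gen [pdvd pz]]]] := primitive_element.
pose pC := map_poly toC p.
have pCm : pC \is monic by rewrite map_monic.
have [r rE] := closed_field_poly_normal pC; rewrite (monicP pCm) scale1r in rE.
have szr : size r = n.
  have := size_map_poly toC p; rewrite -/pC rE size_prod_XsubC ps => -[] //.
have ur : uniq r by rewrite -separable_prod_XsubC -rE separable_map.
have mkemb (a : R[i]) : root pC a -> exists f : {rmorphism K -> R[i]}, f z = a.
  move=> pa; pose qof x : {poly rat} := xget 0 [set q | x = (map_poly inK q).[z]].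
  have qofP x : x = (map_poly inK (qof x)).[z].
    by rewrite /qof; case: xgetP => [q _ //|h]; have [q qx] := gen x; have := h q.
  pose f x : R[i] := (map_poly toC (qof x)).[a].
  have wd q : f (map_poly inK q).[z] = (map_poly toC q).[a].
    have : (map_poly inK (qof (map_poly inK q).[z] - q)).[z] = 0.
      by rewrite rmorphB /= hornerD hornerN -qofP subrr.
    move/pdvd; rewrite -(dvdp_map toC) => /dvdpP[h hE].
    have := congr1 (fun u => u.[a]) hE; rewrite /= hornerM (rootP pa) mulr0 rmorphB /= hornerD hornerN.
    by move/eqP; rewrite subr_eq0 => /eqP.
  have fadd : zmod_morphism f.
    move=> x y; rewrite {1}(qofP x) {1}(qofP y) -hornerN -hornerD -rmorphB /= wd rmorphB /= hornerD hornerN //.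
  have fmul : monoid_morphism f.
    split; first by rewrite -[1 in LHS](hornerC 1 z) -(rmorph1 inK) -map_polyC wd map_polyC /= rmorph1 hornerC.
    by move=> x y; rewrite {1}(qofP x) {1}(qofP y) -hornerM -rmorphM /= wd rmorphM /= hornerM.
  pose fA := GRing.isZmodMorphism.Build K R[i] f fadd.
  pose fM := GRing.isMonoidMorphism.Build K R[i] f fmul.
  pose F : {rmorphism K -> R[i]} := HB.pack f fA fM.
  exists F; rewrite -[LHS]/(f z) -[z in LHS](hornerX z) -(map_polyX inK) wd map_polyX hornerX //.
have rt (i : 'I_n) : root pC r`_i.
  by rewrite rE root_prod_XsubC mem_nth // szr.
have /boolp.choice [s sE] : forall i : 'I_n, exists f : {rmorphism K -> R[i]}, f z = r`_i by move=> i; apply: mkemb.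
exists s, z; split.
  move=> i j; rewrite !sE => /eqP; rewrite nth_uniq ?szr // => /eqP /val_inj //.
move=> g; have gr : root pC (g z).
  have := congr1 g pz; rewrite rmorph0 -horner_map /= -map_poly_comp => h.
  apply/rootP; rewrite -h; congr (_.[_]); apply: eq_map_poly => a /=.
  by rewrite -(emb_rat g).
move: gr; rewrite rE root_prod_XsubC => /(nthP 0)[i ir iE]; rewrite szr in ir.
exists (Ordinal ir) => x; have [q ->] := gen x.
rewrite -!horner_map /= sE /= iE; congr (_.[_]); rewrite -!map_poly_comp; apply: eq_map_poly => a /=.
by rewrite !emb_rat.
Qed.

Lemma int_vector (m : nat) (v : 'rV[rat]_m) : exists2 d : int, d != 0 & exists c : 'rV[int]_m,
  map_mx intr c = d%:~R *: v.
Proof.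
exists (\prod_j denq (v 0 j)); first by apply/prodf_neq0 => j _; rewrite denq_neq0.
exists (\row_j (numq (v 0 j) * \prod_(k | k != j) denq (v 0 k))); apply/matrixP => a j; rewrite ord1 !mxE.
have hn : (numq (v 0 j))%:~R = v 0 j * (denq (v 0 j))%:~R :> rat by rewrite numqE.
have hd : (\prod_j0 denq (v 0 j0))%:~R = (denq (v 0 j))%:~R * (\prod_(k | k != j) denq (v 0 k))%:~R :> rat.
  by rewrite (bigD1 j) //= rmorphM.
transitivity ((numq (v 0 j))%:~R * (\prod_(k | k != j) denq (v 0 k))%:~R : rat); first exact: rmorphM.
by rewrite hn hd; ring.
Qed.

Variables (s : 'I_n -> {rmorphism K -> R[i]}) (z : K).
Hypotheses (sz : injective (fun i => s i z)) (sall : forall g : {rmorphism K -> R[i]}, exists i, g =1 s i).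
Local Notation vb := (vbasis {:K}).
Let Vb : 'M[R[i]]_n := \matrix_(l, i) s i (tnth vb l).

Let emb_coord x i : s i x = \sum_l ratr (coord vb l x) * s i (tnth vb l).
Proof.
rewrite {1}(coord_vbasis (memvf x)) raddf_sum; apply: eq_bigr => l _.
by rewrite /= emb_scale (tnth_nth 0).
Qed.

(** The Vandermonde matrix of the distinct conjugates of z, which is invertible, factors through
    [Vb]. *)
Let Vb_unit : Vb \in unitmx.
Proof.
pose Zm : 'M[rat]_n := \matrix_(k, l) coord vb l (z ^+ k).
have E : Vandermonde n (\row_i s i z) = map_mx ratr Zm *m Vb.
  apply/matrixP => k i; rewrite !mxE -rmorphXn emb_coord; apply: eq_bigr => l _; by rewrite !mxE.
have : \det (Vandermonde n (\row_i s i z)) != 0.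
  rewrite det_Vandermonde; apply/prodf_neq0 => i _; apply/prodf_neq0 => j ij.
  by rewrite !mxE subr_eq0; apply/eqP => /sz e; rewrite e ltnn in ij.
by rewrite E det_mulmx mulf_eq0 negb_or => /andP[_ h]; rewrite unitmxE unitfE.
Qed.

Lemma basis_unit (w : 'I_n -> K) : (forall c, elt w c = 0 -> c = 0) -> (\matrix_(j, i) s i (w j)) \in unitmx.
Proof.
move=> free; pose Wm : 'M[rat]_n := \matrix_(j, l) coord vb l (w j).
have -> : \matrix_(j, i) s i (w j) = map_mx ratr Wm *m Vb.
  apply/matrixP => j i; rewrite !mxE emb_coord; apply: eq_bigr => l _; by rewrite !mxE.
rewrite unitmx_mul Vb_unit andbT map_unitmx unitmxE unitfE; apply/det0P => -[v v0 vW].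
have [d d0 [c cE]] := int_vector v.
case/eqP: v0; have c0 : c = 0.
  apply: free; have dW : map_mx intr c *m Wm = 0 by rewrite cE -scalemxAl vW scaler0.
  rewrite (coord_vbasis (memvf (elt w c))) big1 // => l _.
  have -> : coord vb l (elt w c) = (map_mx intr c *m Wm) 0 l.
    rewrite mxE /elt raddf_sum; apply: eq_bigr => j _; rewrite !mxE /=.
    by rewrite raddfMz /= -mulrzl.
  by rewrite dW mxE scale0r.
apply/matrixP => a j; have /matrixP/(_ a j) := cE; rewrite c0 !mxE => /esym/eqP.
by rewrite mulf_eq0 intr_eq0 (negPf d0) => /eqP.
Qed.

Lemma field_trace_emb x : ratr (field_trace x) = \sum_i s i x :> R[i].
Proof.
pose Mx : 'M[rat]_n := \matrix_(k, l) coord vb l (x * tnth vb k).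
have E : map_mx ratr Mx *m Vb = Vb *m diag_mx (\row_i s i x).
  apply/matrixP => k i; rewrite mul_mx_diag !mxE -rmorphM mulrC emb_coord; apply: eq_bigr => l _; by rewrite !mxE.
have tr : \tr (map_mx toC Mx) = \sum_i s i x.
  rewrite -[map_mx _ _](mulmxK Vb_unit) E mxtrace_mulC mulmxA mulVmx // mul1mx mxtrace_diag.
  by apply: eq_bigr => i _; rewrite mxE.
rewrite -tr /field_trace /mxtrace rmorph_sum; apply: eq_bigr => i _; by rewrite !mxE.
Qed.

Lemma tuple_disc_emb (w : n.-tuple K) :
  ratr `|tuple_disc w| = normc (\det (\matrix_(j, i) s i (tnth w j))) ^+ 2 :> R.
Proof.
set V := \matrix_(j, i) _.
have E : ratr (tuple_disc w) = \det V ^+ 2 :> R[i].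
  have -> : \det V ^+ 2 = \det (V *m V^T) by rewrite det_mulmx det_tr expr2.
  rewrite /tuple_disc -det_map_mx; congr (\det _).
  apply/matrixP => i j; transitivity (ratr (field_trace (tnth w i * tnth w j)) : R[i]); first by rewrite !mxE.
  by rewrite field_trace_emb !mxE; apply: eq_bigr => l _; rewrite !mxE rmorphM.
rewrite expr2 -Normc.normcM -expr2 -E ratr_norm.
have -> : ratr (tuple_disc w) = ((ratr (tuple_disc w) : R)%:C)%C :> R[i] by rewrite fmorph_rat.
by rewrite /= expr0n /= addr0 sqrtr_sqr.
Qed.

Lemma emb_conj : exists2 pi : 'I_n -> 'I_n, injective pi & forall i x, s (pi i) x = ((s i x)^*)%C.
Proof.
have /boolp.choice [pi piE] : forall i, exists j, forall x, ((s i x)^*)%C = s j x.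
  move=> i; pose g : {rmorphism K -> R[i]} := (conjc \o s i).
  by have [j gj] := sall g; exists j => x; rewrite -gj.
exists pi => [i j e|i x]; last by rewrite -piE.
by apply: sz; apply: (can_inj (@conjcK R)); rewrite !piE e.
Qed.

Lemma emb_norm_sum x : emb_norm R x = \sum_i normc (s i x).
Proof.
rewrite /emb_norm (reindex_fsbig (fun i : 'I_n => s i : K -> R[i]) [set: 'I_n]).
  have -> : [set: 'I_n] = [set` index_enum 'I_n] by apply/seteqP; split=> // i _; rewrite /= mem_index_enum.
  by rewrite -fsbig_seq ?index_enum_uniq.
split=> [i _|i j _ _ /= e|g [f _ <-]]; first by exists (s i).
  by apply: sz; rewrite e.
by have [i fi] := sall f; exists i => //; apply/funext => y; rewrite fi.
Qed.
End Embeddings.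

Lemma integral_basis_order (R : realType) (K : fieldExtType rat) (w : (\dim {:K}).-tuple K)
  (s : 'I_(\dim {:K}) -> {rmorphism K -> R[i]}) (z : K) : integral_basis w -> injective (fun i => s i z) ->
  is_order (tnth w) s /\ zspan (tnth w) = integers K.
Proof.
move=> [wi wb] sz.
have zi : integers K `<=` zspan (tnth w).
  move=> x /wb [c [xc _]]; exists (\row_i c i); rewrite xc; apply: eq_bigr => i _; by rewrite mxE.
have i0 : integers K 0 by apply: mxpoly.integral0.
have iz : zspan (tnth w) `<=` integers K.
  move=> _ [c ->]; rewrite /elt; elim/big_ind: _ => [|x y hx hy|i _]; first exact: i0.
    exact: mxpoly.integral_add.
  by rewrite -mulrzr; apply: integral_mul; [exact: wi|exact: integral_id].
split; last by apply/seteqP.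
split.
- apply: (basis_unit sz) => c c0.
  have [d [_ dU]] := wb 0 i0.
  have e1 : d = [ffun=> 0].
    by apply: dU; rewrite big1 // => i _; rewrite ffunE mulr0z.
  have e2 : d = [ffun i => c 0 i].
    by apply: dU; rewrite -[LHS]c0 /elt; apply: eq_bigr => i _; rewrite ffunE.
  apply/matrixP => a i; rewrite ord1 mxE.
  by have := congr1 (fun f : {ffun _} => f i) e2; rewrite e1 !ffunE.
- by move=> j k; apply: zi; apply: integral_mul; apply: wi.
- by apply: zi; apply: mxpoly.integral1.
Qed.

Lemma integers_sqr (K : fieldExtType rat) (x : K) : integers K (x ^+ 2) -> integers K x.
Proof.
move=> h; apply: (@integral_root_monic _ _ _ x ('X^2 - (x ^+ 2)%:P)).
- by rewrite monicXnsubC.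
- by rewrite rootE !hornerE subrr.
- apply/integral_poly => i; rewrite coefB coefXn coefC.
  apply: integral_sub; first by case: (i == 2); [exact: mxpoly.integral1|exact: mxpoly.integral0].
  by case: (i == 0)%N; [exact: h|exact: mxpoly.integral0].
Qed.

(** * Reduced bases of orders *)

Definition qnorm (R : realType) (K : fieldExtType rat) n (s : 'I_n -> {rmorphism K -> R[i]}) (x : K) : R :=
  \sum_i normc (s i x) ^+ 2.

(** A reduced form of the sum of squares of conjugates whose first vector is 1. With 1 in first
    place, varying coordinate 0 translates by integers, as the sieve requires. *)
Definition red_basis (R : realType) (K : fieldExtType rat) n (s : 'I_n.+1 -> {rmorphism K -> R[i]})
    (u : 'I_n.+1 -> K) (L : 'M[R]_n.+1) (b : 'rV[R]_n.+1) :=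
  [/\ is_order u s, u 0 = 1 & forall c, qnorm s (elt u c) = \sum_k b 0 k * ((mxz R c *m L) 0 k) ^+ 2] /\
  [/\ (forall k, 0 < b 0 k), b 0 0 = n.+1%:R, (forall i j : 'I_n.+1, (i < j)%N -> L i j = 0), (forall i, L i i = 1) &
      (forall i j : 'I_n.+1, (j < i)%N -> `|L i j| <= 1 / 2) /\
      (forall i j : 'I_n.+1, i = j.+1 :> nat -> b 0 j <= 2 * b 0 i)].

(** The arithmetic-geometric mean inequality and the fact that the norm is at least 1 in absolute
    value. Hence 1 is a shortest vector, and reduction may start from it. *)
Lemma qnorm_ge_dim (R : realType) (K : fieldExtType rat) n (w : 'I_n.+1 -> K)
  (s : 'I_n.+1 -> {rmorphism K -> R[i]}) (x : K) : is_order w s -> zspan w x -> x != 0 -> n.+1%:R <= qnorm s x.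
Proof.
move=> ow Ox x0; have N1 := onorm_ge1 ow Ox x0.
have [+ _] := @leif_AGM R 'I_n.+1 [set: 'I_n.+1]%SET (fun i => normc (s i x) ^+ 2) (fun i _ => sqr_ge0 _).
rewrite cardsT card_ord.
have -> : \prod_(i in [set: 'I_n.+1]%SET) normc (s i x) ^+ 2 = \prod_i normc (s i x) ^+ 2 by apply: eq_bigl => i; rewrite inE.
have -> : \sum_(i in [set: 'I_n.+1]%SET) normc (s i x) ^+ 2 = qnorm s x by apply: eq_bigl => i; rewrite inE.
move=> h.
have q0 : 0 <= qnorm s x by apply: sumr_ge0 => i _; apply: sqr_ge0.
have p1 : 1 <= \prod_i normc (s i x) ^+ 2 by rewrite prodrXl exprn_ege1.
have : 1 <= qnorm s x / n.+1%:R.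
  rewrite leNgt; apply/negP => lt; have : (qnorm s x / n.+1%:R) ^+ n.+1 < 1 by rewrite exprn_ilt1 // divr_ge0.
  by rewrite ltNge (le_trans p1 h).
by rewrite ler_pdivlMr ?ltr0n // mul1r.
Qed.

Lemma is_order_change (R : realType) (K : fieldExtType rat) n (w : 'I_n -> K)
  (s : 'I_n -> {rmorphism K -> R[i]}) (U : 'M[int]_n) : is_order w s -> U \in unitmx ->
  is_order (fun j => elt w (row j U)) s /\ zspan (fun j => elt w (row j U)) = zspan w.
Proof.
move=> ow Uu; set u := fun j => _.
have uE c : elt u c = elt w (c *m U) by rewrite mulmx_sum_row elt_sum; apply: eq_bigr => j _; rewrite eltZ.
have uw : zspan u = zspan w.
  apply/seteqP; split=> _ [c ->]; first by exists (c *m U).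
  by exists (c *m invmx U); rewrite uE mulmxKV.
split => //; split; last by rewrite uw; apply: zspan1 ow.
  have -> : \matrix_(j, i) s i (u j) = map_mx intr U *m (\matrix_(j, i) s i (w j)).
    by apply/matrixP => j i; rewrite !mxE /u s_elt mxE; apply: eq_bigr => k _; rewrite !mxE.
  rewrite unitmx_mul (order_unit ow) andbT unitmxE det_map_mx rmorph_unit // -unitmxE //.
by move=> j k; rewrite uw; apply: (zspanM ow); eexists.
Qed.

Lemma gram_change (R : realType) (K : fieldExtType rat) n m (w : 'I_m -> K)
  (s : 'I_n -> {rmorphism K -> R[i]}) (t : 'I_n -> R) (U : 'M[int]_m) :
  gram s t (fun j => elt w (row j U)) = mxz R U *m gram s t w *m (mxz R U)^T.
Proof.
apply/matrixP => j k; rewrite !mxE.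
have zE i (c : 'rV[int]_m) : s i (elt w c) = \sum_a (((c 0 a)%:~R : R)%:C)%C * s i (w a).
  by rewrite /elt raddf_sum; apply: eq_bigr => a _; rewrite raddfMz /= -mulrzl rmorph_int.
transitivity (\sum_i \sum_b \sum_a t i * ((U j a)%:~R * (U k b)%:~R * complex.Re (s i (w a) * ((s i (w b))^*)%C))).
  apply: eq_bigr => i _; rewrite !zE rmorph_sum /= mulr_sumr raddf_sum mulr_sumr; apply: eq_bigr => b _.
  rewrite mulr_suml raddf_sum mulr_sumr; apply: eq_bigr => a _; congr (_ * _); rewrite !mxE.
  by move: (s i (w a)) (s i (w b)) ((U j a)%:~R : R) ((U k b)%:~R : R) => [x y] [x' y'] p q /=; ring.
rewrite exchange_big /=; apply: eq_bigr => b _; rewrite !mxE mulr_suml exchange_big /=; apply: eq_bigr => a _.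
by rewrite !mxE mulr_sumr mulr_suml; apply: eq_bigr => i _; ring.
Qed.

Lemma card_ord_lt m N : (m <= N)%N -> #|[set k : 'I_N | (k < m)%N]%SET| = m.
Proof. by move=> mN; rewrite cardsE -sum1_card (big_ord_narrow mN) sum1_card card_ord. Qed.

Lemma exists_red_basis (R : realType) (K : fieldExtType rat) n (w : 'I_n.+1 -> K)
  (s : 'I_n.+1 -> {rmorphism K -> R[i]}) : is_order w s -> exists u L b,
  [/\ red_basis s u L b, zspan u = zspan w & \prod_k b 0 k = \det (gram s (fun=> 1) w)].
Proof.
move=> ow; have [L0 L0u [W Wu [d _ xE]]] := int_Smith_normal_form (ocoord w 1).
have x2 : ocoord w 1 = (L0 0 0 * d`_0) *: row 0 W.
  rewrite xE; apply/matrixP => i j; rewrite !ord1 !mxE (bigD1 ord0) //= big1 ?addr0; last first.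
    by move=> k k0; rewrite !mxE big_ord1 !mxE /= (_ : (0 == k :> nat) = false) ?mulr0 ?mul0r //;
      apply/negbTE; move: k0; rewrite eq_sym.
  by rewrite !mxE big_ord1 !mxE /= mulr1n.
set e := L0 0 0 * d`_0 in x2.
(* The unit 1 is e times an element of the order; taking norms, a power of e divides 1. So the
   coordinate vector of 1 is primitive. *)
have e1 : e = 1 \/ e = -1.
  have E1 : 1 = e%:~R * elt w (row 0 W) by rewrite -[LHS](ocoordK (zspan1 ow)) x2 eltZ mulrzl.
  have Ov : zspan w (elt w (row 0 W)) by eexists.
  have := congr1 (onorm w) E1; rewrite (onorm1 ow) (onormM ow (zspan_int ow _) Ov) (onorm_int ow).
  move/(congr1 absz); rewrite abszM abszX => /esym/eqP; rewrite muln_eq1 -dvdn1 => /andP[h _].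
  have : (`|e| %| 1)%N by apply: dvdn_trans h; apply: dvdn_exp.
  by rewrite dvdn1 => /eqP; move: (e); clear => q; lia.
pose W1 := e *: W.
have W1u : W1 \in unitmx.
  by rewrite unitmxZ // ; case: e1 => ->; rewrite ?unitr1 ?unitrN1.
have W10 : row 0 W1 = ocoord w 1 by rewrite x2 /W1 linearZ.
have [ou uw] := is_order_change ow W1u; set u1 := fun j => _ in ou uw.
have u10 : u1 0 = 1 by rewrite /u1 W10 ocoordK //; apply: zspan1 ow.
pose G := gram s (fun=> 1) u1.
have Gq c : qform G (mxz R c) = qnorm s (elt u1 c) by rewrite gram_qform; apply: eq_bigr => i _; rewrite mul1r.
have u1q : qnorm s 1 = n.+1%:R.
  rewrite /qnorm (eq_bigr (fun=> 1)) => [|i _]; first by rewrite sumr_const card_ord.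
  by rewrite rmorph1 -[1]/(1%:~R) normc_int normr1 expr1n.
have G00 : G 0 0 = n.+1%:R.
  have -> : G 0 0 = qform G (mxz R (delta_mx 0 0)).
    by rewrite /qform map_delta_mx trmx_delta -rowE -colE !mxE.
  by rewrite Gq elt_delta u10.
have Gmin (x : 'rV[int]_(1 + n)) : x != 0 -> n.+1%:R <= qform G (mxz R x).
  move=> x0; rewrite Gq; apply: (qnorm_ge_dim ou); first by eexists.
  by apply: contraNneq x0 => h; apply/eqP; apply: (elt_inj ou); rewrite h elt0.
have [||x x0|H Hs Hc|U [L [b [rf U0 b0]]]] := @reduce_step R n G.
- exact: gram_sym.
- by rewrite G00.
- apply: le_trans (Gmin x x0); rewrite G00; have : 0 <= n.+1%:R :> R by []. lra.
- exact: exists_reduced_form.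
case: rf => -[Uu UE bp] [Lz L1 L2 bb].
have [ou2 uw2] := is_order_change ou Uu.
exists (fun j => elt u1 (row j U)), L, b; split; last first.
- have := congr1 determinant UE; rewrite !det_mulmx !det_tr det_diag det_map_mx.
  have -> : \det L = 1 by rewrite det_trig ?big1 //; apply/is_trig_mxP.
  rewrite mulr1 mul1r mulrAC -expr2 det_unit_sqr // mul1r => <-.
  rewrite /G gram_change.
  by rewrite !det_mulmx det_tr det_map_mx mulrAC -expr2 det_unit_sqr // mul1r.
- by rewrite uw2.
split; split => //.
- by rewrite U0 elt_delta.
- move=> c; rewrite -qform_sum -UE qform_conj -map_mxM Gq; congr (qnorm s _).
  by rewrite mulmx_sum_row elt_sum; apply: eq_bigr => j _; rewrite eltZ.
- by rewrite b0 G00.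
Qed.

(** * Sizes of coordinates and of basis vectors *)

Section RedBasis.
Variables (R : realType) (K : fieldExtType rat) (n : nat) (s : 'I_n.+1 -> {rmorphism K -> R[i]}).
Variables (u : 'I_n.+1 -> K) (L : 'M[R]_n.+1) (b : 'rV[R]_n.+1) (rb : red_basis s u L b).
Local Notation A := (n.+2%:R : R).
Local Notation sb k := (Num.sqrt (b 0 k)).

Let ou : is_order u s. Proof. by case: rb => -[]. Qed.
Let bp k : 0 < b 0 k. Proof. by case: rb => _ []. Qed.

Lemma red_b_le (j k : 'I_n.+1) : (j <= k)%N -> b 0 j <= 2 ^+ (k - j) * b 0 k.
Proof.
case: rb => _ [_ _ _ _ [_ bb]]; case: j k => j hj [k hk] /= jk.
rewrite -(subnKC jk) in hk *; move: (k - j)%N hk => d hk; rewrite addKn.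
elim: d hk => [|d IH] hk; first by rewrite expr0 mul1r (_ : Ordinal hj = Ordinal hk) //; apply: val_inj; rewrite /= addn0.
have hk' : (j + d < n.+1)%N by apply: leq_trans hk; rewrite addnS.
apply: le_trans (IH hk') _; rewrite exprSr -mulrA ler_wpM2l ?exprn_ge0 //.
by apply: bb; rewrite /= addnS.
Qed.

(** The entries of c L are bounded at once; c is recovered from them by solving a triangular system
    from the last coordinate down. Each step adds at most n + 1 terms, whence the base n + 2. *)
Lemma red_coord (c : 'rV[int]_n.+1) (Q : R) k : qnorm s (elt u c) <= Q ->
  `|(c 0 k)%:~R| * sb k <= A ^+ (n - k) * Num.sqrt Q.
Proof.
case: rb => -[_ _ qE] [_ _ Lz L1 [L2 _]] hQ.
have q0 : 0 <= qnorm s (elt u c) by apply: sumr_ge0 => i _; apply: sqr_ge0.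
have Q0 : 0 <= Q by apply: le_trans hQ.
have yk l : `|(mxz R c *m L) 0 l| * sb l <= Num.sqrt Q.
  rewrite -sqrtr_sqr -sqrtrM ?sqr_ge0 // ler_sqrt //; apply: le_trans hQ; rewrite qE (bigD1 l) //= mulrC lerDl.
  by apply: sumr_ge0 => i _; rewrite mulr_ge0 ?sqr_ge0 ?ltW.
have [m] := ubnP (n - k); elim: m k => // m IH k; rewrite ltnS => km.
have yE : (mxz R c *m L) 0 k = (c 0 k)%:~R + \sum_(j < n.+1 | (k < j)%N) (c 0 j)%:~R * L j k.
  rewrite !mxE (bigD1 k) //= !mxE L1 mulr1; congr (_ + _).
  rewrite (bigID (fun j : 'I_n.+1 => (k < j)%N)) /= [X in _ + X]big1 ?addr0.
    apply: eq_big => [j|j _]; last by rewrite !mxE.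
    by case: ltngtP => //= [kj|jk|/val_inj ->]; rewrite ?eqxx ?andbF ?andbT //; apply/eqP => e; rewrite e ltnn in kj.
  by move=> j /andP[jk]; rewrite -leqNgt leq_eqVlt => /orP[/eqP/val_inj e|lt]; [rewrite e eqxx in jk|rewrite Lz ?mulr0].
have sb0 l : 0 < sb l by rewrite sqrtr_gt0.
have sbk (j : 'I_n.+1) : (k < j)%N -> sb k <= 2 ^+ (j - k) * sb j.
  move=> kj; rewrite -[2 ^+ _]ger0_norm ?exprn_ge0 // -sqrtr_sqr -sqrtrM ?sqr_ge0 // ler_sqrt ?mulr_ge0 ?sqr_ge0 ?(ltW (bp _)) //.
  apply: le_trans (red_b_le (ltnW kj)) _; rewrite ler_wpM2r ?(ltW (bp _)) //.
  by rewrite expr2 ler_peMr ?exprn_ge0 // exprn_ege1 // ler1n.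
have term (j : 'I_n.+1) : (k < j)%N -> `|(c 0 j)%:~R * L j k| * sb k <= A ^+ (n - k).-1 * Num.sqrt Q.
  move=> kj; have jn : (j <= n)%N by rewrite -ltnS.
  have IHj : `|(c 0 j)%:~R| * sb j <= A ^+ (n - j) * Num.sqrt Q by apply: IH; lia.
  rewrite normrM; apply: le_trans (_ : `|(c 0 j)%:~R| * (1 / 2) * (2 ^+ (j - k) * sb j) <= _).
    by apply: ler_pM; rewrite ?mulr_ge0 ?sbk ?(ltW (sb0 _)) // ler_wpM2l ?L2.
  have -> : (j - k = (j - k).-1.+1)%N by lia.
  rewrite exprS; have -> : `|(c 0 j)%:~R| * (1 / 2) * (2 * 2 ^+ (j - k).-1 * sb j) = 2 ^+ (j - k).-1 * (`|(c 0 j)%:~R| * sb j).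
    by field.
  apply: le_trans (ler_wpM2l _ IHj) _; first by rewrite exprn_ge0.
  have -> : ((n - k).-1 = (j - k).-1 + (n - j))%N by lia.
  rewrite exprD -mulrA ler_wpM2r ?mulr_ge0 ?exprn_ge0 ?sqrtr_ge0 //.
  by rewrite lerXn2r ?nnegrE ?ler0n // ler_nat.
have ck : `|(c 0 k)%:~R| * sb k <= Num.sqrt Q + \sum_(j < n.+1 | (k < j)%N) A ^+ (n - k).-1 * Num.sqrt Q.
  have -> : (c 0 k)%:~R = (mxz R c *m L) 0 k - \sum_(j < n.+1 | (k < j)%N) (c 0 j)%:~R * L j k by rewrite yE addrK.
  apply: le_trans (_ : (`|(mxz R c *m L) 0 k| + `|\sum_(j < n.+1 | (k < j)%N) (c 0 j)%:~R * L j k|) * sb k <= _).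
    by rewrite ler_wpM2r ?(ltW (sb0 _)) // ler_normB.
  rewrite mulrDl; apply: lerD; first exact: yk.
  apply: le_trans (_ : (\sum_(j < n.+1 | (k < j)%N) `|(c 0 j)%:~R * L j k|) * sb k <= _).
    by rewrite ler_wpM2r ?(ltW (sb0 _)) // ler_norm_sum.
  by rewrite mulr_suml; apply: ler_sum => j kj; apply: term.
apply: le_trans ck _; rewrite sumr_const -[_ *+ _]mulr_natl.
have [k0|k0] := posnP (n - k).
  rewrite (_ : #|_| = 0%N) ?mul0r ?addr0 ?k0 ?expr0 ?mul1r //.
  by apply: eq_card0 => j; rewrite !inE; apply/negbTE; rewrite -leqNgt; have := ltn_ord j; lia.
have cl : (#|[pred j : 'I_n.+1 | (k < j)%N]| <= n.+1)%N by rewrite -[X in (_ <= X)%N]card_ord max_card.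
rewrite -(prednK k0) exprS.
set B := A ^+ (n - k).-1; have B1 : 1 <= B by rewrite exprn_ege1 // ler1n.
have sQ := sqrtr_ge0 Q; have Ae : A = n.+1%:R + 1 by rewrite natr1.
have BQ : 0 <= B * Num.sqrt Q by rewrite mulr_ge0 //; lra.
have h1 : (#|[pred j : 'I_n.+1 | (k < j)%N]|)%:R * (B * Num.sqrt Q) <= n.+1%:R * (B * Num.sqrt Q).
  by rewrite ler_wpM2r // ler_nat.
have h2 : Num.sqrt Q <= B * Num.sqrt Q by rewrite ler_peMl.
by rewrite -mulrA Ae mulrDl mul1r addrC lerD.
Qed.

Lemma red_q_le (k i : 'I_n.+1) : (k <= i)%N -> qnorm s (u k) <= n.+1%:R * 2 ^+ n * b 0 i.
Proof.
case: rb => -[_ _ qE] [_ _ Lz L1 [L2 _]] ki.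
rewrite -(elt_delta u k) qE map_delta_mx -rowE; under eq_bigr do rewrite mxE.
have -> : n.+1%:R * 2 ^+ n * b 0 i = \sum_(l < n.+1) 2 ^+ n * b 0 i by rewrite sumr_const card_ord -[RHS]mulr_natl mulrA.
apply: ler_sum => l _; have [lk|kl] := leqP l k; last first.
  by rewrite Lz // expr0n mulr0 mulr_ge0 ?exprn_ge0 ?ltW.
have Lkl : L k l ^+ 2 <= 1.
  have n1 : `|L k l| <= 1.
    move: lk; rewrite leq_eqVlt => /orP[/eqP/val_inj ->|lt]; first by rewrite L1 normr1.
    by apply: le_trans (L2 _ _ lt) _; lra.
  by rewrite -real_normK ?num_real // exprn_ile1.
apply: le_trans (_ : b 0 l * 1 <= _); first by rewrite ler_pM2l.
rewrite mulr1; apply: le_trans (red_b_le (leq_trans lk ki)) _.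
rewrite ler_wpM2r ?(ltW (bp _)) // ler_weXn2l ?ler1n //; have := ltn_ord i; lia.
Qed.

Lemma normc_le_qnorm (x : K) i : normc (s i x) <= Num.sqrt (qnorm s x).
Proof.
rewrite -[leLHS]ger0_norm ?normc_ge0 // -sqrtr_sqr ler_sqrt ?sumr_ge0 //; last by move=> j _; apply: sqr_ge0.
by rewrite /qnorm (bigD1 i) //= lerDl sumr_ge0 // => j _; apply: sqr_ge0.
Qed.

Lemma qnorm_mul_le (x y : K) : qnorm s (x * y) <= qnorm s x * qnorm s y.
Proof.
rewrite {1 2}/qnorm mulr_suml; apply: ler_sum => i _.
rewrite rmorphM Normc.normcM exprMn ler_wpM2l ?sqr_ge0 //.
by rewrite /qnorm (bigD1 i) //= lerDl sumr_ge0 // => j _; apply: sqr_ge0.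
Qed.

(** Let [Bm k l] be the last coordinate of u_k u_l. For each i some entry with k <= i and l <= n - i
    is nonzero; then b_max is at most the norm of u_k u_l, which is O(b_i b_(n-i)). The product over
    i gives the claim. *)
Lemma red_last_le : b 0 ord_max ^+ n.+1 <= ((n.+1%:R * 2 ^+ n) ^+ 2) ^+ n.+1 * (\prod_k b 0 k) ^+ 2.
Proof.
case: rb => -[_ _ qE] [_ _ Lz L1 [L2 _]].
pose Bm : 'M[int]_n.+1 := \matrix_(k, l) ocoord u (u k * u l) 0 ord_max.
have Ou k : zspan u (u k) by apply: zspan_w.
have last (c : 'rV[int]_n.+1) : b 0 ord_max * ((c 0 ord_max)%:~R) ^+ 2 <= qnorm s (elt u c).
  rewrite qE (bigD1 ord_max) //= (_ : (mxz R c *m L) 0 ord_max = (c 0 ord_max)%:~R); last first.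
    rewrite mxE (bigD1 ord_max) //= big1 ?addr0 ?mxE ?L1 ?mulr1 // => j jm.
    by rewrite Lz ?mulr0 //; move: jm; have := leq_ord j; rewrite leq_eqVlt => /orP[/eqP e /eqP[]|//]; apply: val_inj.
  by rewrite lerDl; apply: sumr_ge0 => i _; rewrite mulr_ge0 ?sqr_ge0 ?ltW.
(* The pairing is nondegenerate: if x is nonzero and x y = N(x), then x times y u_max has last
   coordinate N(x). *)
have Bdet : \det Bm != 0.
  apply/negP => /eqP d0; have : \det (map_mx (intr : int -> rat) Bm) = 0 by rewrite det_map_mx d0.
  move/eqP/det0P => [v v0 vB].
  have [d dn0 [c cE]] := int_vector v.
  have cB : c *m Bm = 0.
    have h : map_mx (intr : int -> rat) (c *m Bm) = 0 by rewrite map_mxM cE -scalemxAl vB scaler0.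
    apply/matrixP => p q; have /matrixP/(_ p q) := h; rewrite !mxE => /eqP; rewrite intr_eq0 => /eqP //.
  have c0 : c != 0.
    apply: contraNneq v0 => c0; apply/eqP/matrixP => p q; have /matrixP/(_ p q) := cE; rewrite c0 !mxE => /esym/eqP.
    by rewrite mulf_eq0 intr_eq0 (negPf dn0) => /eqP.
  have lam0 e : ocoord u (elt u c * elt u e) 0 ord_max = 0.
    have -> : ocoord u (elt u c * elt u e) = \sum_l \sum_k (e 0 l * c 0 k) *: ocoord u (u k * u l).
      apply: (elt_inj ou); rewrite ocoordK; last by apply: (zspanM ou); eexists.
      rewrite elt_sum {1 2}/elt mulr_sumr; apply: eq_bigr => l _; rewrite elt_sum mulr_suml; apply: eq_bigr => k _.
      rewrite eltZ ocoordK; last exact: (zspanM ou).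
      by rewrite mulrzAl mulrzAr mulrC mulrzA.
    rewrite summxE big1 // => l _; rewrite summxE; have /matrixP/(_ 0 l) := cB; rewrite !mxE => h.
    transitivity (e 0 l * (\sum_j c 0 j * Bm j l)); last by rewrite h mulr0.
    by rewrite mulr_sumr; apply: eq_bigr => k _; rewrite !mxE mulrA.
  have x0 : elt u c != 0 by apply: contraNneq c0 => h; apply/eqP; apply: (elt_inj ou); rewrite h elt0.
  have Ox : zspan u (elt u c) by eexists.
  have [y Oy xy] := onorm_dvd ou Ox.
  have [e eE] : zspan u (y * u ord_max) by apply: (zspanM ou).
  have := lam0 e; rewrite -eE mulrA xy mulrzl -(elt_delta u) -eltZ (eltK ou) !mxE !eqxx mulr1 => /eqP.
  by rewrite (negPf (onorm_neq0 ou Ox x0)).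
(* Otherwise the corner k <= i, l <= n - i of [Bm] vanishes. A permutation cannot send the i + 1
   indices k <= i into the i columns beyond n - i, so every term of the determinant would be
   zero. *)
have ex i : b 0 ord_max <= (n.+1%:R * 2 ^+ n) ^+ 2 * (b 0 i * b 0 (rev_ord i)).
  have [k [l [ki li B0]]] : exists k l : 'I_n.+1, [/\ (k <= i)%N, (l <= rev_ord i)%N & Bm k l != 0].
    apply: contrapT => h; case/eqP: Bdet; apply: big1 => p _.
    have [k ki pk] : exists2 k : 'I_n.+1, (k <= i)%N & (p k <= rev_ord i)%N.
      apply: contrapT => h2.
      have inj : {in [set k : 'I_n.+1 | (k <= i)%N]%SET &, injective p} by move=> x y _ _; apply: perm_inj.
      have sub : (p @: [set k : 'I_n.+1 | (k <= i)%N]%SET) \subset [set l : 'I_n.+1 | (rev_ord i < l)%N]%SET.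
        apply/fintype.subsetP => y /imsetP[k]; rewrite !inE => ki ->; rewrite ltnNge; apply/negP => pk.
        by apply: h2; exists k.
      have := subset_leq_card sub; rewrite (card_in_imset inj).
      have -> : [set k : 'I_n.+1 | (k <= i)%N]%SET = [set k : 'I_n.+1 | (k < i.+1)%N]%SET by apply/setP => k; rewrite !inE.
      have -> : [set l : 'I_n.+1 | (rev_ord i < l)%N]%SET = (~: [set l : 'I_n.+1 | (l < (rev_ord i).+1)%N])%SET.
        by apply/setP => l; rewrite !inE ltnS ltnNge.
      rewrite [X in (_ <= X)%N]cardsCs finset.setCK !card_ord_lt ?card_ord //= ?ltn_ord //; last by rewrite ltnS subSS leq_subr.
      by have := ltn_ord i; rewrite subSS; clear; lia.
    rewrite (bigD1 k) //= (_ : Bm k (p k) = 0) ?mul0r ?mulr0 //.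
    by apply/eqP; apply: contraT => Bk; case: h; exists k, (p k).
  have c1 : 1 <= ((Bm k l)%:~R : R) ^+ 2.
    by rewrite -rmorphXn /= ler1z -gtz0_ge1 exprn_even_gt0.
  apply: le_trans (_ : b 0 ord_max * (Bm k l)%:~R ^+ 2 <= _); first by rewrite ler_peMr // ltW.
  rewrite /Bm mxE; apply: le_trans (last _) _; rewrite ocoordK; last by apply: (zspanM ou).
  apply: le_trans (qnorm_mul_le _ _) _.
  have -> : (n.+1%:R * 2 ^+ n) ^+ 2 * (b 0 i * b 0 (rev_ord i)) = (n.+1%:R * 2 ^+ n * b 0 i) * (n.+1%:R * 2 ^+ n * b 0 (rev_ord i)) by ring.
  by apply: ler_pM; rewrite ?red_q_le // sumr_ge0 // => j _; apply: sqr_ge0.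
have -> : b 0 ord_max ^+ n.+1 = \prod_(i < n.+1) b 0 ord_max by rewrite prodr_const card_ord.
apply: le_trans (_ : \prod_(i < n.+1) ((n.+1%:R * 2 ^+ n) ^+ 2 * (b 0 i * b 0 (rev_ord i))) <= _).
  by apply: ler_prod => i _; rewrite ex ltW.
set C2 := (n.+1%:R * 2 ^+ n) ^+ 2; rewrite big_split /= prodr_const card_ord big_split /=.
have -> : \prod_(i < n.+1) b 0 (rev_ord i) = \prod_i b 0 i by rewrite [RHS](reindex_inj rev_ord_inj).
by rewrite -expr2.
Qed.
End RedBasis.

(** * Sieving elements of square norm in an order *)

Lemma normc_le_add (R : rcfType) (x y : R[i]) : normc (x + y) <= normc x + normc y.
Proof. by rewrite -lecR rmorphD; exact: (ler_normD x y). Qed.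

Lemma normcN (R : rcfType) (x : R[i]) : normc (- x) = normc x.
Proof. by case: x => a b /=; rewrite !sqrrN. Qed.

Lemma coef_prod_linear (R : realType) (l : seq (R[i] * R[i])) k :
  normc (\prod_(p <- l) (p.1 *: 'X - p.2%:P))`_k <= \prod_(p <- l) (normc p.1 + normc p.2).
Proof.
elim: l k => [|p l IH] k.
  rewrite !big_nil coef1; case: (k == 0%N); rewrite /= expr0n /= addr0 ?expr1n ?sqrtr1 //.
  by rewrite sqrtr0.
rewrite !big_cons; set q := \prod_(j <- l) _; set B := \prod_(j <- l) _.
have B0 : 0 <= B by apply: prodr_ge0 => j _; rewrite addr_ge0 ?normc_ge0.
rewrite mulrBl coefB -scalerAl coefZ coefXM mul_polyC coefZ.
apply: le_trans (normc_le_add _ _) _; rewrite normcN !Normc.normcM mulrDl.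
apply: lerD; last by rewrite ler_wpM2l ?normc_ge0.
rewrite ler_wpM2l ?normc_ge0 //; case: (k == 0%N); last exact: IH.
by rewrite /= expr0n /= addr0 sqrtr0.
Qed.

Lemma det_bound (R : realType) n (A : 'M[int]_n) (B : R) : (forall i j, `|(A i j)%:~R| <= B) ->
  `|(\det A)%:~R| <= n`!%:R * B ^+ n.
Proof.
move=> AB; rewrite rmorph_sum /=; apply: le_trans (ler_norm_sum _ _ _) _.
apply: le_trans (_ : \sum_(s : 'S_n) B ^+ n <= _); last by rewrite sumr_const card_Sn -[X in X <= _]mulr_natl.
apply: ler_sum => s _; rewrite rmorphM normrM rmorph_sign normr_sign mul1r rmorph_prod normr_prod.
have -> : B ^+ n = \prod_(i < n) B by rewrite prodr_const card_ord.
by apply: ler_prod => i _; rewrite normr_ge0 AB.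
Qed.

Lemma leq_fact (a b : nat) : (a <= b)%N -> (a`! <= b`!)%N.
Proof.
move=> ab; rewrite -(subnKC ab); elim: (b - a)%N => [|k IH]; first by rewrite addn0.
by rewrite addnS factS; apply: leq_trans IH _; rewrite leq_pmull.
Qed.

Lemma map_poly_trace_test (S : comNzRingType) (io : {rmorphism int -> S}) (a t : int) (f : {poly int}) k :
  map_poly io (a ^+ k *: f - (a *: 'X - t%:P) ^+ k) = io a ^+ k *: map_poly io f - (io a *: 'X - (io t)%:P) ^+ k.
Proof. by rewrite rmorphB /= map_polyZ !rmorphXn /= rmorphB /= map_polyZ /= map_polyX map_polyC. Qed.

(** * Integers whose prime factors are the primes to avoid *)

Section Discriminants.
Variables (R : realType) (K : fieldExtType rat) (m : nat) (w : 'I_m.+2 -> K).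
Variables (s : 'I_m.+2 -> {rmorphism K -> R[i]}) (ow : is_order w s).
Local Notation n := m.+2.
Variables (T : R) (T1 : 1 <= T).

Let T1' : 1 <= 1 + T. Proof. by rewrite lerDl (le_trans ler01 T1). Qed.
Let T0' : 0 <= 1 + T. Proof. exact: le_trans ler01 T1'. Qed.

Lemma char_poly_coef_bound (x : K) k : zspan w x -> (forall i, normc (s i x) <= T) ->
  `|((char_poly (zm w x))`_k)%:~R| <= (1 + T) ^+ n.
Proof.
move=> Ox xT; rewrite -normc_int.
have -> : ((char_poly (zm w x))`_k)%:~R = (\prod_i ('X - (s i x)%:P))`_k by rewrite -(char_poly_zm ow) // coef_map.
have := coef_prod_linear [seq (1, s i x) | i <- index_enum 'I_n] k; rewrite !big_map.
under eq_bigr do rewrite scale1r; move/le_trans; apply.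
have -> : (1 + T) ^+ n = \prod_(i < n) (1 + T) by rewrite prodr_const card_ord.
have n1 : normc (1 : R[i]) = 1 by rewrite -[X in normc X]/(1%:~R) normc_int normr1.
by apply: ler_prod => i _; rewrite addr_ge0 ?normc_ge0 // [normc (1, s i x).1]n1 lerD2l xT.
Qed.

(** D is the resultant of f and f'. Being in the ideal (f, f'), it yields a Bezout relation modulo
    every p that does not divide it; its size is bounded through the Sylvester matrix. *)
Lemma good_disc_sep (x : K) : zspan w x -> injective (fun i => s i x) -> (forall i, normc (s i x) <= T) ->
  exists2 D : int, D != 0 & `|D%:~R| <= (2 * n)`!%:R * (n%:R * (1 + T) ^+ n) ^+ (2 * n) /\
   forall p, prime p -> ~~ (p %| `|D|)%N -> separable_poly (char_poly (mxp p (zm w x))).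
Proof.
move=> Ox xinj xT; set f := char_poly (zm w x).
have szf : size f = n.+1 by rewrite size_char_poly.
have szf' : size f^`() = n.
  rewrite /deriv size_poly_eq ?szf //= -mulr_natr mulf_neq0 //.
  by have := monicP (char_poly_monic (zm w x)); rewrite /lead_coef -/f szf /= => ->.
have fC : map_poly (intr : int -> R[i]) f = \prod_i ('X - (s i x)%:P) by rewrite (char_poly_zm ow).
have D0 : resultant f f^`() != 0.
  rewrite resultant_eq0 -leqNgt; set g := gcdp f f^`(); rewrite leqNgt; apply/negP => g1.
  have [c1 c10 [h1 E1]] : exists2 c : int, c != 0 & exists h, c *: f = h * g.
    have := dvdp_gcdl f f^`(); rewrite -/g => /Pdiv.Idomain.dvdpP [[c h] /= c0 E]; exists c => //; by exists h.
  have [c2 c20 [h2 E2]] : exists2 c : int, c != 0 & exists h, c *: f^`() = h * g.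
    have := dvdp_gcdr f f^`(); rewrite -/g => /Pdiv.Idomain.dvdpP [[c h] /= c0 E]; exists c => //; by exists h.
  have gC : (size (map_poly (intr : int -> R[i]) g) != 1)%N.
    by rewrite size_map_inj_poly ?rmorph0 //; [rewrite gtn_eqF|exact: intr_inj].
  have [rho /rootP gr] := closed_rootP _ gC.
  have fr : root (map_poly (intr : int -> R[i]) f) rho.
    have := congr1 (fun q => (map_poly (intr : int -> R[i]) q).[rho]) E1.
    rewrite /= map_polyZ rmorphM /= hornerM gr mulr0 hornerZ => /eqP; rewrite mulf_eq0 intr_eq0 (negPf c10) /= => h.
    exact: h.
  have f'r : root (map_poly (intr : int -> R[i]) f^`()) rho.
    have := congr1 (fun q => (map_poly (intr : int -> R[i]) q).[rho]) E2.
    rewrite /= map_polyZ rmorphM /= hornerM gr mulr0 hornerZ => /eqP; rewrite mulf_eq0 intr_eq0 (negPf c20) /= => h.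
    exact: h.
  have sep : separable_poly (map_poly (intr : int -> R[i]) f).
    rewrite fC -(big_map (fun i => s i x) predT (fun a => 'X - a%:P)) separable_prod_XsubC map_inj_uniq //.
    exact: index_enum_uniq.
  move: sep; rewrite unlock => /coprimep_root /(_ fr).
  by rewrite deriv_map (rootP f'r) eqxx.
exists (resultant f f^`()) => //; split.
  have B1 : 1 <= n%:R * (1 + T) ^+ n :> R.
    by rewrite -[leLHS]mulr1; apply: ler_pM; rewrite ?ler01 ?ler1n ?exprn_ege1.
  set B := n%:R * (1 + T) ^+ n in B1 *.
  have fB k : `|(f`_k)%:~R| <= B.
    apply: le_trans (char_poly_coef_bound k Ox xT) _; rewrite /B; by apply: ler_peMl; rewrite ?exprn_ge0 ?ler1n.
  have f'B k : `|(f^`()`_k)%:~R| <= B.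
    rewrite coef_deriv -[_ *+ k.+1]mulr_natr intrM normrM.
    have [kn|kn] := leqP k.+1 n; last by rewrite nth_default ?szf // normr0 mul0r; lra.
    rewrite /B mulrC; apply: ler_pM; rewrite ?normr_ge0 // ?char_poly_coef_bound //.
    by rewrite natz -pmulrn normr_nat ler_nat.
  apply: le_trans (_ : ((size f^`()).-1 + (size f).-1)`!%:R * B ^+ ((size f^`()).-1 + (size f).-1) <= _).
    apply: det_bound => i j; rewrite Sylvester_mxE; case: (fintype.split i) => k.
      by case: (k <= j)%N; rewrite ?mulr1n ?mulr0n // normr0; lra.
    by case: (k <= j)%N; rewrite ?mulr1n ?mulr0n // normr0; lra.
  have le2 : ((size f^`()).-1 + (size f).-1 <= 2 * n)%N by rewrite szf szf' /= mul2n -addnn leq_add2r leqnSn.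
  apply: ler_pM; rewrite ?ler0n ?exprn_ge0 //; first by lra.
    by rewrite ler_nat; apply: leq_fact.
  by rewrite ler_weXn2l.
move=> p pp pD; have [||[u v] /= [_ _] E] := @resultant_in_ideal _ f f^`(); rewrite ?szf ?szf' //.
rewrite unlock; apply/Bezout_coprimepP.
pose io : {rmorphism int -> 'F_p} := (intr : int -> 'F_p).
have Dp : (resultant f f^`())%:~R != 0 :> 'F_p.
  move: pD; rewrite (dvdn_pcharf (pchar_Fp pp)); case: (intP (resultant f f^`())) => // k.
  by rewrite abszN rmorphN oppr_eq0.
exists (map_poly io u, map_poly io v); rewrite /= -map_char_poly -/f deriv_map -!rmorphM -rmorphD /= -E map_polyC.
by rewrite -size_poly_eq1 size_polyC Dp.
Qed.
(** The polynomial n^n f - (n X - tr)^n vanishes modulo p if f is (X - t)^n there, since then tr = n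
    t; over Z it is nonzero, for otherwise all conjugates would equal tr/n. D is its leading
    coefficient. Scaling by n keeps the test valid when p divides n. *)
Lemma good_disc_nonscalar (x : K) : zspan w x -> (exists i j, s i x != s j x) -> (forall i, normc (s i x) <= T) ->
  exists2 D : int, D != 0 & `|D%:~R| <= n%:R ^+ n * (1 + T) ^+ n + (n%:R + (1 + T) ^+ n) ^+ n /\
   forall p, prime p -> ~~ (p %| `|D|)%N -> forall t, char_poly (mxp p (zm w x)) <> ('X - t%:P) ^+ n.
Proof.
move=> Ox [i0 [j0 xij]] xT; set f := char_poly (zm w x); set tr := \tr (zm w x).
pose P : {poly int} := (n%:R ^+ n) *: f - (n%:R *: 'X - tr%:P) ^+ n.
have trE : f`_m.+1 = - tr by rewrite /f char_poly_trace.
have fC : map_poly (intr : int -> R[i]) f = \prod_i ('X - (s i x)%:P) by rewrite (char_poly_zm ow).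
have P0 : P != 0.
  apply: contraNneq xij => P0.
  have key i : n%:R * s i x = tr%:~R.
    have fr : (map_poly (intr : int -> R[i]) f).[s i x] = 0.
      by rewrite fC horner_prod; apply/eqP/prodf_eq0; exists i => //; rewrite !hornerE subrr.
    pose io : {rmorphism int -> R[i]} := (intr : int -> R[i]).
    have : (map_poly io P).[s i x] = 0 by rewrite P0 rmorph0 horner0.
    rewrite /P map_poly_trace_test !hornerE fr mulr0 add0r => /eqP; rewrite oppr_eq0 expf_eq0 /= subr_eq0 => /eqP <-; congr (_ * _).
    by rewrite (rmorph_nat io).
  by apply/eqP; apply: (mulfI (_ : n%:R != 0 :> R[i])); rewrite ?pnatr_eq0 // !key.
exists (lead_coef P); first by rewrite lead_coef_eq0.
split.
  rewrite /lead_coef; move: (size P).-1 => k; rewrite coefB coefZ intrD mulrNz.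
  apply: le_trans (ler_normB _ _) _; apply: lerD.
    rewrite intrM normrM rmorphXn /= rmorph_nat normrX normr_nat ler_wpM2l ?exprn_ge0 //.
    exact: char_poly_coef_bound.
  have := coef_prod_linear [seq (n%:R, tr%:~R : R[i]) | i <- index_enum 'I_n] k; rewrite !big_map.
  rewrite !prodr_const card_ord /= => h; rewrite -normc_int.
  have -> : (((n%:R *: 'X - tr%:P) ^+ n)`_k)%:~R = ((n%:R *: 'X - (tr%:~R)%:P) ^+ n)`_k :> R[i].
    rewrite -[LHS](coef_map (intr : int -> R[i])) rmorphXn rmorphB /= map_polyZ /= map_polyX map_polyC /= rmorph_nat //.
  apply: le_trans h _; have nc : normc (n%:R : R[i]) = n%:R by rewrite pmulrn normc_int -pmulrn normr_nat.
  have T0 : 0 <= (1 + T) ^+ n by apply: exprn_ge0.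
  apply: lerXn2r; rewrite ?nnegrE; [by apply: addr_ge0; apply: normc_ge0 | by apply: addr_ge0|].
  rewrite nc lerD2l normc_int -normrN -mulrNz -trE; exact: char_poly_coef_bound.
move=> p pp pD t ft.
pose io : {rmorphism int -> 'F_p} := (intr : int -> 'F_p).
have fp : map_poly io f = ('X - t%:P) ^+ n by rewrite /f map_char_poly.
have trp : io tr = n%:R * t.
  have := congr1 (fun q : {poly 'F_p} => q`_m.+1) fp; rewrite coef_map /= trE rmorphN /=.
  have := @coefPn_prod_XsubC _ (nseq n t) isT; rewrite size_nseq !big_nseq -[n.-1]/m.+1 => h.
  have -> : ('X - t%:P) ^+ n = iter n ( *%R ('X - t%:P)) 1 by rewrite -iter_mulr_1.
  by rewrite h => /oppr_inj ->; rewrite iter_addr_0 mulr_natl.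
have : map_poly io P = 0.
  rewrite /P rmorphB /= map_polyZ rmorphXn /= rmorph_nat fp rmorphXn rmorphB /= map_polyZ /= map_polyX map_polyC /=.
  have -> : n%:R%:~R *: 'X - (io tr)%:P = n%:R%:P * ('X - t%:P) :> {poly 'F_p}.
    rewrite trp polyCM mulrBr -mul_polyC; congr (_%:P * _ - _); exact: rmorph_nat.
  by rewrite exprMn -mul_polyC polyC_exp subrr.
move/(congr1 (fun q : {poly 'F_p} => q`_(size P).-1)); rewrite coef_map coef0 -/(lead_coef P) => /eqP h.
case/negP: pD; rewrite (dvdn_pcharf (pchar_Fp pp)); move: h; case: (intP (lead_coef P)) => // k.
by rewrite abszN /= rmorphN oppr_eq0.
Qed.
End Discriminants.

Lemma log_weight (R : realType) (eps : R) : 0 < eps -> exists2 C : R, 0 < C &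
  forall Z : R, 1 <= Z -> exists W : nat, Z <= 2 ^+ W /\ W.+1%:R ^+ 6 <= C * Z `^ eps.
Proof.
move=> e0; have e6 : 0 < eps / 6 by rewrite divr_gt0.
have l2 : 0 < ln 2 :> R by rewrite ln_gt0 // ltr1n.
exists ((eps / 6 * ln 2) ^- 6 * 8 `^ eps); first by rewrite mulr_gt0 ?powR_gt0 // invr_gt0 exprn_gt0 // mulr_gt0.
move=> Z Z1; set N := (Num.truncn Z).+1; set W := up_log 2 N; exists W.
have Z0 : 0 <= Z by apply: le_trans Z1.
have ZN : Z <= N%:R by rewrite ltW // truncnS_gt.
have NZ : N%:R <= Z + 1 by rewrite -natr1 lerD2r truncn_le.
have W1 : (2 ^ W < 2 * N)%N.
  have [N1|N1] := ltnP 1 N; last first.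
    by rewrite /W (_ : N = 1%N) ?up_log1 //; apply/eqP; rewrite eqn_leq N1.
  have /andP[h _] := up_log_bounds (isT : 1 < 2)%N N1; move: h; rewrite -/W.
  case: (W) => [|k] /= h; first by rewrite expn0 mul2n -addnn; apply: leq_trans (leq_addr _ _).
  by rewrite expnS ltn_pmul2l.
split; first by apply: le_trans ZN _; rewrite -natrX ler_nat up_logP.
have h2 : (2 : R) ^+ W.+1 <= 8 * Z.
  rewrite exprS; have : (2 : R) ^+ W <= 2 * N%:R by rewrite -natrX -natrM ler_nat ltnW.
  by move: NZ Z1; clear; lra.
have := ln_le_powR e6 (exprn_gt0 W.+1 (ltr0n R 2)); rewrite lnXn // => h.
have p0 : 0 <= (2 ^+ W.+1 : R) `^ (eps / 6) by apply: powR_ge0.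
have h3 : W.+1%:R <= (eps / 6 * ln 2)^-1 * (2 ^+ W.+1) `^ (eps / 6) :> R.
  rewrite ler_pdivlMl ?mulr_gt0 //; move: h; rewrite ler_pdivlMr // -mulr_natr.
  by congr (_ <= _); ring.
apply: le_trans (_ : ((eps / 6 * ln 2)^-1 * (2 ^+ W.+1) `^ (eps / 6)) ^+ 6 <= _).
  by apply: lerXn2r => //; rewrite nnegrE // mulr_ge0 // invr_ge0 ltW // mulr_gt0.
rewrite exprMn exprVn -[X in _ <= X]mulrA; apply: ler_wpM2l; first by rewrite invr_ge0 exprn_ge0 // ltW // mulr_gt0.
rewrite -[X in X <= _]powR_mulrn // -powRrM mulfVK // -powRM //.
by apply: ge0_ler_powR; rewrite ?nnegrE ?mulr_ge0 ?exprn_ge0 // ltW.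
Qed.

Lemma absz_le (R : realType) (D : int) (W : nat) : `|D%:~R| <= 2 ^+ W :> R -> (`|D| <= 2 ^ W)%N.
Proof. by rewrite -(ler_nat R) natr_absz intr_norm natrX. Qed.

Lemma onorm_le (R : realType) (K : fieldExtType rat) n (w : 'I_n -> K) (s : 'I_n -> {rmorphism K -> R[i]})
  (T : R) (x : K) : is_order w s -> zspan w x -> (forall i, normc (s i x) <= T) -> `|(onorm w x)%:~R| <= T ^+ n.
Proof.
move=> ow Ox xT; rewrite -normc_int (onormE ow Ox) normc_prod.
have -> : T ^+ n = \prod_(i < n) T by rewrite prodr_const card_ord.
by apply: ler_prod => i _; rewrite normc_ge0 xT.
Qed.

Lemma powR_weight (R : realType) (eps c U : R) (k : nat) : 0 < eps -> 1 <= c -> 1 <= U ->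
  (c * U ^+ k.+1) `^ (eps / k.+1%:R) = c `^ (eps / k.+1%:R) * U `^ eps.
Proof.
move=> e0 c1 U1; have U0 : 0 <= U by apply: le_trans U1.
rewrite powRM ?exprn_ge0 //; last by apply: le_trans c1.
by rewrite -powR_mulrn // -powRrM mulrCA divff ?mulr1.
Qed.

Lemma zm_nat (R : realType) (K : fieldExtType rat) n (w : 'I_n -> K) (s : 'I_n -> {rmorphism K -> R[i]}) k :
  is_order w s -> zm w k%:R = k%:R%:M.
Proof. by move=> ow; have := zm_int ow k; rewrite -pmulrn => ->; rewrite -natz. Qed.

Lemma sep_const (R : realType) n : (0 < n)%N -> exists2 c : R, 1 <= c & forall T, 1 <= T ->
  (2 * n)`!%:R * (n%:R * (1 + T) ^+ n) ^+ (2 * n) <= c * T ^+ (n * (2 * n)).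
Proof.
move=> n0; exists ((2 * n)`!%:R * (n%:R * 2 ^+ n) ^+ (2 * n)).
  rewrite -[X in X <= _]mulr1; apply: ler_pM; rewrite ?ler01 ?ler1n ?fact_gt0 // exprn_ege1 //.
  by rewrite -[X in X <= _]mulr1; apply: ler_pM; rewrite ?ler01 ?ler1n // exprn_ege1 // ler1n.
move=> T T1; have T2 : 1 + T <= 2 * T by lra.
have T0 : 0 <= T by lra.
have T3 : 0 <= 1 + T by lra.
rewrite -[X in _ <= X]mulrA ler_wpM2l ?ler0n // [T ^+ (n * _)]exprM -exprMn.
apply: lerXn2r; rewrite ?nnegrE ?mulr_ge0 ?exprn_ge0 ?ler0n //.
by rewrite -mulrA ler_wpM2l ?ler0n // -exprMn; apply: lerXn2r; rewrite ?nnegrE ?mulr_ge0.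
Qed.

Lemma trace_const (R : realType) n : (0 < n)%N -> exists2 c : R, 1 <= c & forall T, 1 <= T ->
  n%:R ^+ n * (1 + T) ^+ n + (n%:R + (1 + T) ^+ n) ^+ n <= c * T ^+ (n * n).
Proof.
move=> n0; exists (n%:R ^+ n * 2 ^+ n + ((n%:R + 1) * 2 ^+ n) ^+ n).
  have h1 : 1 <= n%:R ^+ n * 2 ^+ n :> R.
    by rewrite -[X in X <= _]mulr1; apply: ler_pM; rewrite ?ler01 // exprn_ege1 // ler1n.
  have : 0 <= ((n%:R + 1) * 2 ^+ n) ^+ n :> R by rewrite exprn_ge0 // mulr_ge0 ?exprn_ge0 // addr_ge0 ?ler0n.
  by move: h1 => u1 u2; rewrite -[X in X <= _]addr0 lerD.
move=> T T1; have T2 : 1 + T <= 2 * T by lra.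
have T0 : 0 <= T by lra.
have T3 : 0 <= 1 + T by lra.
have T4 : (1 + T) ^+ n <= 2 ^+ n * T ^+ n by rewrite -exprMn; apply: lerXn2r; rewrite ?nnegrE ?mulr_ge0.
have Tn : 1 <= T ^+ n by rewrite exprn_ege1.
have p2 : 1 <= 2 ^+ n :> R by rewrite exprn_ege1 // ler1n.
have TT : T ^+ n <= T ^+ (n * n) by rewrite exprM ler_eXnr.
have n0' : 0 <= n%:R :> R by rewrite ler0n.
rewrite [X in _ <= X]mulrDl; apply: lerD.
  rewrite -mulrA ler_wpM2l ?exprn_ge0 //; apply: le_trans T4 _; rewrite ler_wpM2l ?exprn_ge0 //.
rewrite [T ^+ (n * n)]exprM -exprMn; apply: lerXn2r; rewrite ?nnegrE ?addr_ge0 ?mulr_ge0 ?exprn_ge0 ?addr_ge0 //.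
rewrite -[X in _ <= X]mulrA mulrDl mul1r; apply: lerD => //; apply: ler_peMr => //.
by rewrite -[X in X <= _]mulr1; apply: ler_pM; rewrite ?ler01.
Qed.

(** All integers involved, norms and bad-prime discriminants alike, are polynomially bounded in T
    and e, so one exponent W serves for all and its sixth power costs an epsilon. In the proof k is
    the total degree of the two discriminant bounds, plus 1 for e. *)
Lemma disc_weight (R : realType) m (eps : R) : 0 < eps -> exists2 C : R, 0 < C &
  forall (K : fieldExtType rat) (w : 'I_m.+2 -> K) (s : 'I_m.+2 -> {rmorphism K -> R[i]}) (T : R) (e : int),
  is_order w s -> 1 <= T -> e != 0 -> exists W : nat, W.+1%:R ^+ 6 <= C * (T * `|e%:~R|) `^ eps /\
  [/\ (forall x, zspan w x -> (forall i, normc (s i x) <= T) -> (`|(e * onorm w x)%R| <= 2 ^ W)%N),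
    (forall x, zspan w x -> injective (fun i => s i x) -> (forall i, normc (s i x) <= T) ->
      exists D : int, [/\ D != 0, (`|D| <= 2 ^ W)%N & forall p, prime p -> ~~ (p %| `|D|)%N ->
        good1 (zm w x) e p]) &
    (forall x v, zspan w x -> zspan w v -> injective (fun i => s i x) -> (exists i j, s i v != s j v) ->
      (forall i, normc (s i x) <= T) -> (forall i, normc (s i v) <= T) ->
      exists D : int, [/\ D != 0, (`|D| <= 2 ^ W)%N & forall p, prime p -> ~~ (p %| `|D|)%N ->
        good2 (zm w v) (zm w x) e p])].
Proof.
move=> e0; have [c1 c11 c1P] := @sep_const R m.+2 isT; have [c2 c21 c2P] := @trace_const R m.+2 isT.
set n := m.+2 in c1P c2P *.
set k := (n * (2 * n) + n * n + 1)%N; have kE : k = k.-1.+1 by rewrite /k addn1.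
have ek : 0 < eps / k.-1.+1%:R by rewrite divr_gt0 // ltr0n.
have [C C0 CP] := log_weight ek.
exists (C * (c1 * c2) `^ (eps / k.-1.+1%:R)); first by rewrite mulr_gt0 ?powR_gt0 // mulr_gt0 // (lt_le_trans ltr01).
move=> K w s T e ow T1 e0'; have T0 : 0 <= T by apply: le_trans T1.
have e1 : 1 <= `|e%:~R| :> R by rewrite -intr_norm ler1z -gtz0_ge1 normr_gt0.
have U1 : 1 <= T * `|e%:~R| by rewrite -[X in X <= _]mulr1; apply: ler_pM; rewrite ?ler01.
have c12 : 1 <= c1 * c2 by rewrite -[X in X <= _]mulr1; apply: ler_pM; rewrite ?ler01.
have c10 : 0 <= c1 by apply: le_trans c11.
have c20 : 0 <= c2 by apply: le_trans c21.
have Z1 : 1 <= c1 * c2 * (T * `|e%:~R|) ^+ k.-1.+1 by rewrite -[X in X <= _]mulr1; apply: ler_pM; rewrite ?ler01 ?exprn_ege1.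
have [W [WZ W6]] := CP _ Z1; exists W; split; first by rewrite -mulrA -powR_weight.
have eU : T ^+ k.-1 * `|e%:~R| <= (T * `|e%:~R|) ^+ k.-1.+1.
  rewrite exprMn; apply: ler_pM; rewrite ?exprn_ge0 //; last by rewrite ler_eXnr.
  by rewrite ler_weXn2l.
have b12 (D : int) : `|D%:~R| <= c1 * T ^+ (n * (2 * n)) * (c2 * T ^+ (n * n)) * `|e%:~R| :> R -> (`|D| <= 2 ^ W)%N.
  move=> h; apply: (@absz_le R); apply: le_trans h _; apply: le_trans WZ.
  have -> : c1 * T ^+ (n * (2 * n)) * (c2 * T ^+ (n * n)) * `|e%:~R| = c1 * c2 * (T ^+ k.-1 * `|e%:~R|).
    have -> : k.-1 = (n * (2 * n) + n * n)%N by rewrite /k addn1.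
    by rewrite exprD; move: (T ^+ (n * (2 * n))) (T ^+ (n * n)) => x y; ring.
  apply: ler_wpM2l eU; exact: mulr_ge0.
have Tp j : 1 <= T ^+ j by rewrite exprn_ege1.
have nF : forall p (E : int), prime p -> ~~ (p %| `|E|)%N -> E%:~R != 0 :> 'F_p.
  move=> p E pp; rewrite (dvdn_pcharf (pchar_Fp pp)); case: (intP E) => // j.
  by rewrite abszN rmorphN oppr_eq0.
split.
- move=> x Ox xT; apply: (@absz_le R); apply: le_trans WZ; rewrite intrM normrM mulrC.
  apply: le_trans (_ : T ^+ k.-1 * `|e%:~R| <= _).
    rewrite ler_wpM2r //; apply: le_trans (onorm_le ow Ox xT) _; rewrite ler_weXn2l // /k addn1 -[_.+1.-1]/(_ + _)%N -{1}[n]muln1; apply: leq_trans (leq_addr _ _); by rewrite leq_pmul2l // muln_gt0.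
  by apply: le_trans eU _; rewrite ler_peMl // exprn_ge0 // mulr_ge0.
- move=> x Ox xinj xT; have [D1 D10 [D1b D1p]] := good_disc_sep ow T1 Ox xinj xT; exists (D1 * e); split.
  + by rewrite mulf_neq0.
  + apply: b12; rewrite intrM normrM ler_wpM2r //; apply: le_trans D1b _; apply: le_trans (c1P _ T1) _.
    apply: ler_peMr; first by rewrite mulr_ge0 ?exprn_ge0.
    by rewrite -[X in X <= _]mulr1; apply: ler_pM; rewrite ?ler01 ?Tp.
  + move=> p pp; rewrite abszM Euclid_dvdM // negb_or => /andP[p1 p2]; split; first exact: nF.
    exact: D1p.
- move=> x v Ox Ov xinj vij xT vT; have [D1 D10 [D1b D1p]] := good_disc_sep ow T1 Ox xinj xT.
  have [D2 D20 [D2b D2p]] := good_disc_nonscalar ow T1 Ov vij vT; exists (D1 * D2 * e); split.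
  + by rewrite !mulf_neq0.
  + apply: b12; rewrite !intrM !normrM ler_wpM2r //; apply: ler_pM => //.
      by apply: le_trans D1b _; apply: c1P.
    by apply: le_trans D2b _; apply: c2P.
  + move=> p pp; rewrite !abszM !Euclid_dvdM // !negb_or => /andP[/andP[p1 p2] p3]; split; first exact: nF.
      exact: D1p.
    exact: D2p.
Qed.

(** * Counting along the first two coordinates *)

Lemma fibre2 (R : realType) m (eps : R) : 0 < eps -> exists2 C : R, 0 < C &
  forall (K : fieldExtType rat) (w : 'I_m.+2 -> K) (s : 'I_m.+2 -> {rmorphism K -> R[i]}) (T : R) (e : int) (v b0 : K) X Y
    (l : seq (nat * nat)), is_order w s -> 1 <= T -> e != 0 ->
  zspan w v -> zspan w b0 -> (exists i j, s i v != s j v) -> injective (fun i => s i b0) ->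
  (forall i, normc (s i v) <= T) -> (forall i, normc (s i b0) <= T) -> (0 < Y)%N -> (Y <= X)%N -> (X <= Y ^ 2)%N ->
  uniq l -> (forall xy, xy \in l -> [/\ (xy.1 < X)%N, (xy.2 < Y)%N, b0 + xy.1%:R + xy.2%:R * v != 0,
     forall i, normc (s i (b0 + xy.1%:R + xy.2%:R * v)) <= T &
     exists t : int, e * onorm w (b0 + xy.1%:R + xy.2%:R * v) = t ^+ 2]) ->
  (size l)%:R <= C * (T * `|e%:~R|) `^ eps * (X * Y)%:R `^ (2 / 3 + eps).
Proof.
move=> e0; have [C1 C10 C1P] := @disc_weight R m eps e0; have [C2 C20 C2P] := @square_sieve2 R m.+2 eps e0.
exists (C2 * C1); first exact: mulr_gt0.
move=> K w s T e v b0 X Y l ow T1 en0 Ov Ob vij binj vT bT Y0 YX XY ul lP.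
have [W [W6 [Wn _ W2]]] := C1P K w s T e ow T1 en0.
have [D [D0 DW Dp]] := W2 _ _ Ob Ov binj vij bT vT.
have nfE x y : nform2 (zm w v) (zm w b0) x y = onorm w (b0 + x%:R + y%:R * v).
  rewrite /nform2 /onorm; congr (\det _).
  have Ox : zspan w x%:R := zspan_nat ow x; have Oyv : zspan w (y%:R * v) by apply: (zspanM ow) => //; apply: zspan_nat ow y.
  rewrite (zmD ow (zspanD Ob Ox) Oyv) (zmD ow Ob Ox) (zmM ow (zspan_nat ow y) Ov).
  rewrite !(zm_nat _ ow) mul_scalar_mx.
  by rewrite [zm w b0 + _]addrC addrAC.
have := C2P (zm w v) (zm w b0) e D W X Y l; rewrite [_ * C1]mulrC => /(_ _ _ _ _ _ _ _ _ _) h.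
apply: le_trans (h _ _ _ _ _ _ _ _ _) _ => //.
- exact: (zm_comm ow).
- by move=> p pp _ pD; apply: Dp.
- move=> xy /lP [x1 y1 n0 nT [t te]]; rewrite !nfE; split=> //; last by exists t.
    apply: mulf_neq0 => //; apply: (onorm_neq0 ow) => //.
    by apply: zspanD; [apply: zspanD => //; apply: zspan_nat ow _ | apply: (zspanM ow) => //; apply: zspan_nat ow _].
  apply: Wn => //.
  by apply: zspanD; [apply: zspanD => //; apply: zspan_nat ow _ | apply: (zspanM ow) => //; apply: zspan_nat ow _].
have P0 : 0 <= (X * Y)%:R `^ (2 / 3 + eps) by apply: powR_ge0.
have -> : C1 * C2 * (T * `|e%:~R|) `^ eps * (X * Y)%:R `^ (2 / 3 + eps) =
  C2 * (X * Y)%:R `^ (2 / 3 + eps) * (C1 * (T * `|e%:~R|) `^ eps) by ring.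
by apply: ler_wpM2l W6; apply: mulr_ge0 => //; apply: ltW.
Qed.

Lemma fibre1 (R : realType) m (eps : R) : 0 < eps -> exists2 C : R, 0 < C &
  forall (K : fieldExtType rat) (w : 'I_m.+2 -> K) (s : 'I_m.+2 -> {rmorphism K -> R[i]}) (T : R) (e : int) (b0 : K) X
    (l : seq nat), is_order w s -> 1 <= T -> e != 0 ->
  zspan w b0 -> injective (fun i => s i b0) -> (forall i, normc (s i b0) <= T) -> (0 < X)%N ->
  uniq l -> (forall x, x \in l -> [/\ (x < X)%N, b0 + x%:R != 0,
     forall i, normc (s i (b0 + x%:R)) <= T & exists t : int, e * onorm w (b0 + x%:R) = t ^+ 2]) ->
  (size l)%:R <= C * (T * `|e%:~R|) `^ eps * X%:R `^ (1 / 2 + eps).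
Proof.
move=> e0; have [C1 C10 C1P] := @disc_weight R m eps e0; have [C2 C20 C2P] := @square_sieve1 R m.+2 eps e0 isT.
exists (C2 * C1); first exact: mulr_gt0.
move=> K w s T e b0 X l ow T1 en0 Ob binj bT X0 ul lP.
have [W [W6 [Wn W1 _]]] := C1P K w s T e ow T1 en0.
have [||i|D [D0 DW Dp]] := W1 (- b0).
- exact: zspanN.
- by move=> i j /=; rewrite !rmorphN => /oppr_inj; apply: binj.
- by rewrite rmorphN normcN.
have zN : zm w (- b0) = - zm w b0.
  by have := zmMz ow (-1) Ob; rewrite mulrN1z => ->; rewrite scaleN1r.
have nfE x : nform1 (zm w (- b0)) x = onorm w (b0 + x%:R).
  rewrite /nform1 /char_poly -horner_evalE -det_map_mx /onorm; congr (\det _); rewrite (zmD ow Ob (zspan_nat ow x)) zN (zm_nat _ ow).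
  apply/matrixP => i j; rewrite /char_poly_mx !mxE /= /horner_eval hornerD hornerN hornerMn hornerX hornerC opprK addrC //.
have := C2P (zm w (- b0)) e D W X l => h.
apply: le_trans (h _ _ _ _ _ _) _ => //.
- by move=> p pp _ pD; apply: Dp.
- move=> x /lP [x1 n0 nT [t te]]; rewrite !nfE; split=> //; last by exists t.
    apply: mulf_neq0 => //; apply: (onorm_neq0 ow) => //.
    by apply: zspanD => //; apply: zspan_nat ow _.
  by apply: Wn => //; apply: zspanD => //; apply: zspan_nat ow _.
have P0 : 0 <= X%:R `^ (1 / 2 + eps) by apply: powR_ge0.
have -> : C2 * C1 * (T * `|e%:~R|) `^ eps * X%:R `^ (1 / 2 + eps) =
  C2 * X%:R `^ (1 / 2 + eps) * (C1 * (T * `|e%:~R|) `^ eps) by ring.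
by apply: ler_wpM2l W6; apply: mulr_ge0 => //; apply: ltW.
Qed.

Lemma size_fibres (R : realType) (A B : eqType) (l : seq A) (f : A -> B) (F : R) :
  (forall b, b \in map f l -> (size [seq x <- l | f x == b])%:R <= F) ->
  (size l)%:R <= (size (undup (map f l)))%:R * F.
Proof.
move=> h; set U := undup (map f l).
have -> : size l = (\sum_(b <- U) size [seq x <- l | f x == b])%N.
  under eq_bigr do rewrite size_filter -sum1_count big_mkcond.
  rewrite exchange_big /= -sum1_size big_seq [RHS]big_seq; apply: eq_bigr => x xl.
  rewrite -big_mkcond sum1_count (eq_count (a2 := pred1 (f x))) => [|b]; last by rewrite /= eq_sym.
  by rewrite count_uniq_mem ?undup_uniq // mem_undup map_f.
rewrite natr_sum -sum1_size natr_sum mulr_suml big_seq [X in _ <= X]big_seq; apply: ler_sum => b bU.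
by rewrite mul1r h // -mem_undup.
Qed.

Lemma size_undup_card (A : eqType) (B : finType) (l : seq A) (g : A -> B) :
  {in l &, injective g} -> (size (undup l) <= #|B|)%N.
Proof.
move=> gi; rewrite -(size_map g); have u : uniq (map g (undup l)).
  by rewrite map_inj_in_uniq ?undup_uniq // => x y; rewrite !mem_undup; apply: gi.
by rewrite -(card_uniqP u) max_card.
Qed.

Lemma box_count n (T : 'I_n -> nat) (l : seq 'rV[int]_n) : uniq l ->
  (forall c, c \in l -> forall k, (`|(c 0 k)%R| <= T k)%N) -> (size l <= \prod_k (2 * T k).+1)%N.
Proof.
move=> ul lT.
pose g (c : 'rV[int]_n) : {dffun forall k : 'I_n, 'I_(2 * T k).+1} := finfun (fun k => inord (absz (c 0%R k + (T k)%:Z)%R)).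
have gi : {in l &, injective g}.
  move=> c d cl dl e; apply/matrixP => a k; rewrite ord1; have := congr1 (fun h : {dffun _} => nat_of_ord (h k)) e.
  have := lT c cl k; have := lT d dl k; rewrite /g !ffunE; move: (c 0 k) (d 0 k) => x y hy hx.
  by rewrite !inordK; lia.
have := size_undup_card gi; rewrite undup_id // => /leq_trans; apply.
rewrite card_dep_ffun foldrE big_map big_enum /=; under eq_bigr do rewrite card_ord.
by [].
Qed.

Lemma normc_sg (R : realType) (K : fieldExtType rat) (f : {rmorphism K -> R[i]}) (sg : int) (x : K) :
  sg ^+ 2 = 1 -> normc (f (sg%:~R * x)) = normc (f x).
Proof.
move=> s1; rewrite rmorphM rmorph_int Normc.normcM normc_int.
suff -> : `|sg%:~R| = 1 :> R by rewrite mul1r.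
by move/eqP: s1; rewrite sqrf_eq1 => /orP[]/eqP ->; rewrite ?normr1 // mulrN1z normrN1.
Qed.

(** The sieve counts natural coordinates, while here they carry fixed signs. Multiplication by sg
    makes the first one positive and moves the other sign into v; the norm changes by sg^n, which
    goes into e. *)
Lemma fibre_quad2 (R : realType) m (eps : R) : 0 < eps -> exists2 C : R, 0 < C &
  forall (K : fieldExtType rat) (w : 'I_m.+2 -> K) (s : 'I_m.+2 -> {rmorphism K -> R[i]}) (T : R) (e : int) (v b0 : K) X Y
    (l : seq K) (p q : K -> nat) (sg tg : int), is_order w s -> 1 <= T -> e != 0 -> sg ^+ 2 = 1 -> tg ^+ 2 = 1 ->
  zspan w v -> zspan w b0 -> (exists i j, s i v != s j v) -> injective (fun i => s i b0) ->
  (forall i, normc (s i v) <= T) -> (forall i, normc (s i b0) <= T) -> (0 < Y)%N -> (Y <= X)%N -> (X <= Y ^ 2)%N ->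
  uniq l -> (forall b, b \in l -> [/\ zspan w b, b = b0 + (sg * p b)%:~R + (tg * q b)%:~R * v, (p b < X)%N && (q b < Y)%N, b != 0 &
     (forall i, normc (s i b) <= T) /\ exists t : int, e * onorm w b = t ^+ 2]) ->
  (size l)%:R <= C * (T * `|e%:~R|) `^ eps * (X * Y)%:R `^ (2 / 3 + eps).
Proof.
move=> e0; have [C C0 CP] := @fibre2 R m eps e0; exists C => //.
move=> K w s T e v b0 X Y l p q sg tg ow T1 en0 sg1 tg1 Ov Ob vij binj vT bT Y0 YX XY ul lP.
have sgn0 : sg != 0 by apply: contra_eq_neq sg1 => ->; rewrite expr0n.
have tgn0 : tg != 0 by apply: contra_eq_neq tg1 => ->; rewrite expr0n.
have st1 : (sg * tg) ^+ 2 = 1 by rewrite exprMn sg1 tg1 mulr1.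
have sgK : (sg%:~R : K) ^+ 2 = 1 by rewrite -rmorphXn sg1.
have sgK0 : sg%:~R != 0 :> K by apply: contra_eq_neq sgK => ->; rewrite expr0n eq_sym oner_eq0.
have eE : `|(e * sg ^+ m.+2)%:~R| = `|e%:~R| :> R.
  rewrite intrM normrM rmorphXn normrX (_ : `|sg%:~R| = 1) ?expr1n ?mulr1 //.
  by move/eqP: sg1; rewrite sqrf_eq1 => /orP[]/eqP ->; rewrite ?normr1 // mulrN1z normrN1.
have bE b : b \in l -> sg%:~R * b0 + (p b)%:R + (q b)%:R * ((sg * tg)%:~R * v) = sg%:~R * b.
  move=> /lP[_ E _ _ _]; rewrite [in RHS]E !intrM -!pmulrn.
  transitivity (sg%:~R * b0 + (sg%:~R ^+ 2) * (p b)%:R + (q b)%:R * (sg%:~R * tg%:~R * v)); last by ring.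
  by rewrite sgK mul1r.
have sginj : injective (fun x : K => sg%:~R * x) by apply: mulfI.
have pinj : {in l &, injective (fun b => (p b, q b))}.
  by move=> b c bl cl [E1 E2]; apply: sginj; rewrite /= -(bE b bl) -(bE c cl) E1 E2.
have := CP K w s T (e * sg ^+ m.+2) ((sg * tg)%:~R * v) (sg%:~R * b0) X Y [seq (p b, q b) | b <- l] ow T1.
rewrite size_map eE; apply => //.
- by rewrite mulf_neq0 // expf_neq0.
- by apply: (zspanM ow) => //; apply: zspan_int ow _.
- by apply: (zspanM ow) => //; apply: zspan_int ow _.
- have [i [j ij]] := vij; exists i, j; apply: contra_neq ij; rewrite !rmorphM !rmorph_int; apply: mulfI.
  by rewrite -intrM intr_eq0 mulf_neq0.
- by move=> i j /=; rewrite !rmorphM !rmorph_int => /mulfI h; apply: binj; apply: h; rewrite intr_eq0.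
- by move=> i; rewrite normc_sg.
- by move=> i; rewrite normc_sg.
- by rewrite map_inj_in_uniq.
move=> xy /mapP[b bl ->] /=; rewrite (bE b bl); have [Obb _ /andP[h1 h2] bn0 [nb [t te]]] := lP b bl; split=> //.
- by rewrite mulf_neq0.
- by move=> i; rewrite normc_sg.
exists t; rewrite (onormM ow (zspan_int ow _) Obb) (onorm_int ow) -te.
have s2 : sg ^+ m.+2 * sg ^+ m.+2 = 1 by rewrite -exprMn -expr2 sg1 expr1n.
by rewrite -mulrA [sg ^+ _ * _]mulrA s2 mul1r.
Qed.

Lemma fibre_half1 (R : realType) m (eps : R) : 0 < eps -> exists2 C : R, 0 < C &
  forall (K : fieldExtType rat) (w : 'I_m.+2 -> K) (s : 'I_m.+2 -> {rmorphism K -> R[i]}) (T : R) (e : int) (b0 : K) X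
    (l : seq K) (p : K -> nat) (sg : int), is_order w s -> 1 <= T -> e != 0 -> sg ^+ 2 = 1 ->
  zspan w b0 -> injective (fun i => s i b0) -> (forall i, normc (s i b0) <= T) -> (0 < X)%N ->
  uniq l -> (forall b, b \in l -> [/\ zspan w b, b = b0 + (sg * p b)%:~R, (p b < X)%N, b != 0 &
     (forall i, normc (s i b) <= T) /\ exists t : int, e * onorm w b = t ^+ 2]) ->
  (size l)%:R <= C * (T * `|e%:~R|) `^ eps * X%:R `^ (1 / 2 + eps).
Proof.
move=> e0; have [C C0 CP] := @fibre1 R m eps e0; exists C => //.
move=> K w s T e b0 X l p sg ow T1 en0 sg1 Ob binj bT X0 ul lP.
have sgn0 : sg != 0 by apply: contra_eq_neq sg1 => ->; rewrite expr0n.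
have sgK : (sg%:~R : K) ^+ 2 = 1 by rewrite -rmorphXn sg1.
have sgK0 : sg%:~R != 0 :> K by apply: contra_eq_neq sgK => ->; rewrite expr0n eq_sym oner_eq0.
have eE : `|(e * sg ^+ m.+2)%:~R| = `|e%:~R| :> R.
  rewrite intrM normrM rmorphXn normrX (_ : `|sg%:~R| = 1) ?expr1n ?mulr1 //.
  by move/eqP: sg1; rewrite sqrf_eq1 => /orP[]/eqP ->; rewrite ?normr1 // mulrN1z normrN1.
have bE b : b \in l -> sg%:~R * b0 + (p b)%:R = sg%:~R * b.
  move=> /lP[_ E _ _ _]; rewrite [in RHS]E !intrM -!pmulrn.
  transitivity (sg%:~R * b0 + (sg%:~R ^+ 2) * (p b)%:R); last by ring.
  by rewrite sgK mul1r.
have sginj : injective (fun x : K => sg%:~R * x) by apply: mulfI.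
have pinj : {in l &, injective p}.
  by move=> b c bl cl E1; apply: sginj; rewrite /= -(bE b bl) -(bE c cl) E1.
have := CP K w s T (e * sg ^+ m.+2) (sg%:~R * b0) X [seq p b | b <- l] ow T1.
rewrite size_map eE; apply => //.
- by rewrite mulf_neq0 // expf_neq0.
- by apply: (zspanM ow) => //; apply: zspan_int ow _.
- by move=> i j /=; rewrite !rmorphM !rmorph_int => /mulfI h; apply: binj; apply: h; rewrite intr_eq0.
- by move=> i; rewrite normc_sg.
- by rewrite map_inj_in_uniq.
move=> xy /mapP[b bl ->] /=; rewrite (bE b bl); have [Obb _ h1 bn0 [nb [t te]]] := lP b bl; split=> //.
- by rewrite mulf_neq0.
- by move=> i; rewrite normc_sg.
exists t; rewrite (onormM ow (zspan_int ow _) Obb) (onorm_int ow) -te.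
have s2 : sg ^+ m.+2 * sg ^+ m.+2 = 1 by rewrite -exprMn -expr2 sg1 expr1n.
by rewrite -mulrA [sg ^+ _ * _]mulrA s2 mul1r.
Qed.

Definition sievable (R : realType) (K : fieldExtType rat) n (w : 'I_n -> K) (s : 'I_n -> {rmorphism K -> R[i]})
    (T : R) (e : int) (b : K) :=
  [/\ zspan w b, injective (fun i => s i b), (forall i, normc (s i b) <= T) & exists t : int, e * onorm w b = t ^+ 2].

Lemma sievable_neq0 (R : realType) (K : fieldExtType rat) m (w : 'I_m.+2 -> K) (s : 'I_m.+2 -> {rmorphism K -> R[i]})
  T e b : sievable w s T e b -> b != 0.
Proof.
case=> _ binj _ _; apply/eqP => b0; have := binj ord0 (lift ord0 ord0); rewrite /= b0 !rmorph0 => /(_ erefl).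
by move/(congr1 val).
Qed.

Definition sgb (b : bool) : int := if b then 1 else -1.
Lemma sgb2 b : sgb b ^+ 2 = 1. Proof. by case: b. Qed.
Lemma sgbE (x : int) : x = sgb (0 <= x) * `|x|%N.
Proof. rewrite /sgb; case: (lerP 0 x) => h; lia. Qed.

Lemma fibre_count2 (R : realType) m (eps : R) : 0 < eps -> exists2 C : R, 0 < C &
  forall (K : fieldExtType rat) (w : 'I_m.+2 -> K) (s : 'I_m.+2 -> {rmorphism K -> R[i]}) (T : R) (e : int) (v b0 : K) X Y
    (l : seq K) (p q : K -> int), is_order w s -> 1 <= T -> e != 0 -> zspan w v -> sievable w s T e b0 ->
  (exists i j, s i v != s j v) -> (forall i, normc (s i v) <= T) -> (0 < Y)%N -> (Y <= X)%N -> (X <= Y ^ 2)%N ->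
  uniq l -> (forall b, b \in l -> [/\ sievable w s T e b, b = b0 + (p b)%:~R + (q b)%:~R * v, (`|p b| < X)%N & (`|q b| < Y)%N]) ->
  (size l)%:R <= C * (T * `|e%:~R|) `^ eps * (X * Y)%:R `^ (2 / 3 + eps).
Proof.
move=> e0; have [C C0 CP] := @fibre_quad2 R m eps e0; exists (4 * C); first by rewrite mulr_gt0.
move=> K w s T e v b0 X Y l p q ow T1 en0 Ov [Ob binj bT _] vij vT Y0 YX XY ul lP.
set F := (T * _) `^ _; set G := _ `^ (2 / 3 + eps).
have F0 : 0 <= C * F * G by rewrite !mulr_ge0 ?powR_ge0 ?ltW.
apply: le_trans (@size_fibres R _ _ l (fun b => (0 <= p b, 0 <= q b)) (C * F * G) _) _.
  move=> [s1 s2] _.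
  apply: (CP K w s T e v b0 X Y _ (fun b => `|p b|%N) (fun b => `|q b|%N) (sgb s1) (sgb s2)) => //; rewrite ?sgb2 ?filter_uniq //.
  move=> b; rewrite mem_filter => /andP[/eqP[<- <-] bl]; have [sb bE px qy] := lP b bl.
  by rewrite -!sgbE px qy; split=> //; [case: sb | exact: sievable_neq0 sb | case: sb].
have c4 : (size (undup [seq (0 <= p b, 0 <= q b)%R | b <- l]) <= 4)%N.
  by have := @size_undup_card _ (bool * bool)%type [seq (0 <= p b, 0 <= q b)%R | b <- l] id (in2W (fun x y => id));
    rewrite card_prod card_bool.
have -> : 4 * C * F * G = 4 * (C * F * G) by ring.
by rewrite ler_wpM2r // ler_nat.
Qed.

Lemma fibre_count1 (R : realType) m (eps : R) : 0 < eps -> exists2 C : R, 0 < C &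
  forall (K : fieldExtType rat) (w : 'I_m.+2 -> K) (s : 'I_m.+2 -> {rmorphism K -> R[i]}) (T : R) (e : int) (b0 : K) X
    (l : seq K) (p : K -> int), is_order w s -> 1 <= T -> e != 0 -> sievable w s T e b0 -> (0 < X)%N ->
  uniq l -> (forall b, b \in l -> [/\ sievable w s T e b, b = b0 + (p b)%:~R & (`|p b| < X)%N]) ->
  (size l)%:R <= C * (T * `|e%:~R|) `^ eps * X%:R `^ (1 / 2 + eps).
Proof.
move=> e0; have [C C0 CP] := @fibre_half1 R m eps e0; exists (2 * C); first by rewrite mulr_gt0.
move=> K w s T e b0 X l p ow T1 en0 [Ob binj bT _] X0 ul lP.
set F := (T * _) `^ _; set G := _ `^ (1 / 2 + eps).
have F0 : 0 <= C * F * G by rewrite !mulr_ge0 ?powR_ge0 ?ltW.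
apply: le_trans (@size_fibres R _ _ l (fun b => (0 <= p b)) (C * F * G) _) _.
  move=> s1 _.
  apply: (CP K w s T e b0 X _ (fun b => `|p b|%N) (sgb s1)) => //; rewrite ?sgb2 ?filter_uniq //.
  move=> b; rewrite mem_filter => /andP[/eqP <- bl]; have [sb bE px] := lP b bl.
  by rewrite -!sgbE px; split=> //; [case: sb | exact: sievable_neq0 sb | case: sb].
have c4 : (size (undup [seq (0 <= p b)%R | b <- l]) <= 2)%N.
  by have := @size_undup_card _ bool [seq (0 <= p b)%R | b <- l] id (in2W (fun x y => id));
    rewrite card_bool.
have -> : 2 * C * F * G = 2 * (C * F * G) by ring.
by rewrite ler_wpM2r // ler_nat.
Qed.

Lemma int_window (Y : nat) (x y : int) : (`|x| < Y)%N -> (`|y| < Y)%N ->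
  inord (absz (x + Y%:Z)%R) = inord (absz (y + Y%:Z)%R) :> 'I_(2 * Y).-1.+1 -> x = y.
Proof. by move=> hx hy /(congr1 val); rewrite /= !inordK; lia. Qed.

(** If X <= Y^2 the two-variable sieve applies. Otherwise the box is thin, and the one-variable
    sieve is used on each of its O(Y) lines. For Y = 1 the second coordinate is constant, so no
    bound on v is asked. *)
Lemma fibre_count (R : realType) m (eps : R) : 0 < eps -> exists2 C : R, 0 < C &
  forall (K : fieldExtType rat) (w : 'I_m.+2 -> K) (s : 'I_m.+2 -> {rmorphism K -> R[i]}) (T : R) (e : int) (v b0 : K) X Y
    (l : seq K) (p q : K -> int), is_order w s -> 1 <= T -> e != 0 -> zspan w v -> sievable w s T e b0 ->
  (exists i j, s i v != s j v) -> (forall i, normc (s i v) <= T) \/ Y = 1%N -> (0 < Y)%N -> (Y <= X)%N ->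
  uniq l -> (forall b, b \in l -> [/\ sievable w s T e b, b = b0 + (p b)%:~R + (q b)%:~R * v, (`|p b| < X)%N & (`|q b| < Y)%N]) ->
  (size l)%:R <= C * (T * `|e%:~R|) `^ eps * (X * Y)%:R `^ (2 / 3 + eps).
Proof.
move=> e0; have [C1 C10 C1P] := @fibre_count1 R m eps e0; have [C2 C20 C2P] := @fibre_count2 R m eps e0.
exists (C2 + 2 * C1 * 2 `^ (1 / 2 + eps)); first by rewrite addr_gt0 ?mulr_gt0 ?powR_gt0.
move=> K w s T e v b0 X Y l p q ow T1 en0 Ov sb0 vij vT Y0 YX ul lP.
set F := (T * _) `^ _; set G := _ `^ (2 / 3 + eps).
have F0 : 0 <= F by apply: powR_ge0.
have G0 : 0 <= G by apply: powR_ge0.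
have p2 : 0 <= 2 `^ (1 / 2 + eps) :> R by apply: powR_ge0.
have [/andP[XY /asboolP vT']|nXY] := boolP ((X <= Y ^ 2)%N && `[< forall i, normc (s i v) <= T >]).
  apply: le_trans (C2P K w s T e v b0 X Y l p q _ _ _ _ _ _ _ _ _ _ _ _) _ => //.
  by rewrite -!mulrA ler_wpM2r ?mulr_ge0 // lerDl !mulr_ge0 ?ltW.
have YX2 : (Y ^ 2 <= X)%N.
  case: vT nXY => [vT|-> _]; last by rewrite exp1n; apply: leq_trans Y0 YX.
  by rewrite (asboolT vT) andbT -ltnNge => /ltnW.
set B := C1 * F * (2 * X)%:R `^ (1 / 2 + eps).
have B0 : 0 <= B by rewrite !mulr_ge0 ?powR_ge0 ?ltW.
apply: le_trans (@size_fibres R _ _ l q B _) _.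
  move=> q0 /mapP[b1 b1l q0E]; have [sb1 b1E p1 _] := lP b1 b1l.
  apply: (C1P K w s T e b1 (2 * X)%N _ (fun b => p b - p b1)) => //; rewrite ?filter_uniq ?muln_gt0 ?(leq_trans Y0 YX) //.
  move=> b; rewrite mem_filter => /andP[/eqP qb bl]; have [sb bE pb _] := lP b bl; split=> //.
    move: bE b1E; rewrite qb q0E intrB; move: (p b) (p b1) (q b1) => x y z hb hb1; rewrite hb hb1; ring.
  by move: p1 pb; clear; lia.
have cq : (size (undup (map q l)) <= 2 * Y)%N.
  have gi : {in map q l &, injective (fun x : int => inord (absz (x + Y%:Z)%R) : 'I_(2 * Y).-1.+1)}.
    move=> x y /mapP[b bl ->] /mapP[c cl ->]; have [_ _ _ hb] := lP b bl; have [_ _ _ hc] := lP c cl.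
    exact: int_window.
  by have := size_undup_card gi; rewrite card_ord prednK // muln_gt0.
have X1 : 1 <= X%:R :> R by rewrite ler1n (leq_trans Y0 YX).
have Y1 : 1 <= Y%:R :> R by rewrite ler1n.
have X0' : 0 <= X%:R :> R by rewrite ler0n.
have Y0' : 0 <= Y%:R :> R by rewrite ler0n.
(* In a thin box Y X^(1/2) = Y^(2/3) (Y^2)^(1/6) X^(1/2) is at most (XY)^(2/3). *)
have key : Y%:R * X%:R `^ (1 / 2 + eps) <= G.
  rewrite /G natrM powRM //.
  have -> : Y%:R * X%:R `^ (1 / 2 + eps) = Y%:R `^ (2 / 3) * ((Y%:R ^+ 2) `^ (1 / 6) * X%:R `^ (1 / 2 + eps)).
    rewrite mulrA -powR_mulrn // -powRrM -powRD; last by rewrite pnatr_eq0 -lt0n Y0 implybT.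
    by rewrite (_ : 2 / 3 + 2%:R * (1 / 6) = 1) ?powRr1 //; field.
  rewrite [X in _ <= X]mulrC; apply: ler_pM; rewrite ?mulr_ge0 ?powR_ge0 //.
    by apply: ler_powR => //; lra.
  have -> : X%:R `^ (2 / 3 + eps) = X%:R `^ (1 / 6) * X%:R `^ (1 / 2 + eps).
    rewrite -powRD; last by rewrite pnatr_eq0 -lt0n (leq_trans Y0 YX) implybT.
    by congr (_ `^ _); field.
  rewrite ler_wpM2r ?powR_ge0 //; apply: ge0_ler_powR; rewrite ?nnegrE ?exprn_ge0 //.
  by rewrite -natrX ler_nat.
apply: le_trans (_ : (2 * Y)%:R * B <= _); first by rewrite ler_wpM2r // ler_nat.
rewrite /B natrM [(2 * X)%:R]natrM powRM //.
have -> : 2 * Y%:R * (C1 * F * (2 `^ (1 / 2 + eps) * X%:R `^ (1 / 2 + eps))) =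
  (2 * C1 * 2 `^ (1 / 2 + eps) * F) * (Y%:R * X%:R `^ (1 / 2 + eps)) by ring.
apply: le_trans (ler_wpM2l _ key) _; first by rewrite !mulr_ge0 // ltW.
by rewrite ler_wpM2r // ler_wpM2r // lerDr ltW.
Qed.

(** If all conjugates of u_1 agreed, its row of embeddings would be a multiple of the row of u_0 =
    1, against invertibility. *)
Lemma red_nonscalar (R : realType) (K : fieldExtType rat) m (s : 'I_m.+2 -> {rmorphism K -> R[i]}) (u : 'I_m.+2 -> K) :
  is_order u s -> u ord0 = 1 -> exists i j, s i (u (lift ord0 ord0)) != s j (u (lift ord0 ord0)).
Proof.
move=> ou u0; apply: contrapT => h; set o1 := lift ord0 ord0 in h *.
have sE i : s i (u o1) = s ord0 (u o1).
  by apply/eqP; apply: contraT => ne; case: h; exists i, ord0.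
set V := \matrix_(j, i) s i (u j).
have V0 : (delta_mx 0 o1 - s ord0 (u o1) *: delta_mx 0 ord0 : 'rV_m.+2) *m V = 0.
  rewrite mulmxBl -scalemxAl -!rowE; apply/matrixP => a i; rewrite !mxE u0 rmorph1 mulr1 sE subrr //.
have := congr1 (fun M => (M *m invmx V) 0 o1) V0; rewrite mulmxK ?(order_unit ou) // mul0mx !mxE !eqxx /= mulr0 subr0.
by move/eqP; rewrite oner_eq0.
Qed.

Definition boxc (R : realType) (n : nat) : R := n.+2%:R ^+ n * n.+1%:R.

Lemma boxc_ge1 (R : realType) n : 1 <= boxc R n.
Proof. by rewrite -[X in X <= _]mulr1; apply: ler_pM; rewrite ?ler01 // ?exprn_ege1 // ler1n. Qed.

Section RedBox.
Variables (R : realType) (K : fieldExtType rat) (n : nat) (s : 'I_n.+1 -> {rmorphism K -> R[i]}).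
Variables (u : 'I_n.+1 -> K) (L : 'M[R]_n.+1) (b : 'rV[R]_n.+1).
Hypothesis rb : red_basis s u L b.
Local Notation sb k := (Num.sqrt (b 0 k)).
Local Notation bx Y k := (Num.truncn (boxc R n * Y / sb k)).

Lemma red_box Y beta k : 0 <= Y -> zspan u beta -> (forall i, normc (s i beta) <= Y) ->
  (`|ocoord u beta 0%R k| <= bx Y k)%N.
Proof.
move=> Y0 Ob bY; have bp : 0 < sb k by case: rb => _ [h _ _ _ _]; rewrite sqrtr_gt0.
have a0 : 0 <= boxc R n by apply: le_trans (boxc_ge1 R n).
have x0 : 0 <= boxc R n * Y / sb k by rewrite !mulr_ge0 // invr_ge0 (ltW bp).
rewrite truncn_ge_nat // natr_absz ler_pdivlMr // intr_norm.
have hQ : qnorm s (elt u (ocoord u beta)) <= n.+1%:R * Y ^+ 2.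
  rewrite ocoordK // /qnorm; have -> : n.+1%:R * Y ^+ 2 = \sum_(i < n.+1) Y ^+ 2 by rewrite sumr_const card_ord mulr_natl.
  by apply: ler_sum => i _; apply: lerXn2r; rewrite ?nnegrE ?normc_ge0.
apply: le_trans (red_coord rb k hQ) _; rewrite /boxc -mulrA; apply: ler_pM; rewrite ?exprn_ge0 ?sqrtr_ge0 ?ler0n //.
  by rewrite ler_weXn2l ?ler1n // leq_subr.
rewrite sqrtrM ?ler0n // sqrtr_sqr ger0_norm // ler_wpM2r //.
rewrite -{2}[n.+1%:R]ger0_norm ?ler0n // -sqrtr_sqr ler_sqrt ?exprn_ge0 ?ler0n // expr2 ler_peMr ?ler0n // ler1n //.
Qed.

Lemma red_box_le Y k : 0 <= Y -> (2 * bx Y k).+1%:R <= (2 * boxc R n + 1) * (1 + Y / sb k).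
Proof.
move=> Y0; have bp : 0 < sb k by case: rb => _ [h _ _ _ _]; rewrite sqrtr_gt0.
have a1 := boxc_ge1 R n.
have y0 : 0 <= Y / sb k by rewrite divr_ge0 // ltW.
have : (bx Y k)%:R <= boxc R n * (Y / sb k) by rewrite mulrA truncn_le // -mulrA mulr_ge0 // (le_trans ler01).
rewrite -natr1 natrM; move: (Y / sb k) (bx Y k) (boxc R n) y0 a1 => y t a y0 a1 h.
have : 0 <= a * y by rewrite mulr_ge0 // (le_trans ler01).
by move=> ay; rewrite mulrDr mulr1 !mulrDl mul1r; lra.
Qed.

Lemma count_all Y (l : seq K) : 0 <= Y -> uniq l -> (forall x, x \in l -> zspan u x /\ forall i, normc (s i x) <= Y) ->
  (size l)%:R <= (2 * boxc R n + 1) ^+ n.+1 * \prod_k (1 + Y / sb k).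
Proof.
move=> Y0 ul lP; have ou : is_order u s by case: rb => -[].
have ui : {in l &, injective (ocoord u)}.
  by move=> x y /lP[Ox _] /lP[Oy _] e; rewrite -(ocoordK Ox) -(ocoordK Oy) e.
have := @box_count n.+1 (fun k => bx Y k) (map (ocoord u) l).
rewrite map_inj_in_uniq // size_map => /(_ ul) h.
apply: le_trans (_ : (\prod_k (2 * bx Y k).+1)%:R <= _).
  by rewrite ler_nat; apply: h => c /mapP[x /lP[Ox xY] ->] k; apply: red_box.
have -> : (2 * boxc R n + 1) ^+ n.+1 = \prod_(k < n.+1) (2 * boxc R n + 1) by rewrite prodr_const card_ord.
by rewrite natr_prod -big_split /=; apply: ler_prod => k _; rewrite ler0n red_box_le.
Qed.
End RedBox.

Lemma weight_combine (R : realType) (C0 a c Z Q P eps : R) : 0 < eps -> 0 <= C0 -> 0 <= a -> 0 < c -> 1 <= Z -> 1 <= Q ->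
  Q <= 2 * (Z * Z) -> 0 <= P -> P <= c * Q ->
  C0 * (a * Z) `^ (eps / 3) * P `^ (2 / 3 + eps / 3) <=
    C0 * a `^ (eps / 3) * c `^ (2 / 3 + eps / 3) * 2 `^ (eps / 3) * (Z `^ eps * Q `^ (2 / 3)).
Proof.
move=> eps0 C00 a0 c0 Z1 Q1 QZ P0 PQ; have Z0 : 0 < Z by apply: lt_le_trans Z1.
have Q0 : 0 < Q by apply: lt_le_trans Q1.
have [e3 e3E] : exists e3, e3 = eps / 3 by eexists.
have e30 : 0 < e3 by rewrite e3E divr_gt0.
have -> : eps = e3 + (e3 + e3) by rewrite e3E; field.
have -> : (e3 + (e3 + e3)) / 3 = e3 by field.
have Pc : P `^ (2 / 3 + e3) <= c `^ (2 / 3 + e3) * Q `^ (2 / 3 + e3).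
  rewrite -powRM; [|exact: ltW|exact: ltW]; apply: ge0_ler_powR.
  - by rewrite addr_ge0 // ?divr_ge0 // ltW.
  - by rewrite nnegrE.
  - by rewrite nnegrE mulr_ge0 // ltW.
  - exact: PQ.
have Qe : Q `^ e3 <= 2 `^ e3 * (Z `^ e3 * Z `^ e3).
  rewrite -!powRM ?mulr_ge0 ?(ltW Z0) //; apply: ge0_ler_powR; rewrite ?nnegrE ?mulr_ge0 ?(ltW Z0) ?(ltW Q0) ?(ltW e30) //.
have Zn0 : Z != 0 by rewrite gt_eqF.
have Qn0 : Q != 0 by rewrite gt_eqF.
have ZE : Z `^ (e3 + (e3 + e3)) = Z `^ e3 * (Z `^ e3 * Z `^ e3) by rewrite !powRD ?Zn0 ?implybT.
have QE : Q `^ (2 / 3 + e3) = Q `^ (2 / 3) * Q `^ e3 by rewrite powRD ?Qn0 ?implybT.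
rewrite powRM ?(ltW Z0) // ZE.
apply: le_trans (_ : C0 * (a `^ e3 * Z `^ e3) * (c `^ (2 / 3 + e3) * Q `^ (2 / 3 + e3)) <= _).
  by apply: ler_wpM2l Pc; rewrite !mulr_ge0 ?powR_ge0.
rewrite QE.
have -> : C0 * (a `^ e3 * Z `^ e3) * (c `^ (2 / 3 + e3) * (Q `^ (2 / 3) * Q `^ e3)) =
  (C0 * a `^ e3 * c `^ (2 / 3 + e3) * Z `^ e3 * Q `^ (2 / 3)) * Q `^ e3 by ring.
apply: le_trans (ler_wpM2l _ Qe) _; first by rewrite !mulr_ge0 ?powR_ge0.
by rewrite le_eqVlt; apply/orP; left; apply/eqP; ring.
Qed.

(** Fix the last m coordinates: their ranges give the product. Within a fibre, every element is
    measured from one element x0 of the same fibre, so that the base point of the sieve is itself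
    sievable. *)
Lemma count_good (R : realType) m (eps : R) : 0 < eps -> exists2 C : R, 0 < C &
  forall (K : fieldExtType rat) (s : 'I_m.+2 -> {rmorphism K -> R[i]}) (u : 'I_m.+2 -> K) (L : 'M[R]_m.+2) (b : 'rV[R]_m.+2)
    (e : int) (Y : R) (l : seq K), red_basis s u L b -> e != 0 -> 1 <= Y -> uniq l ->
  (forall x, x \in l -> sievable u s Y e x) ->
  (size l)%:R <= C * (Y * `|e%:~R|) `^ eps * (\prod_(k < m) (1 + Y / Num.sqrt (b 0 (lift ord0 (lift ord0 k))))
    * (Y * (1 + Y / Num.sqrt (b 0 (lift ord0 ord0)))) `^ (2 / 3)).
Proof.
move=> eps0; set e3 := eps / 3; have e30 : 0 < e3 by rewrite divr_gt0.
have [C0 C00 C0P] := @fibre_count R m e3 e30.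
have [a aE] : exists a, a = boxc R m.+1 by eexists.
have a1 : 1 <= a by rewrite aE boxc_ge1.
have a0 : 0 <= a by apply: le_trans a1.
set a' := m.+2%:R * 2 ^+ m.+1 * a.
have c21 : 1 <= m.+2%:R * 2 ^+ m.+1 :> R.
  by rewrite -[X in X <= _]mulr1; apply: ler_pM; rewrite ?ler01 // ?exprn_ege1 // ler1n.
have a'1 : 1 <= a' by rewrite -[X in X <= _]mulr1; apply: ler_pM; rewrite ?ler01.
set c1 := 5 * a * (2 * a + 1).
have c10 : 0 < c1 by rewrite /c1; apply: mulr_gt0; move: a1; clear; lra.
exists ((2 * a + 1) ^+ m * C0 * a' `^ e3 * c1 `^ (2 / 3 + e3) * 2 `^ e3).
  rewrite !mulr_gt0 ?powR_gt0 ?exprn_gt0 // ?(lt_le_trans ltr01 a'1) //; move: a1; clear; lra.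
move=> K s u L b e Y l rb en0 Y1 ul lP.
have [[ou u0 qE] [bp b0 Lz L1 [L2 bb]]] := rb.
set o1 := lift ord0 ord0; pose ll (k : 'I_m) : 'I_m.+2 := lift ord0 (lift ord0 k).
have Y0 : 0 <= Y by apply: le_trans Y1.
pose T k := Num.truncn (a * Y / Num.sqrt (b 0 k)).
have sbp k : 0 < Num.sqrt (b 0 k) by rewrite sqrtr_gt0.
have lT x k : x \in l -> (`|ocoord u x 0%R k| <= T k)%N.
  by move=> /lP[Ox _ xY _]; rewrite /T aE; apply: (red_box rb).
have Tle k : (2 * T k).+1%:R <= (2 * a + 1) * (1 + Y / Num.sqrt (b 0 k)) by rewrite /T aE; apply: (red_box_le rb).
have Tle' k : (T k)%:R <= a * Y / Num.sqrt (b 0 k) by rewrite truncn_le // !mulr_ge0 // invr_ge0 (ltW (sbp k)).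
(* Adding [T o1] in [X0] forces [Y0n <= X0] at the cost of a constant factor; 2 T bounds a
   difference of two coordinates. *)
pose X0 := (2 * (T ord0 + T o1)).+1; pose Y0n := (2 * T o1).+1.
have b1 : 1 <= b 0 o1.
  have := bb o1 ord0 erefl; rewrite b0 => h.
  have : 2 <= m.+2%:R :> R by rewrite ler_nat.
  by move: h; clear; lra.
have sb1 : 1 <= Num.sqrt (b 0 o1) by rewrite -[X in X <= _]sqrtr1 ler_sqrt // ltW.
have sb0 : 1 <= Num.sqrt (b 0 ord0) by rewrite -[X in X <= _]sqrtr1 ler_sqrt ?b0 ?ltr0n // ler1n.
have aY0 : 0 <= a * Y by rewrite mulr_ge0.
have T0a : (T ord0)%:R <= a * Y by apply: le_trans (Tle' _) _; rewrite ler_pdivrMr // ler_peMr.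
have T1a : (T o1)%:R <= a * Y by apply: le_trans (Tle' _) _; rewrite ler_pdivrMr // ler_peMr.
set y1 := Y / Num.sqrt (b 0 o1).
have y10 : 0 <= y1 by rewrite divr_ge0 // ltW.
have y1Y : y1 <= Y by rewrite ler_pdivrMr // ler_peMr.
set Q := Y * (1 + y1).
have Q1 : 1 <= Q by rewrite -[X in X <= _]mulr1; apply: ler_pM; rewrite ?ler01 // lerDl.
have Q0 : 0 <= Q by apply: le_trans Q1.
have XYQ : (X0 * Y0n)%:R <= c1 * Q.
  have -> : c1 * Q = (5 * a * Y) * ((2 * a + 1) * (1 + y1)) by rewrite /c1 /Q; ring.
  rewrite natrM; apply: ler_pM; rewrite ?ler0n //; last exact: Tle.
  have : 1 <= a * Y by rewrite -[X in X <= _]mulr1; apply: ler_pM; rewrite ?ler01.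
  rewrite /X0 -natr1 natrM natrD -mulrA; move: T0a T1a; move: (T ord0) (T o1) (a * Y) => t t1 z; clear; lra.
have e1 : 1 <= `|e%:~R| :> R by rewrite -intr_norm ler1z -gtz0_ge1 normr_gt0.
have e10 : 0 <= `|e%:~R| :> R by [].
set Z := Y * `|e%:~R|.
have Z1 : 1 <= Z by rewrite -[X in X <= _]mulr1; apply: ler_pM; rewrite ?ler01.
have Z0 : 0 <= Z by apply: le_trans Z1.
have YZ : Y <= Z by rewrite /Z ler_peMr.
have a'0 : 0 <= a' by apply: le_trans a'1.
pose F := C0 * (a' * Y * `|e%:~R|) `^ e3 * (X0 * Y0n)%:R `^ (2 / 3 + e3).
have e23 : 0 <= 2 / 3 + e3 by rewrite addr_ge0 // ?divr_ge0 // ltW.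
have FZ : F <= C0 * a' `^ e3 * c1 `^ (2 / 3 + e3) * 2 `^ e3 * (Z `^ eps * Q `^ (2 / 3)).
  have aZ : a' * Y * `|e%:~R| = a' * Z by rewrite /Z mulrA.
  rewrite /F aZ; apply: weight_combine => //; first exact: ltW.
  have h : 1 + y1 <= 2 * Z by move: y1Y YZ Z1; clear; lra.
  rewrite mulrCA /Q; apply: ler_pM => //; apply: addr_ge0 => //.
pose f x : 'rV[int]_m := \row_k ocoord u x 0 (ll k).
have Fge0 : 0 <= F by rewrite /F !mulr_ge0 ?powR_ge0 // ltW.
apply: le_trans (@size_fibres R _ _ l f F _) _; last first.
  have hbox : (size (undup (map f l)) <= \prod_k (2 * T (ll k)).+1)%N.
    apply: (@box_count m (fun k => T (ll k))); first exact: undup_uniq.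
    by move=> c; rewrite mem_undup => /mapP[x xl ->] k; rewrite mxE; apply: lT.
  apply: le_trans (_ : ((2 * a + 1) ^+ m * \prod_(k < m) (1 + Y / Num.sqrt (b 0 (ll k)))) * F <= _).
    rewrite ler_wpM2r //; apply: le_trans (_ : (\prod_k (2 * T (ll k)).+1)%:R <= _); first by rewrite ler_nat.
    have -> : (2 * a + 1) ^+ m = \prod_(k < m) (2 * a + 1) by rewrite prodr_const card_ord.
    by rewrite natr_prod -big_split /=; apply: ler_prod => k _; rewrite ler0n Tle.
  set P := \prod_(k < m) _.
  have P0 : 0 <= P by apply: prodr_ge0 => k _; rewrite addr_ge0 // divr_ge0 // ltW.
  have A0 : 0 <= (2 * a + 1) ^+ m by apply: exprn_ge0; move: a0; clear; lra.
  apply: le_trans (ler_wpM2l _ FZ) _; first by rewrite mulr_ge0.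
  by rewrite le_eqVlt; apply/orP; left; apply/eqP; rewrite -/P -/y1 -/Q -/Z; ring.
move=> d /mapP[x0 x0l ->].
have siv x : x \in l -> sievable u s (a' * Y) e x.
  move=> /lP[h1 h2 h3 h4]; split=> // i; apply: le_trans (h3 i) _; by rewrite ler_peMl.
apply: (C0P K u s (a' * Y) e (u o1) x0 X0 Y0n _ (fun x => (ocoord u x - ocoord u x0) 0 ord0)
   (fun x => (ocoord u x - ocoord u x0) 0 o1)) => //.
- by rewrite -[X in X <= _]mulr1; apply: ler_pM; rewrite ?ler01.
- exact: zspan_w.
- exact: siv.
- exact: red_nonscalar.
(* If the range of the second coordinate is a single point, nothing is required of u_1. Otherwise
   sqrt b_1 <= a Y, and the conjugates of u_1 are O(sqrt b_1). *)
- have [T10|T10] := posnP (T o1); [by right; rewrite /Y0n T10|left=> i].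
  apply: le_trans (normc_le_qnorm _ _ _) _.
  have sbY : Num.sqrt (b 0 o1) <= a * Y.
    have : 1 <= a * Y / Num.sqrt (b 0 o1) by apply: le_trans (Tle' o1); rewrite ler1n.
    by rewrite ler_pdivlMr // mul1r.
  have h := red_q_le rb (leqnn o1).
  apply: le_trans (_ : Num.sqrt ((m.+2%:R * 2 ^+ m.+1) ^+ 2 * b 0 o1) <= _).
    rewrite ler_sqrt; last by rewrite mulr_ge0 ?sqr_ge0 // ltW.
    apply: le_trans h _; rewrite ler_wpM2r ?(ltW (bp _)) // expr2 ler_peMr // (le_trans ler01 c21).
  rewrite sqrtrM ?sqr_ge0 // sqrtr_sqr ger0_norm; last exact: le_trans c21.
  by rewrite /a' -mulrA ler_wpM2l // (le_trans ler01 c21).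
- by rewrite /Y0n /X0 ltnS leq_mul2l leq_addl orbT.
- exact: filter_uniq.
move=> x; rewrite mem_filter => /andP[/eqP fx xl]; split; first exact: siv.
- have [Ox _ _ _] := lP x xl; have [Ox0 _ _ _] := lP x0 x0l.
  have xE : x - x0 = elt u (ocoord u x - ocoord u x0) by rewrite eltB !ocoordK.
  rewrite -addrA -[LHS](subrK x0) [LHS]addrC xE; congr (_ + _).
  rewrite /elt !big_ord_recl u0 big1 ?addr0 => [|k _]; first by rewrite mulrzl.
  have /matrixP/(_ 0 k) := fx; rewrite !mxE => ->; by rewrite subrr mulr0z.
- have := lT x ord0 xl; have := lT x0 ord0 x0l; rewrite !mxE /X0.
  by move: (ocoord u x 0 ord0) (ocoord u x0 0 ord0) (T ord0) (T o1); clear; lia.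
- have := lT x o1 xl; have := lT x0 o1 x0l; rewrite !mxE /Y0n.
  by move: (ocoord u x 0 o1) (ocoord u x0 0 o1) (T o1); clear; lia.
Qed.

(** * Elements of proper subfields *)

(** A subspace of largest dimension inside S absorbs the line of every element of S. *)
Lemma vspace_of_set (K : fieldExtType rat) (S : set K) : S 0 -> (forall a x y, S x -> S y -> S (a *: x + y)) ->
  exists U : {vspace K}, forall x, (x \in U) <-> S x.
Proof.
move=> S0 SD.
pose P d := `[< exists2 U : {vspace K}, \dim U = d & forall x, x \in U -> S x >].
have P0 : exists d, P d.
  by exists 0%N; apply/asboolP; exists 0%VS; rewrite ?dimv0 // => x; rewrite memv0 => /eqP ->.
have Pb d : P d -> (d <= \dim {:K})%N by move=> /asboolP[U <- _]; rewrite dimvS ?subvf.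
case: (ex_maxnP P0 Pb) => d /asboolP[U dU US] dmax; exists U => x; split=> [|Sx]; first exact: US.
have : P (\dim (U + <[x]>)%VS).
  apply/asboolP; exists (U + <[x]>)%VS => // y /memv_addP[v vU [v' /vlineP[k ->] ->]].
  by rewrite addrC; apply: SD => //; apply: US.
move/dmax; rewrite -dU => le; have : (U == (U + <[x]>))%VS by rewrite eqEdim addvSl.
by move/eqP ->; apply: subvP (addvSr _ _) _ (memv_line x).
Qed.

Lemma elt_rat (K : fieldExtType rat) n (w : 'I_n -> K) (c : 'rV[int]_n) :
  elt w c = \sum_l ((c 0 l)%:~R : rat) *: w l.
Proof. by apply: eq_bigr => l _; rewrite scaler_int. Qed.

Section Suborder.
Variables (R : realType) (K : fieldExtType rat) (n : nat) (w : 'I_n -> K).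
Variables (s : 'I_n -> {rmorphism K -> R[i]}) (ow : is_order w s) (dK : \dim {:K} = n).

Lemma order_scale (x : K) : exists2 d : int, d != 0 & zspan w (x *~ d).
Proof.
pose X := [tuple w i | i < n].
have XE (i : 'I_n) : X`_i = w i by rewrite -tnth_nth tnth_mktuple.
have Xf : free X.
  apply/freeP => k k0 i.
  have [d d0 [c cE]] := int_vector (\row_i k i).
  have cl l : (c 0 l)%:~R = d%:~R * k l :> rat by have /matrixP/(_ 0 l) := cE; rewrite !mxE.
  have c0 : c = 0.
    apply: (elt_inj ow); rewrite elt0 elt_rat; under eq_bigr do rewrite cl -scalerA.
    by rewrite -scaler_sumr (eq_bigr (fun i => k i *: X`_i)) ?k0 ?scaler0 // => l _; rewrite XE.
  have := cl i; rewrite c0 mxE => /esym/eqP; rewrite mulf_eq0 intr_eq0 (negPf d0) => /eqP //.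
have Xb : basis_of {:K} X.
  by rewrite basisEfree Xf subvf size_tuple dK leqnn.
have xE := coord_basis Xb (memvf x).
have [d d0 [c cE]] := int_vector (\row_i coord X i x).
exists d => //; exists c; rewrite elt_rat {1}xE -scaler_int scaler_sumr; apply: eq_bigr => l _.
by have /matrixP/(_ 0 l) := cE; rewrite !mxE => ->; rewrite XE scalerA.
Qed.

(** A basis of U is scaled into the order; by the Smith form the first m rows of a unimodular W span
    the same rational space, and since W is unimodular they span all of O in U. Their m by n matrix
    of embeddings has full rank, so some m embeddings f give an invertible minor. *)
Lemma suborder (U : {vspace K}) m : \dim U = m -> 1 \in U -> (forall x y, x \in U -> y \in U -> x * y \in U) ->
  exists (w' : 'I_m -> K) (f : 'I_m -> 'I_n), is_order w' (fun k => s (f k)) /\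
    forall x, zspan w' x <-> zspan w x /\ x \in U.
Proof.
move=> <- {m} U1 UM; set m := \dim U.
have mn : (m <= n)%N by rewrite -dK dimvS ?subvf.
pose e (k : 'I_m) := tnth (vbasis U) k.
have eU k : e k \in U by apply: vbasis_mem; apply: mem_tnth.
have /boolp.choice [d dP] : forall k, exists d : int, d != 0 /\ zspan w (e k *~ d).
  by move=> k; have [d d0 h] := order_scale (e k); exists d.
pose M : 'M[int]_(m, n) := \matrix_k ocoord w (e k *~ d k).
have ME (r : 'rV[int]_m) : elt w (r *m M) = \sum_k ((r 0 k * d k)%:~R : rat) *: e k.
  rewrite mulmx_sum_row elt_sum; apply: eq_bigr => k _; rewrite eltZ rowK ocoordK; last by case: (dP k).
  by rewrite -mulrzA mulrC scaler_int.
have free0 (r : 'rV[int]_m) : r *m M = 0 -> r = 0.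
  move=> r0; have := ME r; rewrite r0 elt0 => /esym h.
  have /freeP := basis_free (vbasisP U) => /(_ (fun k => (r 0 k * d k)%:~R)) h2.
  apply/matrixP => a k; rewrite ord1 mxE; have := h2 _ k; rewrite (eq_bigr (fun k => ((r 0 k * d k)%:~R : rat) *: e k)).
    by move=> /(_ h)/eqP; rewrite intr_eq0 mulf_eq0 => /orP[/eqP //|]; case: (dP k) => /negPf ->.
  by move=> l _; rewrite /e (tnth_nth 0).
have [L0 L0u [W Wu [g _ MS]]] := int_Smith_normal_form M.
pose wd (k : 'I_m) : 'I_n := widen_ord mn k.
pose w' k := elt w (row (wd k) W).
have rowE (k : 'I_m) : row k (invmx L0) *m M = g`_k *: row (wd k) W.
  rewrite MS !mulmxA -row_mul mulVmx // row1 -rowE; apply/matrixP => a j; rewrite ord1 !mxE.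
  rewrite (bigD1 (wd k)) //= !mxE eqxx mulr1n big1 ?addr0 // => l lk; rewrite !mxE.
  by case: eqP => [E|]; rewrite ?mulr0n ?mul0r //; case/eqP: lk; apply: val_inj.
have g0 (k : 'I_m) : g`_k != 0.
  apply/eqP => gk; have := rowE k; rewrite gk scale0r => /free0 h.
  have : row k (invmx L0 *m L0) = 0 by rewrite row_mul h mul0mx.
  by rewrite mulVmx // row1 => /matrixP/(_ 0 k)/eqP; rewrite !mxE !eqxx oner_eq0.
have w'U k : w' k \in U.
  have : elt w (row k (invmx L0) *m M) \in U by rewrite ME; apply: memv_suml => l _; apply: memvZ.
  rewrite rowE eltZ -/(w' k) -scaler_int => h.
  have -> : w' k = ((g`_k)%:~R : rat)^-1 *: (((g`_k)%:~R : rat) *: w' k) by rewrite scalerA mulVf ?scale1r // intr_eq0.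
  exact: memvZ.
have elt'E (c : 'rV[int]_m) : elt w' c = elt w (\sum_k c 0 k *: row (wd k) W).
  by rewrite elt_sum; apply: eq_bigr => k _; rewrite eltZ.
have span x : zspan w' x <-> zspan w x /\ x \in U.
  split=> [[c ->]|[[c xc] xU]].
    split; first by rewrite elt'E; eexists.
    by rewrite /elt; apply: memv_suml => k _; rewrite -scaler_int; apply: memvZ.
  have [D D0 [r rE]] := int_vector (\row_k (coord (vbasis U) k x / (d k)%:~R)).
  have rc : r *m M = D *: c.
    apply: (elt_inj ow); rewrite ME eltZ -xc -scaler_int {1}(coord_vbasis xU) scaler_sumr; apply: eq_bigr => k _.
    have /matrixP/(_ 0 k) := rE; rewrite !mxE intrM => ->; rewrite scalerA /e (tnth_nth 0); congr (_ *: _).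
    by rewrite -!mulrA mulVf ?mulr1 // intr_eq0; case: (dP k).
  pose c' := c *m invmx W; have cE : c = c' *m W by rewrite mulmxKV.
  have c'0 (j : 'I_n) : (m <= j)%N -> c' 0 j = 0.
    move=> mj; have : (D *: c') 0 j = 0; last by rewrite mxE => /eqP; rewrite mulf_eq0 (negPf D0) => /eqP.
    rewrite /c' scalemxAl -rc MS !mulmxA mulmxK // mxE big1 // => k _; rewrite !mxE.
    by case: eqP => [E|]; rewrite ?mulr0n ?mulr0 //; move: mj; rewrite -E leqNgt ltn_ord.
  exists (\row_k c' 0 (wd k)); rewrite elt'E xc cE mulmx_sum_row; congr (elt w _).
  rewrite (bigID (fun j : 'I_n => (j < m)%N)) /= [X in _ + X]big1 ?addr0; last first.
    by move=> j; rewrite -leqNgt => /c'0 ->; rewrite scale0r.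
  rewrite (big_ord_narrow mn) /=; apply: eq_bigr => k _; rewrite mxE //.
pose Vt : 'M[R[i]]_(n, m) := \matrix_(i, j) s i (w' j).
have Vf : row_full Vt.
  rewrite /row_full -mxrank_tr -/(row_free Vt^T).
  pose WV := map_mx (intr : int -> R[i]) W *m (\matrix_(j, i) s i (w j)).
  have WVu : WV \in unitmx.
    by rewrite unitmx_mul (order_unit ow) andbT unitmxE det_map_mx rmorph_unit // -unitmxE.
  have VE : Vt^T = rowsub wd 1%:M *m WV.
    rewrite mul_rowsub_mx mul1mx; apply/matrixP => k i; rewrite !mxE s_elt mxE; apply: eq_bigr => l _; by rewrite !mxE.
  apply: inj_row_free => v; rewrite VE mulmxA => /(congr1 (mulmx^~ (invmx WV))).
  rewrite mulmxK // mul0mx => /matrixP h; apply/matrixP => a k; have := h a (wd k); rewrite !mxE (bigD1 k) //= !mxE eqxx mulr1.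
  rewrite big1 ?addr0 // => l lk; rewrite !mxE; case: eqP => [E|]; rewrite ?mulr0 //.
  by case/eqP: lk; apply: val_inj; exact: (congr1 val E).
pose f := fullrankfun Vf.
exists w', f; split=> //; split.
- rewrite -unitmx_tr; have -> : (\matrix_(j, i) s (f i) (w' j))^T = rowsub f Vt by apply/matrixP => i j; rewrite !mxE.
  exact: fullrowsub_unit.
- move=> j k; apply/span; split; last exact: UM (w'U _) (w'U _).
  by apply: (zspanM ow); [have [h _] := span (w' j)| have [h _] := span (w' k)]; case: h => //; apply: zspan_w.
- by apply/span; split=> //; apply: zspan1 ow.
Qed.

(** x' is a root of the characteristic polynomial of x, because s_i maps it to the conjugate s_j
    x. *)
Lemma conj_root (x x' : K) i j : zspan w x -> s i x' = s j x ->
  (forall k, exists l, s k x' = s l x) /\ integers K x'.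
Proof.
move=> Ox E; set q := char_poly (zm w x).
have qE k y : s k (map_poly intr q).[y] = (map_poly (intr : int -> R[i]) q).[s k y].
  rewrite -horner_map -map_poly_comp; congr (_.[_]); apply: eq_map_poly => c; exact: rmorph_int.
have qC : map_poly (intr : int -> R[i]) q = \prod_l ('X - (s l x)%:P) by rewrite (char_poly_zm ow).
have qr l : (map_poly (intr : int -> R[i]) q).[s l x] = 0.
  by rewrite qC horner_prod; apply/eqP/prodf_eq0; exists l => //; rewrite !hornerE subrr.
have q0 : (map_poly intr q).[x'] = 0.
  by apply/eqP; rewrite -(fmorph_eq0 (s i)) qE E qr.
split=> [k|].
  have := qE k x'; rewrite q0 rmorph0 qC horner_prod => /esym/eqP/prodf_eq0[l _].
  by rewrite !hornerE subr_eq0 => /eqP; exists l.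
by exists q; [exact: char_poly_monic|apply/rootP].
Qed.
End Suborder.

Lemma subfield_dvd (K : fieldExtType rat) (U : {vspace K}) : 1 \in U -> (forall x y, x \in U -> y \in U -> x * y \in U) ->
  (\dim U %| \dim {:K})%N.
Proof.
move=> U1 UM; have aU : is_aspace U by rewrite /is_aspace has_algid1 //=; apply/prodvP.
exact: (field_dimS (F := ASpace aU) (E := {:K}%AS) (subvf _)).
Qed.

(** * Subfields of index 2 *)

Section Index2.
Variables (R : realType) (K : fieldExtType rat) (si sj : {rmorphism K -> R[i]}) (U : {vspace K}).
Hypothesis UE : forall x, (x \in U) <-> si x = sj x.

Lemma eq_field1 : 1 \in U. Proof. by apply/UE; rewrite !rmorph1. Qed.
Lemma eq_fieldM x y : x \in U -> y \in U -> x * y \in U.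
Proof. by move=> /UE h1 /UE h2; apply/UE; rewrite !rmorphM h1 h2. Qed.

(** For x outside U, K = U + U x, so x^2 = p + q x with p, q in U. As the two embeddings agree on p
    and q, the values of x are the two roots, with sum the image of q. So x |-> a - x is the
    conjugation over U. *)
Lemma index2_trace : (2 * \dim U)%N = \dim {:K} ->
  forall x, exists a, [/\ a \in U, sj x = si (a - x) & si x = sj (a - x)].
Proof.
move=> d2 x; suff [a aU E] : exists2 a, a \in U & si a = si x + sj x.
  have /UE aE := aU; exists a; split=> //; first by rewrite rmorphB E addrAC subrr add0r.
  by rewrite rmorphB -aE E addrK.
have [xU|xU] := boolP (x \in U).
  by exists (x + x); [exact: memvD|rewrite rmorphD; have /UE -> := xU].
have x0 : x != 0 by apply: contraNneq xU => ->; apply: mem0v.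
have disj : (U :&: U * <[x]> = 0)%VS.
  apply/eqP; rewrite -subv0; apply/subvP => y /memv_capP[yU /memv_cosetP[c cU yE]].
  rewrite memv0; apply: contraNT xU => y0.
  have c0 : c != 0 by apply: contraNneq y0 => c0; rewrite yE c0 mul0r.
  have -> : x = y / c by rewrite yE mulrAC divff ?mul1r.
  by move: yU cU => /UE h1 /UE h2; apply/UE; rewrite !rmorphM !fmorphV h1 h2.
have full : (U + U * <[x]> = fullv)%VS.
  by apply/eqP; rewrite eqEdim subvf dimv_disjoint_sum // dim_cosetv // addnn -mul2n d2 leqnn.
have : x ^+ 2 \in (U + U * <[x]>)%VS by rewrite full memvf.
case/memv_addP => p pU [_ /memv_cosetP[q qU ->] E]; exists q => //.
have /UE pE := pU; have /UE qE := qU.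
have Ei := congr1 si E; have Ej := congr1 sj E; rewrite rmorphXn rmorphD rmorphM /= in Ei.
rewrite rmorphXn rmorphD rmorphM /= -pE -qE in Ej.
have : (si x - sj x) * (si x + sj x - si q) = 0.
  transitivity (si x ^+ 2 - sj x ^+ 2 - si q * (si x - sj x)); first by ring.
  by rewrite Ei Ej; ring.
move/eqP; rewrite mulf_eq0 => /orP[h|]; last by rewrite subr_eq0 => /eqP.
by case/negP: xU; apply/UE/eqP; rewrite -subr_eq0.
Qed.
End Index2.

(** Put [th] = x0 - cj x0, which is odd, and c = 4 th^2. If beta is the sum of the products z z',
    then 4 beta is the even part of the sum of (sy + an)(sy' + an'). Multiplied by th^2, the
    products sy sy' and an an' become products of elements of T, the part of I in U; so beta c lies
    in T T, and [parity] applies in the smaller order. *)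
Lemma parity_index2 (R : realType) (K : fieldExtType rat) n (w : 'I_n -> K) (s : 'I_n -> {rmorphism K -> R[i]})
    (i j : 'I_n) (U : {vspace K}) m (w' : 'I_m -> K) (s' : 'I_m -> {rmorphism K -> R[i]}) (x0 : K) :
  is_order w s -> zspan w = integers K -> (forall x, (x \in U) <-> s i x = s j x) -> (2 * \dim U)%N = \dim {:K} ->
  is_order w' s' -> (forall x, zspan w' x <-> zspan w x /\ x \in U) -> zspan w x0 -> x0 \notin U ->
  exists c, [/\ zspan w' c, c != 0, (forall B, (forall k, normc (s k x0) <= B) -> forall k, normc (s k c) <= 16 * B ^+ 2) &
   forall beta p, prime p -> beta \in U -> sqrep w beta -> ~~ (p %| `|onorm w' c|)%N -> ~~ odd (logn p `|onorm w' beta|)].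
Proof.
move=> ow zi UE d2 ow' span Ox0 x0U.
have /boolp.choice [tr trP] := index2_trace UE d2.
have [cj cji cjj] : exists2 cj : K -> K, (forall x, s i (cj x) = s j x) & (forall x, s j (cj x) = s i x).
  by exists (fun x => tr x - x) => x; case: (trP x).
have Ocj x : zspan w x -> zspan w (cj x) by move=> Ox; rewrite zi; case: (conj_root ow Ox (cji x)).
pose th := x0 - cj x0.
have thi : s j th = - s i th by rewrite /th !rmorphB cji cjj opprB.
have Oth : zspan w th by apply: zspanB => //; apply: Ocj.
have th0 : th != 0.
  apply: contraNneq x0U => t0; apply/UE; have := congr1 (s i) t0.
  by rewrite /th rmorphB rmorph0 cji => /eqP; rewrite subr_eq0 => /eqP.
have c0 : 4 * th ^+ 2 != 0.
  rewrite mulf_neq0 ?expf_neq0 // -(fmorph_eq0 (s i)) rmorph_nat pnatr_eq0 //.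
have th2U : th ^+ 2 \in U by apply/UE; rewrite !rmorphXn thi sqrrN.
have Oc : zspan w' (4 * th ^+ 2).
  apply/span; split; first by apply: (zspanM ow); [exact: zspan_nat ow _|exact: (zspanX ow)].
  by apply: (eq_fieldM UE) => //; apply/UE; rewrite !rmorph_nat.
exists (4 * th ^+ 2); split=> //.
  move=> B xB k; rewrite rmorphM rmorphXn rmorph_nat Normc.normcM expr2 Normc.normcM -expr2.
  have -> : normc (4 : R[i]) = 4 by rewrite -[4]/(4%:R) pmulrn normc_int -pmulrn normr_nat.
  have h : normc (s k th) <= 2 * B.
    rewrite /th rmorphB; apply: le_trans (normc_le_add _ _) _; rewrite normcN.
    have [h _] := conj_root ow Ox0 (cji x0); have [l ->] := h k.
    by rewrite mulrDl mul1r lerD.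
  have B0 : 0 <= 2 * B by apply: le_trans h; apply: normc_ge0.
  have -> : 16 * B ^+ 2 = 4 * (2 * B) ^+ 2 by ring.
  by rewrite ler_wpM2l //; apply: lerXn2r; rewrite ?nnegrE ?normc_ge0.
move=> beta p pp bU [b0 Ob [l lI lE]] pc.
have oic x : zspan w (x ^+ 2) -> zspan w x by rewrite zi; apply: integers_sqr.
have bE : s j beta = s i beta by apply/esym/UE.
pose T : set K := [set x | sqideal w beta x /\ x \in U].
have Icj z : sqideal w beta z -> sqideal w beta (cj z).
  move=> Iz; have := conj_root ow Iz (_ : s i (cj z ^+ 2 / beta) = s j (z ^+ 2 / beta)); rewrite -zi => h.
  by case: h => //; rewrite [LHS]rmorphM [RHS]rmorphM !rmorphXn !fmorphV cji bE.
have ID := sqidealD ow oic b0; have IM := @sqidealM R K _ w s ow beta.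
have IN z : sqideal w beta z -> sqideal w beta (- z) by rewrite /sqideal /= sqrrN.
pose sy z := z + cj z; pose an z := z - cj z.
have syU z : sy z \in U by apply/UE; rewrite !rmorphD cji cjj addrC.
have anE z : s j (an z) = - s i (an z) by rewrite /an !rmorphB cji cjj opprB.
have Isy z : sqideal w beta z -> sqideal w beta (sy z) by move=> h; apply: ID => //; apply: Icj.
have Ian z : sqideal w beta z -> sqideal w beta (an z) by move=> h; apply: ID => //; apply/IN/Icj.
have TM a x : zspan w a -> a \in U -> T x -> T (a * x).
  by move=> Oa aU [h1 h2]; split; [exact: IM|exact: (eq_fieldM UE)].
have Tan z : sqideal w beta z -> T (th * an z).
  by move=> h; split; [apply: IM => //; apply: Ian|apply/UE; rewrite !rmorphM thi anE mulrNN].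
(* A product of two odd elements is even; one factor [th] on each side brings both into U. *)
pose l' := [seq (th ^+ 2 * sy q.1, sy q.2) | q <- l] ++ [seq (th * an q.1, th * an q.2) | q <- l].
apply: (@parity R K m w' s' ow' T beta b0 _ _ _ _ _ _ (4 * th ^+ 2) l' p pp Oc pc).
- by apply/span.
- by split; [exact: sqideal0|exact: mem0v].
- by move=> x y [h1 h2] [h3 h4]; split; [exact: ID|exact: memvD].
- by move=> a x /span[Oa aU] Tx; apply: TM.
- move=> x y [h1 h2] [h3 h4]; apply/span; split; first exact: (sqidealMM ow oic b0).
  by move: h2 h4 => /UE e1 /UE e2; apply/UE; rewrite !rmorphM !fmorphV e1 e2 bE.
- by move=> x [h1 h2]; apply/span; split=> //; apply: (sqideal_sub ow oic b0 Ob).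
- move=> q; rewrite mem_cat => /orP[] /mapP[r rl ->] /=; have [I1 I2] := lI r rl.
    split; last by split; [exact: Isy|exact: syU].
    by apply: TM => //; [exact: (zspanX ow)|split; [exact: Isy|exact: syU]].
  by split; apply: Tan.
rewrite big_cat !big_map /= -big_split /=.
pose E := \sum_(q <- l) (sy q.1 * sy q.2 + an q.1 * an q.2).
pose G := \sum_(q <- l) (sy q.1 * an q.2 + an q.1 * sy q.2).
have EG : E + G = 4 * beta.
  rewrite /E /G -big_split /= -lE mulr_sumr; apply: eq_bigr => q _; rewrite /sy /an; ring.
have syE z : s j (sy z) = s i (sy z) by apply/esym/UE; apply: syU.
have jE : s j E = s i E.
  by rewrite /E !rmorph_sum; apply: eq_bigr => q _; rewrite !rmorphD !rmorphM !syE !anE mulrNN.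
have jG : s j G = - s i G.
  rewrite /G !rmorph_sum -sumrN; apply: eq_bigr => q _; rewrite !rmorphD !rmorphM !syE !anE mulrN mulNr opprD //.
have G0 : G = 0.
  have := congr1 (s j) EG; rewrite rmorphD jE jG rmorphM bE.
  have := congr1 (s i) EG; rewrite rmorphD rmorphM !rmorph_nat => <- /addrI h.
  apply/eqP; rewrite -(fmorph_eq0 (s i)); move/eqP: h; rewrite eq_sym -subr_eq0 opprK -mulr2n -mulr_natl mulf_eq0 pnatr_eq0 //=.
have E4 : E = 4 * beta by rewrite -EG G0 addr0.
have -> : beta * (4 * th ^+ 2) = th ^+ 2 * E by rewrite E4; ring.
by rewrite /E mulr_sumr; apply: eq_bigr => q _; ring.
Qed.

(** A prime p >= 2^(1/eps) satisfies p^eps >= 2, and the smaller primes, fewer than M, account for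
    the constant. *)
Lemma omega_bound (R : realType) (eps : R) : 0 < eps -> exists2 C : R, 0 < C &
  forall N, (0 < N)%N -> (2 ^ size (primes N))%:R <= C * N%:R `^ eps.
Proof.
move=> e0; set M := (Num.truncn ((2 : R) `^ (1 / eps))).+1.
exists (2 ^+ M); first by rewrite exprn_gt0.
move=> N N0; pose c p : R := if (p < M)%N then 2 else 1.
have NE : N%:R = \prod_(p <- primes N) (p%:R ^+ logn p N) :> R.
  rewrite {1}(prod_prime_decomp N0) prime_decompE big_map natr_prod; apply: eq_bigr => p _; by rewrite natrX.
have pE : N%:R `^ eps = \prod_(p <- primes N) (p%:R ^+ logn p N) `^ eps :> R.
  rewrite NE; elim: (primes N) => [|p l IH]; first by rewrite !big_nil powR1.
  by rewrite !big_cons powRM ?exprn_ge0 ?IH // prodr_ge0 // => q _; rewrite exprn_ge0.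
have cM : \prod_(p <- primes N) c p <= 2 ^+ M.
  have -> : \prod_(p <- primes N) c p = 2 ^+ count (fun p => (p < M)%N) (primes N).
    elim: (primes N) => [|p l IH]; first by rewrite big_nil.
    by rewrite big_cons IH /= exprD /c; case: (p < M)%N; rewrite ?expr1 ?expr0.
  have h : (size [seq p <- primes N | (p < M)%N] <= size (iota 0 M))%N.
    apply: uniq_leq_size; first by rewrite filter_uniq ?primes_uniq.
    by move=> p; rewrite mem_filter mem_iota /= add0n => /andP[].
  by rewrite size_iota in h; rewrite ler_weXn2l ?ler1n // -size_filter.
have -> : (2 ^ size (primes N))%:R = \prod_(p <- primes N) 2 :> R.
  by rewrite natrX; elim: (primes N) => [|p l IH]; rewrite ?big_nil // big_cons exprS IH.
apply: le_trans (_ : \prod_(p <- primes N) (c p * (p%:R ^+ logn p N) `^ eps) <= _); last first.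
  by rewrite big_split /= -pE ler_wpM2r ?powR_ge0.
rewrite big_seq [X in _ <= X]big_seq; apply: ler_prod => p pN; rewrite ler0n /=.
have lp : (0 < logn p N)%N by rewrite logn_gt0.
have pp : prime p by move: pN; rewrite mem_primes => /and3P[].
have p1 : 1 <= p%:R :> R by rewrite ler1n prime_gt0.
have p0 : 0 <= p%:R :> R by rewrite ler0n.
have pl : p%:R <= p%:R ^+ logn p N :> R by rewrite ler_eXnr.
rewrite /c; case: ltnP => pM.
  have h1 : 1 `^ eps <= (p%:R ^+ logn p N) `^ eps.
    by apply: ge0_ler_powR; rewrite ?nnegrE ?exprn_ge0 ?(ltW e0) ?(le_trans p1 pl).
  by rewrite powR1 in h1; apply: ler_peMr.
rewrite mul1r.
have h : (2 : R) `^ (1 / eps) <= p%:R ^+ logn p N.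
  apply: le_trans pl; apply: le_trans (_ : M%:R <= _); last by rewrite ler_nat.
  by rewrite ltW // truncnS_gt.
have -> : (2 : R) = (2 `^ (1 / eps)) `^ eps by rewrite -powRrM div1r mulVf ?gt_eqF // powRr1.
by apply: ge0_ler_powR h; rewrite ?nnegrE ?powR_ge0 ?exprn_ge0 // ltW.
Qed.

Lemma onorm_change (R : realType) (K : fieldExtType rat) n (u w : 'I_n -> K) (s : 'I_n -> {rmorphism K -> R[i]}) x :
  is_order u s -> is_order w s -> zspan u = zspan w -> zspan w x -> onorm u x = onorm w x.
Proof.
move=> ou ow uw Ox; have Ox' : zspan u x by rewrite uw.
by apply: (@intr_inj R[i]); rewrite (onormE ou Ox') (onormE ow Ox).
Qed.

Lemma red_sqrt_le (R : realType) (K : fieldExtType rat) n (s : 'I_n.+1 -> {rmorphism K -> R[i]}) u L b k (Y : R) :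
  red_basis s u L b -> 1 <= Y -> 1 + Y / Num.sqrt (b 0 k) <= 2 ^+ n.+1 * Y.
Proof.
move=> rb Y1; have [_ [bp b0 _ _ _]] := rb.
have Y0 : 0 <= Y by apply: le_trans Y1.
have p1 : 1 <= 2 ^+ n :> R by rewrite exprn_ege1 // ler1n.
have p0 : 0 <= 2 ^+ n :> R by apply: le_trans p1.
have sb0 : 0 < Num.sqrt (b 0 k) by rewrite sqrtr_gt0.
have h1 : 1 <= 2 ^+ n * b 0 k.
  apply: le_trans (_ : b 0 0 <= _); first by rewrite b0 ler1n.
  apply: le_trans (@red_b_le _ _ _ _ _ _ _ rb 0 k (leq0n k)) _; rewrite ler_wpM2r ?(ltW (bp _)) // ler_weXn2l ?ler1n //.
  by rewrite leq_subLR (leq_trans (leq_ord k)) // leq_addl.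
have h2 : 1 <= 2 ^+ n * Num.sqrt (b 0 k).
  rewrite -[X in X <= _]sqrtr1 -[2 ^+ n]ger0_norm // -sqrtr_sqr -sqrtrM ?sqr_ge0 // ler_sqrt ?mulr_ge0 ?sqr_ge0 ?(ltW (bp _)) //.
  apply: le_trans h1 _; rewrite ler_wpM2r ?(ltW (bp _)) // expr2 ler_peMr //.
have h3 : Y / Num.sqrt (b 0 k) <= 2 ^+ n * Y.
  by rewrite ler_pdivrMr // mulrAC ler_peMl.
have h4 : 1 <= 2 ^+ n * Y by rewrite -[X in X <= _]mulr1; apply: ler_pM; rewrite ?ler01.
by rewrite exprS -mulrA mulrDl mul1r lerD.
Qed.

Lemma count_order (R : realType) m : exists2 C : R, 0 < C &
  forall (K : fieldExtType rat) (w : 'I_m.+1 -> K) (s : 'I_m.+1 -> {rmorphism K -> R[i]}) (Y : R) (l : seq K),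
  is_order w s -> 1 <= Y -> uniq l -> (forall x, x \in l -> zspan w x /\ forall i, normc (s i x) <= Y) ->
  (size l)%:R <= C * Y ^+ m.+1.
Proof.
have a1 := boxc_ge1 R m.
have a0 : 0 <= boxc R m by apply: le_trans a1.
exists ((2 * boxc R m + 1) ^+ m.+1 * (2 ^+ m.+1) ^+ m.+1).
  by rewrite mulr_gt0 ?exprn_gt0 // addr_gt0 // mulr_gt0 // (lt_le_trans ltr01).
move=> K w s Y l ow Y1 ul lP; have [u [L [b [rb uw _]]]] := exists_red_basis ow.
have Y0 : 0 <= Y by apply: le_trans Y1.
apply: le_trans (count_all rb Y0 ul _) _; first by move=> x xl; rewrite uw; apply: lP.
rewrite -mulrA ler_wpM2l //; first by rewrite exprn_ge0 // addr_ge0 // mulr_ge0.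
rewrite -exprMn; have -> : (2 ^+ m.+1 * Y) ^+ m.+1 = \prod_(k < m.+1) (2 ^+ m.+1 * Y) by rewrite prodr_const card_ord.
apply: ler_prod => k _; rewrite (red_sqrt_le _ rb Y1) andbT addr_ge0 // divr_ge0 // sqrtr_ge0 //.
Qed.

(** The b_k are bounded below by a constant, so every factor in [count_good] is O(Y); the exponent
    is m from the product and 2 times 2/3 from the sieve. *)
Lemma count_order_good (R : realType) m (eps : R) : 0 < eps -> exists2 C : R, 0 < C &
  forall (K : fieldExtType rat) (w : 'I_m.+2 -> K) (s : 'I_m.+2 -> {rmorphism K -> R[i]}) (e : int) (Y : R) (l : seq K),
  is_order w s -> e != 0 -> 1 <= Y -> uniq l -> (forall x, x \in l -> sievable w s Y e x) ->
  (size l)%:R <= C * (Y * `|e%:~R|) `^ eps * Y `^ (m%:R + 4 / 3).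
Proof.
move=> e0; have [C C0 CP] := @count_good R m eps e0.
have [c cE] : exists c : R, c = 2 ^+ m.+2 by eexists.
have c0 : 0 < c by rewrite cE exprn_gt0.
exists (C * (c ^+ m * c `^ (2 / 3))); first by rewrite !mulr_gt0 ?exprn_gt0 ?powR_gt0.
move=> K w s e Y l ow en0 Y1 ul lP; have [u [L [b [rb uw _]]]] := exists_red_basis ow.
have [[ou _ _] _] := rb.
have Y0 : 0 < Y by apply: lt_le_trans Y1.
have Y0' := ltW Y0.
apply: le_trans (CP K s u L b e Y l rb en0 Y1 ul _) _.
  move=> x /lP[h1 h2 h3 h4]; split=> //; first by rewrite uw.
  by rewrite (onorm_change ou ow uw h1).
have bnd k : 1 + Y / Num.sqrt (b 0 k) <= c * Y by rewrite cE; apply: red_sqrt_le rb Y1.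
have nn k : 0 <= 1 + Y / Num.sqrt (b 0 k) by rewrite addr_ge0 // divr_ge0 // sqrtr_ge0.
have F0 : 0 <= (Y * `|e%:~R|) `^ eps by apply: powR_ge0.
have -> : C * (c ^+ m * c `^ (2 / 3)) * (Y * `|e%:~R|) `^ eps * Y `^ (m%:R + 4 / 3) =
  C * (Y * `|e%:~R|) `^ eps * ((c ^+ m * c `^ (2 / 3)) * Y `^ (m%:R + 4 / 3)) by ring.
apply: ler_wpM2l; first by rewrite mulr_ge0 // ltW.
have Yn0 : Y != 0 by rewrite gt_eqF.
have -> : (c ^+ m * c `^ (2 / 3)) * Y `^ (m%:R + 4 / 3) = (c * Y) ^+ m * (Y * (c * Y)) `^ (2 / 3).
  rewrite powRD ?Yn0 ?implybT // powR_mulrn // exprMn.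
  have -> : Y * (c * Y) = c * Y ^+ 2 by ring.
  rewrite powRM ?exprn_ge0 ?(ltW c0) // -[Y ^+ 2]powR_mulrn // -powRrM.
  have -> : 2%:R * (2 / 3) = 4 / 3 :> R by field.
  by ring.
apply: ler_pM; rewrite ?powR_ge0 ?prodr_ge0 //.
  have -> : (c * Y) ^+ m = \prod_(k < m) (c * Y) by rewrite prodr_const card_ord.
  by apply: ler_prod => k _; rewrite bnd nn.
apply: ge0_ler_powR; rewrite ?nnegrE ?mulr_ge0 ?(ltW c0) // ?divr_ge0 // ler_wpM2l //.
Qed.

Lemma even_logn_square (a : nat) : (0 < a)%N -> (forall p, prime p -> ~~ odd (logn p a)) -> exists t, a = (t ^ 2)%N.
Proof.
move=> a0 h; have [d [t [[aE _ _] dE]]] := square_part a0; exists t; rewrite aE dE.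
have -> : [seq p <- primes a | odd (logn p a)] = [::].
  apply/eqP; rewrite -size_eq0 size_filter eqn0Ngt -has_count; apply/hasPn => p.
  by rewrite mem_primes => /and3P[pp _ _]; apply: h.
by rewrite big_nil mul1n.
Qed.

Lemma sign_square (y z : int) (t : nat) : (0 <= y) = (0 <= z) -> (`|z| * `|y| = t ^ 2)%N -> z * y = t%:Z ^+ 2.
Proof.
move=> fs tE; have -> : z * y = (`|z| * `|y|)%N.
  by rewrite PoszM; case: (lerP 0 z) fs => hz; case: (lerP 0 y) => hy // _; [rewrite !gez0_abs | rewrite !ltz0_abs // mulrNN].
by rewrite tE -mulnn PoszM expr2.
Qed.

(** Sort the elements by the sign of the norm and the parities of its valuations at the primes
    dividing N(c): there are 2^(omega + 1) classes, an epsilon power of Y. Inside a class the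
    product of two norms is a square, so the norm of one member serves as e. *)
Lemma count_index2 (R : realType) m (eps : R) : 0 < eps -> exists2 C : R, 0 < C &
  forall (K : fieldExtType rat) (w : 'I_m.+2 -> K) (s : 'I_m.+2 -> {rmorphism K -> R[i]}) (c : K) (Y : R) (l : seq K),
  is_order w s -> zspan w c -> c != 0 -> 1 <= Y -> (forall k, normc (s k c) <= 16 * Y ^+ 2) -> uniq l ->
  (forall x, x \in l -> [/\ zspan w x, injective (fun i => s i x), (forall i, normc (s i x) <= Y) &
     forall p, prime p -> ~~ (p %| `|onorm w c|)%N -> ~~ odd (logn p `|onorm w x|)]) ->
  (size l)%:R <= C * Y `^ (m%:R + 4 / 3 + eps).
Proof.
(* The number of classes costs 2(m + 2) times e' in the exponent and the sieve m + 3 times e', in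
   total 3m + 7. *)
move=> eps0; pose q := (3 * m + 7)%N; have [e' e'E] : exists e', e' = eps / q%:R by eexists.
have q0 : 0 < q%:R :> R by rewrite ltr0n /q addn_gt0 orbT.
have e'0 : 0 < e' by rewrite e'E divr_gt0.
have [C1 C10 C1P] := omega_bound e'0; have [C2 C20 C2P] := @count_order_good R m e' e'0.
exists (2 * C1 * (16 ^+ m.+2) `^ e' * C2); first by rewrite !mulr_gt0 ?powR_gt0 ?exprn_gt0.
move=> K w s c Y l ow Oc c0 Y1 cY ul lP.
have Y0 : 0 < Y by apply: lt_le_trans Y1.
have Y0' := ltW Y0.
have Nc0 := onorm_neq0 ow Oc c0; set N := `|onorm w c|%N; have N0 : (0 < N)%N by rewrite absz_gt0.
have lsiv x : x \in l -> onorm w x != 0.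
  move=> /lP[Ox xi _ _]; apply: (onorm_neq0 ow Ox); apply/eqP => x0.
  by have := xi ord0 (lift ord0 ord0); rewrite /= x0 !rmorph0 => /(_ erefl)/(congr1 val).
pose f x := ([ffun k : 'I_(size (primes N)) => odd (logn (nth 0%N (primes N) k) `|onorm w x|)], (0 <= onorm w x)%R).
set B := C2 * (Y * Y ^+ m.+2) `^ e' * Y `^ (m%:R + 4 / 3).
have B0 : 0 <= B by rewrite !mulr_ge0 ?powR_ge0 ?(ltW C20).
apply: le_trans (@size_fibres R _ _ l f B _) _.
  move=> d /mapP[x0 x0l ->]; have [Ox0 xi0 xY0 par0] := lP x0 x0l.
  have en0 := lsiv x0 x0l; set e := onorm w x0.
  apply: le_trans (C2P K w s e Y [seq x <- l | f x == f x0] ow en0 Y1 _ _) _; rewrite ?filter_uniq //.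
    move=> x; rewrite mem_filter => /andP[/eqP fx xl]; have [Ox xi xY par] := lP x xl; split=> //.
    have xn0 := lsiv x xl; case: fx => fp fs.
    have [t tE] : exists t, (`|e| * `|onorm w x| = t ^ 2)%N.
      apply: even_logn_square; first by rewrite muln_gt0 !absz_gt0 en0.
      move=> p pp; rewrite lognM ?absz_gt0 // oddD.
      have [pN|pN] := boolP (p %| N)%N; last by rewrite (negPf (par p pp pN)) (negPf (par0 p pp pN)).
      have pl : p \in primes N by rewrite mem_primes pp N0 pN.
      have ip : (index p (primes N) < size (primes N))%N by rewrite index_mem.
      have /ffunP/(_ (Ordinal ip)) := fp; rewrite !ffunE /= nth_index // => ->.
      by rewrite addbb.
    by exists t%:Z; apply: sign_square.
  apply: ler_wpM2r; first exact: powR_ge0.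
  apply: ler_wpM2l; first exact: ltW.
  apply: ge0_ler_powR; [exact: ltW|by rewrite nnegrE; apply: mulr_ge0|by rewrite nnegrE; apply: mulr_ge0 => //; apply: exprn_ge0|].
  by apply: ler_wpM2l => //; apply: (onorm_le ow).
have card : (size (undup (map f l)) <= 2 ^ size (primes N) * 2)%N.
  have := @size_undup_card _ ({ffun 'I_(size (primes N)) -> bool} * bool)%type (map f l) id (in2W (fun x y => id)).
  by rewrite card_prod card_ffun !card_bool card_ord.
have Nb : N%:R `^ e' <= (16 ^+ m.+2) `^ e' * (Y ^+ (2 * m.+2)) `^ e'.
  rewrite -powRM; [|exact: exprn_ge0|exact: exprn_ge0]; apply: ge0_ler_powR.
  - exact: ltW.
  - by rewrite nnegrE ler0n.
  - by rewrite nnegrE; apply: mulr_ge0; apply: exprn_ge0.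
  - by rewrite exprM -exprMn natr_absz intr_norm; apply: (onorm_le ow).
have cardR : (size (undup (map f l)))%:R <= 2 * C1 * (16 ^+ m.+2) `^ e' * (Y ^+ (2 * m.+2)) `^ e'.
  apply: le_trans (_ : (2 ^ size (primes N) * 2)%:R <= _); first by rewrite ler_nat.
  rewrite natrM mulrC -[X in _ <= X]mulrA -[X in _ <= X]mulrA; apply: ler_wpM2l => //.
  by apply: le_trans (C1P N N0) _; apply: ler_wpM2l => //; apply: ltW.
apply: le_trans (ler_wpM2r B0 cardR) _.
have Yn0 : Y != 0 by rewrite gt_eqF.
have -> : Y `^ (m%:R + 4 / 3 + eps) = (Y ^+ (2 * m.+2)) `^ e' * (Y * Y ^+ m.+2) `^ e' * Y `^ (m%:R + 4 / 3).
  rewrite -exprS -!powR_mulrn // -!powRrM -!powRD ?Yn0 ?implybT //; congr (_ `^ _).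
  have -> : eps = q%:R * e' by rewrite e'E mulrC divfK // gt_eqF.
  rewrite /q !natrD !natrM -[m.+2]addn2 -[(m + 2).+1]addn1 !natrD; ring.
by rewrite /B le_eqVlt; apply/orP; left; apply/eqP; ring.
Qed.

Lemma size_cover (R : realType) (A : eqType) (I : finType) (l : seq A) (P : I -> A -> bool) (B : R) : 0 <= B ->
  (forall x, x \in l -> exists i, P i x) -> (forall i, (size [seq x <- l | P i x])%:R <= B) ->
  (size l)%:R <= #|I|.+1%:R * B.
Proof.
move=> B0 lP lB; pose f x := [pick i | P i x].
apply: le_trans (@size_fibres R _ _ l f B _) _.
  move=> d /mapP[x0 x0l ->]; have [i iP] := lP x0 x0l; rewrite {2}/f.
  case: pickP => [k kP|/(_ i)]; last by rewrite iP.
  apply: le_trans (lB k); rewrite ler_nat !size_filter; apply: sub_count => x /eqP; rewrite /f.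
  by case: pickP => // k' kP' [<-].
rewrite ler_wpM2r // ler_nat -card_option.
by have := @size_undup_card _ (option I) (map f l) id (in2W (fun x y => id)).
Qed.

Lemma count_subspace (R : realType) (M : nat) : exists2 C : R, 0 < C &
  forall (K : fieldExtType rat) n (w : 'I_n -> K) (s : 'I_n -> {rmorphism K -> R[i]}) (U : {vspace K}) (Y : R) (l : seq K),
  is_order w s -> \dim {:K} = n -> 1 \in U -> (forall x y, x \in U -> y \in U -> x * y \in U) -> (\dim U <= M)%N ->
  1 <= Y -> uniq l -> (forall x, x \in l -> [/\ zspan w x, x \in U & forall i, normc (s i x) <= Y]) ->
  (size l)%:R <= C * Y ^+ \dim U.
Proof.
have /boolp.choice [Cf CfP] : forall m, exists C : R, 0 < C /\
  forall (K : fieldExtType rat) (w : 'I_m.+1 -> K) (s : 'I_m.+1 -> {rmorphism K -> R[i]}) (Y : R) (l : seq K),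
  is_order w s -> 1 <= Y -> uniq l -> (forall x, x \in l -> zspan w x /\ forall i, normc (s i x) <= Y) ->
  (size l)%:R <= C * Y ^+ m.+1.
  by move=> m; have [C C0 CP] := count_order R m; exists C.
have Cf0 m : 0 <= Cf m by apply: ltW; case: (CfP m).
exists (1 + \sum_(m < M) Cf m); first by rewrite ltr_wpDr ?ltr01 // sumr_ge0.
move=> K n w s U Y l ow dK U1 UM dM Y1 ul lP.
have dU : (0 < \dim U)%N.
  by rewrite lt0n dimv_eq0; apply: contraTneq U1 => ->; rewrite memv0 oner_eq0.
have [w' [f [ow' span]]] := suborder ow dK (esym (prednK dU)) U1 UM.
have [_ CP] := CfP (\dim U).-1.
apply: le_trans (CP K w' (fun k => s (f k)) Y l ow' Y1 ul _) _.
  by move=> x /lP[h1 h2 h3]; split; [apply/span|move=> i; apply: h3].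
rewrite prednK // ler_wpM2r ?exprn_ge0 ?(le_trans ler01) //.
have lt : ((\dim U).-1 < M)%N by rewrite prednK.
rewrite (bigD1 (Ordinal lt)) //= addrA addrAC lerDr addr_ge0 // sumr_ge0 //.
Qed.

Lemma exp_le_powR (R : realType) (Y E : R) (m : nat) : 1 <= Y -> m%:R <= E -> Y ^+ m <= Y `^ E.
Proof. by move=> Y1 mE; rewrite -powR_mulrn ?(le_trans ler01) //; apply: ler_powR. Qed.

(** Elements on which s_i and s_j agree form a proper subfield U, of degree dividing n. For index at
    least 3, Y^(n/3) is enough since n/6 >= 2/3. For index 2, the elements with distinct conjugates
    in U fall under [count_index2], with m0 + 4/3 = n/2 - 2/3. *)
Lemma count_bad (R : realType) n (eps : R) : (4 <= n)%N -> 0 < eps -> exists2 C : R, 0 < C &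
  forall (K : fieldExtType rat) (w : 'I_n -> K) (s : 'I_n -> {rmorphism K -> R[i]}) (z : K) (Y : R) (l : seq K),
  is_order w s -> zspan w = integers K -> \dim {:K} = n -> injective (fun i => s i z) -> 1 <= Y ->
  (forall k i, normc (s i (w k)) <= Y) -> uniq l ->
  (forall x, x \in l -> [/\ sqrep w x, (forall i, normc (s i x) <= Y) & exists i j, i != j /\ s i x = s j x]) ->
  (size l)%:R <= C * Y `^ (n%:R / 2 - 2 / 3 + eps).
Proof.
move=> n4 eps0; have [C1 C10 C1P] := count_subspace R n.
set m0 := (n./2 - 2)%N; have [C2 C20 C2P] := @count_index2 R m0 eps eps0.
have nR : 4 <= n%:R :> R by rewrite ler_nat.
pose B0 := C1 + (C2 + #|{: 'I_m0.+2 * 'I_m0.+2}|.+1%:R * C1).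
have B00 : 0 < B0 by rewrite !addr_gt0 // mulr_gt0.
exists (#|{: 'I_n * 'I_n}|.+1%:R * B0); first by rewrite mulr_gt0.
move=> K w s z Y l ow zi dK zinj Y1 wY ul lP.
set E := n%:R / 2 - 2 / 3 + eps; set F := Y `^ E.
have F0 : 0 <= F by apply: powR_ge0.
rewrite -mulrA; pose P (ij : 'I_n * 'I_n) x := (ij.1 != ij.2) && (s ij.1 x == s ij.2 x).
apply: (@size_cover R _ _ l P) => [|x /lP[_ _ [i [j [ij E1]]]]|[i j]]; first by rewrite mulr_ge0 // ltW.
  by exists (i, j); rewrite /P /= ij E1 eqxx.
rewrite /P /=; have [->|ij] := eqVneq i j.
  by rewrite /= (eq_filter (a2 := pred0)) // filter_pred0 /= mulr_ge0 // ltW.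
have [U UE] := @vspace_of_set K [set x | s i x = s j x] (etrans (rmorph0 _) (esym (rmorph0 _)))
  (fun a x y (h1 : s i x = s j x) (h2 : s i y = s j y) => ltac:(by rewrite /= !rmorphD /= !emb_scale h1 h2)).
have U1 := eq_field1 UE; have UM := @eq_fieldM _ _ _ _ _ UE.
have zU : z \notin U by apply/negP => /UE /zinj e; rewrite e eqxx in ij.
have dlt : (\dim U < n)%N.
  rewrite ltn_neqAle -{2}dK dimvS ?subvf // andbT; apply: contra zU => /eqP dU.
  have -> : U = fullv by apply/eqP; rewrite eqEdim subvf dK dU leqnn.
  exact: memvf.
set l1 := [seq x <- l | _].
have ul1 : uniq l1 by rewrite filter_uniq.
have l1P x : x \in l1 -> [/\ sqrep w x, x \in U & forall k, normc (s k x) <= Y].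
  by rewrite mem_filter => /andP[/eqP h xl]; have [h1 h2 _] := lP x xl; split=> //; apply/UE.
have l1O x : x \in l1 -> zspan w x by case/l1P => -[].
have /dvdnP [k nk] := subfield_dvd U1 UM; rewrite dK in nk.
have k2 : (2 <= k)%N by move: dlt; rewrite nk; case: (k) => [|[|?]] //; rewrite ?mul0n ?mul1n ?ltnn.
have [k3|k3] := leqP 3 k.
  apply: le_trans (C1P K n w s U Y l1 ow dK U1 UM (ltnW dlt) Y1 ul1 _) _.
    by move=> x xl; have [_ h2 h3] := l1P x xl; split=> //; apply: l1O.
  apply: le_trans (_ : C1 * F <= _); last first.
    by rewrite ler_wpM2r // lerDl addr_ge0 ?mulr_ge0 ?(ltW C10) ?(ltW C20).
  rewrite ler_wpM2l ?(ltW C10) // exp_le_powR //.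
  have : (\dim U)%:R * 3 <= n%:R :> R by rewrite -natrM ler_nat nk mulnC leq_mul2r k3 orbT.
  by rewrite /E; move: nR eps0; lra.
have {k2 k3} kE : k = 2%N by apply/eqP; rewrite eqn_leq k2 -ltnS k3.
rewrite kE in nk.
have dE : \dim U = m0.+2.
  by rewrite /m0 nk mul2n doubleK subn2; move: n4; rewrite nk; case: (\dim U) => [|[|d]].
have m0R : m0%:R + 4 / 3 + eps = E.
  by rewrite /E nk dE natrM -[m0.+2]addn2 natrD; field.
have [w' [f [ow' span]]] := suborder ow dK dE U1 UM.
(* A basis vector outside U, because a multiple of z is a combination of basis vectors. Its
   conjugates are at most Y, which controls the size of c. *)
have [k1 k1U] : exists k, w k \notin U.
  apply: contrapT => h; case/negP: zU; have [d d0 [c cE]] := order_scale ow dK z.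
  have wU (a : 'I_n) : w a \in U by apply: contraT => hk; case: h; exists a.
  have : z *~ d \in U by rewrite cE; apply: memv_suml => l0 _; rewrite -scaler_int; apply: memvZ.
  rewrite -scaler_int => /(memvZ (d%:~R)^-1); rewrite scalerA mulVf ?scale1r // intr_eq0 //.
have d2 : (2 * \dim U)%N = \dim {:K} by rewrite dK nk.
have [c [Oc c0 cB cpar]] := parity_index2 ow zi UE d2 ow' span (zspan_w w k1) k1U.
pose G x := `[< injective (fun a => s (f a) x) >].
have -> : size l1 = (size [seq x <- l1 | G x] + size [seq x <- l1 | ~~ G x])%N by rewrite -[LHS](count_predC G l1) !size_filter.
rewrite natrD [B0 * F]mulrDl; apply: ler_wpDl; first by rewrite mulr_ge0 // ltW.
rewrite mulrDl; apply: lerD.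
  apply: le_trans (C2P K w' (fun a => s (f a)) c Y _ ow' Oc c0 Y1 _ _ _) _; rewrite ?filter_uniq //.
  - by move=> a; apply: cB => b; apply: wY.
  - move=> x; rewrite mem_filter => /andP[/asboolP xinj xl]; have [h1 h2 h3] := l1P x xl; split=> //.
      by apply/span; split=> //; apply: l1O.
    by move=> p pp pc; apply: cpar.
  by rewrite m0R.
rewrite -mulrA; pose Q (ab : 'I_m0.+2 * 'I_m0.+2) x := (ab.1 != ab.2) && (s (f ab.1) x == s (f ab.2) x).
apply: (@size_cover R _ _ _ Q) => [|x|[a b]]; first by rewrite mulr_ge0 // ltW.
  rewrite mem_filter => /andP[/asboolP ninj _]; apply: contrapT => h; apply: ninj => a b E1; apply/eqP.
  by apply: contraT => ab; case: h; exists (a, b); rewrite /Q /= ab E1 eqxx.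
rewrite /Q /=; have [->|ab] := eqVneq a b.
  by rewrite /= (eq_filter (a2 := pred0)) // filter_pred0 /= mulr_ge0 // ltW.
have [U2 U2E] := @vspace_of_set K [set x | s i x = s j x /\ s (f a) x = s (f b) x]
  (conj (etrans (rmorph0 _) (esym (rmorph0 _))) (etrans (rmorph0 _) (esym (rmorph0 _))))
  (fun t x y (h1 : s i x = s j x /\ s (f a) x = s (f b) x) (h2 : s i y = s j y /\ s (f a) y = s (f b) y) =>
     ltac:(by case: h1 h2 => e1 e2 [e3 e4]; split; rewrite !rmorphD /= !emb_scale ?e1 ?e2 ?e3 ?e4)).
have U21 : 1 \in U2 by apply/U2E; rewrite /= !rmorph1.
have U2M x y : x \in U2 -> y \in U2 -> x * y \in U2.
  by move=> /U2E[e1 e2] /U2E[e3 e4]; apply/U2E; rewrite /= !rmorphM e1 e2 e3 e4.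
have U2U : (U2 <= U)%VS by apply/subvP => x /U2E[e1 _]; apply/UE.
have d2lt : (\dim U2 < \dim U)%N.
  rewrite ltn_neqAle dimvS // andbT; apply/negP => /eqP dU.
  have UU : U2 = U by apply/eqP; rewrite eqEdim U2U dU leqnn.
  have col : col a (\matrix_(j, i) s (f i) (w' j)) = col b (\matrix_(j, i) s (f i) (w' j)).
    apply/matrixP => j0 o; rewrite !mxE; have : w' j0 \in U2 by rewrite UU; have [h _] := span (w' j0); case: h => //; apply: zspan_w.
    by move/U2E => -[].
  have V0 : (\matrix_(j, i) s (f i) (w' j)) *m (delta_mx a 0 - delta_mx b 0 : 'cV_m0.+2) = 0.
    by rewrite mulmxBr -!colE col subrr.
  have := congr1 (fun M => (invmx (\matrix_(j, i) s (f i) (w' j)) *m M) a 0) V0.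
  rewrite mulmxA mulVmx ?(order_unit ow') // mul1mx mulmx0 !mxE !eqxx (negPf ab) /= subr0 => /eqP.
  by rewrite oner_eq0.
apply: le_trans (C1P K n w s U2 Y _ ow dK U21 U2M _ Y1 _ _) _; rewrite ?filter_uniq //.
- exact: leq_trans (ltnW d2lt) (ltnW dlt).
- move=> x; rewrite mem_filter => /andP[/eqP e1]; rewrite mem_filter => /andP[_ xl]; have [_ h2 h3] := l1P x xl; split=> //; first exact: l1O.
  by apply/U2E; split=> //; apply/UE.
(* The remaining elements lie in a proper subfield of U, of degree at most n/2 - 1 = m0 + 1, below
   m0 + 4/3. *)
rewrite ler_wpM2l ?(ltW C10) // exp_le_powR // -m0R.
have : (\dim U2)%:R <= m0.+1%:R :> R by rewrite ler_nat -ltnS -dE.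
by rewrite -natr1; move: eps0; lra.
Qed.

(** * The class group *)

Lemma counting_le (R : realType) (T : choiceType) (A : set T) (N : R) :
  (forall l : seq T, uniq l -> (forall x, x \in l -> A x) -> (size l)%:R <= N) -> (counting A <= N%:E)%E.
Proof.
move=> h; rewrite /counting; case: asboolP => [fA|iA].
  rewrite lee_fin; apply: h => [|x]; first exact: fset_uniq.
  by rewrite in_fset_set // inE.
have [X XA Xn] := infinite_set_fset (Num.truncn N).+1 iA.
have := h (enum_fset X) (fset_uniq _) (fun x xX => XA x xX).
rewrite leNgt => /negP[]; apply: lt_le_trans (truncnS_gt N) _; rewrite ler_nat //.
Qed.

Section ClassRep.
Variables (R : realType) (K : fieldExtType rat) (n : nat) (w : 'I_n.+1 -> K).
Variables (s : 'I_n.+1 -> {rmorphism K -> R[i]}).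
Local Notation V := (\matrix_(j, i) s i (w j)).

Lemma ideal_class_scale (a : K) (I : set K) : a != 0 -> ideal_class [set a * x | x in I] = ideal_class I.
Proof.
move=> a0; apply/seteqP; split=> J [b b0 ->].
  exists (b * a); first exact: mulf_neq0.
  by apply/seteqP; split=> x; [move=> [_ [y Iy <-] <-]; exists y; rewrite ?mulrA|move=> [y Iy <-]; exists (a * y); [exists y|rewrite mulrA]].
exists (b / a); first by rewrite mulf_neq0 ?invr_eq0.
apply/seteqP; split=> x; last by move=> [_ [y Iy <-] <-]; exists y => //; rewrite mulrA divfK.
by move=> [y Iy <-]; exists (a * y); [exists y|rewrite mulrA divfK].
Qed.

(** From I I = (b) and a common denominator d, beta = d^2 b is integral and its [sqideal] is d I.
    With kappa a short vector of d I, scaling by a = kappa/beta stays in the class and replaces beta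
    by kappa^2/beta, whose conjugates are at most B. *)
Lemma h2_rep (c : set (set K)) (B : R) : is_order w s -> zspan w = integers K ->
  (exists2 pi : 'I_n.+1 -> 'I_n.+1, injective pi & forall i x, s (pi i) x = ((s i x)^*)%C) ->
  0 < B -> 2 ^+ (n.+1 ^ 2) * normc (\det V) ^+ 2 <= B ^+ n.+1 -> h2 K c ->
  exists beta, [/\ sqrep w beta, (forall i, normc (s i beta) <= B) & c = ideal_class (sqideal w beta)].
Proof.
move=> ow zi conjs B0 hB [[I FI <-] cc].
have [I0 ID IM [x0 Ix0 x00] [d [Od d0 dI]]] := FI.
have oic x : zspan w (x ^+ 2) -> zspan w x by rewrite zi; apply: integers_sqr.
have cI : ideal_class I I by exists 1; [exact: oner_neq0|apply/seteqP; split=> x; [move=> Ix; exists x; rewrite ?mul1r|move=> [y Iy <-]; rewrite mul1r]].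
have : class_mul (ideal_class I) (ideal_class I) (ideal_mul I I) by exists I, I.
rewrite cc => -[b b0 IIb].
pose beta := d ^+ 2 * b.
have be0 : beta != 0 by rewrite mulf_neq0 // expf_neq0.
have IIO x y : I x -> I y -> zspan w (x * y / b).
  move=> Ix Iy; have : ideal_mul I I (x * y).
    by exists [:: (x, y)]; split=> [p|]; [rewrite inE => /eqP ->|rewrite big_seq1].
  rewrite IIb => -[t Ot <-]; rewrite zi; have -> : b * t / b = t by field.
  exact: Ot.
have [l lI bE] : exists2 l : seq (K * K), forall p, p \in l -> I p.1 /\ I p.2 & \sum_(p <- l) p.1 * p.2 = b.
  have : ideal_mul I I b by rewrite IIb; exists 1; [rewrite -zi; exact: zspan1 ow|rewrite mulr1].
  by move=> [l [lI lE]]; exists l.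
(* For z with z^2/beta integral, expand z/d with b = sum of p1 p2: the coefficients (z/d) p1 / b are
   integral since their squares are. *)
have sqE z : sqideal w beta z <-> I (z / d).
  split=> [Oz|Iz].
    have -> : z / d = \sum_(p <- l) (z / d * p.1 / b) * p.2.
      transitivity (z / d / b * \sum_(p <- l) p.1 * p.2); first by rewrite bE divfK.
      by rewrite mulr_sumr; apply: eq_bigr => p _; field; rewrite b0 d0.
    rewrite big_seq; elim/big_ind: _ => [|x y|p /lI[I1 I2]]; [exact: I0|exact: ID|apply: IM => //].
    rewrite -zi; apply: oic.
    have -> : (z / d * p.1 / b) ^+ 2 = (z ^+ 2 / beta) * (p.1 * p.1 / b) by rewrite /beta; field; rewrite b0 d0.
    by apply: (zspanM ow) => //; apply: IIO.
  rewrite /sqideal /=; have -> : z ^+ 2 / beta = (z / d) * (z / d) / b by rewrite /beta; field; rewrite b0 d0.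
  exact: IIO.
have dK x : d * x / d = x by rewrite mulrAC divff ?mul1r.
have Obeta : zspan w beta.
  have -> : beta = \sum_(p <- l) (d * p.1) * (d * p.2).
    by rewrite /beta -bE mulr_sumr; apply: eq_bigr => p _; ring.
  rewrite big_seq; apply: zspan_sum => p /lI[I1 I2]; apply: (zspanM ow); rewrite zi; exact: dI.
have rep : sqrep w beta.
  split=> //; exists [seq (d * p.1, d * p.2) | p <- l].
    by move=> _ /mapP[p /lI[I1 I2] ->] /=; split; apply/sqE; rewrite dK.
  by rewrite big_map /beta -bE mulr_sumr; apply: eq_bigr => p _ /=; ring.
have [kap [k0 Ik kB]] := sqrep_short ow oic conjs rep B0 hB.
have [_ _ [l2 l2I l2E]] := rep.
exists (kap ^+ 2 / beta); have be'0 : kap ^+ 2 / beta != 0 by rewrite mulf_neq0 ?invr_eq0 ?expf_neq0.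
pose a := kap / beta; have a0 : a != 0 by rewrite mulf_neq0 ?invr_eq0.
have sqE' z : sqideal w (kap ^+ 2 / beta) z <-> sqideal w beta (z / a).
  rewrite /sqideal /=; have -> : z ^+ 2 / (kap ^+ 2 / beta) = (z / a) ^+ 2 / beta by rewrite /a; field; rewrite k0 be0.
  by [].
split.
- split=> //; exists [seq (a * p.1, a * p.2) | p <- l2].
    by move=> _ /mapP[p /l2I[I1 I2] ->] /=; split; apply/sqE'; rewrite mulrAC divff ?mul1r.
  rewrite big_map; transitivity (a ^+ 2 * \sum_(p <- l2) p.1 * p.2).
    by rewrite mulr_sumr; apply: eq_bigr => p _ /=; ring.
  by rewrite l2E /a; field.
- move=> i; have nb0 : 0 < normc (s i beta) by rewrite lt_neqAle normc_ge0 eq_sym normc_eq0 fmorph_eq0 be0.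
  have : normc (s i (kap ^+ 2 / beta)) * normc (s i beta) = normc (s i kap) ^+ 2.
    by rewrite -Normc.normcM -rmorphM divfK // rmorphXn expr2 Normc.normcM.
  by move=> E; rewrite -(ler_pM2r nb0) E.
- rewrite -(ideal_class_scale I (mulf_neq0 a0 d0)); congr ideal_class; apply/seteqP; split=> z.
    move=> [y Iy <-]; apply/sqE'/sqE; have -> : a * d * y / a / d = y by field; rewrite a0 d0.
    exact: Iy.
  move=> /sqE'/sqE h; exists (z / a / d) => //; field; by rewrite a0 d0.
Qed.
End ClassRep.

(** The square of the determinant is the determinant of the trace matrix, a nonzero integer. *)
Lemma disc_ge1 (R : realType) (K : fieldExtType rat) n (w : 'I_n -> K) (s : 'I_n -> {rmorphism K -> R[i]}) :
  is_order w s -> 1 <= normc (\det (\matrix_(j, i) s i (w j))) ^+ 2.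
Proof.
move=> ow; set V := \matrix_(j, i) _.
pose T : 'M[int]_n := \matrix_(j, k) \tr (zm w (w j * w k)).
have TE : V *m V^T = map_mx intr T.
  apply/matrixP => j k; rewrite !mxE.
  have Ox : zspan w (w j * w k) by apply: order_mul ow _ _.
  have := zm_diag ow Ox => /(congr1 (fun M => M *m invmx V)); rewrite mulmxK ?(order_unit ow) // => h.
  have := congr1 (fun M => \tr M) h; rewrite mxtrace_mulC mulmxA mulVmx ?(order_unit ow) // mul1mx mxtrace_diag => h2.
  transitivity (\tr (map_mx (intr : int -> R[i]) (zm w (w j * w k)))).
    by rewrite h2; apply: eq_bigr => i _; rewrite !mxE rmorphM.
  by rewrite trace_map_mx.
have dE : \det V * \det V = (\det T)%:~R by rewrite -{2}det_tr -det_mulmx TE det_map_mx.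
have T0 : \det T != 0.
  rewrite -(intr_eq0 R[i]) -dE mulf_eq0 orbb; have := order_unit ow; rewrite unitmxE unitfE //.
by rewrite expr2 -Normc.normcM dE normc_int -intr_norm ler1z -gtz0_ge1 normr_gt0.
Qed.

Lemma number_field_setup (R : realType) (K : fieldExtType rat) n (alpha : n.-tuple K) :
  \dim {:K} = n -> integral_basis alpha ->
  exists (w : 'I_n -> K) (s : 'I_n -> {rmorphism K -> R[i]}) (z : K),
  [/\ is_order w s, zspan w = integers K, injective (fun i => s i z),
      exists2 pi : 'I_n -> 'I_n, injective pi & forall i x, s (pi i) x = ((s i x)^*)%C &
      (forall x, emb_norm R x = \sum_i normc (s i x)) /\
      ratr (abs_disc K) = normc (\det (\matrix_(j, i) s i (w j))) ^+ 2 :> R].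
Proof.
move=> dK; move: alpha; rewrite -{}dK => alpha ia.
have [s [z [sz sall]]] := exists_embeddings R K.
have [w iw dE] : exists2 w : (\dim {:K}).-tuple K, integral_basis w & abs_disc K = `|tuple_disc w|.
  rewrite /abs_disc; case: xgetP => [d _ [w [iw ->]]|/(_ `|tuple_disc alpha|)]; first by exists w.
  by case; exists alpha.
have [ow zi] := integral_basis_order iw sz.
exists (tnth w), s, z; split=> //; first exact: (emb_conj sz sall).
split; first by move=> x; apply: (emb_norm_sum sz sall).
by rewrite dE (tuple_disc_emb sz).
Qed.

(** [parity] with c = 1, whose norm is prime to every p. *)
Lemma sqrep_norm_square (R : realType) (K : fieldExtType rat) n (w : 'I_n -> K) (s : 'I_n -> {rmorphism K -> R[i]}) beta :
  is_order w s -> (forall x, zspan w (x ^+ 2) -> zspan w x) -> sqrep w beta -> exists t, (`|onorm w beta| = t ^ 2)%N.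
Proof.
move=> ow oic [b0 Ob [l lI lE]]; apply: even_logn_square; first by rewrite absz_gt0 (onorm_neq0 ow).
move=> p pp; apply: (@parity R K n w s ow (sqideal w beta) beta b0 Ob _ _ _ _ _ 1 l p pp) => //.
- exact: sqideal0.
- exact: (sqidealD ow oic b0).
- exact: (@sqidealM R K _ w s ow beta).
- exact: (sqidealMM ow oic b0).
- exact: (sqideal_sub ow oic b0 Ob).
- exact: zspan1 ow.
- by rewrite (onorm1 ow) /= dvdn1; move: pp; case: (p) => [|[|q]].
- by rewrite mulr1.
Qed.

(** * Assembling the bound *)

Lemma count_sqrep (R : realType) m (eps : R) : (2 <= m)%N -> 0 < eps -> exists2 C : R, 0 < C &
  forall (K : fieldExtType rat) (s : 'I_m.+2 -> {rmorphism K -> R[i]}) (u : 'I_m.+2 -> K) (L : 'M[R]_m.+2) (b : 'rV[R]_m.+2)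
    (z : K) (Y : R) (l : seq K), red_basis s u L b -> zspan u = integers K -> \dim {:K} = m.+2 ->
  injective (fun i => s i z) -> 1 <= Y -> (forall k i, normc (s i (u k)) <= Y) -> uniq l ->
  (forall x, x \in l -> sqrep u x /\ forall i, normc (s i x) <= Y) ->
  (size l)%:R <= C * (Y `^ eps * (\prod_(k < m) (1 + Y / Num.sqrt (b 0 (lift ord0 (lift ord0 k))))
    * (Y * (1 + Y / Num.sqrt (b 0 (lift ord0 ord0)))) `^ (2 / 3)) + Y `^ (m.+2%:R / 2 - 2 / 3 + eps)).
Proof.
move=> m2 eps0; have [C1 C10 C1P] := @count_good R m eps eps0.
have [C2 C20 C2P] := @count_bad R m.+2 eps (m2 : (4 <= m.+2)%N) eps0.
exists (2 * C1 + C2); first by rewrite addr_gt0 // mulr_gt0.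
move=> K s u L b z Y l rb ui dK zinj Y1 uY ul lP; have [[ou _ _] _] := rb.
have oic x : zspan u (x ^+ 2) -> zspan u x by rewrite ui; apply: integers_sqr.
set P := \prod_(k < m) _; set Q := _ `^ (2 / 3); set F := Y `^ eps; set H := Y `^ _.
have P0 : 0 <= P by apply: prodr_ge0 => k _; rewrite addr_ge0 // divr_ge0 ?sqrtr_ge0 // (le_trans ler01).
have Q0 : 0 <= Q by apply: powR_ge0.
have F0 : 0 <= F by apply: powR_ge0.
have H0 : 0 <= H by apply: powR_ge0.
have FPQ : 0 <= F * (P * Q) by rewrite !mulr_ge0.
pose G x := `[< injective (fun i => s i x) >].
have -> : size l = (size [seq x <- l | G x] + size [seq x <- l | ~~ G x])%N by rewrite !size_filter count_predC.
rewrite natrD; apply: le_trans (_ : 2 * C1 * (F * (P * Q)) + C2 * H <= _); last first.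
  rewrite mulrDr; apply: lerD; apply: ler_wpM2r => //; rewrite ?lerDl ?lerDr ?(ltW C20) // mulr_ge0 ?(ltW C10) //.
apply: lerD; last first.
  apply: (C2P K u s z Y) => //; first by rewrite filter_uniq.
  move=> x; rewrite mem_filter => /andP[/asboolP ni xl]; have [h1 h2] := lP x xl; split=> //.
  apply: contrapT => h; apply: ni => i j E; apply/eqP; apply: contraT => ij; case: h; by exists i, j.
apply: le_trans (@size_fibres R _ _ _ (fun x => (0 <= onorm u x)) (C1 * F * (P * Q)) _) _; last first.
  have c2 : (size (undup [seq (0 <= onorm u x)%R | x <- [seq x <- l | G x]]) <= 2)%N.
    by have := @size_undup_card _ bool [seq (0 <= onorm u x)%R | x <- [seq x <- l | G x]] id (in2W (fun x y => id)); rewrite card_bool.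
  have -> : 2 * C1 * (F * (P * Q)) = 2 * (C1 * F * (P * Q)) by ring.
  by apply: ler_wpM2r; rewrite ?ler_nat // -mulrA mulr_ge0 // ltW.
move=> sg _; have -> : F = (Y * `|(sgb sg)%:~R|) `^ eps by rewrite /F /sgb; case: sg; rewrite ?mulrN1z ?normrN1 ?normr1 ?mulr1.
apply: (C1P K s u L b (sgb sg) Y) => //; first by case: sg.
  by rewrite !filter_uniq.
move=> x; rewrite !mem_filter => /and3P[/eqP sx /asboolP xi xl]; have [h1 h2] := lP x xl.
have [_ Ox _] := h1; split=> //.
have [t tE] := sqrep_norm_square ou oic h1; exists t%:Z.
have := sgbE (onorm u x); rewrite tE sx => ->.
by rewrite mulrA -expr2 sgb2 mul1r -mulnn PoszM expr2.
Qed.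

Lemma prod_sqrt (R : realType) n (b : 'I_n -> R) : (forall k, 0 < b k) ->
  \prod_k Num.sqrt (b k) = Num.sqrt (\prod_k b k).
Proof.
move=> bp; elim/big_rec2: _ => [|k x y _ ->]; first by rewrite sqrtr1.
by rewrite sqrtrM // ltW.
Qed.

Lemma integral_basis_nonint (K : fieldExtType rat) n (alpha : n.-tuple K) (c : int) : (1 < n)%N ->
  integral_basis alpha -> alpha`_0 = 1 -> alpha`_1 <> c%:~R.
Proof.
move=> n1 [ai ab] a0 E; have n0 : (0 < n)%N by apply: leq_trans n1.
have aE : alpha`_1 = tnth alpha (Ordinal n1) by rewrite (tnth_nth 0).
have [f [fE fu]] := ab _ (ai (Ordinal n1)).
have h1 : [ffun i : 'I_n => (i == Ordinal n1)%:R] = f.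
  apply/esym/fu; rewrite (bigD1 (Ordinal n1)) //= ffunE eqxx mulr1z big1 ?addr0 // => i /negPf h.
  by rewrite ffunE h mulr0z.
have h2 : [ffun i : 'I_n => if i == Ordinal n0 then c else 0] = f.
  apply/esym/fu; rewrite (bigD1 (Ordinal n0)) //= ffunE eqxx big1 ?addr0; last by move=> i /negPf h; rewrite ffunE h mulr0z.
  by rewrite -aE E (tnth_nth 0) /= a0.
have := congr1 (fun g : {ffun 'I_n -> int} => g (Ordinal n1)) (etrans h1 (esym h2)); by rewrite !ffunE eqxx.
Qed.

(** An element outside Z has a nonzero coordinate at some k >= 1, so sqrt b_k is O(||x||), and b_1
    <= 2^(k-1) b_k. Applied to alpha_2, this is how delta_2 enters. *)
Lemma red_second_le (R : realType) (K : fieldExtType rat) m (s : 'I_m.+2 -> {rmorphism K -> R[i]}) u L b x :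
  red_basis s u L b -> zspan u x -> (forall c : int, x <> c%:~R) ->
  Num.sqrt (b 0 (lift ord0 ord0)) <= 2 ^+ m.+1 * m.+3%:R ^+ m.+1 * \sum_i normc (s i x).
Proof.
move=> rb Ox xn; have [[ou u0 _] [bp _ _ _ _]] := rb; set o1 := lift ord0 ord0.
have [k k1 ck] : exists2 k : 'I_m.+2, (1 <= k)%N & ocoord u x 0 k != 0.
  apply: contrapT => h; apply: (xn (ocoord u x 0 ord0)); rewrite -{1}(ocoordK Ox) /elt big_ord_recl u0 big1 ?addr0 // => k _.
  have [->|ck] := eqVneq (ocoord u x 0 (lift ord0 k)) 0; first by rewrite mulr0z.
  by case: h; exists (lift ord0 k).
set S := \sum_i _; have S0 : 0 <= S by apply: sumr_ge0 => i _; apply: normc_ge0.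
have qS : qnorm s (elt u (ocoord u x)) <= S ^+ 2.
  rewrite ocoordK // /qnorm expr2 {1}/S mulr_suml; apply: ler_sum => i _; rewrite expr2 ler_wpM2l ?normc_ge0 //.
  by rewrite /S (bigD1 i) //= lerDl sumr_ge0 // => j _; apply: normc_ge0.
have := red_coord rb k qS; rewrite sqrtr_sqr (ger0_norm S0) => h.
have sk : Num.sqrt (b 0 k) <= m.+3%:R ^+ m.+1 * S.
  apply: le_trans (_ : `|(ocoord u x 0 k)%:~R| * Num.sqrt (b 0 k) <= _).
    by rewrite ler_peMl ?sqrtr_ge0 // -intr_norm ler1z -gtz0_ge1 normr_gt0.
  by apply: le_trans h _; rewrite ler_wpM2r // ler_weXn2l ?ler1n // leq_subr.
have p1 : 1 <= 2 ^+ m.+1 :> R by rewrite exprn_ege1 // ler1n.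
have p0 : 0 <= 2 ^+ m.+1 :> R by apply: le_trans p1.
rewrite -mulrA; apply: le_trans (ler_wpM2l p0 sk).
rewrite -[2 ^+ m.+1]ger0_norm // -sqrtr_sqr -sqrtrM ?sqr_ge0 // ler_sqrt ?mulr_ge0 ?sqr_ge0 ?(ltW (bp _)) //.
apply: le_trans (@red_b_le _ _ _ _ _ _ _ rb o1 k k1) _; rewrite ler_wpM2r ?(ltW (bp _)) //.
apply: le_trans (_ : 2 ^+ m.+1 <= _); last by rewrite expr2 ler_peMr.
by rewrite ler_weXn2l ?ler1n // leq_subLR; apply: leq_trans (leq_ord k) _; rewrite leq_addl.
Qed.

(** With r = sqrt b_1 and sb = sqrt b_0, the quotient is the product of 1/sqrt b_k over k >= 2, as
    the b_k multiply to X^n. The powers of r combine to 1 - 2/3 = 1/3, those of X to m - n/2 + 4/3 =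
    n/2 - 2/3. *)
Lemma good_estimate (R : realType) (m : nat) (X r sb c k : R) : 0 < X -> 0 < r -> 0 <= k ->
  (c * X) ^+ m * (sb * r / X `^ (m.+2%:R / 2)) * (k * X ^+ 2 / r) `^ (2 / 3) =
  c ^+ m * sb * k `^ (2 / 3) * (X `^ (m.+2%:R / 2 - 2 / 3) * r `^ (1 / 3)).
Proof.
move=> X0 r0 k0.
have Xn0 : X != 0 by rewrite gt_eqF.
have rn0 : r != 0 by rewrite gt_eqF.
have X2 : 0 <= X ^+ 2 by apply: exprn_ge0; apply: ltW.
have kX : 0 <= k * X ^+ 2 by apply: mulr_ge0.
have ri : 0 <= r^-1 by rewrite invr_ge0 ltW.
rewrite exprMn (powRM _ kX ri) (powRM _ k0 X2).
have hX : X ^+ m * (X ^+ 2) `^ (2 / 3) = X `^ (m.+2%:R / 2 - 2 / 3) * X `^ (m.+2%:R / 2).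
  rewrite -!powR_mulrn ?(ltW X0) // -powRrM -!powRD ?Xn0 ?implybT //; congr (_ `^ _).
  by rewrite -[m.+2]addn2 natrD; field.
have hr : r = r `^ (1 / 3) * r `^ (2 / 3).
  by rewrite -powRD ?rn0 ?implybT // (_ : 1 / 3 + 2 / 3 = 1) ?powRr1 ?(ltW r0) //; field.
have hri : r^-1 `^ (2 / 3) = (r `^ (2 / 3))^-1.
  have rr : r `^ (2 / 3) * r^-1 `^ (2 / 3) = 1.
    by rewrite -powRM ?invr_ge0 ?(ltW r0) // divff // powR1.
  by apply: (mulfI (_ : r `^ (2 / 3) != 0)); rewrite ?gt_eqF ?powR_gt0 // rr divff // gt_eqF // powR_gt0.
rewrite hri.
have n1 : r `^ (2 / 3) != 0 by rewrite gt_eqF // powR_gt0.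
have n2 : X `^ (m.+2%:R / 2) != 0 by rewrite gt_eqF // powR_gt0.
move: hX hr n1 n2; move: (X ^+ m) ((X ^+ 2) `^ (2 / 3)) (X `^ (m.+2%:R / 2 - 2 / 3)) (X `^ (m.+2%:R / 2)) => xm x43 xe xn.
move: (r `^ (1 / 3)) (r `^ (2 / 3)) (c ^+ m) (k `^ (2 / 3)) => r13 r23 cm kk hX hr n1 n2.
rewrite hr.
transitivity (cm * sb * kk * (xm * x43) * r13 / xn); first by field; rewrite n1 n2.
by rewrite hX; field.
Qed.

Theorem theorem2p2 (R : realType) (n : nat) (hn : (5 <= n)%N)
    (eps : R) (heps : 0 < eps) (M : R) :
  exists C : R, 0 < C /\
    forall (K : fieldExtType rat) (alpha : n.-tuple K) (delta2 : R),
      \dim {:K} = n ->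
      minkowski_reduced M alpha ->
      0 <= delta2 ->
      emb_norm R alpha`_1 = ratr (abs_disc K) `^ delta2 ->
      (counting (h2 K) <=
        (C * ratr (abs_disc K) `^
           (1 / 2 - 1 / (2 * n%:R)
            - (1 / (6 * n%:R) - delta2 / 3) + eps))%:E)%E.
Proof.
case: n hn => [|[|m]] // hn.
have m2 : (2 <= m)%N by move: hn; clear; lia.
have [C0 C00 C0P] := @count_sqrep R m eps m2 heps.
have [N NE] : exists N : R, N = m.+2%:R by eexists.
have N1 : 1 <= N by rewrite NE ler1n.
have N0 : 0 < N by apply: lt_le_trans N1.
have [T T1 TE] : exists2 T : R, 1 <= T & T = 2 ^+ m.+1 by exists (2 ^+ m.+1) => //; rewrite exprn_ege1 // ler1n.
have [A A1 AE] : exists2 A : R, 1 <= A & A = m.+2%:R * 2 ^+ m.+1.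
  by exists (m.+2%:R * 2 ^+ m.+1) => //; rewrite -[X in X <= _]mulr1; apply: ler_pM; rewrite ?ler01 ?ler1n // exprn_ege1 // ler1n.
have A0 : 0 <= A by apply: le_trans A1.
have T0 : 0 <= T by apply: le_trans T1.
(* Y = cY X must bound the conjugates of the representatives beta, at most 2 T X, and those of the
   reduced basis, at most A A X. *)
have [cY cY1 cYE] : exists2 c : R, 1 <= c & c = 2 * T + A * A.
  have AA : 0 <= A * A by apply: mulr_ge0.
  by exists (2 * T + A * A) => //; move: AA T1; clear; lra.
have cY0 : 0 < cY by apply: lt_le_trans cY1.
have [cb cbE] : exists c : R, c = T * A by eexists.
have cb0 : 0 <= cb by rewrite cbE mulr_ge0.
have [c3 c3E] : exists c : R, c = cb + cY by eexists.
have c30 : 0 < c3 by rewrite c3E ltr_wpDl.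
have [c4 c4E] : exists c : R, c = 2 ^+ m.+1 * m.+3%:R ^+ m.+1 by eexists.
have c40 : 0 <= c4 by rewrite c4E mulr_ge0 // exprn_ge0 ?ler0n.
have [sb sb0 sbE] : exists2 c : R, 0 <= c & c = Num.sqrt m.+2%:R by exists (Num.sqrt m.+2%:R); rewrite ?sqrtr_ge0.
have [e2 e2E] : exists e : R, e = N / 2 - 2 / 3 + eps by eexists.
pose k1 := cY `^ eps * (c3 ^+ m * sb * (cY * c3) `^ (2 / 3) * c4 `^ (1 / 3)).
have k10 : 0 <= k1 by rewrite /k1 !mulr_ge0 ?powR_ge0 // exprn_ge0 // ltW.
exists (C0 * (k1 + cY `^ e2)); split; first by rewrite mulr_gt0 // ltr_wpDl // powR_gt0.
move=> K alpha delta dK [ia a0 _ _ _] d0 aE.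
have [w [s [z [ow zi zinj conjs [en dE]]]]] := number_field_setup R dK ia.
set D := ratr (abs_disc K) in aE dE *.
have D1 : 1 <= D by rewrite dE disc_ge1.
have D0 : 0 < D by apply: lt_le_trans D1.
have D0' := ltW D0.
have Dn0 : D != 0 by rewrite gt_eqF.
have [u [L [b [rb uw bD]]]] := exists_red_basis ow.
have gE : \det (gram s (fun=> 1) w) = D.
  have := @gram_det R K _ w s conjs (fun=> 1) 1%:M (fun _ _ _ => erefl); rewrite big1 // det1 expr1n !mul1r -dE => <-.
  by congr (\det (gram s _ _)); apply/funext => j; rewrite row1 elt_delta.
rewrite {}gE in bD.
have [[ou u0 _] [bp b0 _ _ _]] := rb.
have [X XE] : exists X, X = D `^ (1 / N) by eexists.
have X1 : 1 <= X.
  have h1 : 1 `^ (1 / N) <= D `^ (1 / N) by apply: ge0_ler_powR; rewrite ?nnegrE // divr_ge0 // ltW.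
  by rewrite powR1 in h1; rewrite XE.
have X0 : 0 < X by apply: lt_le_trans X1.
have X0' := ltW X0.
have Xp (e : R) : X `^ e = D `^ (e / N) by rewrite XE -powRrM; congr (_ `^ _); ring.
have Xn : X ^+ m.+2 = D by rewrite -powR_mulrn // Xp -NE divff ?powRr1 // gt_eqF.
have Xh : X `^ (m.+2%:R / 2) = Num.sqrt D.
  by rewrite Xp -NE (_ : N / 2 / N = 2^-1) ?powR12_sqrt //; field; rewrite gt_eqF.
have bl : b 0 ord_max <= A ^+ 2 * X ^+ 2.
  have e : (A ^+ 2 * X ^+ 2) ^+ m.+2 = (A ^+ 2) ^+ m.+2 * (X ^+ m.+2) ^+ 2.
    by rewrite exprMn; congr (_ * _); rewrite -!exprM mulnC.
  have := red_last_le rb; rewrite -AE bD -Xn -e.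
  by rewrite ler_pXn2r ?nnegrE ?(ltW (bp _)) ?mulr_ge0 ?exprn_ge0.
have sbk k : Num.sqrt (b 0 k) <= cb * X.
  have cX0 : 0 <= cb * X by apply: mulr_ge0.
  rewrite -[cb * X]ger0_norm // -sqrtr_sqr ler_sqrt ?sqr_ge0 //.
  apply: le_trans (@red_b_le _ _ _ _ _ _ _ rb k ord_max (leq_ord k)) _.
  apply: le_trans (_ : T * (A ^+ 2 * X ^+ 2) <= _).
    by apply: ler_pM => //; rewrite ?exprn_ge0 ?(ltW (bp _)) // TE ler_weXn2l ?ler1n // leq_subr.
  have -> : (cb * X) ^+ 2 = T * (T * (A ^+ 2 * X ^+ 2)) by rewrite cbE; ring.
  by apply: ler_peMl => //; rewrite !mulr_ge0 ?exprn_ge0.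
have [Y YE] : exists Y, Y = cY * X by eexists.
have Y1 : 1 <= Y by rewrite YE -[X in X <= _]mulr1; apply: ler_pM; rewrite ?ler01.
have Y0 : 0 <= Y by apply: le_trans Y1.
have uY k i : normc (s i (u k)) <= Y.
  apply: le_trans (normc_le_qnorm _ _ _) _; apply: le_trans (_ : A * A * X <= _); last first.
    by rewrite YE ler_wpM2r // cYE lerDr mulr_ge0.
  have AX : 0 <= A * A * X by rewrite !mulr_ge0.
  rewrite -[A * A * X]ger0_norm // -sqrtr_sqr ler_sqrt ?sqr_ge0 //.
  apply: le_trans (@red_q_le _ _ _ _ _ _ _ rb k ord_max (leq_ord k)) _; rewrite -AE.
  apply: le_trans (ler_wpM2l A0 bl) _.
  have -> : (A * A * X) ^+ 2 = A * (A * (A ^+ 2 * X ^+ 2)) by ring.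
  by apply: ler_wpM2l => //; apply: ler_peMl => //; rewrite mulr_ge0 ?exprn_ge0.
have sk0 k : 0 < Num.sqrt (b 0 k) by rewrite sqrtr_gt0.
(* Here all sqrt b_k = O(X) is used: it absorbs the 1, so that the product of the factors is
   governed by the discriminant. *)
have facb k : 1 + Y / Num.sqrt (b 0 k) <= c3 * X / Num.sqrt (b 0 k).
  by rewrite ler_pdivlMr // mulrDl mul1r divfK ?gt_eqF // c3E mulrDl -YE lerD2r sbk.
have fac0 k : 0 <= 1 + Y / Num.sqrt (b 0 k) by rewrite addr_ge0 // divr_ge0 // ltW.
have [r rE] : exists r, r = Num.sqrt (b 0 (lift ord0 ord0)) by eexists.
have r0 : 0 < r by rewrite rE.
have rD : r <= c4 * D `^ delta.
  rewrite rE c4E -aE en; apply: (red_second_le rb).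
    by rewrite uw zi; case: ia => ai _; have := ai (lift ord0 ord0); rewrite (tnth_nth 0).
  by move=> c; apply: integral_basis_nonint ia a0.
pose ll (k : 'I_m) : 'I_m.+2 := lift ord0 (lift ord0 k).
have Pinv : \prod_(k < m) (Num.sqrt (b 0 (ll k)))^-1 = sb * r / X `^ (m.+2%:R / 2).
  have h := prod_sqrt (b := fun k => b 0 k) bp; rewrite bD -Xh !big_ord_recl -rE (_ : b 0 ord0 = m.+2%:R) ?b0 // -sbE in h.
  rewrite prodfV -h; have n1 : sb != 0 by rewrite sbE gt_eqF // sqrtr_gt0 ltr0n.
  have n2 : \prod_(k < m) Num.sqrt (b 0 (ll k)) != 0 by apply/prodf_neq0 => k _; rewrite gt_eqF.
  have n3 : r != 0 by rewrite gt_eqF.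
  by rewrite -/ll; field; rewrite n1 n2 n3.
apply: counting_le => l ul lP.
(* The value 0 is a default outside [h2 K]; on [h2 K] the map is injective because beta determines
   the class. *)
have /boolp.choice [g gP] : forall c, exists beta, h2 K c -> [/\ sqrep w beta, (forall i, normc (s i beta) <= Y) & c = ideal_class (sqideal w beta)].
  move=> c; have [hc|nc] := pselect (h2 K c); last by exists 0.
  have B0 : 0 < 2 * T * X by rewrite !mulr_gt0 // (lt_le_trans ltr01).
  have hB : 2 ^+ (m.+2 ^ 2) * normc (\det (\matrix_(j, i) s i (w j))) ^+ 2 <= (2 * T * X) ^+ m.+2.
    by rewrite -dE exprMn Xn TE -exprS -exprM mulnn.
  have [beta [h1 h2' h3]] := h2_rep ow zi conjs B0 hB hc.
  exists beta => _; split=> // i; by apply: le_trans (h2' i) _; rewrite YE ler_wpM2r // cYE lerDl mulr_ge0.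
have gi : {in l &, injective g}.
  by move=> x y /lP/gP[_ _ h1] /lP/gP[_ _ h3] e; rewrite h1 h3 e.
have sqE x : sqrep u x = sqrep w x by rewrite /sqrep /sqideal uw.
rewrite -(size_map g).
have ug : uniq (map g l) by rewrite map_inj_in_uniq.
have ui : zspan u = integers K by rewrite uw.
apply: le_trans (C0P K s u L b z Y (map g l) rb ui dK zinj Y1 uY ug _) _.
  by move=> _ /mapP[c /lP/gP[h1 h2' _] ->]; rewrite sqE.
rewrite -mulrA; apply: ler_wpM2l; first exact: ltW.
rewrite -/ll -rE; set E := (X in D `^ X).
have De (e : R) : e <= E -> D `^ e <= D `^ E by move=> h; apply: ler_powR.
have eN : eps / N <= eps by rewrite ler_pdivrMr // ler_peMr // ltW.
(* Indeed 1/(2n) + 1/(6n) = 2/(3n): the saving is X^(2/3), as X^n = D. *)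
have EE : E = 1 / 2 - 2 / 3 / N + delta / 3 + eps.
  by rewrite /E -NE; field; rewrite gt_eqF.
have e2N : e2 / N = 1 / 2 - 2 / 3 / N + eps / N by rewrite e2E; field; rewrite gt_eqF.
rewrite [X in _ <= X]mulrDl; apply: lerD; last first.
  (* The contribution of the proper subfields has the exponent of the case delta = 0, and delta >=
     0. *)
  rewrite -NE -e2E YE powRM ?(ltW cY0) //; apply: ler_wpM2l; first exact: powR_ge0.
  rewrite Xp; apply: De; rewrite e2N EE; move: eN d0; clear; lra.
have main : \prod_(k < m) (1 + Y / Num.sqrt (b 0 (ll k))) * (Y * (1 + Y / r)) `^ (2 / 3) <=
    c3 ^+ m * sb * (cY * c3) `^ (2 / 3) * (X `^ (m.+2%:R / 2 - 2 / 3) * r `^ (1 / 3)).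
  rewrite -good_estimate ?mulr_ge0 ?(ltW cY0) ?(ltW c30) //; apply: ler_pM; rewrite ?powR_ge0 ?prodr_ge0 //.
    have -> : (c3 * X) ^+ m * (sb * r / X `^ (m.+2%:R / 2)) = \prod_(k < m) (c3 * X / Num.sqrt (b 0 (ll k))).
      by rewrite -Pinv big_split /= prodr_const card_ord.
    by apply: ler_prod => k _; rewrite fac0 facb.
  have fr : 1 + Y / r <= c3 * X / r by rewrite rE.
  have fr0 : 0 <= 1 + Y / r by rewrite rE.
  apply: ge0_ler_powR; rewrite ?nnegrE ?divr_ge0 ?mulr_ge0 ?exprn_ge0 ?(ltW cY0) ?(ltW c30) ?(ltW r0) //.
  have -> : cY * c3 * X ^+ 2 / r = Y * (c3 * X / r) by rewrite YE; ring.
  exact: ler_wpM2l.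
have rp : r `^ (1 / 3) <= c4 `^ (1 / 3) * D `^ (delta / 3).
  have -> : D `^ (delta / 3) = (D `^ delta) `^ (1 / 3) by rewrite -powRrM; congr (_ `^ _); ring.
  by rewrite -powRM ?powR_ge0 //; apply: ge0_ler_powR; rewrite ?nnegrE ?mulr_ge0 ?powR_ge0 ?(ltW r0) ?divr_ge0.
have YX : Y `^ eps = cY `^ eps * X `^ eps by rewrite YE powRM // ltW.
set k2 := c3 ^+ m * sb * (cY * c3) `^ (2 / 3) in main *.
have k20 : 0 <= k2 by rewrite /k2 !mulr_ge0 ?powR_ge0 // exprn_ge0 // ltW.
apply: le_trans (ler_wpM2l (powR_ge0 _ _) main) _; rewrite YX.
apply: le_trans (_ : cY `^ eps * X `^ eps * (k2 * (X `^ (m.+2%:R / 2 - 2 / 3) * (c4 `^ (1 / 3) * D `^ (delta / 3)))) <= _).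
  apply: ler_wpM2l; first by rewrite mulr_ge0 ?powR_ge0.
  by apply: ler_wpM2l => //; apply: ler_wpM2l => //; apply: powR_ge0.
have -> : cY `^ eps * X `^ eps * (k2 * (X `^ (m.+2%:R / 2 - 2 / 3) * (c4 `^ (1 / 3) * D `^ (delta / 3)))) =
  k1 * (X `^ eps * X `^ (m.+2%:R / 2 - 2 / 3) * D `^ (delta / 3)) by rewrite /k1 -/k2; ring.
apply: ler_wpM2l => //; rewrite !Xp -!powRD ?Dn0 ?implybT //; apply: De; rewrite -NE.
have -> : eps / N + (N / 2 - 2 / 3) / N + delta / 3 = e2 / N + delta / 3 by rewrite e2E; ring.
rewrite e2N EE; move: eN; clear; lra.
Qed.
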